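(* Let $T\ge 2$, let $\xi\in(0,1)$ be strategic, i.e. $\sin\big(\frac{2m+1}{2}\pi\xi\big)\neq 0$ for all $m\in\mathbb{N}$, and let $(y^0,y^1)\in F'$. For each $n\in\mathbb{N}^*$ with $\frac1n<1-\xi$, let $\phi_n$ be a solution of the homogeneous beam system $$\frac{\partial^2\phi_n}{\partial t^2}+\frac{\partial^4\phi_n}{\partial x^4}=0\quad (0<x<1,\ t>0),\qquad \phi_n(0,t)=\frac{\partial\phi_n}{\partial x}(1,t)=\frac{\partial^2\phi_n}{\partial x^2}(0,t)=\frac{\partial^3\phi_n}{\partial x^3}(1,t)=0,$$ put $\widetilde\phi_n=n\phi_n$, and let $\psi_n$ be the solution of the internally controlled system $$\frac{\partial^2\psi_n}{\partial t^2}(x,t)+\frac{\partial^4\psi_n}{\partial x^4}(x,t)=\chi_n(x)\widetilde\phi_n(x,t),\quad 0<x<1,\ t>0,$$ $$\psi_n(0,t)=\frac{\partial\psi_n}{\partial x}(1,t)=\frac{\partial^2\psi_n}{\partial x^2}(0,t)=\frac{\partial^3\psi_n}{\partial x^3}(1,t)=0,$$ $$\psi_n(x,0)=y^0(x),\quad \frac{\partial\psi_n}{\partial t}(x,0)=y^1(x),\quad \psi_n(x,T)=\frac{\partial\psi_n}{\partial t}(x,T)=0,\quad 0<x<1,$$ where $\phi_n$ is chosen so that the final conditions at time $T$ hold (internal exact control). Then, as $n\to\infty$, $\psi_n$ converges for the weak* topology of $L^\infty(0,T,V)$ to the solution $\psi$ of the pointwise controlled system $$\frac{\partial^2\psi}{\partial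 t^2}(x,t)+\frac{\partial^4\psi}{\partial x^4}(x,t)=v(t)\,\delta_\xi,\quad 0<x<1,\ t>0,$$ $$\psi(0,t)=\frac{\partial\psi}{\partial x}(1,t)=\frac{\partial^2\psi}{\partial x^2}(0,t)=\frac{\partial^3\psi}{\partial x^3}(1,t)=0,$$ $$\psi(x,0)=y^0(x),\quad \frac{\partial\psi}{\partial t}(x,0)=y^1(x),\quad \psi(x,T)=\frac{\partial\psi}{\partial t}(x,T)=0,\quad 0<x<1,$$ where $v\in L^2(0,T)$, and $\phi_n(\xi,t)+\frac1{2n}\frac{\partial\phi_n}{\partial x}(\xi,t)$ converges to $v(t)$ for the weak* topology of $H^{-1}(0,T)$.
   Context: $V=\{u\in H^2(0,1): u(0)=0,\ \frac{du}{dx}(1)=0\}$, and $V'$ is its dual with respect to the pivot space $L^2(0,1)$. $\chi_n$ is the characteristic function of $(\xi,\xi+\frac1n)$, and $\delta_\xi$ is the Dirac mass at $\xi$. The space $F$: writing $\phi^0=\sum_{m\ge0}a_m\sin(\frac{2m+1}{2}\pi x)$ and $\phi^1=\sum_{m\ge0}\frac{b_m}{(\frac{2m+1}{2}\pi)^2}\sin(\frac{2m+1}{2}\pi x)$, the quantity $\|(\phi^0,\phi^1)\|_F=\big(\int_0^T\phi^2(\xi,t)\,dt\big)^{1/2}$, where $\phi$ is the solution of the homogeneous beam system above with initial data $\phi(\cdot,0)=\phi^0$, $\frac{\partial\phi}{\partial t}(\cdot,0)=\phi^1$, is a norm on $\mathcal D(0,1)\times\mathcal D(0,1)$, and $F$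 is the completion for this norm; $(\phi^0,\phi^1)\in F$ iff $\sum_{m\ge0}\big\{a_m^2+\frac{b_m^2}{(\frac{2m+1}{2}\pi)^8}\big\}\sin^2(\frac{2m+1}{2}\pi\xi)<\infty$. The dual space $F'$: writing $y^0=\sum_{m\ge0}a_m\sin(\frac{2m+1}{2}\pi x)$ and $y^1=\sum_{m\ge0}\frac{b_m}{(\frac{2m+1}{2}\pi)^2}\sin(\frac{2m+1}{2}\pi x)$, one has $(y^0,y^1)\in F'$ iff $\sum_{m\ge0}\frac{a_m^2+b_m^2/(\frac{2m+1}{2}\pi)^4}{\sin^2(\frac{2m+1}{2}\pi\xi)}<\infty$.
   Formalization: F' is taken as the dual of F in the pairing <y1,phi0>-<y0,phi1>, i.e. the sum of (mu_m^4 a_m^2 + b_m^2/mu_m^4)/sin^2(mu_m xi) is finite, mu_m=(2m+1)pi/2; the printed criterion lacks the factor mu_m^4 on a_m^2, and with it the control v in L^2(0,T) need not exist. *)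

(* Defs.v *)
From HB Require Import structures.
From mathcomp Require Import all_boot all_order all_algebra.
From mathcomp Require Import all_classical all_reals all_analysis.
Set Implicit Arguments.
Unset Strict Implicit.
Unset Printing Implicit Defensive.
Import Order.TTheory GRing.Theory Num.Theory.
Import numFieldNormedType.Exports.
Local Open Scope classical_set_scope.
Local Open Scope ring_scope.

(* Functions of one variable are plain functions R -> R of which only the
   values on the relevant interval matter; elements of L^2 are considered up to
   equality almost everywhere, elements of H^1 and H^2 are given by their
   continuous representative. A function of time and space is written u t x. *)

Definition intg (R : realType) (a b : R) (f : R -> R) : R :=
  Rintegral (@lebesgue_measure R) `[a, b] f.

Definition integrable_on (R : realType) (a b : R) (f : R -> R) : Prop :=
  (@lebesgue_measure R).-integrable `[a, b] (EFin \o f).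

Definition L2 (R : realType) (a b : R) (f : R -> R) : Prop :=
  measurable_fun `[a, b] f /\ integrable_on a b (fun x => f x ^+ 2).

Definition ip (R : realType) (f g : R -> R) : R :=
  intg 0 1 (fun x => f x * g x).

(* u, du are absolutely continuous on [a, b], u' = du and du' = d2u a.e. *)
Definition W21 (R : realType) (a b : R) (u du d2u : R -> R) : Prop :=
  integrable_on a b d2u /\
  forall x, a <= x <= b ->
    u x = u a + intg a x du /\ du x = du a + intg a x d2u.

Definition H2 (R : realType) (u du d2u : R -> R) : Prop :=
  W21 0 1 u du d2u /\ L2 0 1 d2u.

Definition normH2 (R : realType) (u du d2u : R -> R) : R :=
  Num.sqrt (ip u u + ip du du + ip d2u d2u).

Definition V_with (R : realType) (u du d2u : R -> R) : Prop :=
  [/\ H2 u du d2u, u 0 = 0 & du 1 = 0].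

Definition V (R : realType) (u : R -> R) : Prop :=
  exists du d2u, V_with u du d2u.

Definition linear_on (R : realType) (S : (R -> R) -> Prop)
    (l : (R -> R) -> R) : Prop :=
  forall (a : R) (u w : R -> R), S u -> S w ->
    l (fun x => a * u x + w x) = a * l u + l w.

(* l is an element of V' whose dual norm is at most c *)
Definition dualV (R : realType) (l : (R -> R) -> R) (c : R) : Prop :=
  linear_on (@V R) l /\
  forall u du d2u, V_with u du d2u -> `|l u| <= c * normH2 u du d2u.

(* L^1(0,T;V'). Since V' is separable, strong measurability is measurability of
   t |-> <g(t), w> for each w in V; h is an integrable bound of the norm. *)
Definition L1dualV (R : realType) (T : R) (g : R -> (R -> R) -> R) : Prop :=
  (forall w, V w -> measurable_fun `[0, T] (fun t => g t w)) /\
  exists h : R -> R, integrable_on 0 T h /\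
    forall t, 0 <= t <= T -> dualV (g t) (h t).

(* Weak* convergence in L^oo(0,T;V), the dual of L^1(0,T;V') *)
Definition weakstar_LooV (R : realType) (T : R) (u_ : nat -> R -> R -> R)
    (u : R -> R -> R) : Prop :=
  forall g, L1dualV T g ->
    intg 0 T (fun t => g t (u_ n t)) @[n --> \oo]
      --> intg 0 T (fun t => g t (u t)).

(* C([0,T];L^2(0,1)), C([0,T];V) and C^1([0,T];L^2(0,1)) *)
Definition CL2 (R : realType) (T : R) (u : R -> R -> R) : Prop :=
  (forall t, 0 <= t <= T -> L2 0 1 (u t)) /\
  forall t, 0 <= t <= T ->
    intg 0 1 (fun x => (u s x - u t x) ^+ 2)
      @[s --> within `[0, T] (nbhs t)] --> (0 : R).

Definition CV (R : realType) (T : R) (u : R -> R -> R) : Prop :=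
  exists du d2u : R -> R -> R,
    (forall t, 0 <= t <= T -> V_with (u t) (du t) (d2u t)) /\
    [/\ CL2 T u, CL2 T du & CL2 T d2u].

Definition C1L2 (R : realType) (T : R) (u ut : R -> R -> R) : Prop :=
  [/\ CL2 T u, CL2 T ut &
   forall t, 0 <= t <= T ->
     intg 0 1 (fun x => ((u s x - u t x) / (s - t) - ut t x) ^+ 2)
       @[s --> within `[0, T] (dnbhs t)] --> (0 : R)].

(* C^4 test functions satisfying the four boundary conditions of the beam *)
Definition beam_test (R : realType) (w : R -> R) : Prop :=
  [/\ (forall (k : nat) (x : R), (k < 4)%N -> derivable (derive1n k w) x 1),
      continuous (derive1n 4 w),
      w 0 = 0, derive1n 1 w 1 = 0 & derive1n 2 w 0 = 0 /\ derive1n 3 w 1 = 0].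

(* Weak form on (0,1) x (0,T) of u_tt + u_xxxx = f together with the boundary
   conditions u = u_xx = 0 at x = 0 and u_x = u_xxx = 0 at x = 1: integration
   by parts against a test function w leaves no boundary term exactly because of
   them. The source is given by its action f t w = <f(t), w>. *)
Definition beam_weak (R : realType) (T : R) (f : R -> (R -> R) -> R)
    (u : R -> R -> R) : Prop :=
  forall w, beam_test w -> exists m : R -> R,
    W21 0 T (fun t => ip (u t) w) m
      (fun t => f t w - ip (u t) (derive1n 4 w)).

(* Solutions of the homogeneous system with initial data in L^2(0,1) x V';
   no further regularity is available for the states of the dual system. *)
Definition hom_solution (R : realType) (T : R) (phi : R -> R -> R) : Prop :=
  CL2 T phi /\ beam_weak T (fun _ _ => 0) phi.

Definition eq_ae01 (R : realType) (f g : R -> R) : Prop :=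
  {ae @lebesgue_measure R, forall x, 0 <= x <= 1 -> f x = g x}.

Definition beam_solution (R : realType) (T : R) (f : R -> (R -> R) -> R)
    (y0 y1 : R -> R) (u ut : R -> R -> R) : Prop :=
  [/\ CV T u, C1L2 T u ut, beam_weak T f u,
      eq_ae01 (u 0) y0 & eq_ae01 (ut 0) y1].

Definition controlled_solution (R : realType) (T : R)
    (f : R -> (R -> R) -> R) (y0 y1 : R -> R) (u : R -> R -> R) : Prop :=
  exists ut : R -> R -> R,
    [/\ beam_solution T f y0 y1 u ut,
        eq_ae01 (u T) (fun=> 0) & eq_ae01 (ut T) (fun=> 0)].

Definition chi (R : realType) (xi : R) (n : nat) : R -> R :=
  \1_(`]xi, (xi + n%:R^-1)[ : set R).

Definition internal_source (R : realType) (xi : R) (n : nat)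
    (phi : R -> R -> R) : R -> (R -> R) -> R :=
  fun t w => ip (fun x => chi xi n x * phi t x) w.

Definition pointwise_source (R : realType) (xi : R) (v : R -> R) :
    R -> (R -> R) -> R :=
  fun t w => v t * w xi.

Definition strategic (R : realType) (xi : R) : Prop :=
  forall m : nat, sin ((2 * m + 1)%:R / 2 * pi * xi) != 0.

(* D(0,1) *)
Definition testD (R : realType) (f : R -> R) : Prop :=
  (forall (k : nat) (x : R), derivable (derive1n k f) x 1) /\
  exists a b : R, [/\ 0 < a, b < 1 &
    forall x, ~~ (a <= x <= b) -> f x = 0].

(* The norm of (phi0, phi1) in F, where phi is the solution of the homogeneous
   system with these initial data. *)
Definition normF (R : realType) (T xi : R) (phi : R -> R -> R) : R :=
  Num.sqrt (intg 0 T (fun t => phi t xi ^+ 2)).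

(* (y0, y1) belongs to F', the dual of the completion F of D(0,1) x D(0,1), in
   the duality  <y1, phi0> - <y0, phi1>  attached to the wave-type equation.
   With mu_m = (2m+1)pi/2, y0 = sum a_m sin(mu_m x) and
   y1 = sum (b_m / mu_m^2) sin(mu_m x), this amounts to
   sum (mu_m^4 a_m^2 + b_m^2 / mu_m^4) / sin^2(mu_m xi) < oo;
   in particular y0 is in V and y1 in L^2(0,1). *)
Definition in_dualF (R : realType) (T xi : R) (y0 y1 : R -> R) : Prop :=
  [/\ L2 0 1 y0, L2 0 1 y1 &
   exists C : R, forall (phi0 phi1 : R -> R) (phi phit : R -> R -> R),
     testD phi0 -> testD phi1 ->
     beam_solution T (fun _ _ => 0) phi0 phi1 phi phit ->
     `|ip y1 phi0 - ip y0 phi1| <= C * normF T xi phi].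

Definition H10_with (R : realType) (T : R) (p dp : R -> R) : Prop :=
  [/\ L2 0 T dp, forall t, 0 <= t <= T -> p t = intg 0 t dp & p T = 0].

Definition H10 (R : realType) (T : R) (p : R -> R) : Prop :=
  exists dp, H10_with T p dp.

(* H^{-1}(0,T), the dual of H^1_0(0,T) *)
Definition Hm1 (R : realType) (T : R) (z : (R -> R) -> R) : Prop :=
  linear_on (H10 T) z /\
  exists C : R, forall p dp, H10_with T p dp ->
    `|z p| <= C * Num.sqrt (intg 0 T (fun t => p t ^+ 2 + dp t ^+ 2)).

(* P is the function x |-> int_0^T phi(t, x) p(t) dt, as an element of
   L^2(0,1): the integral over time is that of an L^2(0,1)-valued function. *)
Definition time_pairing (R : realType) (T : R) (phi : R -> R -> R)
    (p P : R -> R) : Prop :=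
  L2 0 1 P /\
  forall w, L2 0 1 w -> ip P w = intg 0 T (fun t => ip (phi t) w * p t).

(* z0 and z1 are the traces phi(xi, .) and phi_x(xi, .) in H^{-1}(0,T): phi is a
   C^1 function of x with values in H^{-1}(0,T), and z0, z1 are its value and
   its derivative at xi. For initial data in L^2(0,1) x V', phi_x(xi, .) is not a
   function of t in general. *)
Definition xtraces (R : realType) (T xi : R) (phi : R -> R -> R)
    (z0 z1 : (R -> R) -> R) : Prop :=
  [/\ Hm1 T z0, Hm1 T z1 &
   forall p, H10 T p -> exists P : R -> R,
     [/\ time_pairing T phi p P,
         forall x, 0 < x < 1 -> derivable P x 1 /\ {for x, continuous (derive1 P)},
         z0 p = P xi & z1 p = derive1 P xi]].

(* Weak* convergence in H^{-1}(0,T) to the element of L^2(0,T) given by v *)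
Definition weakstar_Hm1 (R : realType) (T : R) (z_ : nat -> (R -> R) -> R)
    (v : R -> R) : Prop :=
  forall p, H10 T p ->
    z_ n p @[n --> \oo] --> intg 0 T (fun t => v t * p t).

(* Main.v *)
Require Import Defs.
From mathcomp Require Import all_boot all_order all_algebra.
From mathcomp Require Import all_classical all_reals all_analysis measurable_realfun.
From mathcomp Require Import ring lra zify.
Set Implicit Arguments.
Unset Strict Implicit.
Unset Printing Implicit Defensive.
Import Order.TTheory GRing.Theory Num.Theory.
Import numFieldNormedType.Exports.
Local Open Scope classical_set_scope.
Local Open Scope ring_scope.

(* Everything is expanded in the eigenfunctions sin(mu_m x) of the beam, where
   mu_m = (2m+1)pi/2. The frequencies mu_m^2 lie in pi^2 (m(m+1) + 1/4), so the
   functions cos(mu_m^2 t) and sin(mu_m^2 t) are orthogonal on (0, 4/pi), and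
   4/pi < 2 <= T: no Ingham-type inequality is needed. Testing membership in F'
   with eigenfunction sums cut off by bump functions gives
     sum (mu_m^4 (y0)_m^2 + (y1)_m^2) / sin(mu_m xi)^2 < oo.
   Write omega_n for the interval (xi, xi + 1/n). Exact controllability of psi_n
   amounts to moment equations for n int_(omega_n) phi_n sin(mu_m x) dx, whose
   right-hand sides depend on the data only. Testing the equation of psi_n with
   phi_n and using that the mean of sin(mu_m x)^2 over omega_n is at least
   sin(mu_m xi)^2 / 8 bounds the energies n int_0^T int_(omega_n) phi_n^2
   uniformly in n. Hence the averages g_n = n int_(omega_n) phi_n dx are bounded
   in L^2(0,T), lie in the closed span of the trigonometric functions, and have
   moments converging to the data divided by sin(mu_m xi): they converge weakly
   to the element v of that span with these moments, which is the pointwise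
   control. The states psi_n are bounded in V and converge mode by mode, whence
   the weak* convergence. Finally phi_n(xi) + phi_n'(xi)/(2n) differs from g_n
   by a Taylor remainder of order 1/n in H^{-1}(0,T). *)

(** Nothing bounds the data of [phi n] in a fixed space as n grows: only the energy over the
    shrinking window is controlled, so the estimates keep the factor
    [wdot (window xi n) (sn m) (sn m)] to the end. This explains the correction phi_x(xi)/(2n):
    where sin(mu_m xi) is small, that factor can be of order (mu_m/n)^2, the same order as the
    square of the first Taylor term of the average, so that term would give no decay; the
    second-order remainder does. The functions cos(mu_m^2 t), sin(mu_m^2 t) are orthogonal but not
    complete, so moments determine only a projection; the weak limit is identified because the
    averages and [v] lie in the same closed span. States are merely continuous in time with values
    in L^2(0,1), without joint measurability: time and space integrals are interchanged on finite
    sums only, and limits are taken afterwards, uniformly in t. Solutions with a point load are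
    constructed explicitly and serve twice: without control, to evaluate the norm of F on test data,
    and with [v], to produce the limit state. *)

(** * Integrals over segments and limits under the integral sign *)

Section Integration.
Context {R : realType}.
Implicit Types (a b c d k x : R) (f g : R -> R).
Let mu := @lebesgue_measure R.

Lemma itvccP a b x : `[a, b]%classic x <-> a <= x <= b.
Proof. by rewrite /= in_itv. Qed.

Let mitv a b : measurable (`[a, b]%classic : set (measurableTypeR R)).
Proof. exact: measurable_itv. Qed.

Lemma integrable_onD a b f g : integrable_on a b f -> integrable_on a b g ->
  integrable_on a b (fun x => f x + g x).
Proof.
move=> hf hg; have := integrableD (mitv a b) hf hg.
by apply: eq_integrable => // x _; rewrite /= EFinD.
Qed.

Lemma integrable_onZl k a b f : integrable_on a b f ->
  integrable_on a b (fun x => k * f x).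
Proof.
move=> hf; have := integrableZl (mitv a b) k hf.
by apply: eq_integrable => // x _; rewrite /= EFinM.
Qed.

Lemma integrable_onZr k a b f : integrable_on a b f ->
  integrable_on a b (fun x => f x * k).
Proof.
by move=> /(integrable_onZl k); congr integrable_on; apply/funext => x;
  rewrite mulrC.
Qed.

Lemma integrable_onN a b f : integrable_on a b f ->
  integrable_on a b (fun x => - f x).
Proof.
by move=> /(integrable_onZl (-1)); congr integrable_on; apply/funext => x;
  rewrite mulN1r.
Qed.

Lemma integrable_onB a b f g : integrable_on a b f -> integrable_on a b g ->
  integrable_on a b (fun x => f x - g x).
Proof. by move=> hf /integrable_onN; exact: integrable_onD. Qed.

Lemma integrable_on_cst a b k : integrable_on a b (fun=> k).
Proof.
apply: continuous_compact_integrable; first exact: segment_compact.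
by apply: continuous_subspaceT => ?; exact: cvg_cst.
Qed.

Lemma integrable_on_sum a b (F : nat -> R -> R) N :
  (forall i, (i < N)%N -> integrable_on a b (F i)) ->
  integrable_on a b (fun x => \sum_(i < N) F i x).
Proof.
elim: N => [|N ih] hF.
  by under eq_fun do rewrite big_ord0; exact: integrable_on_cst.
under eq_fun do rewrite big_ord_recr/=.
by apply: integrable_onD; [apply: ih => i iN; apply: hF; exact: ltnW|exact: hF].
Qed.

Lemma integrable_on_normr a b f : integrable_on a b f ->
  integrable_on a b (fun x => `|f x|).
Proof. by move/integrable_norm. Qed.

Lemma integrable_on_measurable a b f :
  integrable_on a b f -> measurable_fun `[a, b] f.
Proof. by move=> /integrableP[/measurable_EFinP]. Qed.

Lemma integrable_on_le a b f g : measurable_fun `[a, b] f ->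
  integrable_on a b g -> (forall x, a <= x <= b -> `|f x| <= g x) ->
  integrable_on a b f.
Proof.
move=> mf hg fg; apply: (le_integrable (mitv a b) _ _ hg).
  exact/measurable_EFinP.
move=> x /itvccP xab /=; rewrite lee_fin (le_trans (fg _ xab))// ler_norm.
by [].
Qed.

Lemma integrable_on_sub a b c d f : a <= c -> d <= b ->
  integrable_on a b f -> integrable_on c d f.
Proof.
move=> ac db; apply: integrableS => //.
by apply: subset_itv; rewrite bnd_simp.
Qed.

Lemma continuous_integrable_on a b f : {within `[a, b], continuous f} ->
  integrable_on a b f.
Proof. by move=> cf; apply: continuous_compact_integrable; [exact: segment_compact|]. Qed.

Lemma eq_integrable_on a b f g : (forall x, a <= x <= b -> f x = g x) ->
  integrable_on a b f -> integrable_on a b g.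
Proof.
move=> fg; apply: eq_integrable => // x; rewrite inE => /itvccP xab.
by rewrite /= fg.
Qed.

Lemma eq_intg a b f g : (forall x, a <= x <= b -> f x = g x) ->
  intg a b f = intg a b g.
Proof.
by move=> fg; apply: eq_Rintegral => x; rewrite inE => /itvccP; exact: fg.
Qed.

Lemma intgD a b f g : integrable_on a b f -> integrable_on a b g ->
  intg a b (fun x => f x + g x) = intg a b f + intg a b g.
Proof. by move=> hf hg; rewrite /intg RintegralD. Qed.

Lemma intgB a b f g : integrable_on a b f -> integrable_on a b g ->
  intg a b (fun x => f x - g x) = intg a b f - intg a b g.
Proof. by move=> hf hg; rewrite /intg RintegralB. Qed.

Lemma intgZl k a b f : integrable_on a b f ->
  intg a b (fun x => k * f x) = k * intg a b f.
Proof. by move=> hf; rewrite /intg RintegralZl. Qed.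

Lemma intgZr k a b f : integrable_on a b f ->
  intg a b (fun x => f x * k) = intg a b f * k.
Proof. by move=> hf; rewrite /intg RintegralZr. Qed.

Lemma intgN a b f : integrable_on a b f ->
  intg a b (fun x => - f x) = - intg a b f.
Proof.
move=> hf; rewrite -mulN1r -intgZl//; apply: eq_intg => x _.
by rewrite mulN1r.
Qed.

Lemma intg_cst a b k : a <= b -> intg a b (fun=> k) = k * (b - a).
Proof.
move=> ab; rewrite /intg Rintegral_cst//=.
rewrite (_ : lebesgue_measure _ = lebesgue_measure `[a, b])// lebesgue_measure_itv/= lte_fin.
by case: ltgtP ab => // ->; rewrite subrr.
Qed.

Lemma intg0 a b : intg a b (fun=> 0) = 0.
Proof. by rewrite /intg Rintegral_cst// mul0r. Qed.

Lemma intg_sum a b (F : nat -> R -> R) N :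
  (forall i, (i < N)%N -> integrable_on a b (F i)) ->
  intg a b (fun x => \sum_(i < N) F i x) = \sum_(i < N) intg a b (F i).
Proof.
elim: N => [|N ih] hF.
  by rewrite big_ord0; under eq_fun do rewrite big_ord0; rewrite intg0.
rewrite big_ord_recr/= -ih; last by move=> i iN; apply: hF; exact: ltnW.
rewrite -intgD; last 2 first.
- by apply: integrable_on_sum => i iN; apply: hF; exact: ltnW.
- exact: hF.
by apply: eq_intg => x _; rewrite big_ord_recr.
Qed.

Lemma intg_ge0 a b f : (forall x, a <= x <= b -> 0 <= f x) -> 0 <= intg a b f.
Proof. by move=> f0; apply: Rintegral_ge0 => x /itvccP; exact: f0. Qed.

Lemma le_intg a b f g : integrable_on a b f -> integrable_on a b g ->
  (forall x, a <= x <= b -> f x <= g x) -> intg a b f <= intg a b g.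
Proof.
by move=> hf hg fg; apply: le_Rintegral => // x /itvccP; exact: fg.
Qed.

Lemma ler_norm_intg a b f : integrable_on a b f ->
  `|intg a b f| <= intg a b (fun x => `|f x|).
Proof. by move=> hf; exact: le_normr_Rintegral. Qed.

Lemma ler_norm_intg_cst a b f M : a <= b -> integrable_on a b f ->
  (forall x, a <= x <= b -> `|f x| <= M) -> `|intg a b f| <= M * (b - a).
Proof.
move=> ab hf fM; rewrite (le_trans (ler_norm_intg hf))// -intg_cst//.
by apply: le_intg => //; [exact: integrable_on_normr|exact: integrable_on_cst].
Qed.

Lemma intg_set1 a f : intg a a f = 0.
Proof. by rewrite /intg set_itv1 Rintegral_set1. Qed.

Lemma intg_cat c a b f : a <= c <= b -> integrable_on a b f ->
  intg a b f = intg a c f + intg c b f.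
Proof.
move=> /andP[ac cb] hf; rewrite /intg addrC.
have := @Rintegral_itvB _ f (BLeft a) (BRight b) c hf.
rewrite !bnd_simp => /(_ ac cb) /eqP; rewrite subr_eq => /eqP ->.
congr (_ + _); rewrite Rintegral_itv_obnd_cbnd//.
apply: integrableS hf => //.
by apply: subset_itv; rewrite bnd_simp.
Qed.

Lemma le_intg_sub a b c d f : a <= c -> c <= d -> d <= b -> integrable_on a b f ->
  (forall x, a <= x <= b -> 0 <= f x) -> intg c d f <= intg a b f.
Proof.
move=> ac cd db hf f0.
rewrite (@intg_cat c a b)//; last by rewrite ac (le_trans cd).
rewrite (@intg_cat d c b)//; last 2 first.
- by rewrite cd.
- exact: integrable_on_sub hf.
rewrite addrCA lerDl addr_ge0// intg_ge0// => x /andP[h1 h2]; apply: f0; lra.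
Qed.

Lemma continuous_within a b f : continuous f -> {within `[a, b], continuous f}.
Proof. by move=> cf; exact: continuous_subspaceT. Qed.

Lemma continuous_integrable a b f : continuous f -> integrable_on a b f.
Proof. by move/(@continuous_within a b)/continuous_integrable_on. Qed.

Lemma FTC2 a b (F f : R -> R) : a <= b -> continuous f ->
  (forall x, is_derive x 1 F (f x)) -> intg a b f = F b - F a.
Proof.
rewrite le_eqVlt => /predU1P[-> _ _|ab cf dF]; first by rewrite intg_set1 subrr.
have cF : continuous F.
  by move=> x; apply/differentiable_continuous/derivable1_diffP;
    have [] := dF x.
rewrite /intg /Rintegral (@continuous_FTC2 _ f F)//=.
- exact: continuous_within.
- split; first by move=> x _; have [] := dF x.
    by apply: cvg_at_right_filter; exact: cF.
  by apply: cvg_at_left_filter; exact: cF.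
- by move=> x _; rewrite derive1E; have [_ ->] := dF x.
Qed.

Lemma FTC1_continuous a b f x : continuous f -> a < x < b ->
  is_derive x 1 (fun y => intg a y f) (f x).
Proof.
move=> cf /andP[ax xb].
have [] := @continuous_FTC1 R f (BLeft a) x b xb _ _ (cf x).
- exact: continuous_integrable.
- by rewrite lte_fin.
rewrite derive1E => dF eF.
by split; first exact: dF.
Qed.

End Integration.

Section LimitsOfIntegrals.
Context {R : realType}.
Implicit Types (a b M : R) (f g : R -> R) (F : nat -> R -> R).
Let mu := @lebesgue_measure R.

Let mitv a b : measurable (`[a, b]%classic : set (measurableTypeR R)).
Proof. exact: measurable_itv. Qed.

Lemma cvgn_ge (u : nat -> R) l M : u n @[n --> \oo] --> l ->
  (forall n, M <= u n) -> M <= l.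
Proof.
move=> ul uM; rewrite -(cvg_lim _ ul)//; apply: limr_ge; last exact: nearW.
by apply/cvg_ex; exists l.
Qed.

Lemma cvgn_le (u : nat -> R) l M : u n @[n --> \oo] --> l ->
  (forall n, u n <= M) -> l <= M.
Proof.
move=> ul uM; rewrite -(cvg_lim _ ul)//; apply: limr_le; last exact: nearW.
by apply/cvg_ex; exists l.
Qed.

Lemma cvgn_addE (f g h : nat -> R) (a b c : R) : f n @[n --> \oo] --> a ->
  g n @[n --> \oo] --> b -> h n @[n --> \oo] --> c ->
  (forall n, f n = g n + h n) -> a = b + c.
Proof.
move=> fa gb hc e.
have fbc : f n @[n --> \oo] --> b + c.
  by rewrite (_ : f = (fun n => g n + h n)); [exact: cvgD|apply/funext].
by rewrite -(cvg_lim (@Rhausdorff R) fa) -(cvg_lim (@Rhausdorff R) fbc).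
Qed.

Lemma intg_EFin a b f : integrable_on a b f ->
  (\int[mu]_(x in `[a, b]) (f x)%:E)%E = (intg a b f)%:E.
Proof. by move=> hf; rewrite /intg /Rintegral fineK// integrable_fin_num. Qed.

(** [intg] reads 0 when the integral is infinite, so a bound on it says little by itself. The
    extended-real Fatou inequality comes first and yields integrability of the limit together with
    the bound. *)
Lemma fatou_intg a b F f M :
  (forall n, integrable_on a b (F n)) ->
  (forall n x, a <= x <= b -> 0 <= F n x) ->
  (forall x, a <= x <= b -> F n x @[n --> \oo] --> f x) ->
  (forall n, intg a b (F n) <= M) ->
  integrable_on a b f /\ intg a b f <= M.
Proof.
move=> iF F0 Ff FM.
have f0 x : a <= x <= b -> 0 <= f x.
  by move=> xab; apply: cvgn_ge (Ff _ xab) _ => n; exact: F0.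
have mf : measurable_fun `[a, b] f.
  apply: (@measurable_fun_cvg _ _ _ _ F) => [n|x /itvccP]; last exact: Ff.
  exact: integrable_on_measurable.
have key : (\int[mu]_(x in `[a, b]) (f x)%:E <= M%:E)%E.
  have -> : (\int[mu]_(x in `[a, b]) (f x)%:E =
      \int[mu]_(x in `[a, b]) limn_einf (fun n => (F n x)%:E))%E.
    apply: eq_integral => x; rewrite inE => /itvccP xab.
    have h : (F n x)%:E @[n --> \oo] --> (f x)%:E.
      by apply: cvg_EFin; [exact: nearW|exact: Ff].
    by rewrite is_cvg_limn_einfE; [apply/esym/cvg_lim|apply/cvg_ex; eexists; exact: h].
  apply: le_trans (fatou _ (mitv a b) _ _) _.
  - by move=> n; apply/measurable_EFinP; exact: integrable_on_measurable.
  - by move=> n x /itvccP xab; rewrite lee_fin F0.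
  rewrite limn_einf_lim; apply: lime_le; first exact: is_cvg_einfs.
  apply: nearW => n; apply: (@le_trans _ _ (\int[mu]_(x in `[a, b]) (F n x)%:E)%E).
    by apply: ereal_inf_lbound; exists n => //=.
  by rewrite intg_EFin// lee_fin.
have intf : integrable_on a b f.
  apply/integrableP; split; first exact/measurable_EFinP.
  have -> : (\int[mu]_(x in `[a, b]) `|(EFin \o f) x| =
      \int[mu]_(x in `[a, b]) (f x)%:E)%E.
    apply: eq_integral => x; rewrite inE => /itvccP xab.
    by rewrite /= ger0_norm// f0.
  by rewrite (le_lt_trans key)// ltry.
by split=> //; rewrite -lee_fin -intg_EFin.
Qed.

Lemma dominated_intg a b F f g :
  (forall n, measurable_fun `[a, b] (F n)) -> integrable_on a b g ->
  (forall x, a <= x <= b -> F n x @[n --> \oo] --> f x) ->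
  (forall n x, a <= x <= b -> `|F n x| <= g x) ->
  integrable_on a b f /\ intg a b (F n) @[n --> \oo] --> intg a b f.
Proof.
move=> mF ig Ff Fg.
have Ff' x : `[a, b]%classic x -> (F n x)%:E @[n --> \oo] --> (f x)%:E.
  by move=> /itvccP xab; apply: cvg_EFin; [exact: nearW|exact: Ff].
have mF' n : measurable_fun `[a, b] (fun x => (F n x)%:E).
  exact/measurable_EFinP.
have Fg' n x : `[a, b]%classic x -> (`|(F n x)%:E| <= (g x)%:E)%E.
  by move=> /itvccP xab; rewrite lee_fin Fg.
have [] := @dominated_convergence _ _ _ mu _ (mitv a b) _ (EFin \o f) (EFin \o g) mF'.
  apply/measurable_EFinP; apply: (@measurable_fun_cvg _ _ _ _ F) => //.
- exact: aeW.
- exact: ig.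
- by apply: aeW => x n; exact: Fg'.
move=> intf _ h; split => //.
rewrite intg_EFin// in h.
exact: fine_cvg h.
Qed.

Lemma uniform_intg a b F f : a <= b ->
  (forall n, integrable_on a b (F n)) ->
  (forall e, 0 < e -> \forall n \near \oo,
     forall x, a <= x <= b -> `|F n x - f x| <= e) ->
  integrable_on a b f /\ intg a b (F n) @[n --> \oo] --> intg a b f.
Proof.
move=> ab iF Ff.
have Fx x : a <= x <= b -> F n x @[n --> \oo] --> f x.
  move=> xab; apply/cvgrPdist_le => e e0.
  by apply: filterS (Ff e e0) => n /(_ x xab); rewrite distrC.
have mf : measurable_fun `[a, b] f.
  apply: (@measurable_fun_cvg _ _ _ _ F) => [n|x /itvccP]; last exact: Fx.
  exact: integrable_on_measurable.
have intf : integrable_on a b f.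
  have [N _ hN] := Ff 1 ltr01.
  have h1 : integrable_on a b (fun x => 1 + `|F N x|).
    by apply: integrable_onD; [exact: integrable_on_cst|exact: integrable_on_normr].
  apply: integrable_on_le mf h1 _ => x xab.
  have := hN N (leqnn N) x xab.
  rewrite -lerBlDr; apply: le_trans.
  by rewrite distrC lerB_dist.
split=> //; apply/cvgrPdist_le => e e0.
have e1 : 0 < e / (b - a + 1) by rewrite divr_gt0// ltr_wpDl// subr_ge0.
apply: filterS (Ff _ e1) => n hn; rewrite -intgB//.
apply: le_trans (ler_norm_intg_cst ab _ _) _; first exact: integrable_onB.
  by move=> x xab; rewrite distrC; exact: hn.
rewrite mulrAC ler_pdivrMr ?ltr_wpDl ?subr_ge0//.
by rewrite ler_pM2l// lerDl.
Qed.

(** Term-by-term integration makes the extended sum integrable, hence finite almost everywhere. This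
    supplies the convergent subsequence in the completeness of L^2. *)
Lemma ae_summable a b F M :
  (forall n, integrable_on a b (F n)) ->
  (forall n x, a <= x <= b -> 0 <= F n x) ->
  (forall n, \sum_(i < n) intg a b (F i) <= M) ->
  {ae mu, forall x, a <= x <= b -> cvgn (series (F ^~ x))}.
Proof.
move=> iF F0 FM.
have mF n : measurable_fun `[a, b] (fun x => (F n x)%:E).
  by apply/measurable_EFinP; exact: integrable_on_measurable.
have F0' n x : `[a, b]%classic x -> (0 <= (F n x)%:E)%E.
  by move=> /itvccP xab; rewrite lee_fin F0.
pose S x := (\sum_(n <oo) (F n x)%:E)%E.
have S0 x : `[a, b]%classic x -> (0 <= S x)%E.
  by move=> xab; apply: nneseries_ge0 => n _ _; exact: F0'.
have intS : mu.-integrable `[a, b] S.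
  apply/integrableP; split.
    rewrite /S; apply: ge0_emeasurable_sum => [n x xab _|n _]; [exact: F0'|exact: mF].
  have -> : (\int[mu]_(x in `[a, b]) `|S x| = \int[mu]_(x in `[a, b]) S x)%E.
    by apply: eq_integral => x; rewrite inE => xab; rewrite gee0_abs// S0.
  rewrite integral_nneseries//.
  apply: (@le_lt_trans _ _ M%:E); last exact: ltry.
  apply: lime_le; first by apply: is_cvg_nneseries => n _ _; apply: integral_ge0 => x; exact: F0'.
  apply: nearW => n; rewrite (eq_bigr (fun i => (intg a b (F i))%:E)); last first.
    by move=> i _; rewrite intg_EFin.
  by rewrite sumEFin lee_fin big_mkord.
apply: filterS (integrable_ae (mitv a b) intS) => x h /itvccP xab.
have {}h := h xab.
apply: nondecreasing_is_cvgn.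
  apply: nondecreasing_series => n _ _; exact: F0.
exists (fine (S x)) => _ [n _ <-].
rewrite -lee_fin fineK// /series/= -sumEFin.
by apply: nneseries_lim_ge => i _ _; exact: F0'.
Qed.

End LimitsOfIntegrals.

(** * Scalar products, completeness and orthogonal projection in L^2 *)

Section SquareIntegrable.
Context {R : realType}.
Implicit Types (a b c d k M x : R) (f g h : R -> R) (F : nat -> R -> R).
Local Notation mu := (@lebesgue_measure R).

(** [dot 0 1] is convertible to [ip]. Arbitrary segments are allowed because the same calculus
    serves in space, on (0,1) and on the window, and in time, on (0,T) and its subintervals. *)
Definition dot a b f g : R := intg a b (fun x => f x * g x).

Lemma L2_mul a b f g : L2 a b f -> L2 a b g ->
  integrable_on a b (fun x => f x * g x).
Proof.
move=> [mf if2] [mg ig2].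
apply: (@integrable_on_le _ _ _ _ (fun x => f x ^+ 2 + g x ^+ 2)).
- exact: measurable_funM.
- exact: integrable_onD.
move=> x _; rewrite normrM -(real_normK (num_real (f x))).
rewrite -(real_normK (num_real (g x))).
by have := normr_ge0 (f x); have := normr_ge0 (g x); nra.
Qed.

Lemma L2_bounded_mul a b f g M : measurable_fun `[a, b] g ->
  (forall x, a <= x <= b -> `|g x| <= M) -> L2 a b f ->
  L2 a b (fun x => g x * f x).
Proof.
move=> mg gM [mf if2]; split; first exact: measurable_funM.
apply: (@integrable_on_le _ _ _ _ (fun x => M ^+ 2 * f x ^+ 2)).
- by apply: measurable_funX; exact: measurable_funM.
- exact: integrable_onZl.
move=> x xab; rewrite normrX normrM exprMn [`|f x| ^+ 2]real_normK ?num_real//.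
by rewrite ler_wpM2r ?sqr_ge0// lerXn2r ?nnegrE// ?gM// (le_trans (normr_ge0 _) (gM x xab)).
Qed.

Lemma L2_cst a b k : L2 a b (fun=> k).
Proof. by split; [exact: measurable_cst|exact: integrable_on_cst]. Qed.

Lemma L2Zl k a b f : L2 a b f -> L2 a b (fun x => k * f x).
Proof.
apply: (@L2_bounded_mul _ _ _ (fun=> k) `|k|) => //; exact: measurable_cst.
Qed.

Lemma L2D a b f g : L2 a b f -> L2 a b g -> L2 a b (fun x => f x + g x).
Proof.
move=> hf hg; have hfg := L2_mul hf hg; case: hf hg => mf if2 [mg ig2].
split; first exact: measurable_funD.
have : integrable_on a b (fun x => f x ^+ 2 + 2 * (f x * g x) + g x ^+ 2).
  by apply: integrable_onD => //; apply: integrable_onD => //; exact: integrable_onZl.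
by apply: eq_integrable_on => x _; ring.
Qed.

Lemma L2N a b f : L2 a b f -> L2 a b (fun x => - f x).
Proof.
by move=> /(L2Zl (-1)); congr L2; apply/funext => x; rewrite mulN1r.
Qed.

Lemma L2B a b f g : L2 a b f -> L2 a b g -> L2 a b (fun x => f x - g x).
Proof. by move=> hf /L2N; exact: L2D. Qed.

Lemma L2_integrable a b f : L2 a b f -> integrable_on a b f.
Proof.
move=> hf; have := L2_mul hf (L2_cst a b 1).
by apply: eq_integrable_on => x _; rewrite mulr1.
Qed.

Lemma continuous_L2 a b f : continuous f -> L2 a b f.
Proof.
move=> cf; split.
  by apply: integrable_on_measurable; exact: continuous_integrable.
apply: continuous_integrable => x.
by apply: continuousM; exact: cf.
Qed.

Lemma L2_sub a b c d f : a <= c -> d <= b -> L2 a b f -> L2 c d f.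
Proof.
move=> ac db [mf if2]; split; last exact: integrable_on_sub if2.
apply: measurable_funS mf => //.
by apply: subset_itv; rewrite bnd_simp.
Qed.

Lemma eq_L2 a b f g : (forall x, a <= x <= b -> f x = g x) ->
  L2 a b f -> L2 a b g.
Proof.
move=> fg [mf if2]; split.
  apply: eq_measurable_fun mf => x; rewrite inE => /itvccP; exact: fg.
by apply: eq_integrable_on if2 => x xab; rewrite fg.
Qed.

Lemma dotC a b f g : dot a b f g = dot a b g f.
Proof. by apply: eq_intg => x _; rewrite mulrC. Qed.

Lemma eq_dot a b f f' g g' : (forall x, a <= x <= b -> f x = f' x) ->
  (forall x, a <= x <= b -> g x = g' x) -> dot a b f g = dot a b f' g'.
Proof. by move=> ff' gg'; apply: eq_intg => x xab; rewrite ff'// gg'. Qed.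

Lemma dotDl a b f g h : L2 a b f -> L2 a b g -> L2 a b h ->
  dot a b (fun x => f x + g x) h = dot a b f h + dot a b g h.
Proof.
move=> hf hg hh; rewrite /dot -intgD; [|exact: L2_mul..].
by apply: eq_intg => x _; rewrite mulrDl.
Qed.

Lemma dotZl a b k f g : L2 a b f -> L2 a b g ->
  dot a b (fun x => k * f x) g = k * dot a b f g.
Proof.
move=> hf hg; rewrite /dot -intgZl; last exact: L2_mul.
by apply: eq_intg => x _; rewrite mulrA.
Qed.

Lemma dotDr a b f g h : L2 a b f -> L2 a b g -> L2 a b h ->
  dot a b f (fun x => g x + h x) = dot a b f g + dot a b f h.
Proof. by move=> hf hg hh; rewrite dotC dotDl// !(dotC _ _ f). Qed.

Lemma dotZr a b k f g : L2 a b f -> L2 a b g ->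
  dot a b f (fun x => k * g x) = k * dot a b f g.
Proof. by move=> hf hg; rewrite dotC dotZl// (dotC _ _ f). Qed.

Lemma dotBl a b f g h : L2 a b f -> L2 a b g -> L2 a b h ->
  dot a b (fun x => f x - g x) h = dot a b f h - dot a b g h.
Proof.
move=> hf hg hh; rewrite /dot -intgB; [|exact: L2_mul..].
by apply: eq_intg => x _; rewrite mulrBl.
Qed.

Lemma dotBr a b f g h : L2 a b f -> L2 a b g -> L2 a b h ->
  dot a b f (fun x => g x - h x) = dot a b f g - dot a b f h.
Proof. by move=> hf hg hh; rewrite dotC dotBl// !(dotC _ _ f). Qed.

Lemma dot_suml a b F g N : (forall i, L2 a b (F i)) -> L2 a b g ->
  dot a b (fun x => \sum_(i < N) F i x) g = \sum_(i < N) dot a b (F i) g.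
Proof.
move=> hF hg; rewrite /dot -(intg_sum (F := fun i x => F i x * g x)).
  by apply: eq_intg => x _; rewrite mulr_suml.
by move=> i _; exact: L2_mul.
Qed.

Lemma dot_sumr a b F g N : (forall i, L2 a b (F i)) -> L2 a b g ->
  dot a b g (fun x => \sum_(i < N) F i x) = \sum_(i < N) dot a b g (F i).
Proof.
by move=> hF hg; rewrite dotC dot_suml//; apply: eq_bigr => i _; rewrite dotC.
Qed.

Lemma dotNN a b f : dot a b (fun x => - f x) (fun x => - f x) = dot a b f f.
Proof. by apply: eq_intg => x _; rewrite mulrNN. Qed.

Lemma dot_ge0 a b f : 0 <= dot a b f f.
Proof. by apply: intg_ge0 => x _; rewrite -expr2 sqr_ge0. Qed.

Lemma dot_sqrD a b f g : L2 a b f -> L2 a b g ->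
  dot a b (fun x => f x + g x) (fun x => f x + g x) =
  dot a b f f + 2 * dot a b f g + dot a b g g.
Proof.
by move=> hf hg; rewrite dotDl ?dotDr// ?(dotC _ _ g f); [ring|exact: L2D].
Qed.

Lemma dot_sqrB a b f g : L2 a b f -> L2 a b g ->
  dot a b (fun x => f x - g x) (fun x => f x - g x) =
  dot a b f f - 2 * dot a b f g + dot a b g g.
Proof.
by move=> hf hg; rewrite dotBl ?dotBr// ?(dotC _ _ g f); [ring|exact: L2B].
Qed.

Lemma dotBC a b f g : dot a b (fun x => f x - g x) (fun x => f x - g x) =
  dot a b (fun x => g x - f x) (fun x => g x - f x).
Proof. by apply: eq_intg => x _; ring. Qed.

Lemma dot_sqrD_le a b f g : L2 a b f -> L2 a b g ->
  dot a b (fun x => f x + g x) (fun x => f x + g x) <=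
  2 * dot a b f f + 2 * dot a b g g.
Proof.
move=> hf hg; have := dot_ge0 a b (fun x => f x - g x).
by rewrite dot_sqrB// dot_sqrD//; lra.
Qed.

Lemma young_dot a b k f g : 0 < k -> L2 a b f -> L2 a b g ->
  2 * `|dot a b f g| <= k * dot a b f f + k^-1 * dot a b g g.
Proof.
move=> k0 hf hg.
have h1 := dot_ge0 a b (fun x => k * f x + g x).
have h2 := dot_ge0 a b (fun x => k * f x - g x).
rewrite dot_sqrD ?dotZl ?dotZr// in h1; try exact: L2Zl.
rewrite dot_sqrB ?dotZl ?dotZr// in h2; try exact: L2Zl.
have -> : k * dot a b f f + k^-1 * dot a b g g =
    k^-1 * (k * (k * dot a b f f) + dot a b g g) by field; rewrite gt_eqF.
rewrite [leRHS]mulrC ler_pdivlMr//.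
by case: (ger0P (dot a b f g)) => _; lra.
Qed.

Lemma CauchySchwarz a b f g : L2 a b f -> L2 a b g ->
  dot a b f g ^+ 2 <= dot a b f f * dot a b g g.
Proof.
move=> hf hg.
have A0 := dot_ge0 a b f; have B0 := dot_ge0 a b g.
have [gg0|gg0] := eqVneq (dot a b g g) 0.
  suff -> : dot a b f g = 0 by rewrite gg0 expr0n/= mulr0.
  apply/eqP; apply: contraT => fg0.
  (* When g has norm 0, Young's inequality reads 2|(f,g)| <= k (f,f) for every positive k; this k
     makes the right-hand side smaller than |(f,g)|. *)
  have k0 : 0 < `|dot a b f g| / (dot a b f f + 1).
    by rewrite divr_gt0// ?normr_gt0// ltr_wpDl.
  have := young_dot k0 hf hg; rewrite gg0 mulr0 addr0.
  rewrite mulrAC ler_pdivlMr ?ltr_wpDl//.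
  have : 0 < `|dot a b f g| by rewrite normr_gt0.
  nra.
have h := dot_ge0 a b (fun x => dot a b g g * f x - dot a b f g * g x).
rewrite dot_sqrB ?dotZl ?dotZr// in h; try exact: L2Zl.
have gg1 : 0 < dot a b g g by rewrite lt_neqAle eq_sym gg0.
rewrite -(ler_pM2l gg1); nra.
Qed.

Definition nrm a b f := Num.sqrt (dot a b f f).

Lemma nrm_ge0 a b f : 0 <= nrm a b f. Proof. exact: sqrtr_ge0. Qed.

Lemma nrm_sqr a b f : nrm a b f ^+ 2 = dot a b f f.
Proof. by rewrite sqr_sqrtr// dot_ge0. Qed.

Lemma ler_dot_nrm a b f g : L2 a b f -> L2 a b g ->
  `|dot a b f g| <= nrm a b f * nrm a b g.
Proof.
move=> hf hg; rewrite /nrm -sqrtrM ?dot_ge0// -sqrtr_sqr.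
by rewrite ler_wsqrtr// CauchySchwarz.
Qed.

Lemma cvg_dot a b F f g : (forall n, L2 a b (F n)) -> L2 a b f -> L2 a b g ->
  dot a b (fun x => F n x - f x) (fun x => F n x - f x) @[n --> \oo] --> 0 ->
  dot a b (F n) g @[n --> \oo] --> dot a b f g.
Proof.
move=> hF hf hg h0; apply/cvgrPdist_le => e e0.
pose k := e / (dot a b g g + 1).
have gg1 : 0 < dot a b g g + 1 by rewrite ltr_wpDl ?dot_ge0.
have k0 : 0 < k by rewrite divr_gt0.
have ke0 : 0 < k * e by rewrite mulr_gt0.
move/cvgrPdist_le : h0 => /(_ _ ke0); apply: filterS => n.
rewrite sub0r normrN ger0_norm ?dot_ge0// => hn.
rewrite distrC -dotBl//.
have ki0 : 0 < k^-1 by rewrite invr_gt0.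
have := young_dot ki0 (L2B (hF n) hf) hg; rewrite invrK.
have : k^-1 * dot a b (fun x => F n x - f x) (fun x => F n x - f x) <= e.
  by rewrite mulrC ler_pdivrMr// mulrC.
have : k * dot a b g g <= e.
  by rewrite /k mulrAC ler_pdivrMr// ler_pM2l// lerDl.
lra.
Qed.

Lemma ae_eq_dot a b f f' g : L2 a b f -> L2 a b f' -> L2 a b g ->
  {ae mu, forall x, a <= x <= b -> f x = f' x} -> dot a b f g = dot a b f' g.
Proof.
move=> hf hf' hg ff'; rewrite /dot /intg /Rintegral; congr fine.
apply: ae_eq_integral => //.
- by apply/measurable_EFinP; exact: measurable_funM hf.1 hg.1.
- by apply/measurable_EFinP; exact: measurable_funM hf'.1 hg.1.
case: ff' => N [mN N0 sub]; exists N; split=> // x /= hx; apply: sub => /= h.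
by apply: hx => xab; rewrite h.
Qed.

End SquareIntegrable.

Section Completeness.
Context {R : realType}.
Implicit Types (a b e : R) (f g : R -> R) (F : nat -> R -> R).
Local Notation mu := (@lebesgue_measure R).

Lemma cvg0_squeeze (u w : nat -> R) : (forall n, 0 <= u n) ->
  (forall n, u n <= w n) -> w n @[n --> \oo] --> 0 -> u n @[n --> \oo] --> 0.
Proof.
move=> u0 uw w0; apply: (@squeeze_cvgr _ _ _ _ (fun=> 0) w) => //.
- by apply: nearW => n; rewrite u0 uw.
- exact: (@cvg_cst R^o).
Qed.

Lemma L2_ae_eq a b f g : measurable_fun `[a, b] g -> L2 a b f ->
  {ae mu, forall x, a <= x <= b -> f x = g x} ->
  L2 a b g /\ dot a b g g = dot a b f f.
Proof.
move=> mg [mf if2] [N [mN N0 sub]].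
have mab : measurable (`[a, b]%classic : set (measurableTypeR R)).
  exact: measurable_itv.
have fg2 : (\int[mu]_(x in `[a, b]) (g x ^+ 2)%:E =
            \int[mu]_(x in `[a, b]) (f x ^+ 2)%:E)%E.
  apply: ae_eq_integral => //.
  - by apply/measurable_EFinP; exact: measurable_funX.
  - by apply/measurable_EFinP; exact: measurable_funX.
  exists N; split=> // x /= hx; apply: sub => /= h.
  by apply: hx => xab; rewrite h.
split; last by rewrite /dot /intg /Rintegral; congr fine.
split=> //; apply/integrableP; split.
  by apply/measurable_EFinP; exact: measurable_funX.
under eq_integral => x _ do rewrite /= ger0_norm ?sqr_ge0//.
rewrite fg2; have /integrableP[_] := if2.
by under eq_integral => x _ do rewrite /= ger0_norm ?sqr_ge0//.
Qed.

(** A fast Cauchy subsequence has increments summable in L^1, so it converges almost everywhere;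
    Fatou's lemma with one index fixed then gives mean-square convergence of the whole sequence. *)
Theorem L2_complete a b F : (forall n, L2 a b (F n)) ->
  (forall e, 0 < e -> exists N, forall m n, (N <= m)%N -> (N <= n)%N ->
     dot a b (fun x => F m x - F n x) (fun x => F m x - F n x) <= e) ->
  exists f, L2 a b f /\
    dot a b (fun x => F n x - f x) (fun x => F n x - f x) @[n --> \oo] --> 0.
Proof.
move=> hF cF.
have e0 k : 0 < (1 / 2 : R) ^+ k ^+ 2 by rewrite !exprn_gt0.
have /choice[N hN] k := cF _ (e0 k).
(* The running maximum and the added k make the extraction nondecreasing, unbounded and above
   [N]. *)
pose M k := (k + \max_(i < k.+1) N i)%N.
have MS k : (M k <= M k.+1)%N.
  by rewrite /M leq_add// [in leqRHS]big_ord_recr/= leq_maxl.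
have NM k : (N k <= M k)%N.
  by rewrite /M (leq_trans _ (leq_addl _ _))// big_ord_recr/= leq_maxr.
have kM k : (k <= M k)%N by rewrite /M leq_addr.
pose G k := F (M k).
pose D k x := `|G k.+1 x - G k x|.
have LD k : L2 a b (fun x => G k.+1 x - G k x).
  by apply: L2B; exact: hF.
have iD k : integrable_on a b (D k).
  exact/integrable_on_normr/L2_integrable.
have LD' k : L2 a b (D k).
  have [m i2] := LD k; split; first exact: measurableT_comp.
  by apply: eq_integrable_on i2 => x _; rewrite /D real_normK ?num_real.
have intD k : intg a b (D k) <= (1 / 2) ^+ k * nrm a b (fun=> 1).
  have -> : intg a b (D k) = dot a b (D k) (fun=> 1).
    by apply: eq_intg => x _; rewrite mulr1.
  apply: le_trans (ler_norm _) _.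
  apply: le_trans (ler_dot_nrm _ _) _; [exact: LD'|exact: L2_cst|].
  rewrite ler_wpM2r ?nrm_ge0//.
  rewrite -(@ler_pXn2r _ 2)// ?nnegrE ?nrm_ge0 ?exprn_ge0// nrm_sqr.
  apply: le_trans (hN k _ _ (leq_trans (NM k) (MS k)) (NM k)).
  apply: le_intg; [exact: L2_mul|exact: L2_mul (LD k) (LD k)|move=> x _].
  by rewrite /D -!expr2 real_normK ?num_real.
have [Z [mZ Z0 subZ]] : {ae mu, forall x, a <= x <= b -> cvgn (series (D ^~ x))}.
  apply: (@ae_summable _ _ _ _ (2 * nrm a b (fun=> 1))) => //.
    by move=> n x _; exact: normr_ge0.
  move=> n; apply: le_trans (_ : _ <= \sum_(i < n) (1 / 2) ^+ i * nrm a b (fun=> 1)) _.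
    by apply: ler_sum => i _; exact: intD.
  rewrite -mulr_suml ler_wpM2r ?nrm_ge0//.
  have -> : \sum_(i < n) (1 / 2 : R) ^+ i = 2 - 2 * (1 / 2) ^+ n.
    elim: n => [|n ih]; first by rewrite big_ord0 expr0 mulr1 subrr.
    by rewrite big_ord_recr/= ih exprS; field.
  by rewrite gerBl mulr_ge0// exprn_ge0.
(* Putting the subsequence to 0 on the exceptional null set makes it converge at every point, as
   [fatou_intg] requires. *)
pose G' k := G k \_ (~` Z).
have cG' x : a <= x <= b -> cvgn (G' ^~ x).
  move=> xab; rewrite /G' /patch; have [|_] := boolP (x \in ~` Z); last first.
    by apply/cvg_ex; exists (point : R); exact: cvg_cst.
  rewrite inE/= => nZ.
  have cs : cvgn (series (D ^~ x)).
    by apply: contrapT => h; apply: nZ; apply: subZ => /= /(_ xab).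
  have {}cs : cvgn (series (fun k => G k.+1 x - G k x)) by exact: normed_cvg.
  have -> : (fun k => G k x) =
      (fun k => G 0%N x + series (fun k => G k.+1 x - G k x) k).
    apply/funext => k; rewrite /series/=; elim: k => [|k ih].
      by rewrite big_geq// addr0.
    by rewrite big_nat_recr//= addrA -ih; ring.
  by apply: is_cvgD => //; exact: is_cvg_cst.
pose f x := limn (G' ^~ x).
have G'f x : a <= x <= b -> G' n x @[n --> \oo] --> f x by exact: cG'.
have GG' k : {ae mu, forall x, a <= x <= b -> G k x = G' k x}.
  exists Z; split=> // x /= hx; apply: contrapT => nZ; apply: hx => _.
  by rewrite /G' /patch mem_set.
have mG' k : measurable_fun `[a, b] (G' k).
  apply/measurable_restrict => //; first exact: measurableC.
  have [m _] := hF (M k); apply: measurable_funS m => //.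
have LG' k : L2 a b (G' k) by have [] := L2_ae_eq (mG' k) (hF (M k)) (GG' k).
have key e : 0 < e -> exists K, forall n, (K <= n)%N -> 
    integrable_on a b (fun x => (F n x - f x) ^+ 2) /\
    intg a b (fun x => (F n x - f x) ^+ 2) <= e.
  move=> egt0; have [K hK] := cF _ egt0; exists K => n Kn.
  apply: (@fatou_intg _ _ _ (fun k x => (F n x - G' (k + K)%N x) ^+ 2)).
  - by move=> k; have [] : L2 a b (fun x => F n x - G' (k + K)%N x) by exact: L2B.
  - by move=> k x _; exact: sqr_ge0.
  - move=> x xab.
    have h1 : F n x - G' (k + K)%N x @[k --> \oo] --> F n x - f x.
      apply: cvgB; first exact: (@cvg_cst R^o).
      by have := G'f x xab; rewrite -(cvg_shiftn K).
    rewrite expr2; under eq_fun do rewrite expr2.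
    exact: cvgM.
  move=> k; apply: le_trans (hK n (M (k + K)) Kn _); last first.
    by rewrite (leq_trans _ (kM _))// leq_addl.
  rewrite le_eqVlt; apply/orP; left; apply/eqP.
  apply: (L2_ae_eq _ _ _).2; [|exact: L2B|].
    by apply: measurable_funB => //; have [] := hF n.
  case: (GG' (k + K)%N) => W [mW W0 subW]; exists W; split=> // x /= nh.
  by apply: subW => /= h; apply: nh => xab; rewrite -h.
have Lf : L2 a b f.
  have [K /(_ K (leqnn K))[i2 _]] := key 1 ltr01.
  have mf : measurable_fun `[a, b] f.
    exact: (@measurable_fun_cvg _ _ _ _ G').
  have : L2 a b (fun x => F K x - f x).
    by split=> //; apply: measurable_funB => //; have [] := hF K.
  move=> /(L2B (hF K)); apply: eq_L2 => x _; ring.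
exists f; split=> //.
apply/cvgrPdist_le => e egt0; have [K hK] := key e egt0.
exists K => // n /= Kn; rewrite sub0r normrN ger0_norm ?dot_ge0//.
by have [] := hK n Kn.
Qed.

End Completeness.

Section Projection.
Context {R : realType}.
Implicit Types (a b e : R) (f g u w : R -> R).

(** [S] is a subspace that need not be closed, so the projection is only a limit of elements of [S].
    A minimizing sequence is Cauchy by the parallelogram identity, and minimality gives the
    orthogonality. *)
Lemma L2_projection a b (S : (R -> R) -> Prop) theta :
  (forall w, S w -> L2 a b w) -> S (fun=> 0) ->
  (forall k u w, S u -> S w -> S (fun x => k * u x + w x)) ->
  L2 a b theta ->
  exists u, [/\ L2 a b u,
    exists w : nat -> R -> R, (forall k, S (w k)) /\
      dot a b (fun x => w k x - u x) (fun x => w k x - u x) @[k --> \oo] --> 0 &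
    forall w, S w -> dot a b theta w = dot a b u w].
Proof.
move=> SL S0 Slin Lt.
pose dist w := dot a b (fun x => theta x - w x) (fun x => theta x - w x).
pose D := [set dist w | w in [set w | S w]].
have hD : has_inf D.
  split; first by exists (dist (fun=> 0)), (fun=> 0).
  by exists 0 => _ [w _ <-]; exact: dot_ge0.
have dle w : S w -> inf D <= dist w.
  by move=> Sw; apply: ge_inf; [case: hD|exists w].
have /choice[w_ hw] k : exists w, S w /\ dist w <= inf D + k.+1%:R^-1.
  have k0 : 0 < k.+1%:R^-1 :> R by rewrite invr_gt0.
  have [_ [w Sw <-] wD] := inf_adherent k0 hD.
  by exists w; split=> //; exact: ltW.
have Sw k : S (w_ k) by have [] := hw k.
have Lw k : L2 a b (w_ k) by exact: SL.
have Ld w : S w -> L2 a b (fun x => theta x - w x) by move=> /SL; exact: L2B.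
have parallelogram k l : dot a b (fun x => w_ k x - w_ l x) (fun x => w_ k x - w_ l x)
    <= 2 * k.+1%:R^-1 + 2 * l.+1%:R^-1.
  (* The midpoint, written with a final 0 so that the closure of [S] under [k * u + w] applies
     twice. Its distance to [theta] is at least the infimum. *)
  pose m x := 2^-1 * w_ k x + (2^-1 * w_ l x + 0).
  have Sm : S m by apply: (Slin 2^-1 _ (fun x => 2^-1 * w_ l x + 0)) => //; exact: Slin.
  have -> : dot a b (fun x => w_ k x - w_ l x) (fun x => w_ k x - w_ l x) =
      2 * dist (w_ k) + 2 * dist (w_ l) - 4 * dist m.
    rewrite /dist -!intgZl; [|by apply: L2_mul; exact: Ld..].
    rewrite -intgD; [|by apply: integrable_onZl; apply: L2_mul; exact: Ld..].
    rewrite -intgB; [|apply: integrable_onD|]; try by apply: integrable_onZl; apply: L2_mul; exact: Ld.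
    by apply: eq_intg => x _; rewrite /m; field.
  have [_ h1] := hw k; have [_ h2] := hw l; have h3 := dle m Sm.
  move: h1 h2; set p := k.+1%:R^-1; set q := l.+1%:R^-1; lra.
have [||u [Lu wu]] := @L2_complete _ a b w_ => //.
  move=> e e0; have e4 : 0 < e / 4 by rewrite divr_gt0.
  have /cvgrPdist_le/(_ _ e4)[N _ hN] := @cvg_harmonic R.
  exists N => k l Nk Nl; apply: le_trans (parallelogram k l) _.
  have := hN k Nk; have := hN l Nl.
  rewrite /= /harmonic !sub0r !normrN !ger0_norm ?invr_ge0//.
  by set p := k.+1%:R^-1; set q := l.+1%:R^-1; lra.
exists u; split=> //; first by exists w_.
move=> w Sw'; have Lw' := SL w Sw'.
apply/eqP; rewrite -subr_eq0 -dotBl//; apply/eqP.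
set q := dot _ _ _ _.
have cq : dot a b (fun x => theta x - w_ k x) w @[k --> \oo] --> q.
  rewrite /q dotBl//; under eq_fun do rewrite dotBl//.
  by apply: cvgB; [exact: (@cvg_cst R^o)|exact: cvg_dot].
(* Replacing [w_ k] by [w_ k + s * w] cannot bring the squared distance below the infimum; the
   excess 1/(k+1) disappears in the limit. *)
have variation s : 2 * s * q <= s ^+ 2 * dot a b w w.
  have h : 2 * s * dot a b (fun x => theta x - w_ k x) w - k.+1%:R^-1
      @[k --> \oo] --> 2 * s * q - 0.
    by apply: cvgB; [exact: cvgMr|exact: cvg_harmonic].
  rewrite subr0 in h; apply: cvgn_le h _ => k.
  have [_ hk] := hw k.
  have := dle (fun x => s * w x + w_ k x) (Slin _ _ _ Sw' (Sw k)).
  have -> : dist (fun x => s * w x + w_ k x) =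
      dist (w_ k) - 2 * s * dot a b (fun x => theta x - w_ k x) w
      + s ^+ 2 * dot a b w w.
    have h1 : L2 a b (fun x => theta x - w_ k x) by exact: L2B.
    transitivity (dot a b (fun x => (theta x - w_ k x) - s * w x)
        (fun x => (theta x - w_ k x) - s * w x)).
      by apply: eq_dot => x _; ring.
    rewrite dot_sqrB ?dotZr ?dotZl//; try exact: L2Zl.
    by rewrite /dist; ring.
  by move: hk; set p := k.+1%:R^-1; lra.
have W1 : 0 < dot a b w w + 1 by rewrite ltr_wpDl ?dot_ge0.
(* With W = (w,w), this s turns the inequality into 2 q^2 (W + 1) <= q^2 W, which forces q = 0. The
   added 1 covers W = 0. *)
have := variation (q / (dot a b w w + 1)); rewrite expr_div_n.
have -> : 2 * (q / (dot a b w w + 1)) * q =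
    (2 * q ^+ 2 * (dot a b w w + 1)) / (dot a b w w + 1) ^+ 2.
  by field; rewrite gt_eqF.
rewrite [leRHS]mulrAC ler_pM2r ?invr_gt0 ?exprn_gt0//.
by have := dot_ge0 a b w; have := sqr_ge0 q => q2 w2 h; apply/eqP;
  rewrite -sqrf_eq0 eq_le q2 andbT; nra.
Qed.

End Projection.

(** * Integration by parts for absolutely continuous functions *)

Section IntegrationByParts.
Context {R : realType}.
Implicit Types (a b M x : R) (f g w : R -> R).
Local Notation mu := (@lebesgue_measure R).

Lemma within_continuousM (A : set R) f g : {within A, continuous f} ->
  {within A, continuous g} -> {within A, continuous (fun x => f x * g x)}.
Proof. by move=> cf cg x; apply: (cvgM (cf x) (cg x)). Qed.

Lemma continuous_bounded a b f : {within `[a, b], continuous f} ->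
  exists M, 0 <= M /\ forall x, a <= x <= b -> `|f x| <= M.
Proof.
move=> cf; have /compact_bounded[M [_ hM]] := continuous_compact cf (@segment_compact R a b).
exists (`|M| + 1); split; first by rewrite addr_ge0.
move=> x xab; apply: (hM (`|M| + 1)); first by rewrite (le_lt_trans (ler_norm _))// ltrDl.
by exists x.
Qed.

Lemma FTC2_near a b (F f : R -> R) : a <= b -> {within `[a, b], continuous f} ->
  (forall x, a - 1 < x < b + 1 -> is_derive x 1 F (f x)) ->
  intg a b f = F b - F a.
Proof.
rewrite le_eqVlt => /predU1P[-> _ _|ab cf dF]; first by rewrite intg_set1 subrr.
have cF x : a <= x <= b -> {for x, continuous F}.
  move=> xab; apply/differentiable_continuous/derivable1_diffP.
  by have /dF[] : a - 1 < x < b + 1 by lra.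
rewrite /intg /Rintegral (@continuous_FTC2 _ f F)//=.
- split.
  + by move=> x; rewrite in_itv/= => xab; have /dF[] : a - 1 < x < b + 1 by lra.
  + by apply: cvg_at_right_filter; apply: cF; rewrite lexx ltW.
  + by apply: cvg_at_left_filter; apply: cF; rewrite lexx ltW.
- by move=> x; rewrite in_itv/= => xab; rewrite derive1E;
  have /dF[_ ->] : a - 1 < x < b + 1 by lra.
Qed.

Lemma primitive_continuous a b f : a <= b -> integrable_on a b f ->
  {within `[a, b], continuous (fun x => intg a x f)}.
Proof. exact: parameterized_integral_continuous. Qed.

Lemma is_derive_continuous (F f : R -> R) :
  (forall x, is_derive x 1 F (f x)) -> continuous F.
Proof.
move=> dF x; apply/differentiable_continuous/derivable1_diffP.
by have [] := dF x.
Qed.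

Let parts_continuous a b w w' g c : a <= b -> continuous w' ->
  (forall x, is_derive x 1 w (w' x)) -> continuous g ->
  intg a b (fun x => w' x * (c + intg a x g)) =
  w b * (c + intg a b g) - w a * c - intg a b (fun x => w x * g x).
Proof.
move=> ab cw' dw cg.
have cw := is_derive_continuous dw.
(* Starting the primitive at [a - 2] makes it differentiable from both sides at [a]; for x at or
   beyond [a] it coincides with the primitive from [a]. *)
pose G x := c + (intg (a - 2) x g - intg (a - 2) a g).
have GE x : a <= x -> G x = c + intg a x g.
  move=> ax; rewrite /G (@intg_cat _ a (a - 2) x)//; first by congr (_ + _); ring.
    by rewrite ax andbT; lra.
  exact: continuous_integrable.
have dG x : a - 1 < x < b + 1 -> is_derive x 1 G (g x).
  move=> xab; rewrite /G.
  have h : is_derive x 1 (fun x => intg (a - 2) x g) (g x).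
    by apply: (@FTC1_continuous _ _ (b + 1)) => //; lra.
  apply: is_derive_eq.
  by rewrite add0r subr0 mul1r.
have cG : {within `[a, b], continuous G}.
  apply: derivable_within_continuous => x; rewrite in_itv/= => xab.
  by have /dG[] : a - 1 < x < b + 1 by lra.
have : intg a b (fun x => w' x * G x + w x * g x) = w b * G b - w a * G a.
  apply: (@FTC2_near _ _ (fun x => w x * G x)) => //.
    apply: within_continuousD.
      by apply: within_continuousM => //; exact: continuous_within.
    by apply: within_continuousM; exact: continuous_within.
  move=> x /dG hG; have hw := dw x.
  by apply: is_derive_eq; rewrite /GRing.scale/=; ring.
rewrite intgD.
- rewrite (GE b)// (GE a)// intg_set1 addr0 => <-; rewrite addrK.
  by apply: eq_intg => x /andP[ax _]; rewrite GE.
- apply: continuous_integrable_on.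
  by apply: within_continuousM => //; exact: continuous_within.
- apply: continuous_integrable => x.
  by apply: continuousM; [exact: cw|exact: cg].
Qed.

(** The density [g] is only integrable, so no pointwise product rule is available. Continuous
    functions approximating [g] in L^1 satisfy the formula, and the defect [Z] is at most a constant
    times the L^1 error. *)
Lemma integral_by_parts a b w w' g G : a <= b -> continuous w' ->
  (forall x, is_derive x 1 w (w' x)) -> integrable_on a b g ->
  (forall x, a <= x <= b -> G x = G a + intg a x g) ->
  intg a b (fun x => w' x * G x) =
  w b * G b - w a * G a - intg a b (fun x => w x * g x).
Proof.
move=> ab cw' dw ig GE.
have cw := is_derive_continuous dw.
have aab : a <= a <= b by rewrite lexx.
have abb : a <= b <= b by rewrite lexx ab.
have mab : measurable (`[a, b]%classic : set (measurableTypeR R)).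
  exact: measurable_itv.
have fab : (mu `[a, b] < +oo)%E.
  by rewrite lebesgue_measure_itv/=; case: ifP; rewrite ?ltry// -EFinB ltry.
have [g_ [cg_ _ cvg_g]] := approximation_continuous_integrable mab fab ig.
have [M [M0 hM]] := continuous_bounded (@continuous_within _ a b _ cw).
have [M' [M'0 hM']] := continuous_bounded (@continuous_within _ a b _ cw').
pose E k := intg a b (fun x => `|g x - g_ k x|).
have ig_ k x y : integrable_on x y (g_ k) by exact: continuous_integrable.
have iE k : integrable_on a b (fun x => `|g x - g_ k x|).
  by apply: integrable_on_normr; exact: integrable_onB.
have E0 : E k @[k --> \oo] --> 0 by exact: fine_cvg cvg_g.
have cG : {within `[a, b], continuous G}.
  apply: (@subspace_eq_continuous _ _ _ (fun x => G a + intg a x g)).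
    by move=> x; rewrite inE => /itvccP xab; rewrite /from_subspace/= -GE.
  apply: within_continuousD; last exact: primitive_continuous.
  exact/continuous_within/cst_continuous.
have iwg : integrable_on a b (fun x => w x * g x).
  apply: (@integrable_on_le _ _ _ _ (fun x => M * `|g x|)).
  - apply: measurable_funM; last exact: integrable_on_measurable.
    by apply: integrable_on_measurable; exact: continuous_integrable.
  - by apply: integrable_onZl; exact: integrable_on_normr.
  - by move=> x xab; rewrite normrM ler_wpM2r// hM.
have cw'G : {within `[a, b], continuous (fun x => w' x * G x)}.
  by apply: within_continuousM => //; exact: continuous_within.
apply/eqP; rewrite -subr_eq0 -normr_eq0 eq_le normr_ge0 andbT.
set Z := `|_|.
have key k : Z <= (M' * (b - a) + 2 * M) * E k.
  pose Gk x := G a + intg a x (g_ k).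
  have cGk : {within `[a, b], continuous Gk}.
    apply: within_continuousD; last exact: primitive_continuous.
    exact/continuous_within/cst_continuous.
  have GGk x : a <= x <= b -> `|G x - Gk x| <= E k.
    move=> /andP[ax xb]; rewrite GE ?ax// /Gk.
    have igx : integrable_on a x g by exact: integrable_on_sub ig.
    rewrite opprD addrACA subrr add0r -intgB//.
    apply: le_trans (ler_norm_intg _) _; first exact: integrable_onB.
    by apply: le_intg_sub.
  have := parts_continuous (G a) ab cw' dw (cg_ k).
  rewrite -/(Gk b) => hk.
  have -> : Z = `|intg a b (fun x => w' x * (G x - Gk x)) - w b * (G b - Gk b)
      + intg a b (fun x => w x * (g x - g_ k x))|.
    have -> : intg a b (fun x => w' x * (G x - Gk x)) =
        intg a b (fun x => w' x * G x) - intg a b (fun x => w' x * Gk x).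
      rewrite -intgB; first by apply: eq_intg => x _; rewrite mulrBr.
        exact: continuous_integrable_on.
      apply: continuous_integrable_on.
      by apply: within_continuousM => //; exact: continuous_within.
    have -> : intg a b (fun x => w x * (g x - g_ k x)) =
        intg a b (fun x => w x * g x) - intg a b (fun x => w x * g_ k x).
      rewrite -intgB//; first by apply: eq_intg => x _; rewrite mulrBr.
      apply: continuous_integrable => x.
      by apply: continuousM; [exact: cw|exact: cg_].
    by rewrite hk /Z; congr `|_|; ring.
  apply: le_trans (ler_normD _ _) _; rewrite mulrDl mulr_natl mulr2n mulrDl addrA.
  apply: lerD; first apply: le_trans (ler_normB _ _) _; first apply: lerD.
  - rewrite mulrAC; apply: ler_norm_intg_cst => //.
      apply: continuous_integrable_on.
      apply: within_continuousM; first exact: continuous_within.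
      exact: within_continuousB.
    by move=> x xab; rewrite normrM ler_pM ?hM'// GGk.
  - by rewrite normrM ler_pM ?hM// GGk.
  - rewrite /E -intgZl//.
    have h : integrable_on a b (fun x => w x * (g x - g_ k x)).
      have -> : (fun x => w x * (g x - g_ k x)) = (fun x => w x * g x - w x * g_ k x).
        by apply/funext => x; rewrite mulrBr.
      apply: integrable_onB => //; apply: continuous_integrable => x.
      by apply: continuousM; [exact: cw|exact: cg_].
    apply: le_trans (ler_norm_intg h) _; apply: le_intg.
    + exact: integrable_on_normr.
    + exact: integrable_onZl.
    + by move=> x xab; rewrite normrM ler_wpM2r// hM.
have h0 : (M' * (b - a) + 2 * M) * E k @[k --> \oo] --> (M' * (b - a) + 2 * M) * 0.
  exact: cvgMr.
by rewrite mulr0 in h0; apply: cvgn_ge h0 key.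
Qed.

(** Two integrations by parts against a smooth [w]. It serves in space with the sines, where the
    boundary conditions kill the boundary terms, and in time with [ct] and [st], where those terms
    carry the data. *)
Lemma W21_green a b u du d2u w dw d2w : a <= b -> W21 a b u du d2u ->
  continuous d2w -> (forall x, is_derive x 1 w (dw x)) ->
  (forall x, is_derive x 1 dw (d2w x)) ->
  intg a b (fun x => w x * d2u x) =
  w b * du b - w a * du a - (dw b * u b - dw a * u a) +
  intg a b (fun x => d2w x * u x).
Proof.
move=> ab [i2 hW] c2 h1 h2.
have cdw := is_derive_continuous h2.
have hdu x : a <= x <= b -> du x = du a + intg a x d2u by move=> /hW[].
have hu x : a <= x <= b -> u x = u a + intg a x du by move=> /hW[].
have idu : integrable_on a b du.
  apply: (@eq_integrable_on _ _ _ (fun x => du a + intg a x d2u)).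
    by move=> x xab; rewrite -hdu.
  apply: integrable_onD; first exact: integrable_on_cst.
  by apply: continuous_integrable_on; exact: primitive_continuous.
have := integral_by_parts ab cdw h1 i2 hdu.
have := integral_by_parts ab c2 h2 idu hu.
by move=> -> ->; ring.
Qed.

End IntegrationByParts.

(** * Eigenfunctions in space and orthogonality in time *)

Section Modes.
Context {R : realType}.
Implicit Types (a b k x t : R) (m n N K : nat).

Definition freq m : R := (2 * m + 1)%:R / 2 * pi.
Definition eig m : R := freq m ^+ 2.
Definition sn m x : R := sin (freq m * x).
Definition cn m x : R := cos (freq m * x).
Definition ct m t : R := cos (eig m * t).
Definition st m t : R := sin (eig m * t).

Lemma freqE m : freq m = (2 * m%:R + 1) / 2 * pi.
Proof. by rewrite /freq natrD natrM. Qed.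

Lemma freq_gt0 m : 0 < freq m.
Proof. by rewrite mulr_gt0 ?pi_gt0// divr_gt0// ltr0n addn1. Qed.

Lemma freq_ge1 m : 1 <= freq m.
Proof.
have : (1 : R) <= (2 * m + 1)%:R by rewrite ler1n addn1.
by have := pi_ge2 R; rewrite /freq; nra.
Qed.

Lemma eig_gt0 m : 0 < eig m.
Proof. by rewrite exprn_gt0// freq_gt0. Qed.

Lemma eig_ge1 m : 1 <= eig m.
Proof. by rewrite exprn_ege1// freq_ge1. Qed.

Lemma sin_natpi n : sin (n%:R * pi : R) = 0.
Proof.
elim: n => [|n ih]; first by rewrite mul0r sin0.
by rewrite -natr1 mulrDl mul1r sinDpi ih oppr0.
Qed.

Lemma cos_natpi n : cos (n%:R * pi : R) = (-1) ^+ n.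
Proof.
elim: n => [|n ih]; first by rewrite mul0r cos0.
by rewrite -natr1 mulrDl mul1r cosDpi ih exprS mulN1r.
Qed.

Lemma is_derive_sinM k x :
  is_derive x 1 (fun y => sin (k * y)) (k * cos (k * x)).
Proof.
apply: is_derive_eq.
by rewrite /GRing.scale/= mulr1 mulrC.
Qed.

Lemma is_derive_cosM k x :
  is_derive x 1 (fun y => cos (k * y)) (- k * sin (k * x)).
Proof.
apply: is_derive_eq.
by rewrite /GRing.scale/=; ring.
Qed.

Lemma continuous_sinM k : continuous (fun x : R => sin (k * x)).
Proof. by apply: is_derive_continuous; exact: is_derive_sinM. Qed.

Lemma continuous_cosM k : continuous (fun x : R => cos (k * x)).
Proof. by apply: is_derive_continuous; exact: is_derive_cosM. Qed.

Lemma continuousZ k (f : R -> R) : continuous f -> continuous (fun x => k * f x).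
Proof. by move=> cf x; apply: cvgMr; exact: cf. Qed.

Lemma int_cos k L : 0 <= L -> k != 0 ->
  intg 0 L (fun t => cos (k * t)) = sin (k * L) / k.
Proof.
move=> L0 k0.
have dF x : is_derive x 1 (fun t => sin (k * t) / k) (cos (k * x)).
  have h := is_derive_sinM k x; apply: is_derive_eq.
  by rewrite /GRing.scale/=; field.
by rewrite (FTC2 L0 (@continuous_cosM k) dF) mulr0 sin0 mul0r subr0.
Qed.

Lemma int_sin k L : 0 <= L -> k != 0 ->
  intg 0 L (fun t => sin (k * t)) = (1 - cos (k * L)) / k.
Proof.
move=> L0 k0.
have dF x : is_derive x 1 (fun t => - (cos (k * t) / k)) (sin (k * x)).
  have h := is_derive_cosM k x; apply: is_derive_eq.
  by rewrite /GRing.scale/=; field.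
by rewrite (FTC2 L0 (@continuous_sinM k) dF) mulr0 cos0; field.
Qed.

Lemma int_coscos j k L : 0 <= L -> j != k -> j + k != 0 ->
  dot 0 L (fun t => cos (j * t)) (fun t => cos (k * t)) =
  (sin ((j - k) * L) / (j - k) + sin ((j + k) * L) / (j + k)) / 2.
Proof.
move=> L0 jk jk'; rewrite -!int_cos// ?subr_eq0//.
rewrite -intgD; try exact/continuous_integrable/continuous_cosM.
rewrite -intgZr; last by apply: integrable_onD; exact/continuous_integrable/continuous_cosM.
apply: eq_intg => x _.
by rewrite !mulrDl mulNr cosB cosD; field.
Qed.

Lemma int_sinsin j k L : 0 <= L -> j != k -> j + k != 0 ->
  dot 0 L (fun t => sin (j * t)) (fun t => sin (k * t)) =
  (sin ((j - k) * L) / (j - k) - sin ((j + k) * L) / (j + k)) / 2.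
Proof.
move=> L0 jk jk'; rewrite -!int_cos// ?subr_eq0//.
rewrite -intgB; try exact/continuous_integrable/continuous_cosM.
rewrite -intgZr; last by apply: integrable_onB; exact/continuous_integrable/continuous_cosM.
apply: eq_intg => x _.
by rewrite !mulrDl mulNr cosB cosD; field.
Qed.

Lemma int_sincos j k L : 0 <= L -> j != k -> j + k != 0 ->
  dot 0 L (fun t => sin (j * t)) (fun t => cos (k * t)) =
  ((1 - cos ((j + k) * L)) / (j + k) + (1 - cos ((j - k) * L)) / (j - k)) / 2.
Proof.
move=> L0 jk jk'; rewrite -!int_sin// ?subr_eq0//.
rewrite -intgD; try exact/continuous_integrable/continuous_sinM.
rewrite -intgZr; last by apply: integrable_onD; exact/continuous_integrable/continuous_sinM.
apply: eq_intg => x _.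
by rewrite !mulrDl mulNr sinB sinD; field.
Qed.

Lemma int_sinsin_diag k L : 0 <= L -> k != 0 ->
  dot 0 L (fun t => sin (k * t)) (fun t => sin (k * t)) =
  L / 2 - sin (2 * k * L) / (4 * k).
Proof.
move=> L0 k0.
have k20 : 2 * k != 0 by rewrite mulf_neq0.
have -> : L / 2 - sin (2 * k * L) / (4 * k) =
    intg 0 L (fun t => 2^-1 - 2^-1 * cos (2 * k * t)).
  rewrite intgB; [|exact: integrable_on_cst|apply: integrable_onZl; exact/continuous_integrable/continuous_cosM].
  rewrite intg_cst// intgZl; last exact/continuous_integrable/continuous_cosM.
  by rewrite int_cos//; field.
apply: eq_intg => x _.
have -> : 2 * k * x = (k * x) *+ 2 by rewrite mulr2n; ring.
by rewrite cos_mulr2n [cos _ ^+ 2]cos2sin2; field.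
Qed.

Lemma int_coscos_diag k L : 0 <= L -> k != 0 ->
  dot 0 L (fun t => cos (k * t)) (fun t => cos (k * t)) =
  L / 2 + sin (2 * k * L) / (4 * k).
Proof.
move=> L0 k0.
have k20 : 2 * k != 0 by rewrite mulf_neq0.
have -> : L / 2 + sin (2 * k * L) / (4 * k) =
    intg 0 L (fun t => 2^-1 + 2^-1 * cos (2 * k * t)).
  rewrite intgD; [|exact: integrable_on_cst|apply: integrable_onZl; exact/continuous_integrable/continuous_cosM].
  rewrite intg_cst// intgZl; last exact/continuous_integrable/continuous_cosM.
  by rewrite int_cos//; field.
apply: eq_intg => x _.
have -> : 2 * k * x = (k * x) *+ 2 by rewrite mulr2n; ring.
by rewrite cos_mulr2n; field.
Qed.

Lemma int_sincos_diag k L : 0 <= L -> k != 0 ->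
  dot 0 L (fun t => sin (k * t)) (fun t => cos (k * t)) =
  (1 - cos (2 * k * L)) / (4 * k).
Proof.
move=> L0 k0.
have k20 : 2 * k != 0 by rewrite mulf_neq0.
have -> : (1 - cos (2 * k * L)) / (4 * k) = intg 0 L (fun t => 2^-1 * sin (2 * k * t)).
  rewrite intgZl; last exact/continuous_integrable/continuous_sinM.
  by rewrite int_sin//; field.
apply: eq_intg => x _.
have -> : 2 * k * x = (k * x) *+ 2 by rewrite mulr2n; ring.
by rewrite sin_mulr2n mulr2n; field.
Qed.

Lemma freq_inj m n : m != n -> freq m != freq n.
Proof.
apply: contra_neq => /(mulIf (lt0r_neq0 (pi_gt0 R))).
by move=> /(mulIf _)-/(_ _)/eqP; rewrite invr_eq0 pnatr_eq0 eqr_nat => /(_ isT); lia.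
Qed.

Lemma freqB m n : exists j : nat, freq m - freq n = j%:R * pi \/ freq m - freq n = - (j%:R * pi).
Proof.
have [mn|/ltnW nm] := leqP n m.
  exists (m - n)%N; left; rewrite natrB// !freqE; by field.
exists (n - m)%N; right; rewrite natrB// !freqE; by field.
Qed.

Lemma freqD m n : freq m + freq n = (m + n + 1)%:R * pi.
Proof. by rewrite !freqE !natrD; field. Qed.

Lemma sn_orthogonal m n : dot 0 1 (sn m) (sn n) = if m == n then 2^-1 else 0.
Proof.
have h : freq m + freq n != 0 by rewrite gt_eqF// addr_gt0// freq_gt0.
case: eqVneq => [->|mn].
  rewrite int_sinsin_diag//; last by rewrite gt_eqF// freq_gt0.
  have -> : 2 * freq n * 1 = (2 * n + 1)%:R * pi by rewrite /freq; field.
  by rewrite sin_natpi mul0r subr0 mul1r.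
rewrite int_sinsin//; last exact: freq_inj.
rewrite !mulr1 freqD sin_natpi mul0r subr0.
by have [j [->|->]] := freqB m n; rewrite ?sinN sin_natpi ?oppr0 !mul0r.
Qed.

Lemma eigE m : eig m = ((m * m.+1)%:R + 4^-1) * pi ^+ 2.
Proof. by rewrite /eig freqE natrM -natr1; field. Qed.

Lemma eig_inj m n : m != n -> eig m != eig n.
Proof.
move=> mn; rewrite /eig eqf_sqr negb_or freq_inj//=.
by rewrite gt_eqF// (lt_trans _ (freq_gt0 m))// oppr_lt0 freq_gt0.
Qed.

(** By [eigE], [eig m * (4 / pi)] is (4m(m+1) + 1) pi, an odd multiple of pi. All [ct m] and [st m]
    change sign under translation by this length: it is a common antiperiod. *)
Definition period : R := 4 / pi.

Lemma period_gt0 : 0 < period.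
Proof. by rewrite divr_gt0// pi_gt0. Qed.

Lemma period_le2 : period <= 2.
Proof. by rewrite ler_pdivrMr ?pi_gt0//; have := pi_ge2 R; lra. Qed.

Let pi0 : pi != 0 :> R. Proof. by rewrite gt_eqF// pi_gt0. Qed.

Lemma eig_period m K : eig m * (K%:R * period) = (4 * K * (m * m.+1) + K)%:R * pi.
Proof.
rewrite eigE /period [in RHS]natrD [(4 * K * _)%:R]natrM [(4 * K)%:R]natrM.
by move: (pi : R) pi0 => p p0; field.
Qed.

Lemma sin_eig_period m K : sin (eig m * (K%:R * period)) = 0.
Proof. by rewrite eig_period sin_natpi. Qed.

Lemma cos_eig_period m K : cos (eig m * (K%:R * period)) = (-1) ^+ K.
Proof.
rewrite eig_period cos_natpi exprD -!mulnA exprM (_ : (-1) ^+ 4 = 1 :> R).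
  by rewrite expr1n mul1r.
by rewrite -signr_odd.
Qed.

(** The numbers [eig m * L] are multiples of pi of the parity of [K], so their sums and differences
    are even multiples and all boundary terms vanish. [K = 1] serves lower bounds and the moment
    problem, larger [K] upper bounds on (0,T). *)
Lemma periodic_orthogonal m n K (L := K%:R * period) :
  [/\ dot 0 L (ct m) (ct n) = if m == n then L / 2 else 0,
      dot 0 L (st m) (st n) = (if m == n then L / 2 else 0) &
      dot 0 L (st m) (ct n) = 0].
Proof.
have L0 : 0 <= L by rewrite mulr_ge0// ltW// period_gt0.
have e0 i : eig i != 0 by rewrite gt_eqF// eig_gt0.
have h : eig m + eig n != 0 by rewrite gt_eqF// addr_gt0// eig_gt0.
have sD : sin ((eig m + eig n) * L) = 0.
  by rewrite mulrDl sinD !sin_eig_period mul0r mulr0 addr0.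
have sB : sin ((eig m - eig n) * L) = 0.
  by rewrite mulrBl sinB !sin_eig_period mul0r mulr0 subr0.
have cD : cos ((eig m + eig n) * L) = 1.
  by rewrite mulrDl cosD !sin_eig_period !cos_eig_period mul0r subr0 -expr2 sqrr_sign.
have cB : cos ((eig m - eig n) * L) = 1.
  by rewrite mulrBl cosB !sin_eig_period !cos_eig_period mul0r addr0 -expr2 sqrr_sign.
case: eqVneq => [emn|mn].
  subst n; rewrite /ct /st int_coscos_diag// int_sinsin_diag// int_sincos_diag//.
  have -> : 2 * eig m * L = (eig m + eig m) * L by ring.
  by rewrite sD cD subrr !mul0r addr0 subr0.
have mn' := eig_inj mn.
rewrite /ct /st int_coscos// int_sinsin// int_sincos//.
by rewrite sD sB cD cB subrr !mul0r addr0 subr0 mul0r.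
Qed.

End Modes.

(** * Completeness of the sine modes in L^2(0,1) *)

Section CompletenessOfModes.
Context {R : realType}.
Implicit Types (a b x y : R) (f g : R -> R) (m n : nat).
Local Notation mu := (@lebesgue_measure R).

Lemma eq_intg_oo a b f g : integrable_on a b f -> integrable_on a b g ->
  (forall x, a < x < b -> f x = g x) -> intg a b f = intg a b g.
Proof.
move=> hf hg fg; have [ab|ab|->] := ltgtP a b; last by rewrite !intg_set1.
- have io h : integrable_on a b h -> mu.-integrable `]a, b] (EFin \o h).
    by apply: integrableS => //; apply: subset_itv; rewrite bnd_simp.
  have ioo h : integrable_on a b h -> mu.-integrable `]a, b[ (EFin \o h).
    by apply: integrableS => //; apply: subset_itv; rewrite bnd_simp.
  rewrite /intg -!Rintegral_itv_obnd_cbnd; [|exact: io..].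
  rewrite -!Rintegral_itv_bndo_bndc; [|exact: ioo..].
  by apply: eq_Rintegral => x; rewrite inE/= in_itv/=; exact: fg.
- by apply: eq_intg => x xab; exfalso; move: xab; lra.
Qed.

Lemma bernoulli_le x n : 0 <= x <= 1 -> 1 - n%:R * x <= (1 - x) ^+ n.
Proof.
move=> x01; elim: n => [|n ih]; first by rewrite mul0r subr0 expr0.
rewrite exprS -natr1.
have h : (1 - x) * (1 - n%:R * x) <= (1 - x) * (1 - x) ^+ n.
  by rewrite ler_wpM2l//; lra.
apply: le_trans h; have := ler0n R n; nra.
Qed.

Lemma bernoulli_ge x n : 0 <= x -> 1 + n%:R * x <= (1 + x) ^+ n.
Proof.
move=> x01; elim: n => [|n ih]; first by rewrite mul0r addr0 expr0.
rewrite exprS -natr1.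
have h : (1 + x) * (1 + n%:R * x) <= (1 + x) * (1 + x) ^+ n.
  by rewrite ler_wpM2l//; lra.
apply: le_trans h; have := ler0n R n; nra.
Qed.

Lemma bernoulli_inv x n : 0 <= x <= 1 -> (1 - x) ^+ n <= (1 + n%:R * x)^-1.
Proof.
move=> x01; have nx : 0 < 1 + n%:R * x.
  by rewrite ltr_pwDl// mulr_ge0//; lra.
rewrite -[leRHS]mul1r ler_pdivlMr//.
apply: le_trans (_ : (1 - x) ^+ n * (1 + x) ^+ n <= _).
  by rewrite ler_wpM2l ?bernoulli_ge ?exprn_ge0//; lra.
by rewrite -exprMn exprn_ile1//; nra.
Qed.

Lemma cvg_n_expr r : 0 <= r < 1 -> n%:R * r ^+ n @[n --> \oo] --> (0 : R).
Proof.
(* By the arithmetic-geometric inequality r <= q^2. Bernoulli's inequality for 1/q bounds n q^n by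
   q/(1-q), and the other factor q^n supplies the decay. *)
move=> r01; pose q := (1 + r) / 2.
have q01 : 0 < q < 1 by rewrite /q; lra.
have rq : r <= q * q by rewrite /q; nra.
have h0 : q / (1 - q) * q ^+ n @[n --> \oo] --> q / (1 - q) * 0.
  by apply: cvgMr; apply: cvg_expr; rewrite ger0_norm; lra.
rewrite mulr0 in h0.
apply: cvg0_squeeze h0 => n; first by rewrite mulr_ge0// exprn_ge0//; lra.
apply: le_trans (_ : n%:R * (q * q) ^+ n <= _).
  by rewrite ler_wpM2l// lerXn2r// nnegrE; nra.
rewrite exprMn mulrA ler_wpM2r ?exprn_ge0//; first lra.
have d0 : 0 <= q^-1 - 1 by rewrite subr_ge0 invf_ge1; lra.
have := bernoulli_ge n d0.
rewrite (_ : 1 + (q^-1 - 1) = q^-1) ?exprVn => [h|]; last by ring.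
have qn : 0 < q ^+ n by rewrite exprn_gt0//; lra.
rewrite ler_pdivlMr; last lra.
have : (1 + n%:R * (q^-1 - 1)) * q ^+ n <= 1 by rewrite -ler_pdivlMr// div1r.
have -> : q^-1 - 1 = (1 - q) / q by field; rewrite gt_eqF//; lra.
rewrite -(@ler_pM2r _ q); last lra.
rewrite mulrDl mul1r mulrDl.
have -> : n%:R * ((1 - q) / q) * q ^+ n * q = n%:R * q ^+ n * (1 - q).
  by field; rewrite gt_eqF//; lra.
have : 0 < q ^+ n * q by rewrite mulr_gt0//; lra.
lra.
Qed.

(* Polynomials in [y] converging boundedly to the indicator of [0, c); they play
   the role of Weierstrass approximation in the completeness of the modes. *)
Lemma threshold c : 0 < c < 1 -> exists M : nat -> nat,
  (forall y, 0 <= y < c -> (1 - y ^+ n) ^+ M n @[n --> \oo] --> (1 : R)) /\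
  (forall y, c <= y <= 1 -> (1 - y ^+ n) ^+ M n @[n --> \oo] --> (0 : R)).
Proof.
(* With [M n] about n / c^n, the product M_n y^n behaves like n (y/c)^n: it tends to 0 for y < c and
   is at least n for y >= c. Bernoulli's inequalities turn this into the limits 1 and 0. *)
move=> c01; pose M n := (Num.truncn (n%:R / c ^+ n)).+1.
have cn n : 0 < c ^+ n by rewrite exprn_gt0//; lra.
have nc n : 0 <= n%:R / c ^+ n by rewrite divr_ge0// ltW.
have Mlow n : n%:R / c ^+ n <= (M n)%:R.
  by rewrite /M; have /andP[_ /ltW] := truncn_itv (nc n).
have Mup n : (M n)%:R <= n%:R / c ^+ n + 1.
  by rewrite /M -natr1 lerD2r; have /andP[] := truncn_itv (nc n).
exists M; split=> y hy.
  have yn n : 0 <= y ^+ n <= 1.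
    by rewrite exprn_ge0 ?exprn_ile1//; lra.
  have r01 : 0 <= y / c < 1.
    by rewrite divr_ge0 ?ltr_pdivrMr//; lra.
  have hup : n%:R * (y / c) ^+ n + y ^+ n @[n --> \oo] --> (0 + 0 : R).
    apply: cvgD; first exact: cvg_n_expr.
    by apply: cvg_expr; rewrite ger0_norm; lra.
  rewrite addr0 in hup.
  have h : 1 - (n%:R * (y / c) ^+ n + y ^+ n) @[n --> \oo] --> (1 - 0 : R).
    by apply: cvgB => //; exact: (@cvg_cst R^o).
  rewrite subr0 in h.
  apply: squeeze_cvgr h (@cvg_cst R^o _ _ _ _); apply: nearW => n.
  apply/andP; split; last by have := yn n => ?; rewrite exprn_ile1//; lra.
  apply: le_trans (bernoulli_le (M n) (yn n)).
  rewrite lerD2l lerN2 expr_div_n.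
  have -> : n%:R * (y ^+ n / c ^+ n) + y ^+ n = (n%:R / c ^+ n + 1) * y ^+ n by ring.
  by rewrite ler_wpM2r//; have /andP[] := yn n.
have yn n : 0 <= y ^+ n <= 1.
  by rewrite exprn_ge0 ?exprn_ile1//; lra.
apply: (@cvg0_squeeze _ _ (fun n => n.+1%:R^-1)); last exact: cvg_harmonic.
  by move=> n; rewrite exprn_ge0//; have := yn n; lra.
move=> n; apply: le_trans (bernoulli_inv (M n) (yn n)) _.
have n0 := ler0n R n.
have h : n%:R <= (M n)%:R * y ^+ n.
  apply: le_trans (_ : (M n)%:R * c ^+ n <= _).
    by rewrite -ler_pdivrMr.
  by rewrite ler_wpM2l// lerXn2r// ?nnegrE; lra.
have h1 : n.+1%:R <= 1 + (M n)%:R * y ^+ n by rewrite -natr1 addrC lerD2l.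
by rewrite lef_pV2 ?posrE ?ltr0n// (lt_le_trans _ h1) ?ltr0n.
Qed.

(* [sn m * u] is a combination of neighbouring modes, so a function orthogonal to
   every [sn m] is orthogonal to [sn 0] times any polynomial in [u], and [u] is
   decreasing on [0, 1]. *)
Let u x : R := (1 + cos (pi * x)) / 2.

Let cu : continuous u.
Proof.
move=> x; apply: cvgMl; apply: cvgD; first exact: cvg_cst.
exact: continuous_cosM.
Qed.

Let u01 x : 0 <= u x <= 1.
Proof. by rewrite /u; have := cos_le1 (pi * x); have := cos_geN1 (pi * x); lra. Qed.

(** The product formula for sin(mu_m x) cos(pi x). For m = 0 the lower neighbour has frequency
    -pi/2, hence the term [- sn 0 x]. *)
Let sn_u m x : sn m x * u x =
  2^-1 * sn m x + 4^-1 * (sn m.+1 x + (if m is k.+1 then sn k x else - sn 0 x)).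
Proof.
rewrite /u /sn.
have -> : freq m.+1 * x = freq m * x + pi * x by rewrite !freqE -natr1; field.
have -> : (if m is k.+1 then sin (freq k * x) else - sin (freq 0 * x)) =
    sin (freq m * x - pi * x).
  case: m => [|k]; last by congr sin; rewrite !freqE -natr1; field.
  by rewrite -sinN; congr sin; rewrite !freqE; field.
by rewrite sinD sinB; field.
Qed.

Let cXu n : continuous (fun x => u x ^+ n).
Proof. by move=> x; apply: (@continuous_comp _ _ _ u (fun y => y ^+ n)); [exact: cu|exact: exprn_continuous]. Qed.

Lemma continuous_sn m : continuous (@sn R m).
Proof. exact: continuous_sinM. Qed.

Lemma L2_sn a b m : L2 a b (@sn R m).
Proof. exact/continuous_L2/continuous_sn. Qed.

Section Orthogonal.
Variables (f : R -> R) (Lf : L2 0 1 f) (f_sn : forall m, dot 0 1 f (sn m) = 0).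

Let LsnX m n : L2 0 1 (fun x => sn m x * u x ^+ n).
Proof.
apply: continuous_L2 => x; apply: cvgM; first exact: continuous_sn.
exact: cXu.
Qed.

Let f_snX n m : dot 0 1 f (fun x => sn m x * u x ^+ n) = 0.
Proof.
elim: n m => [|n ih] m.
  by apply: etrans (f_sn m); apply: eq_dot => // x _; rewrite expr0 mulr1.
transitivity (dot 0 1 f (fun x => 2^-1 * (sn m x * u x ^+ n) + 4^-1 *
  (sn m.+1 x * u x ^+ n + (if m is k.+1 then 1 else - 1) * (sn m.-1 x * u x ^+ n)))).
  apply: eq_dot => // x _; rewrite exprS mulrA sn_u.
  by case: m => [|k] /=; ring.
have h1 i := L2Zl 2^-1 (LsnX i n).
have h2 k i := L2Zl k (LsnX i n).
have h3 i k j := L2D (LsnX i n) (h2 k j).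
have h4 i k j := L2Zl 4^-1 (h3 i k j).
rewrite (dotDr Lf (h1 m) (h4 _ _ _)) (dotZr 2^-1 Lf (LsnX m n)).
rewrite (dotZr 4^-1 Lf (h3 _ _ _)) (dotDr Lf (LsnX _ n) (h2 _ _)).
by rewrite (dotZr _ Lf (LsnX _ n)) !ih !mulr0 addr0 mulr0 addr0.
Qed.

Let F x := f x * sn 0 x.

Let iF : integrable_on 0 1 F.
Proof. by apply: L2_mul => //; exact: L2_sn. Qed.

Let iFg g : continuous g -> integrable_on 0 1 (fun x => F x * g x).
Proof.
move=> cg; have h : L2 0 1 (fun x => sn 0 x * g x).
  by apply: continuous_L2 => x; apply: cvgM; [exact: continuous_sn|exact: cg].
by have := L2_mul Lf h; apply: eq_integrable_on => x _; rewrite mulrA.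
Qed.

Let cbump k n M : continuous (fun x => u x ^+ k * (1 - u x ^+ n) ^+ M).
Proof.
move=> x; apply: cvgM; first exact: cXu.
apply: (@continuous_comp _ _ _ (fun x => 1 - u x ^+ n) (fun y => y ^+ M)).
  by apply: cvgB; [exact: cvg_cst|exact: cXu].
exact: exprn_continuous.
Qed.

(** The free exponent [k] carries the induction on [M]: splitting off one factor [1 - u x ^+ n]
    produces the exponents [k] and [k + n]. *)
Let F_bump M n k : intg 0 1 (fun x => F x * (u x ^+ k * (1 - u x ^+ n) ^+ M)) = 0.
Proof.
elim: M k => [|M ih] k.
  apply: etrans (f_snX k 0); apply: eq_intg => x _.
  by rewrite expr0 mulr1 /F mulrA.
transitivity (intg 0 1 (fun x => F x * (u x ^+ k * (1 - u x ^+ n) ^+ M)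
   - F x * (u x ^+ (k + n) * (1 - u x ^+ n) ^+ M))).
  by apply: eq_intg => x _; rewrite exprS exprD; ring.
by rewrite intgB; [rewrite !ih subrr|exact: iFg|exact: iFg].
Qed.

(** Since [u] decreases, u x < u y exactly when x > y. The polynomials of [threshold] at c = u y
    thus converge boundedly to the indicator of (y, 1], and the vanishing integrals pass to the
    limit. *)
Let F_right y : 0 < y < 1 -> intg y 1 F = 0.
Proof.
move=> y01; have pi0 := pi_gt0 R.
have u_decr x z : 0 <= x -> x < z -> z <= 1 -> u z < u x.
  move=> x0 xz z1; rewrite /u ltr_pM2r// ltrD2l ltr_cos// ?in_itv/= ?ltr_pM2l//.
  - by rewrite mulr_ge0 ?ler_piMr//; lra.
  - by rewrite mulr_ge0 ?ler_piMr//; lra.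
have uy : 0 < u y < 1.
  have h0 : u 0 = 1 by rewrite /u mulr0 cos0; field.
  have h1 : u 1 = 0 by rewrite /u mulr1 cospi subrr mul0r.
  by rewrite -{1}h1 -h0 !u_decr//; lra.
have [M [M1 M0]] := threshold uy.
pose chi x : R := if u x < u y then 1 else 0.
have [|||ic lim] := @dominated_intg _ 0 1 (fun n x => F x * (u x ^+ 0 * (1 - u x ^+ n) ^+ M n))
    (fun x => F x * chi x) (fun x => `|F x|) _ (integrable_on_normr iF).
- by move=> n; apply: integrable_on_measurable; exact: iFg.
- move=> x x01; apply: cvgMr; rewrite /chi; under eq_fun do rewrite expr0 mul1r.
  case: ltP => h; [apply: M1|apply: M0]; first by have := u01 x; lra.
  by have := u01 x; lra.
- move=> n x x01; rewrite normrM ler_piMr// expr0 mul1r.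
  have := u01 x => h; have h' : 0 <= u x ^+ n <= 1 by rewrite exprn_ge0 ?exprn_ile1//; lra.
  by rewrite ger0_norm ?exprn_ile1 ?exprn_ge0//; lra.
have : intg 0 1 (fun x => F x * chi x) = 0.
  rewrite -(cvg_lim _ lim)//; under eq_fun do rewrite F_bump.
  exact: lim_cst.
rewrite (@intg_cat _ y)//; last lra.
rewrite (_ : intg 0 y _ = 0); last first.
  apply: etrans (intg0 0 y); apply: eq_intg => x xy.
  rewrite /chi ifF ?mulr0//; apply/negbTE; rewrite -leNgt.
  case/andP: xy => x0; rewrite le_eqVlt => /predU1P[->//|xy].
  by rewrite ltW// u_decr//; lra.
rewrite add0r => h; apply: etrans h.
apply: eq_intg_oo; [apply: integrable_on_sub iF; lra|apply: integrable_on_sub ic; lra|].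
by move=> x xy; rewrite /chi u_decr ?mulr1//; lra.
Qed.

(** The primitive of [F] from 0 vanishes throughout (0,1), so Lebesgue differentiation gives F = 0
    almost everywhere there. [F0] extends [F] by 0 to obtain a function integrable on the line. *)
Let F_ae0 : {ae mu, forall x, 0 < x < 1 -> F x = 0}.
Proof.
pose F0 := F \_ `[0, 1].
have mab : measurable (`[0, 1]%classic : set (measurableTypeR R)).
  exact: measurable_itv.
have [iF0 _ _] := integrable_locally mab iF.
have iFT : mu.-integrable setT (EFin \o F0).
  rewrite -restrict_EFin.
  by move: iF; rewrite /integrable_on (integrable_mkcond _ mab).
have := @FTC1 R F0 (BLeft 0) _ (integrable_locally mab iF).
case.
  by move=> y; apply: integrableS iFT => //; exact: measurable_itv.
move=> N [mN N0 subN]; exists N; split=> // x /= nx; apply: subN => /= h.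
apply: nx => x01; have [|_] := h; first by rewrite lte_fin; lra.
have F0E z : 0 < z < 1 -> \int[mu]_(t in [set` Interval (BLeft 0) (BRight z)]) F0 t = 0.
  move=> z01.
  have -> : \int[mu]_(t in [set` Interval (BLeft 0) (BRight z)]) F0 t = intg 0 z F.
    apply: eq_intg => t tz; rewrite /F0 patchE mem_set//=.
    by rewrite in_itv/=; lra.
  have := f_snX 0 0.
  rewrite (_ : dot 0 1 f _ = intg 0 1 F); last first.
    by apply: eq_intg => t _; rewrite expr0 mulr1.
  rewrite (@intg_cat _ z)//; last lra.
  by rewrite F_right// addr0.
have -> : F0 x = F x.
  by rewrite /F0 patchE mem_set//= in_itv/=; lra.
move=> <-; rewrite derive1E.
apply: etrans (derive_cst (0 : R) x 1).
apply: near_eq_derive => //.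
near=> z; rewrite F0E//.
have h1 : 0 < z by near: z; apply: lt_nbhsr; lra.
have h2 : z < 1 by near: z; apply: lt_nbhsl; lra.
by rewrite h1.
Unshelve. all: by end_near.
Qed.

Lemma ae_zero_of_orthogonal : {ae mu, forall x, 0 <= x <= 1 -> f x = 0}.
Proof.
case: F_ae0 => N [mN N0 subN].
(* The endpoints are added to the null set because the previous result concerns the open interval,
   where [sn 0] is positive and can be divided out. *)
exists (N `|` ([set 0] `|` [set 1])); split.
- by apply: measurableU => //; apply: measurableU; exact: measurable_set1.
- rewrite null_set_setU ?null_set_setU//; try exact: lebesgue_measure_set1.
  by apply: measurableU; exact: measurable_set1.
- move=> x /= nx; have [[->|->]|h] : (x = 0 \/ x = 1) \/ (x != 0 /\ x != 1).
  + by have [->|] := eqVneq x 0; [left; left|have [->|] := eqVneq x 1; [left; right|right]].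
  + by right; left.
  + by right; right.
  left; apply: subN => /= hF; apply: nx => x01.
  have xo : 0 < x < 1 by rewrite !lt_neqAle; case: h => h1 h2; rewrite eq_sym h1 h2 /=.
  have /eqP := hF xo; rewrite mulf_eq0 => /predU1P[//|].
  rewrite /sn gt_eqF// sin_gt0_pi//.
  by have := pi_gt0 R; rewrite freqE => p0; nra.
Qed.

End Orthogonal.
End CompletenessOfModes.

(** * Square-summable sequences and Fourier sine series *)

Section SquareSummable.
Context {R : realType}.
Implicit Types (c d x z : nat -> R) (m n N : nat).

Definition ell2 c := exists M, forall N, \sum_(m < N) c m ^+ 2 <= M.

Lemma sum_young k N c d : 0 < k ->
  2 * `|\sum_(m < N) c m * d m| <=
  k * \sum_(m < N) c m ^+ 2 + k^-1 * \sum_(m < N) d m ^+ 2.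
Proof.
move=> k0; apply: le_trans (_ : 2 * \sum_(m < N) `|c m * d m| <= _).
  by rewrite ler_pM2l// ler_norm_sum.
rewrite !mulr_sumr -big_split/=; apply: ler_sum => m _.
rewrite normrM -(real_normK (num_real (c m))) -(real_normK (num_real (d m))).
set a := `|c m|; set b := `|d m|.
have -> : k * a ^+ 2 + k^-1 * b ^+ 2 = k^-1 * ((k * a) ^+ 2 + b ^+ 2).
  by field; rewrite gt_eqF.
rewrite [leRHS]mulrC ler_pdivlMr//; have := sqr_ge0 (k * a - b); lra.
Qed.

Lemma sum_CauchySchwarz N c d :
  (\sum_(m < N) c m * d m) ^+ 2 <= (\sum_(m < N) c m ^+ 2) * (\sum_(m < N) d m ^+ 2).
Proof.
set A := \sum_(m < N) c m ^+ 2; set B := \sum_(m < N) d m ^+ 2.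
set P := \sum_(m < N) _.
have A0 : 0 <= A by apply: sumr_ge0 => i _; exact: sqr_ge0.
have h s : 0 <= s ^+ 2 * A - 2 * s * P + B.
  have -> : s ^+ 2 * A - 2 * s * P + B = \sum_(m < N) (s * c m - d m) ^+ 2.
    rewrite /A /P /B !mulr_sumr -sumrB -big_split/=.
    by apply: eq_bigr => i _; ring.
  by apply: sumr_ge0 => i _; exact: sqr_ge0.
have [A0'|A0'] := eqVneq A 0.
  suff -> : P = 0 by rewrite A0' expr0n mul0r.
  rewrite /P big1// => i _; suff -> : c i = 0 by rewrite mul0r.
  apply/eqP; rewrite -sqrf_eq0; apply/eqP.
  by apply: (psumr_eq0P (P := xpredT) _ A0') => // j _; exact: sqr_ge0.
have A1 : 0 < A by rewrite lt_neqAle eq_sym A0'.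
have := h (P / A).
have -> : (P / A) ^+ 2 * A - 2 * (P / A) * P + B = (A * B - P ^+ 2) / A by field.
by rewrite pmulr_lge0 ?invr_gt0// subr_ge0.
Qed.

Lemma le_sum_sqr c N N' : (N <= N')%N ->
  \sum_(m < N) c m ^+ 2 <= \sum_(m < N') c m ^+ 2.
Proof.
move=> NN'; rewrite -!(big_mkord xpredT (fun m => c m ^+ 2)).
rewrite [leRHS](big_cat_nat (n := N))//= lerDl.
by apply: sumr_ge0 => i _; exact: sqr_ge0.
Qed.

Lemma ell2_tail c : ell2 c -> forall e, 0 < e ->
  exists N0, forall N N', (N0 <= N)%N -> (N <= N')%N ->
    \sum_(m < N') c m ^+ 2 - \sum_(m < N) c m ^+ 2 <= e.
Proof.
move=> [M hM] e e0.
have : cvgn (fun N => \sum_(m < N) c m ^+ 2).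
  apply: nondecreasing_is_cvgn; first by move=> N N'; exact: le_sum_sqr.
  by exists M => _ [N _ <-].
move=> /cvg_cauchy/cauchy_ballP/(_ _ e0)[[A B]] /= [[N1 _ h1] [N2 _ h2]] h.
exists (maxn N1 N2) => N N' NN NN'.
have /= := h (\sum_(m < N') c m ^+ 2, \sum_(m < N) c m ^+ 2).
rewrite /ball/= => hh; apply: le_trans (ler_norm _) (ltW (hh _)).
split; [apply: h1|apply: h2] => /=.
  by rewrite (leq_trans _ NN')// (leq_trans _ NN)// leq_maxl.
by rewrite (leq_trans _ NN)// leq_maxr.
Qed.

Lemma ell2_le c d : (forall m, `|d m| <= `|c m|) -> ell2 c -> ell2 d.
Proof.
move=> dc [M hM]; exists M => N; apply: le_trans (hM N); apply: ler_sum => i _.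
by rewrite -[leLHS]real_normK ?num_real// -[leRHS]real_normK ?num_real// lerXn2r ?nnegrE.
Qed.

Lemma ell2Z k c : ell2 c -> ell2 (fun m => k * c m).
Proof.
move=> [M hM]; exists (k ^+ 2 * M) => N.
under eq_bigr do rewrite exprMn.
by rewrite -mulr_sumr ler_wpM2l ?sqr_ge0.
Qed.

Lemma cvg_sumr (T : Type) (F : set_system T) (FF : Filter F) N
    (u : T -> nat -> R) (v : nat -> R) :
  (forall m, u n m @[n --> F] --> v m) ->
  \sum_(m < N) u n m @[n --> F] --> \sum_(m < N) v m.
Proof.
move=> uv; elim: N => [|N ih].
  by rewrite big_ord0; under eq_fun do rewrite big_ord0; exact: cvg_cst.
rewrite big_ord_recr/=; under eq_fun do rewrite big_ord_recr/=.
by apply: cvgD => //; exact: uv.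
Qed.

(* Moore--Osgood for series. *)
Lemma cvg_uniform_tails (T : Type) (F : set_system T) (FF : Filter F)
    (s : T -> R) (s0 : R) (u : T -> nat -> R) (v : nat -> R) :
  (forall e, 0 < e -> exists N,
     (\forall n \near F, `|s n - \sum_(m < N) u n m| <= e) /\
     `|s0 - \sum_(m < N) v m| <= e) ->
  (forall m, u n m @[n --> F] --> v m) -> s n @[n --> F] --> s0.
Proof.
move=> tails uv; apply/cvgrPdist_le => e e0.
have e3 : 0 < e / 3 by rewrite divr_gt0.
have [N [h1 h2]] := tails _ e3.
have : \sum_(m < N) u n m @[n --> F] --> \sum_(m < N) v m.
  exact: cvg_sumr.
move/cvgrPdist_le/(_ _ e3); apply: filterS2 h1 => n h1 h3.
have -> : s0 - s n = (s0 - \sum_(m < N) v m) +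
    (\sum_(m < N) v m - \sum_(m < N) u n m) - (s n - \sum_(m < N) u n m) by ring.
apply: le_trans (ler_normB _ _) _; apply: le_trans (lerD (ler_normD _ _) (lexx _)) _.
lra.
Qed.

End SquareSummable.

Section FourierSeries.
Context {R : realType}.
Implicit Types (c d : nat -> R) (f g : R -> R) (m n N : nat).

Definition coef f m : R := dot 0 1 f (sn m).

(** The sines have squared norm 1/2 on (0,1); the factor 2 compensates, so that [c] is the sequence
    of unnormalized coefficients [coef]. *)
Definition fsum c N (x : R) : R := \sum_(m < N) 2 * c m * sn m x.

Lemma fsum_continuous c N : continuous (fsum c N).
Proof.
move=> x; apply: (@cvg_sumr _ _ _ _ N (fun x m => 2 * c m * sn m x) (fun m => 2 * c m * sn m x)) => m.
by apply: cvgMr; exact: continuous_sn.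
Qed.

Lemma L2_fsum a b c N : L2 a b (fsum c N).
Proof. exact/continuous_L2/fsum_continuous. Qed.

Lemma dot_fsum f c N : L2 0 1 f ->
  dot 0 1 f (fsum c N) = 2 * \sum_(m < N) c m * coef f m.
Proof.
move=> Lf; rewrite (dot_sumr _ (F := fun m x => 2 * c m * sn m x))//; last first.
  by move=> i; apply: L2Zl; exact: L2_sn.
rewrite mulr_sumr; apply: eq_bigr => i _.
by rewrite dotZr -?mulrA//; exact: L2_sn.
Qed.

Lemma coef_fsum c N m : coef (fsum c N) m = if (m < N)%N then c m else 0.
Proof.
rewrite /coef dotC dot_fsum; last exact: L2_sn.
under eq_bigr do rewrite /coef sn_orthogonal.
case: ifPn => mN.
  rewrite (bigD1 (Ordinal mN))//= eqxx big1 ?addr0; first by field.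
  move=> i /eqP; case: eqVneq => [mi /=|]; last by rewrite mulr0.
  by case; apply/val_inj.
rewrite big1 ?mulr0// => i _; case: eqVneq => [mi|]; last by rewrite mulr0.
by rewrite mi ltn_ord in mN.
Qed.

Lemma dot_fsum_fsum c d N N' : (N <= N')%N ->
  dot 0 1 (fsum c N) (fsum d N') = 2 * \sum_(m < N) c m * d m.
Proof.
move=> NN'; rewrite dotC dot_fsum; last exact: L2_fsum.
congr (2 * _); apply: eq_bigr => i _.
by rewrite coef_fsum (leq_trans (ltn_ord i)).
Qed.

Lemma dot_sub_fsum f N : L2 0 1 f ->
  dot 0 1 (fun x => f x - fsum (coef f) N x) (fun x => f x - fsum (coef f) N x) =
  dot 0 1 f f - 2 * \sum_(m < N) coef f m ^+ 2.
Proof.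
move=> Lf; rewrite dot_sqrB//; last exact: L2_fsum.
rewrite dot_fsum// dot_fsum_fsum//.
by under eq_bigr do rewrite -expr2; ring.
Qed.

Lemma bessel f N : L2 0 1 f -> 2 * \sum_(m < N) coef f m ^+ 2 <= dot 0 1 f f.
Proof.
by move=> Lf; rewrite -subr_ge0 -dot_sub_fsum// dot_ge0.
Qed.

Lemma coef_ell2 f : L2 0 1 f -> ell2 (coef f).
Proof.
move=> Lf; exists (dot 0 1 f f / 2) => N.
by rewrite ler_pdivlMr// mulrC bessel.
Qed.

Lemma dot_fsumB c N N' : (N <= N')%N ->
  dot 0 1 (fun x => fsum c N' x - fsum c N x) (fun x => fsum c N' x - fsum c N x)
  = 2 * (\sum_(m < N') c m ^+ 2 - \sum_(m < N) c m ^+ 2).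
Proof.
move=> NN'; rewrite dot_sqrB; [|exact: L2_fsum..].
rewrite (dotC _ _ (fsum c N')) !dot_fsum_fsum//.
by under eq_bigr do rewrite -expr2; under [X in _ + _ * X]eq_bigr do rewrite -expr2; ring.
Qed.

(** Partial sums are Cauchy by orthogonality and converge by [L2_complete]; each coefficient is
    stationary along the sums and continuous in L^2, so the limit keeps it. *)
Theorem RieszFischer c : ell2 c -> exists f,
  [/\ L2 0 1 f, forall m, coef f m = c m &
   dot 0 1 (fun x => fsum c N x - f x) (fun x => fsum c N x - f x) @[N --> \oo] --> 0].
Proof.
move=> lc; have [||f [Lf cf]] := @L2_complete _ 0 1 (fsum c).
- by move=> n; exact: L2_fsum.
- move=> e e0; have e2 : 0 < e / 2 by rewrite divr_gt0.
  have [N0 h] := ell2_tail lc e2; exists N0 => m n mN nN.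
  wlog mn : m n mN nN / (n <= m)%N.
    have [mn|/ltnW nm] := leqP n m; first exact.
    by rewrite dotBC; apply.
  by rewrite dot_fsumB//; have := h n m nN mn; lra.
exists f; split=> // m.
have h : coef (fsum c n) m @[n --> \oo] --> coef f m.
  by apply: cvg_dot => //; [move=> n; exact: L2_fsum|exact: L2_sn].
rewrite -(cvg_lim _ h)//; apply: lim_near_cst => //.
by exists m.+1 => // n /= mn; rewrite coef_fsum mn.
Qed.

Lemma coef_sub f g m : L2 0 1 f -> L2 0 1 g ->
  coef (fun x => f x - g x) m = coef f m - coef g m.
Proof. by move=> Lf Lg; rewrite /coef dotBl//; exact: L2_sn. Qed.

Lemma coef_inj f g : L2 0 1 f -> L2 0 1 g -> (forall m, coef f m = coef g m) ->
  eq_ae01 f g.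
Proof.
move=> Lf Lg fg.
have := @ae_zero_of_orthogonal _ (fun x => f x - g x) (L2B Lf Lg).
case.
  by move=> m; rewrite -/(coef _ m) coef_sub// fg subrr.
move=> N [mN N0 sub]; exists N; split=> // x /= nx; apply: sub => /= h; apply: nx.
by move=> x01; apply/eqP; rewrite -subr_eq0 h.
Qed.

Lemma eq_ae01_dot f g h : L2 0 1 f -> L2 0 1 g -> L2 0 1 h -> eq_ae01 f g ->
  dot 0 1 f h = dot 0 1 g h.
Proof. by move=> Lf Lg Lh fg; exact: ae_eq_dot. Qed.

(** The sine series converges to some g with the coefficients of f by [RieszFischer]; completeness
    of the modes identifies g with f almost everywhere. *)
Theorem parseval_cvg f : L2 0 1 f ->
  dot 0 1 (fun x => fsum (coef f) N x - f x) (fun x => fsum (coef f) N x - f x)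
    @[N --> \oo] --> 0.
Proof.
move=> Lf; have [g [Lg gc cg]] := RieszFischer (coef_ell2 Lf).
have fg : eq_ae01 g f by exact: coef_inj.
have -> : (fun N => dot 0 1 (fun x => fsum (coef f) N x - f x)
   (fun x => fsum (coef f) N x - f x)) = (fun N => dot 0 1
   (fun x => fsum (coef f) N x - g x) (fun x => fsum (coef f) N x - g x)) => //.
apply/funext => N; have LN := L2_fsum 0 1 (coef f) N.
rewrite !dot_sqrB// !(dotC _ _ (fsum _ _)) (eq_ae01_dot Lf Lg LN)//; last first.
  by case: fg => Z [mZ Z0 sub]; exists Z; split=> // x /= nx; apply: sub => /= h;
    apply: nx => x01; rewrite h.
by rewrite -(eq_ae01_dot Lg Lf Lf fg) (dotC _ _ g f) -(eq_ae01_dot Lg Lf Lg fg).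
Qed.

Lemma parseval_dot f g : L2 0 1 f -> L2 0 1 g ->
  2 * \sum_(m < N) coef f m * coef g m @[N --> \oo] --> dot 0 1 f g.
Proof.
move=> Lf Lg.
have -> : (fun N => 2 * \sum_(m < N) coef f m * coef g m) =
    (fun N => dot 0 1 (fsum (coef f) N) g).
  by apply/funext => N; rewrite dotC dot_fsum.
apply: cvg_dot => //; last exact: parseval_cvg.
by move=> N; exact: L2_fsum.
Qed.

Lemma parseval f : L2 0 1 f ->
  2 * \sum_(m < N) coef f m ^+ 2 @[N --> \oo] --> dot 0 1 f f.
Proof.
move=> Lf; have := parseval_dot Lf Lf.
by under eq_fun do under eq_bigr do rewrite -expr2.
Qed.

Lemma dot_le_coef f M : L2 0 1 f -> (forall N, \sum_(m < N) coef f m ^+ 2 <= M) ->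
  dot 0 1 f f <= 2 * M.
Proof.
move=> Lf hM; apply: cvgn_le (parseval Lf) _ => N.
by rewrite ler_pM2l.
Qed.

End FourierSeries.

Section WeakSquareSummable.
Context {R : realType}.
Implicit Types (c d x z : nat -> R) (m n N : nat).

Lemma ler_sqr_norm (a b : R) : 0 <= b -> a ^+ 2 <= b ^+ 2 -> `|a| <= b.
Proof. by move=> b0; rewrite -[a ^+ 2]real_normK ?num_real// ler_pXn2r ?nnegrE. Qed.

(** Cauchy-Schwarz on the tail. The estimate sees [x] only through the bound [M], so it is uniform
    over a ball of square-summable sequences. *)
Lemma sum_tail_le x z M delta N s : 
  (forall N', \sum_(m < N') x m ^+ 2 <= M) ->
  (forall N', (N <= N')%N -> \sum_(m < N') z m ^+ 2 - \sum_(m < N) z m ^+ 2 <= delta) ->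
  \sum_(m < N') x m * z m @[N' --> \oo] --> s ->
  (s - \sum_(m < N) x m * z m) ^+ 2 <= M * delta.
Proof.
move=> xM zd xs.
have M0 : 0 <= M by have := xM 0%N; rewrite big_ord0.
have d0 : 0 <= delta by have := zd N (leqnn N); rewrite subrr.
suff h N' : (N <= N')%N ->
    (\sum_(m < N') x m * z m - \sum_(m < N) x m * z m) ^+ 2 <= M * delta.
  have cv : (\sum_(m < N' + N) x m * z m - \sum_(m < N) x m * z m) ^+ 2
      @[N' --> \oo] --> (s - \sum_(m < N) x m * z m) ^+ 2.
    have cv1 : \sum_(m < N' + N) x m * z m - \sum_(m < N) x m * z m
        @[N' --> \oo] --> s - \sum_(m < N) x m * z m.
      apply: cvgB; last exact: (@cvg_cst R^o).
      by move: xs; rewrite -(cvg_shiftn N).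
    by rewrite expr2; under eq_fun do rewrite expr2; exact: cvgM.
  by apply: cvgn_le cv _ => N'; apply: h; rewrite leq_addl.
move=> NN'.
pose x' m := if (N <= m)%N then x m else 0.
pose z' m := if (N <= m)%N then z m else 0.
have split_sum (f g : nat -> R) : (forall m, g m = if (N <= m)%N then f m else 0) ->
    \sum_(m < N') f m - \sum_(m < N) f m = \sum_(m < N') g m.
  move=> gf; rewrite -!(big_mkord xpredT).
  rewrite [X in X - _](big_cat_nat (n := N))//= [RHS](big_cat_nat (n := N))//=.
  rewrite addrAC subrr add0r [X in _ = X + _]big_nat [X in _ = X + _]big1.
    rewrite add0r; apply: eq_big_nat => i /andP[Ni _].
    by rewrite gf Ni.
  by move=> i /andP[_ iN]; rewrite gf leqNgt iN.
rewrite (split_sum (fun m => x m * z m) (fun m => x' m * z' m)); last first.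
  by move=> m; rewrite /x' /z'; case: ifP => // _; rewrite mul0r.
apply: le_trans (sum_CauchySchwarz _ _ _) _.
apply: ler_pM.
- by apply: sumr_ge0 => i _; exact: sqr_ge0.
- by apply: sumr_ge0 => i _; exact: sqr_ge0.
- apply: le_trans (xM N'); apply: ler_sum => i _; rewrite /x'.
  by case: ifP => // _; rewrite expr0n sqr_ge0.
- rewrite -(split_sum (fun m => z m ^+ 2) (fun m => z' m ^+ 2)) ?zd// => m.
  by rewrite /z'; case: ifP => // _; rewrite expr0n.
Qed.

Lemma cvg_sum_sqr (T : Type) (F : set_system T) (FF : Filter F) N
    (x : T -> nat -> R) (x0 : nat -> R) : (forall m, x n m @[n --> F] --> x0 m) ->
  \sum_(m < N) x n m ^+ 2 @[n --> F] --> \sum_(m < N) x0 m ^+ 2.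
Proof.
move=> xx0; elim: N => [|N ih].
  by rewrite big_ord0; under eq_fun do rewrite big_ord0; exact: cvg_cst.
rewrite big_ord_recr/=; under eq_fun do rewrite big_ord_recr/=.
apply: cvgD => //; rewrite expr2; under eq_fun do rewrite expr2.
by apply: cvgM; exact: xx0.
Qed.

(** In a ball of square-summable sequences, componentwise convergence is weak convergence: the tails
    of [z] are small, uniformly over the ball by [sum_tail_le]. *)
Lemma ell2_weak_cvg (T : Type) (F : set_system T) (FF : ProperFilter F)
    (s : T -> R) (s0 : R) (x : T -> nat -> R) (x0 z : nat -> R) (M : R) : ell2 z ->
  (\forall n \near F, forall N, \sum_(m < N) x n m ^+ 2 <= M) ->
  (forall m, x n m @[n --> F] --> x0 m) ->
  (\forall n \near F, \sum_(m < N) x n m * z m @[N --> \oo] --> s n) ->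
  \sum_(m < N) x0 m * z m @[N --> \oo] --> s0 ->
  s n @[n --> F] --> s0.
Proof.
move=> lz xM xx0 xs x0s.
have x0M N : \sum_(m < N) x0 m ^+ 2 <= M.
  have cv : \sum_(m < N) x n m ^+ 2 @[n --> F] --> \sum_(m < N) x0 m ^+ 2.
    exact: cvg_sum_sqr.
  rewrite -(cvg_lim _ cv)//; apply: limr_le; first by apply/cvg_ex; eexists; exact: cv.
  by apply: filterS xM.
have M0 : 0 <= M by have := x0M 0%N; rewrite big_ord0.
apply: (@cvg_uniform_tails _ _ _ _ _ _ (fun i m => x i m * z m) (fun m => x0 m * z m)).
  move=> e e0; have e2 : 0 < e ^+ 2 / (M + 1) by rewrite divr_gt0 ?exprn_gt0// ltr_wpDl.
  have [N hN] := ell2_tail lz e2; exists N.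
  have small (y : nat -> R) t : (forall N', \sum_(m < N') y m ^+ 2 <= M) ->
      \sum_(m < N') y m * z m @[N' --> \oo] --> t ->
      `|t - \sum_(m < N) y m * z m| <= e.
    move=> yM yt; apply: ler_sqr_norm; first exact: ltW.
    apply: le_trans (sum_tail_le yM (hN N ^~ _) yt) _ => //.
    by rewrite mulrCA ler_piMr ?sqr_ge0// ler_pdivrMr ?mul1r ?lerDl// ltr_wpDl.
  split; last exact: small.
  by apply: filterS2 xM xs => n; exact: small.
by move=> m; apply: cvgMl; exact: xx0.
Qed.

End WeakSquareSummable.

(** * The space V in terms of sine coefficients *)

Section SpaceV.
Context {R : realType}.
Implicit Types (c d : nat -> R) (f g u du d2u w dw d2w : R -> R) (m n N : nat) (x : R).

Lemma within_continuous_L2 a b f : {within `[a, b], continuous f} -> @L2 R a b f.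
Proof.
move=> cf; split.
  by apply: integrable_on_measurable; exact: continuous_integrable_on.
by apply: continuous_integrable_on; apply: (within_continuousM cf cf).
Qed.

Lemma W21_continuous a b u du d2u : a <= b -> @W21 R a b u du d2u ->
  {within `[a, b], continuous u} /\ {within `[a, b], continuous du}.
Proof.
move=> ab [i2 hW].
have cprim f k : integrable_on a b f -> {within `[a, b], continuous (fun x => k + intg a x f)}.
  move=> hf; apply: within_continuousD; last exact: primitive_continuous.
  exact/continuous_within/cst_continuous.
have cdu : {within `[a, b], continuous du}.
  apply: (@subspace_eq_continuous _ _ _ (fun x => du a + intg a x d2u)); last exact: cprim.
  by move=> x; rewrite inE => /itvccP xab; rewrite /from_subspace/=; have [_ ->] := hW x xab.
split=> //.
apply: (@subspace_eq_continuous _ _ _ (fun x => u a + intg a x du)).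
  by move=> x; rewrite inE => /itvccP xab; rewrite /from_subspace/=; have [-> _] := hW x xab.
by apply: cprim; exact: continuous_integrable_on.
Qed.

Lemma V_with_L2 u du d2u : V_with u du d2u ->
  [/\ L2 0 1 u, L2 0 1 du & L2 0 1 d2u].
Proof.
move=> [[hW L2d] _ _]; have [cu cdu] := W21_continuous ler01 hW.
by split=> //; exact: within_continuous_L2.
Qed.

(** Green's formula without boundary terms: [u 0] and [du 1] vanish by membership in V, while the
    free values [u 1] and [du 0] meet [cn m 1 = 0] and [sn m 0 = 0]. *)
Lemma V_coef_d2 u du d2u m : V_with u du d2u -> coef d2u m = - eig m * coef u m.
Proof.
move=> Vu; have [Lu _ Ld2] := V_with_L2 Vu; case: Vu => [[hW _] u0 du1].
have c2 : continuous (fun x => - eig m * @sn R m x) by exact/continuousZ/continuous_sn.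
have h1 x : is_derive x 1 (@sn R m) (freq m * cos (freq m * x)).
  exact: is_derive_sinM.
have h2 x : is_derive x 1 (fun x => freq m * cos (freq m * x)) (- eig m * sn m x).
  have h := is_derive_cosM (freq m) x; apply: is_derive_eq.
  by rewrite /GRing.scale/= /eig /sn; ring.
have := W21_green ler01 hW c2 h1 h2.
rewrite /coef dotC /dot => ->.
have -> : sn m 0 = 0 :> R by rewrite /sn mulr0 sin0.
have -> : cos (freq m * 1) = 0 :> R.
  have -> : cos (freq m * 1) = cos (m%:R * pi + pi / 2) :> R.
    by congr cos; rewrite freqE; field.
  by rewrite cosDpihalf sin_natpi oppr0.
rewrite u0 du1 !mul0r !mulr0 mul0r !subr0 add0r.
rewrite -intgZl; last exact: L2_mul (L2_sn _ _ _).
by apply: eq_intg => x _; ring.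
Qed.

Lemma V_with_lin k u du d2u w dw d2w : V_with u du d2u -> V_with w dw d2w ->
  V_with (fun x => k * u x + w x) (fun x => k * du x + dw x)
    (fun x => k * d2u x + d2w x).
Proof.
move=> Vu Vw; have [Lu Ldu Ld2u] := V_with_L2 Vu; have [Lw Ldw Ld2w] := V_with_L2 Vw.
case: Vu => [[[iu hu] _] u0 du1]; case: Vw => [[[iw hw] _] w0 dw1].
split; [split|by rewrite u0 w0 mulr0 addr0|by rewrite du1 dw1 mulr0 addr0].
- split; first by apply: integrable_onD => //; exact: integrable_onZl.
  move=> x x01; have [eu edu] := hu x x01; have [ew edw] := hw x x01.
  have sub f : L2 0 1 f -> integrable_on 0 x f.
    by move=> /L2_integrable; apply: integrable_on_sub; case/andP: x01.
  rewrite !intgD ?intgZl//; try exact: sub; try exact/integrable_onZl/sub.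
  by split; [rewrite {1}eu {1}ew|rewrite {1}edu {1}edw]; ring.
- by apply: L2D => //; exact: L2Zl.
Qed.

(** [du] vanishes at 1 and [u] at 0, so each is an integral of its derivative over an interval of
    length at most 1, and Cauchy-Schwarz applies twice. *)
Lemma V_with_bound u du d2u x : V_with u du d2u -> 0 <= x <= 1 ->
  u x ^+ 2 <= dot 0 1 d2u d2u /\ du x ^+ 2 <= dot 0 1 d2u d2u.
Proof.
move=> Vu; have [Lu Ldu Ld2u] := V_with_L2 Vu; case: Vu => [[[iu hu] _] u0 du1].
have CS a b f : 0 <= a -> a <= b -> b <= 1 -> L2 0 1 f ->
    intg a b f ^+ 2 <= dot 0 1 f f.
  move=> a0 ab b1 Lf; have Lab : L2 a b f by exact: L2_sub Lf.
  have -> : intg a b f = dot a b f (fun=> 1) by apply: eq_intg => y _; rewrite mulr1.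
  apply: le_trans (CauchySchwarz Lab (L2_cst _ _ _)) _.
  have -> : dot a b (fun=> 1) (fun=> 1) = b - a :> R.
    by rewrite /dot intg_cst// mulr1 mul1r.
  apply: le_trans (_ : dot a b f f <= _).
    by rewrite ler_piMr ?dot_ge0//; lra.
  apply: le_intg_sub => //; first exact: L2_mul.
  by move=> y _; rewrite -expr2 sqr_ge0.
have hdu y : 0 <= y <= 1 -> du y ^+ 2 <= dot 0 1 d2u d2u.
  move=> y01; have [_ e1] : u 1 = u 0 + intg 0 1 du /\ du 1 = du 0 + intg 0 1 d2u.
    by apply: hu; rewrite ler01 lexx.
  have [_ ey] := hu y y01.
  have -> : du y = - intg y 1 d2u.
    move: e1; rewrite (@intg_cat _ y)// du1 => e1; rewrite ey; lra.
  by rewrite sqrrN; apply: CS => //; lra.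
move=> x01; split; last exact: hdu.
have [-> _] := hu x x01; rewrite u0 add0r.
apply: le_trans (CS 0 x du _ _ _ _) _ => //; try lra.
have -> : dot 0 1 d2u d2u = intg 0 1 (fun=> dot 0 1 d2u d2u).
  by rewrite intg_cst// subr0 mulr1.
apply: le_intg; [exact: L2_mul|exact: integrable_on_cst|].
by move=> y y01; rewrite -expr2 hdu.
Qed.

(** Each of the three terms under the root is at most the squared norm of [d2u], and 3 <= 2^2. Hence
    on V the second derivative alone controls the norm. *)
Lemma normH2_le u du d2u : V_with u du d2u -> normH2 u du d2u <= 2 * nrm 0 1 d2u.
Proof.
move=> Vu; have [Lu Ldu Ld2u] := V_with_L2 Vu.
have D0 := dot_ge0 0 1 d2u.
have h f : L2 0 1 f -> (forall x, 0 <= x <= 1 -> f x ^+ 2 <= dot 0 1 d2u d2u) ->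
    ip f f <= dot 0 1 d2u d2u.
  move=> Lf hf; have -> : dot 0 1 d2u d2u = intg 0 1 (fun=> dot 0 1 d2u d2u).
    by rewrite intg_cst// subr0 mulr1.
  apply: le_intg; [exact: L2_mul|exact: integrable_on_cst|].
  by move=> y y01; rewrite -expr2 hf.
have h1 := h u Lu (fun x x01 => (V_with_bound Vu x01).1).
have h2 := h du Ldu (fun x x01 => (V_with_bound Vu x01).2).
rewrite -(@ler_pXn2r _ 2) ?nnegrE ?sqrtr_ge0 ?mulr_ge0 ?nrm_ge0//.
rewrite exprMn nrm_sqr sqr_sqrtr; last by rewrite !addr_ge0//; exact: dot_ge0.
by have : ip d2u d2u = dot 0 1 d2u d2u by []; lra.
Qed.

Lemma V_with_sn m : @V_with R (sn m) (fun x => freq m * cn m x) (fun x => - eig m * sn m x).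
Proof.
have c2 : continuous (fun x => - eig m * @sn R m x) by exact/continuousZ/continuous_sn.
have h1 x : is_derive x 1 (@sn R m) (freq m * cn m x) by exact: is_derive_sinM.
have h2 x : is_derive x 1 (fun x => freq m * cn m x) (- eig m * sn m x).
  have h := is_derive_cosM (freq m) x; apply: is_derive_eq.
  by rewrite /GRing.scale/= /eig /sn; ring.
split.
- split; last exact: continuous_L2.
  split; first exact: continuous_integrable.
  move=> x /andP[x0 _]; rewrite (FTC2 x0 (is_derive_continuous h2) h1) (FTC2 x0 c2 h2).
  by split; ring.
- by rewrite /sn mulr0 sin0.
- have -> : cn m 1 = 0 :> R; last by rewrite mulr0.
  have -> : cn m 1 = cos (m%:R * pi + pi / 2) :> R by congr cos; rewrite freqE; field.
  by rewrite cosDpihalf sin_natpi oppr0.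
Qed.

Lemma V_with0 : @V_with R (fun=> 0) (fun=> 0) (fun=> 0).
Proof.
split=> //; split; last exact: L2_cst.
by split; [exact: integrable_on_cst|move=> x _; rewrite !intg0 addr0].
Qed.

Lemma V_with_fsum c N : exists du,
  V_with (fsum c N) du (fsum (fun m => - eig m * c m) N).
Proof.
elim: N => [|N [du ih]].
  exists (fun=> 0); have := V_with0; congr V_with; apply/funext => x;
  by rewrite /fsum big_ord0.
exists (fun x => 2 * c N * (freq N * cn N x) + du x).
have := V_with_lin (2 * c N) (V_with_sn N) ih; congr V_with; apply/funext => x.
  by rewrite /fsum big_ord_recr/= addrC.
by rewrite /fsum big_ord_recr/= addrC; congr (_ + _); ring.
Qed.

Lemma eig_coef_ell2 u du d2u : V_with u du d2u -> ell2 (fun m => eig m * coef u m).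
Proof.
move=> Vu; have [_ _ Ld2] := V_with_L2 Vu.
have := coef_ell2 Ld2; apply: ell2_le => m.
by rewrite (V_coef_d2 m Vu) mulNr normrN.
Qed.

Lemma V_dot_d2 u du d2u M : V_with u du d2u ->
  (forall N, \sum_(m < N) (eig m * coef u m) ^+ 2 <= M) -> dot 0 1 d2u d2u <= 2 * M.
Proof.
move=> Vu hM; have [_ _ Ld2] := V_with_L2 Vu; apply: dot_le_coef => // N.
apply: le_trans (hM N); apply: ler_sum => i _.
by rewrite (V_coef_d2 i Vu) mulNr sqrrN.
Qed.

Lemma V_sub_fsum u du d2u N : V_with u du d2u -> exists dr,
  V_with (fun x => u x - fsum (coef u) N x) dr
    (fun x => d2u x - fsum (coef d2u) N x).
Proof.
move=> Vu; have [du' Vs] := V_with_fsum (coef u) N.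
exists (fun x => - 1 * du' x + du x).
have := V_with_lin (-1) Vs Vu; congr V_with; apply/funext => x; first by ring.
rewrite (_ : fsum (coef d2u) N x = fsum (fun m => - eig m * coef u m) N x); first by ring.
by apply: eq_bigr => i _; rewrite (V_coef_d2 i Vu).
Qed.

(** The remainder of the sine series is again in V, and its second derivative is the Parseval
    remainder of [d2u]; [V_with_bound] then gives pointwise convergence. *)
Lemma V_fsum_cvg u du d2u x : V_with u du d2u -> 0 <= x <= 1 ->
  fsum (coef u) N x @[N --> \oo] --> u x.
Proof.
move=> Vu x01; have [_ _ Ld2] := V_with_L2 Vu.
apply/cvgrPdist_le => e e0.
have e2 : 0 < e ^+ 2 by rewrite exprn_gt0.
have /cvgrPdist_le/(_ _ e2) := parseval_cvg Ld2; apply: filterS => N.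
rewrite sub0r normrN ger0_norm ?dot_ge0// => h.
have [dr Vr] := V_sub_fsum N Vu.
apply: ler_sqr_norm; first exact: ltW.
have [h1 _] := V_with_bound Vr x01.
by apply: le_trans h1 _; rewrite dotBC.
Qed.

Lemma V_of_coef c : ell2 (fun m => eig m * c m) -> exists u du d2u,
  V_with u du d2u /\ forall m, coef u m = c m.
Proof.
move=> lc; have [d2u [Ld2 cd2 _]] := RieszFischer (ell2Z (-1) lc).
have id2 := L2_integrable Ld2.
(* The constant enforces [du 1 = 0]; integrating from 0 next enforces [u 0 = 0]. *)
pose du x := intg 0 x d2u - intg 0 1 d2u.
pose u x := intg 0 x du.
have Vu : V_with u du d2u.
  split; [|by rewrite /u intg_set1|by rewrite /du subrr].
  split=> //; split=> // x x01; rewrite /u intg_set1 add0r; split=> //.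
  by rewrite /du intg_set1; ring.
exists u, du, d2u; split=> // m.
have := V_coef_d2 m Vu; rewrite cd2 => h.
have e0 : eig m != 0 :> R by rewrite gt_eqF// eig_gt0.
by apply: (mulfI e0); lra.
Qed.

End SpaceV.

(** * Trigonometric sums in time and weighted energies *)

Section TrigonometricSums.
Context {R : realType}.
Implicit Types (al be ga de : nat -> R) (f v : R -> R) (m n N K : nat) (a b t T : R).

Definition mode al be m t : R := al m * ct m t + be m * st m t.

Definition tsum al be N t : R := \sum_(m < N) mode al be m t.

Lemma continuous_ct m : continuous (@ct R m).
Proof. exact: continuous_cosM. Qed.

Lemma continuous_st m : continuous (@st R m).
Proof. exact: continuous_sinM. Qed.

Lemma L2_ct a b m : L2 a b (@ct R m).
Proof. exact/continuous_L2/continuous_ct. Qed.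

Lemma L2_st a b m : L2 a b (@st R m).
Proof. exact/continuous_L2/continuous_st. Qed.

Lemma continuous_mode al be m : continuous (mode al be m).
Proof.
by move=> t; apply: cvgD; apply: cvgMr; [exact: continuous_ct|exact: continuous_st].
Qed.

Lemma continuous_tsum al be N : continuous (tsum al be N).
Proof.
move=> t; apply: (@cvg_sumr _ _ _ _ N (fun t m => mode al be m t) (fun m => mode al be m t)) => m.
exact: continuous_mode.
Qed.

Lemma L2_mode a b al be m : L2 a b (mode al be m).
Proof. exact/continuous_L2/continuous_mode. Qed.

Lemma L2_tsum a b al be N : L2 a b (tsum al be N).
Proof. exact/continuous_L2/continuous_tsum. Qed.

Lemma dot_mode f a b al be m : L2 a b f ->
  dot a b f (mode al be m) = al m * dot a b f (ct m) + be m * dot a b f (st m).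
Proof.
move=> Lf; rewrite dotDr ?dotZr//; try exact: L2_ct; try exact: L2_st.
  by apply: L2Zl; exact: L2_ct.
by apply: L2Zl; exact: L2_st.
Qed.

Lemma dot_mode_mode K al be ga de m n :
  dot 0 (K%:R * period) (mode al be m) (mode ga de n) =
  if m == n then K%:R * period / 2 * (al m * ga m + be m * de m) else 0.
Proof.
rewrite dot_mode; last exact: L2_mode.
have [h1 h2 h3] := @periodic_orthogonal R m n K.
have [_ _ h4] := @periodic_orthogonal R n m K.
have sym f g : dot 0 (K%:R * period) f g = dot 0 (K%:R * period) g f :> R by exact: dotC.
rewrite !(sym (mode al be m)) !dot_mode; try exact: L2_ct; try exact: L2_st.
rewrite h4 (sym (ct n)) h1 (sym (ct n)) h3 (sym (st n) (st m)) h2.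
by case: eqVneq => [->|_]; ring.
Qed.

Lemma dot_tsum_tsum K al be ga de N :
  dot 0 (K%:R * period) (tsum al be N) (tsum ga de N) =
  K%:R * period / 2 * \sum_(m < N) (al m * ga m + be m * de m).
Proof.
rewrite (dot_suml _ (F := mode al be)); last exact: L2_tsum; last by move=> i; exact: L2_mode.
rewrite mulr_sumr; apply: eq_bigr => i _.
rewrite (dot_sumr _ (F := mode ga de)); last exact: L2_mode; last by move=> j; exact: L2_mode.
under eq_bigr do rewrite dot_mode_mode.
rewrite (bigD1 i)//= eqxx big1 ?addr0// => j ji.
by rewrite ifN// eq_sym; apply: contra ji => /eqP/val_inj->.
Qed.

Lemma exists_periods T : exists K, T <= K%:R * period.
Proof.
exists (Num.truncn (`|T| / period)).+1.
have p0 := @period_gt0 R.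
have /andP[_ h] : _ <= _ < _ := truncn_itv (divr_ge0 (normr_ge0 T) (ltW p0)).
rewrite (le_trans (ler_norm T))// -ler_pdivrMr// ltW//.
Qed.

(** Upper bounds on a subinterval of (0,T) come from enlarging it to (0, K period), where the modes
    are orthogonal; positivity of [K] makes [bconst K], their squared norm there, invertible. *)
Definition covers T K : Prop := (0 < K)%N /\ T <= K%:R * period.

Lemma exists_cover T : exists K, covers T K.
Proof.
have [K hK] := exists_periods T; exists K.+1; split=> //.
apply: le_trans hK _; rewrite ler_pM2r ?period_gt0//; by rewrite ler_nat.
Qed.

Definition bconst K : R := K%:R * period / 2.

Lemma bconst_gt0 T K : covers T K -> 0 < bconst K.
Proof. by move=> [K0 _]; rewrite divr_gt0// mulr_gt0 ?period_gt0// ltr0n. Qed.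

Lemma dot_tsum_le T K a b al be N : covers T K -> 0 <= a -> a <= b -> b <= T ->
  dot a b (tsum al be N) (tsum al be N) <=
  bconst K * \sum_(m < N) (al m ^+ 2 + be m ^+ 2).
Proof.
move=> [_ TK] a0 ab bT; rewrite /bconst.
under eq_bigr do rewrite !expr2.
rewrite -dot_tsum_tsum; apply: le_intg_sub => //; first by lra.
  by apply: L2_mul; exact: L2_tsum.
by move=> x _; rewrite -expr2 sqr_ge0.
Qed.

(** The modes are not orthogonal on (a,b), so Bessel's inequality is obtained by duality: the sum Q
    is the pairing of [v] with the trigonometric sum having the moments of [v] as coefficients. That
    sum has squared norm at most [bconst K * Q], and Young's inequality absorbs it. *)
Lemma bessel_time T K a b v N : covers T K -> 0 <= a -> a <= b -> b <= T ->
  L2 a b v ->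
  \sum_(m < N) (dot a b v (ct m) ^+ 2 + dot a b v (st m) ^+ 2) <= bconst K * dot a b v v.
Proof.
move=> cT a0 ab bT Lv; have k0 := bconst_gt0 cT.
pose al m := dot a b v (ct m); pose be m := dot a b v (st m).
set Q := \sum_(m < N) _.
have Qe : Q = dot a b v (tsum al be N).
  rewrite (dot_sumr _ (F := mode al be))//; last by move=> i; exact: L2_mode.
  by apply: eq_bigr => i _; rewrite dot_mode// !expr2.
have := young_dot k0 Lv (L2_tsum a b al be N).
have := dot_tsum_le al be N cT a0 ab bT.
have -> : \sum_(m < N) (al m ^+ 2 + be m ^+ 2) = Q by [].
rewrite -Qe; set W := dot a b (tsum _ _ _) _ => WQ.
have : (bconst K)^-1 * W <= Q by rewrite mulrC ler_pdivrMr// mulrC.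
have := ler_norm Q; lra.
Qed.

End TrigonometricSums.

Section Weights.
Context {R : realType}.
Implicit Types (al be ga de c d : nat -> R) (f g h rho : R -> R) (m n N K : nat) (a b t T M : R).

(** Instantiated by n times the indicator of the window, and by the constant 1 to recover the plain
    scalar product. *)
Definition weight rho M : Prop :=
  measurable_fun `[0 : R, 1] rho /\ forall x, 0 <= x <= 1 -> 0 <= rho x <= M.

Definition wdot rho f g : R := dot 0 1 (fun x => rho x * f x) g.

Variables (rho : R -> R) (M : R) (hrho : weight rho M).

Lemma L2_weight f : L2 0 1 f -> L2 0 1 (fun x => rho x * f x).
Proof.
move=> Lf; apply: (@L2_bounded_mul _ _ _ _ _ M); [by case: hrho| |by []].
by move=> x x01; rewrite ger0_norm; have [_ /(_ x x01)/andP[]] := hrho.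
Qed.

Lemma wdotC f g : wdot rho f g = wdot rho g f.
Proof. by apply: eq_intg => x _; ring. Qed.

Lemma wdotDl f g h : L2 0 1 f -> L2 0 1 g -> L2 0 1 h ->
  wdot rho (fun x => f x + g x) h = wdot rho f h + wdot rho g h.
Proof.
move=> Lf Lg Lh; rewrite /wdot -dotDl//; try exact: L2_weight.
by apply: eq_dot => // x _; rewrite mulrDr.
Qed.

Lemma wdotZl k f g : L2 0 1 f -> L2 0 1 g ->
  wdot rho (fun x => k * f x) g = k * wdot rho f g.
Proof.
move=> Lf Lg; rewrite /wdot -dotZl//; try exact: L2_weight.
by apply: eq_dot => // x _; ring.
Qed.

Lemma wdotBl f g h : L2 0 1 f -> L2 0 1 g -> L2 0 1 h ->
  wdot rho (fun x => f x - g x) h = wdot rho f h - wdot rho g h.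
Proof.
move=> Lf Lg Lh; rewrite /wdot -dotBl//; try exact: L2_weight.
by apply: eq_dot => // x _; rewrite mulrBr.
Qed.

Lemma wdot_ge0 f : 0 <= wdot rho f f.
Proof.
apply: intg_ge0 => x x01; rewrite -mulrA -expr2 mulr_ge0 ?sqr_ge0//.
by have [_ /(_ x x01)/andP[]] := hrho.
Qed.

Lemma wdot_young k f g : 0 < k -> L2 0 1 f -> L2 0 1 g ->
  2 * `|wdot rho f g| <= k * wdot rho f f + k^-1 * wdot rho g g.
Proof.
move=> k0 Lf Lg.
have e s : wdot rho (fun x => k * f x + s * g x) (fun x => k * f x + s * g x) =
    k * (k * wdot rho f f) + 2 * s * (k * wdot rho f g) + s ^+ 2 * wdot rho g g.
  have Lk := L2Zl k Lf; have Ls := L2Zl s Lg; have Lks := L2D Lk Ls.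
  rewrite wdotDl// !wdotZl// (wdotC f) (wdotC g) !wdotDl// !wdotZl// (wdotC g f).
  by ring.
have := wdot_ge0 (fun x => k * f x + 1 * g x).
have := wdot_ge0 (fun x => k * f x + -1 * g x).
rewrite !e sqrrN expr1n => h1 h2.
have -> : k * wdot rho f f + k^-1 * wdot rho g g =
    k^-1 * (k * (k * wdot rho f f) + wdot rho g g) by field; rewrite gt_eqF.
rewrite [leRHS]mulrC ler_pdivlMr//.
by case: (ger0P (wdot rho f g)) => _; lra.
Qed.

Lemma wdot_fsumr f c N : L2 0 1 f ->
  wdot rho f (fsum c N) = 2 * \sum_(m < N) c m * wdot rho f (sn m).
Proof. by move=> Lf; rewrite /wdot dot_fsum//; exact: L2_weight. Qed.

Lemma wdot_fsum2 c d N : wdot rho (fsum c N) (fsum d N) =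
  4 * \sum_(m < N) \sum_(n < N) c m * d n * wdot rho (sn m) (sn n).
Proof.
rewrite wdotC wdot_fsumr; last exact: L2_fsum.
have -> : (4 : R) = 2 * 2 by ring.
rewrite -mulrA; congr (2 * _); rewrite mulr_sumr; apply: eq_bigr => i _.
rewrite wdotC wdot_fsumr; last exact: L2_sn.
rewrite mulrCA; congr (2 * _); rewrite mulr_sumr; apply: eq_bigr => j _.
by ring.
Qed.

(** The sines are not orthogonal for the weighted product, but orthogonality in time removes every
    cross term, so the energy over whole periods is diagonal for any weight. *)
Lemma int_wdot_modes K al be N :
  intg 0 (K%:R * period) (fun t =>
    wdot rho (fsum (mode al be ^~ t) N) (fsum (mode al be ^~ t) N)) =
  4 * bconst K * \sum_(m < N) (al m ^+ 2 + be m ^+ 2) * wdot rho (sn m) (sn m).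
Proof.
under eq_intg => t _ do rewrite wdot_fsum2.
pose F m n t := wdot rho (sn m) (sn n) * (mode al be m t * mode al be n t).
have iF m n : integrable_on 0 (K%:R * period) (F m n).
  by apply: integrable_onZl; apply: L2_mul; exact: L2_mode.
have iS m : integrable_on 0 (K%:R * period) (fun t => \sum_(n < N) F m n t).
  by apply: integrable_on_sum.
have -> : intg 0 (K%:R * period) (fun t => 4 *
    (\sum_(m < N) \sum_(n < N) mode al be m t * mode al be n t * wdot rho (sn m) (sn n)))
  = intg 0 (K%:R * period) (fun t => 4 * \sum_(m < N) \sum_(n < N) F m n t).
  apply: eq_intg => t _; congr (4 * _); apply: eq_bigr => i _; apply: eq_bigr => j _.
  by rewrite /F mulrC.
rewrite intgZl; last by apply: (integrable_on_sum (F := fun m t => \sum_(n < N) F m n t)).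
rewrite (intg_sum (F := fun m t => \sum_(n < N) F m n t))// -mulrA; congr (4 * _).
rewrite mulr_sumr; apply: eq_bigr => i _.
rewrite (intg_sum (F := F i))//.
rewrite (bigD1 i)//= big1 ?addr0 => [|j ji].
  rewrite intgZl; last by apply: L2_mul; exact: L2_mode.
  by rewrite -/(dot _ _ _ _) dot_mode_mode eqxx /bconst; ring.
rewrite intgZl; last by apply: L2_mul; exact: L2_mode.
rewrite -/(dot _ _ _ _) dot_mode_mode ifN ?mulr0// eq_sym.
by apply: contra ji => /eqP/val_inj->.
Qed.

Lemma continuous_wdot_modes al be N : continuous (fun t =>
  wdot rho (fsum (mode al be ^~ t) N) (fsum (mode al be ^~ t) N)).
Proof.
under eq_fun do rewrite wdot_fsum2.
apply: continuousZ => t.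
apply: (@cvg_sumr _ _ _ _ N (fun t m => \sum_(n < N) mode al be m t * mode al be n t * wdot rho (sn m) (sn n)) (fun m => \sum_(n < N) mode al be m t * mode al be n t * wdot rho (sn m) (sn n))) => m.
apply: (@cvg_sumr _ _ _ _ N (fun t n => mode al be m t * mode al be n t * wdot rho (sn m) (sn n)) (fun n => mode al be m t * mode al be n t * wdot rho (sn m) (sn n))) => n.
by apply: cvgMl; apply: cvgM; exact: continuous_mode.
Qed.

(* Duality replaces Fubini: testing against finite sums, where integrals can be
   interchanged, bounds the moments of a distributed source. *)
Lemma bessel_weighted T K a b (phi : R -> R -> R) E N : covers T K ->
  0 <= a -> a <= b -> b <= T ->
  (forall m, wdot rho (sn m) (sn m) <= 1) ->
  (forall t, a <= t <= b -> L2 0 1 (phi t)) ->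
  (forall m, L2 a b (fun t => wdot rho (phi t) (sn m))) ->
  integrable_on a b (fun t => wdot rho (phi t) (phi t)) ->
  intg a b (fun t => wdot rho (phi t) (phi t)) <= E ->
  \sum_(m < N) (dot a b (fun t => wdot rho (phi t) (sn m)) (ct m) ^+ 2 +
                dot a b (fun t => wdot rho (phi t) (sn m)) (st m) ^+ 2) <= bconst K * E.
Proof.
move=> cT a0 ab bT sn1 Lphi Lh iphi phiE; have k0 := bconst_gt0 cT.
pose h m t := wdot rho (phi t) (sn m).
pose al m := dot a b (h m) (ct m); pose be m := dot a b (h m) (st m).
set Q := \sum_(m < N) _.
pose c t m := 2^-1 * mode al be m t.
(* The halves cancel the factor 2 of [fsum], so that pairing [phi] with this sum returns [Q]
   itself. *)
pose al' m := 2^-1 * al m; pose be' m := 2^-1 * be m.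
have cE t m : mode al' be' m t = 2^-1 * mode al be m t by rewrite /mode /al' /be'; ring.
have Qe : Q = intg a b (fun t => wdot rho (phi t) (fsum (mode al' be' ^~ t) N)).
  transitivity (intg a b (fun t => \sum_(m < N) h m t * mode al be m t)).
    rewrite (intg_sum (F := fun m t => h m t * mode al be m t)); last first.
      by move=> i _; apply: L2_mul; [exact: Lh|exact: L2_mode].
    apply: eq_bigr => i _; rewrite -/(dot _ _ _ _) dot_mode ?expr2//; exact: Lh.
  apply: eq_intg => t tab; rewrite wdot_fsumr; last exact: Lphi.
  by rewrite mulr_sumr; apply: eq_bigr => i _; rewrite cE /h; field.
pose W t := wdot rho (fsum (mode al' be' ^~ t) N) (fsum (mode al' be' ^~ t) N).
have cW : continuous W by exact: continuous_wdot_modes.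
have W0 t : 0 <= W t by exact: wdot_ge0.
(* Enlarging to (0, K period) makes the energy of the test sum diagonal; the weighted squared norms
   of the sines are at most 1 by hypothesis. *)
have intW : intg a b W <= bconst K * Q.
  apply: le_trans (_ : intg 0 (K%:R * period) W <= _).
    apply: le_intg_sub => //; last exact: continuous_integrable.
    by case: cT => _ h1; lra.
  rewrite int_wdot_modes mulrAC mulrC ler_pM2l// /Q mulr_sumr.
  apply: ler_sum => i _; rewrite /al' /be' !exprMn -/(h i) -/(al i) -/(be i).
  have -> : 4 * ((2^-1 ^+ 2 * al i ^+ 2 + 2^-1 ^+ 2 * be i ^+ 2) * wdot rho (sn i) (sn i))
     = (al i ^+ 2 + be i ^+ 2) * wdot rho (sn i) (sn i) by field.
  by rewrite ler_piMr ?sn1// addr_ge0// sqr_ge0.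
have iT : integrable_on a b (fun t => wdot rho (phi t) (fsum (mode al' be' ^~ t) N)).
  apply: (@eq_integrable_on _ _ _ (fun t => \sum_(m < N) h m t * mode al be m t)).
    move=> t tab; rewrite wdot_fsumr; last exact: Lphi.
    by rewrite mulr_sumr; apply: eq_bigr => i _; rewrite cE /h; field.
  apply: (integrable_on_sum (F := fun m t => h m t * mode al be m t)) => i _.
  by apply: L2_mul; [exact: Lh|exact: L2_mode].
have : 2 * Q <= intg a b (fun t => bconst K * wdot rho (phi t) (phi t) + (bconst K)^-1 * W t).
  rewrite Qe -intgZl//; apply: le_intg.
  - exact: integrable_onZl.
  - by apply: integrable_onD; apply: integrable_onZl => //; exact: continuous_integrable.
  - move=> t tab; apply: le_trans (wdot_young k0 (Lphi t tab) (L2_fsum 0 1 (mode al' be' ^~ t) N)).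
    by rewrite ler_pM2l// ler_norm.
rewrite intgD ?intgZl//; try exact: continuous_integrable; try by apply: integrable_onZl => //; exact: continuous_integrable.
have h1 : (bconst K)^-1 * intg a b W <= Q by rewrite mulrC ler_pdivrMr// mulrC.
have h2 : bconst K * intg a b (fun t => wdot rho (phi t) (phi t)) <= bconst K * E by rewrite ler_pM2l.
move=> h3; apply: le_trans h2; rewrite -(lerD2r Q) -mulr2n -mulr_natl.
by apply: le_trans h3 _; rewrite lerD2l.
Qed.

End Weights.

(** * Modal equations and homogeneous solutions *)

Section Oscillators.
Context {R : realType}.
Implicit Types (al be : nat -> R) (p M h : R -> R) (m n N : nat) (a b c d t T x : R).

Lemma W21_restrict a b c d u du d2u : a <= c -> c <= d -> d <= b ->
  @W21 R a b u du d2u -> W21 c d u du d2u.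
Proof.
move=> ac cd db [i2 hW]; have cb : c <= b by exact: le_trans db.
have ab : a <= b by exact: le_trans cb.
have [cu cdu] := W21_continuous ab (conj i2 hW).
split; first exact: integrable_on_sub i2.
move=> x /andP[cx xd].
have [ux dux] : u x = u a + intg a x du /\ du x = du a + intg a x d2u.
  by apply: hW; lra.
have [uc duc] : u c = u a + intg a c du /\ du c = du a + intg a c d2u.
  by apply: hW; lra.
have split_ax f : integrable_on a b f -> intg a x f = intg a c f + intg c x f.
  move=> hf; apply: intg_cat; first lra.
  by apply: integrable_on_sub hf; lra.
split; first by rewrite ux uc (split_ax du) ?addrA//; exact: continuous_integrable_on.
by rewrite dux duc (split_ax d2u) ?addrA.
Qed.

(** [ct m] and [st m] solve the free oscillator equation, so in Green's formula the terms in p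
    cancel and the moments of the forcing [h] are pure boundary terms. *)
Lemma oscillator_moments m a b p M h : a <= b ->
  W21 a b p M (fun t => h t - eig m ^+ 2 * p t) -> integrable_on a b h ->
  intg a b (fun t => h t * ct m t) =
    ct m b * M b - ct m a * M a + eig m * (st m b * p b - st m a * p a) /\
  intg a b (fun t => h t * st m t) =
    st m b * M b - st m a * M a - eig m * (ct m b * p b - ct m a * p a).
Proof.
move=> ab hW ih; have [cp cM] := W21_continuous ab hW.
have ip : integrable_on a b p by exact: continuous_integrable_on.
have iprod (w : R -> R) f : continuous w -> integrable_on a b f ->
    integrable_on a b (fun t => f t * w t).
  move=> cw hf; have [C [C0 hC]] := continuous_bounded (@continuous_within _ a b _ cw).
  apply: (@integrable_on_le _ _ _ _ (fun t => `|f t| * C)).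
  - apply: measurable_funM; first exact: integrable_on_measurable.
    by apply: integrable_on_measurable; exact: continuous_integrable.
  - by apply: integrable_onZr; exact: integrable_on_normr.
  - by move=> x xab; rewrite normrM ler_wpM2l// hC.
have key (w dw : R -> R) : (forall x, is_derive x 1 w (dw x)) ->
    (forall x, is_derive x 1 dw (- eig m ^+ 2 * w x)) ->
    intg a b (fun t => h t * w t) = w b * M b - w a * M a - (dw b * p b - dw a * p a).
  move=> h1 h2; have cw := is_derive_continuous h1.
  have c2 : continuous (fun x => - eig m ^+ 2 * w x) by exact: continuousZ.
  have := W21_green ab hW c2 h1 h2.
  have -> : intg a b (fun x => w x * (h x - eig m ^+ 2 * p x)) =
      intg a b (fun x => h x * w x) - eig m ^+ 2 * intg a b (fun x => p x * w x).
    rewrite -intgZl; last exact: iprod.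
    rewrite -intgB; [|exact: iprod|by apply: integrable_onZl; exact: iprod].
    by apply: eq_intg => x _; ring.
  have -> : intg a b (fun x => - eig m ^+ 2 * w x * p x) =
      - (eig m ^+ 2 * intg a b (fun x => p x * w x)).
    rewrite -intgZl; last exact: iprod.
    rewrite -intgN; last by apply: integrable_onZl; exact: iprod.
    by apply: eq_intg => x _; ring.
  by move=> e; lra.
split.
- have h1 x : is_derive x 1 (ct m) (- eig m * st m x) by exact: is_derive_cosM.
  have h2 x : is_derive x 1 (fun x => - eig m * st m x) (- eig m ^+ 2 * ct m x).
    have hs := is_derive_sinM (eig m) x; apply: is_derive_eq.
    by rewrite /GRing.scale/= /ct; ring.
  by rewrite (key _ _ h1 h2); ring.
- have h1 x : is_derive x 1 (st m) (eig m * ct m x) by exact: is_derive_sinM.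
  have h2 x : is_derive x 1 (fun x => eig m * ct m x) (- eig m ^+ 2 * st m x).
    have hs := is_derive_cosM (eig m) x; apply: is_derive_eq.
    by rewrite /GRing.scale/= /st; ring.
  by rewrite (key _ _ h1 h2); ring.
Qed.

Lemma ct2st2 m t : ct m t ^+ 2 + st m t ^+ 2 = 1 :> R.
Proof. exact: cos2Dsin2. Qed.

(** Duhamel's formula backwards from rest at T: the two moment identities on (t,T) form a rotation
    in the unknowns eig p(t), M(t), inverted with cos^2 + sin^2 = 1. *)
Lemma oscillator_final m T p M h t : 0 <= t <= T ->
  W21 0 T p M (fun t => h t - eig m ^+ 2 * p t) -> integrable_on 0 T h ->
  p T = 0 -> M T = 0 ->
  eig m * p t = ct m t * intg t T (fun s => h s * st m s)
              - st m t * intg t T (fun s => h s * ct m s).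
Proof.
move=> /andP[t0 tT] hW ih pT MT.
have hW' := W21_restrict t0 tT (lexx T) hW.
have ih' : integrable_on t T h by exact: integrable_on_sub ih.
have [-> ->] := oscillator_moments tT hW' ih'.
rewrite pT MT !mulr0 !sub0r.
rewrite -[LHS]mulr1 -(ct2st2 m t); ring.
Qed.

Lemma oscillator_free m T p M t : 0 <= t <= T ->
  W21 0 T p M (fun t => - (eig m ^+ 2 * p t)) ->
  p t = p 0 * ct m t + M 0 / eig m * st m t.
Proof.
move=> /andP[t0 tT] hW; have e0 : eig m != 0 :> R by rewrite gt_eqF// eig_gt0.
have hW' : W21 0 t p M (fun t => 0 - eig m ^+ 2 * p t).
  have := W21_restrict (lexx 0) t0 tT hW; congr W21; apply/funext => s.
  by rewrite sub0r.
have [h1 h2] := oscillator_moments t0 hW' (integrable_on_cst 0 t 0).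
have z (w : R -> R) : intg 0 t (fun s => 0 * w s) = 0.
  by apply: etrans (intg0 0 t); apply: eq_intg => s _; rewrite mul0r.
have c0 : ct m 0 = 1 :> R by rewrite /ct mulr0 cos0.
have s0 : st m 0 = 0 :> R by rewrite /st mulr0 sin0.
rewrite z c0 s0 in h1; rewrite z c0 s0 in h2.
apply: (mulfI e0); rewrite -[LHS]mulr1 -(ct2st2 m t).
have -> : eig m * (p 0 * ct m t + M 0 / eig m * st m t) =
  eig m * p 0 * ct m t + M 0 * st m t by field.
have h1' : eig m * (st m t * p t) = M 0 - ct m t * M t by lra.
have h2' : eig m * (ct m t * p t) = st m t * M t + eig m * p 0 by lra.
have -> : eig m * p t * (ct m t ^+ 2 + st m t ^+ 2) =
    ct m t * (eig m * (ct m t * p t)) + st m t * (eig m * (st m t * p t)) by ring.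
by rewrite h1' h2'; ring.
Qed.

Lemma derive1_sinM k : derive1 (fun x : R => sin (k * x)) = (fun x => k * cos (k * x)).
Proof.
by apply/funext => x; rewrite derive1E; have [_ ->] := is_derive_sinM k x.
Qed.

Lemma derive1_scale k (f df : R -> R) : (forall x, is_derive x 1 f (df x)) ->
  derive1 (fun x => k * f x) = (fun x => k * df x).
Proof.
move=> hf; apply/funext => x; rewrite derive1E.
have h := hf x; have -> : (fun x => k * f x) = k *: f by [].
by have [_ ->] : is_derive x 1 (k *: f) (k *: df x) by exact: is_deriveZ.
Qed.

Lemma derive1n_sn m : [/\ derive1n 1 (@sn R m) = (fun x => freq m * cn m x),
  derive1n 2 (@sn R m) = (fun x => - eig m * sn m x),
  derive1n 3 (@sn R m) = (fun x => - eig m * (freq m * cn m x)) &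
  derive1n 4 (@sn R m) = (fun x => eig m ^+ 2 * sn m x)].
Proof.
have e1 : derive1n 1 (@sn R m) = (fun x => freq m * cn m x).
  by rewrite derive1nS derive1n0 derive1_sinM.
have e2 : derive1n 2 (@sn R m) = (fun x => - eig m * sn m x).
  rewrite derive1nS e1 (derive1_scale _ (is_derive_cosM (freq m))).
  by apply/funext => x; rewrite /eig /sn; ring.
have e3 : derive1n 3 (@sn R m) = (fun x => - eig m * (freq m * cn m x)).
  by rewrite derive1nS e2 (derive1_scale _ (is_derive_sinM (freq m))).
split=> //.
rewrite derive1nS e3.
rewrite (_ : (fun x => - eig m * (freq m * cn m x)) = (fun x => (- eig m * freq m) * cn m x)); last first.
  by apply/funext => x; ring.
rewrite (derive1_scale _ (is_derive_cosM (freq m))).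
by apply/funext => x; rewrite /eig /sn; ring.
Qed.

Lemma cn_at1 m : cn m 1 = 0 :> R.
Proof.
have -> : cn m 1 = cos (m%:R * pi + pi / 2) :> R by congr cos; rewrite freqE; field.
by rewrite cosDpihalf sin_natpi oppr0.
Qed.

Lemma beam_test_sn m : beam_test (@sn R m).
Proof.
have [e1 e2 e3 e4] := derive1n_sn m.
have s0 : sn m 0 = 0 :> R by rewrite /sn mulr0 sin0.
have ds x := is_derive_sinM (freq m) x; have dc x := is_derive_cosM (freq m) x.
split.
- have d1 x : derivable (fun x => freq m * cn m x) x 1.
    by have [] : is_derive x 1 (freq m *: (fun x => cn m x)) (freq m *: (- freq m * sin (freq m * x))) by exact: is_deriveZ.
  have d2 x : derivable (fun x => - eig m * sn m x) x 1.
    by have [] : is_derive x 1 (- eig m *: (fun x => sn m x)) (- eig m *: (freq m * cos (freq m * x))) by exact: is_deriveZ.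
  have d3 x : derivable (fun x => - eig m * (freq m * cn m x)) x 1.
    exact: derivableZ.
  move=> k x; case: k => [_|[_|[_|[_|//]]]]; rewrite ?derive1n0 ?e1 ?e2 ?e3 //.
- by rewrite e4; exact/continuousZ/continuous_sn.
- exact: s0.
- by rewrite e1 cn_at1 mulr0.
- by rewrite e2 e3 s0 cn_at1 !mulr0.
Qed.

(** Each sine satisfies the four boundary conditions, so it is an admissible test function and the
    weak equation becomes a scalar oscillator. The velocity [M] remains existential at this
    stage. *)
Lemma beam_weak_coef T f u m : @beam_weak R T f u -> (forall t, 0 <= t <= T -> L2 0 1 (u t)) ->
  exists M, W21 0 T (fun t => coef (u t) m) M
    (fun t => f t (sn m) - eig m ^+ 2 * coef (u t) m).
Proof.
move=> hu Lu; have [M [iM hM]] := hu _ (beam_test_sn m).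
have [_ _ _ e4] := derive1n_sn m.
have e t : 0 <= t <= T -> f t (sn m) - ip (u t) (derive1n 4 (sn m)) =
    f t (sn m) - eig m ^+ 2 * coef (u t) m.
  move=> tT; rewrite e4; congr (_ - _); rewrite -dotZr//; last exact: L2_sn.
  exact: Lu.
exists M; split; first exact: eq_integrable_on e iM.
move=> t tT; have [h1 h2] := hM t tT; split=> //; rewrite h2; congr (_ + _).
by apply: eq_intg => s s0t; apply: e; lra.
Qed.

Lemma mode_sqr_le al be m t : mode al be m t ^+ 2 <= al m ^+ 2 + be m ^+ 2.
Proof.
rewrite -[leRHS]mulr1 -(ct2st2 m t) /mode.
have := sqr_ge0 (al m * st m t - be m * ct m t); lra.
Qed.

(** [eig m * (2 / pi)] is pi/2 plus an even multiple of pi, because 2m(m+1) is even: at this instant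
    all modes are simultaneously a quarter of a turn ahead. *)
Lemma trig_at_quarter m : ct m (2 / pi) = 0 :> R /\ st m (2 / pi) = 1 :> R.
Proof.
have e : eig m * (2 / pi) = (2 * (m * m.+1))%:R * pi + pi / 2 :> R.
  have pi0 : pi != 0 :> R by rewrite gt_eqF// pi_gt0.
  rewrite eigE [(2 * _)%:R]natrM; move: (m * m.+1)%:R => r; move: (pi : R) pi0 => q q0.
  by field.
rewrite /ct /st e cosDpihalf sinDpihalf sin_natpi cos_natpi oppr0.
by rewrite exprM -signr_odd/= expr0 expr1n.
Qed.

(** A homogeneous solution comes without information on its velocity. The sine amplitudes are square
    summable because they are the coefficients of the L^2 state at time 2/pi, an instant that
    [2 <= T] places inside [0,T]. *)
Theorem hom_modes T (phi : R -> R -> R) : 2 <= T -> hom_solution T phi ->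
  exists al be, [/\ ell2 al, ell2 be &
    forall t m, 0 <= t <= T -> coef (phi t) m = mode al be m t].
Proof.
move=> T2 [[Lphi _] wphi].
have /choice[M hM] m := beam_weak_coef m wphi Lphi.
pose al m := coef (phi 0) m; pose be m := M m 0 / eig m.
have e t m : 0 <= t <= T -> coef (phi t) m = mode al be m t.
  move=> tT; apply: (@oscillator_free m T (fun t => coef (phi t) m) (M m) t tT).
  have := hM m; congr W21; apply/funext => s; by rewrite sub0r.
have p0 := pi_gt0 R.
have q1 : 0 <= 2 / (pi : R) <= T.
  have h : 2 / (pi : R) <= 2 by rewrite ler_pdivrMr//; have := pi_ge2 R; lra.
  by rewrite divr_ge0 ?(ltW p0)//= (le_trans h).
exists al, be; split=> //.
- by apply: coef_ell2; apply: Lphi; lra.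
- have -> : be = coef (phi (2 / pi)); last by apply: coef_ell2; exact: Lphi.
  apply/funext => m; rewrite e// /mode; have [-> ->] := trig_at_quarter m.
  by rewrite mulr0 add0r mulr1.
Qed.

End Oscillators.

(** * Uniform convergence of modal sums and energy estimates *)

Section UniformLimits.
Context {R : realType}.
Implicit Types (a b e : R) (f : R -> R) (F : nat -> R -> R).

Definition unif_cvg a b F f := forall e, 0 < e -> \forall n \near \oo,
  forall x, a <= x <= b -> `|F n x - f x| <= e.

Lemma unif_cvg_L2 a b F f : a <= b -> (forall n, continuous (F n)) ->
  unif_cvg a b F f ->
  [/\ L2 a b f, intg a b (F n) @[n --> \oo] --> intg a b f &
   dot a b (fun x => F n x - f x) (fun x => F n x - f x) @[n --> \oo] --> 0].
Proof.
move=> ab cF Ff.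
have iF n : integrable_on a b (F n) by exact: continuous_integrable.
have [intf intFf] := uniform_intg ab iF Ff.
have Lf : L2 a b f.
  have [N _ hN] := Ff 1 ltr01.
  have [C [C0 hC]] := continuous_bounded (@continuous_within _ a b _ (cF N)).
  have : L2 a b (fun x => f x * 1).
    apply: (@L2_bounded_mul _ _ _ _ _ (C + 1)); last exact: L2_cst.
      exact: integrable_on_measurable.
    move=> x xab; have := hN N (leqnn N) x xab; have := hC x xab.
    have := ler_normB (F N x) (F N x - f x).
    by rewrite [X in `|X| <= _](_ : _ = f x); [lra|ring].
  by apply: eq_L2 => x _; rewrite mulr1.
split=> //; apply/cvgrPdist_le => e e0.
have e1 : 0 < e / (b - a + 1) by rewrite divr_gt0// ltr_wpDl// subr_ge0.
have s0 : 0 < Num.sqrt (e / (b - a + 1)) by rewrite sqrtr_gt0.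
apply: filterS (Ff _ s0) => n hn.
have LF : L2 a b (fun x => F n x - f x) by apply: L2B => //; exact: continuous_L2.
rewrite sub0r normrN ger0_norm ?dot_ge0//.
apply: le_trans (_ : intg a b (fun=> e / (b - a + 1)) <= _).
  apply: le_intg; [exact: L2_mul|exact: integrable_on_cst|move=> x xab].
  rewrite -expr2 -(sqr_sqrtr (ltW e1)) -[leLHS]real_normK ?num_real//.
  by rewrite lerXn2r ?nnegrE ?(ltW s0)// hn.
rewrite intg_cst// mulrAC ler_pdivrMr ?ltr_wpDl ?subr_ge0//.
by rewrite ler_pM2l// lerDl.
Qed.

End UniformLimits.

Section ModalFamilies.
Context {R : realType}.
Implicit Types (f g : R -> R) (m n N : nat) (t x e : R).
Variables (T : R) (phi : R -> R -> R) (al be : nat -> R).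
Hypotheses (T0 : 0 <= T) (lal : ell2 al) (lbe : ell2 be).
Hypothesis Lphi : forall t, 0 <= t <= T -> L2 0 1 (phi t).
Hypothesis cphi : forall t m, 0 <= t <= T -> coef (phi t) m = mode al be m t.

Local Notation phiN N t := (fsum (mode al be ^~ t) N).

Lemma sum_diff_le (u w : nat -> R) N N' : (forall m, u m <= w m) -> (N <= N')%N ->
  \sum_(m < N') u m - \sum_(m < N) u m <= \sum_(m < N') w m - \sum_(m < N) w m.
Proof.
move=> uw; elim: N' => [|N' ih]; first by rewrite leqn0 => /eqP->; rewrite !subrr.
rewrite leq_eqVlt => /predU1P[->|]; first by rewrite !subrr.
by rewrite ltnS => /ih; rewrite !big_ord_recr/=; have := uw N'; lra.
Qed.

(** The squared coefficients at time t are at most [al m ^+ 2 + be m ^+ 2], independent of t, so the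
    truncation error is uniform on [0,T]. *)
Lemma modal_tail e : 0 < e -> exists N0, forall N, (N0 <= N)%N ->
  forall t, 0 <= t <= T ->
  dot 0 1 (fun x => phi t x - phiN N t x) (fun x => phi t x - phiN N t x) <= e.
Proof.
move=> e0; have e4 : 0 < e / 4 by rewrite divr_gt0.
have [N1 h1] := ell2_tail lal e4; have [N2 h2] := ell2_tail lbe e4.
exists (maxn N1 N2) => N; rewrite geq_max => /andP[n1 n2] t tT.
have Lt := Lphi tT.
have -> : phiN N t = fsum (coef (phi t)) N.
  by apply/funext => x; apply: eq_bigr => i _; rewrite cphi.
rewrite dot_sub_fsum//.
have cv : 2 * (\sum_(m < N' + N) coef (phi t) m ^+ 2) - 2 * \sum_(m < N) coef (phi t) m ^+ 2
    @[N' --> \oo] --> dot 0 1 (phi t) (phi t) - 2 * \sum_(m < N) coef (phi t) m ^+ 2.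
  apply: cvgB; last exact: (@cvg_cst R^o).
  by have := parseval Lt; rewrite -(cvg_shiftn N).
apply: cvgn_le cv _ => N'; have NN : (N <= N' + N)%N by rewrite leq_addl.
have le_mode m : coef (phi t) m ^+ 2 <= al m ^+ 2 + be m ^+ 2.
  by rewrite cphi// mode_sqr_le.
have := sum_diff_le le_mode NN.
have := h1 N (N' + N)%N n1 NN; have := h2 N (N' + N)%N n2 NN.
rewrite !big_split/=; lra.
Qed.

Section Weighted.
Variables (rho : R -> R) (M : R) (hrho : weight rho M).

Let M0 : 0 <= M.
Proof.
by case: hrho => _ /(_ 0 _)/andP[]; [rewrite lexx ler01|exact: le_trans].
Qed.

Lemma wdot_sqr_le f g : L2 0 1 f -> L2 0 1 g ->
  wdot rho f g ^+ 2 <= M ^+ 2 * (dot 0 1 f f * dot 0 1 g g).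
Proof.
move=> Lf Lg; apply: le_trans (CauchySchwarz (L2_weight hrho Lf) Lg) _.
rewrite mulrA ler_wpM2r ?dot_ge0// -intgZl; last exact: L2_mul.
apply: le_intg.
- by apply: L2_mul; exact: (L2_weight hrho Lf).
- by apply: integrable_onZl; exact: L2_mul.
- move=> x x01; have [_ /(_ x x01)/andP[r0 rM]] := hrho.
  have -> : rho x * f x * (rho x * f x) = rho x ^+ 2 * f x ^+ 2 by ring.
  by rewrite -[f x * f x]expr2 ler_wpM2r ?sqr_ge0// lerXn2r ?nnegrE.
Qed.

(** This is how functions of time such as [wdot rho (phi t) f] become measurable and square
    integrable: they are uniform limits of continuous ones, with no joint measurability of [phi]. *)
Lemma wdot_modal_unif f : L2 0 1 f ->
  unif_cvg 0 T (fun N t => wdot rho (phiN N t) f) (fun t => wdot rho (phi t) f).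
Proof.
move=> Lf e e0.
pose C := M ^+ 2 * dot 0 1 f f + 1.
have C0 : 0 < C by rewrite ltr_wpDl// mulr_ge0 ?sqr_ge0 ?dot_ge0.
have e1 : 0 < e ^+ 2 / C by rewrite divr_gt0// exprn_gt0.
have [N0 hN0] := modal_tail e1; exists N0 => // N /= NN t tT.
rewrite distrC -(wdotBl hrho)//; [|exact: Lphi|exact: L2_fsum].
have Ld : L2 0 1 (fun x => phi t x - phiN N t x).
  by apply: L2B; [exact: Lphi|exact: L2_fsum].
apply: ler_sqr_norm; first exact: ltW.
apply: le_trans (wdot_sqr_le Ld Lf) _.
set d := dot 0 1 _ _; have hd : d <= e ^+ 2 / C by exact: hN0.
have -> : M ^+ 2 * (d * dot 0 1 f f) = d * (C - 1) by rewrite /C; ring.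
apply: le_trans (_ : d * C <= _); last by rewrite -ler_pdivlMr.
by rewrite ler_wpM2l ?dot_ge0//; lra.
Qed.

Lemma continuous_wdot_modal f N : L2 0 1 f ->
  continuous (fun t => wdot rho (phiN N t) f).
Proof.
move=> Lf.
have -> : (fun t => wdot rho (phiN N t) f) =
    (fun t => 2 * \sum_(m < N) mode al be m t * wdot rho f (sn m)).
  by apply/funext => t; rewrite wdotC (wdot_fsumr hrho).
apply: continuousZ => t.
apply: (@cvg_sumr _ _ _ _ N (fun t m => mode al be m t * wdot rho f (sn m)) (fun m => mode al be m t * wdot rho f (sn m))) => m.
by apply: cvgMl; exact: continuous_mode.
Qed.

Lemma wdot_modal_L2 f : L2 0 1 f -> L2 0 T (fun t => wdot rho (phi t) f).
Proof.
move=> Lf; have [] // := @unif_cvg_L2 _ 0 T (fun N t => wdot rho (phiN N t) f)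
  (fun t => wdot rho (phi t) f) T0.
  by move=> n; exact: continuous_wdot_modal.
exact: wdot_modal_unif.
Qed.

(** Two truncations are needed: with both factors truncated the time integral is diagonal, which
    gives the lower bound; with one factor truncated it is linear in the moments of [phi], which
    gives the upper bound. *)
Lemma energy_modal_unif :
  unif_cvg 0 T (fun N t => wdot rho (phiN N t) (phiN N t)) (fun t => wdot rho (phi t) (phi t)) /\
  unif_cvg 0 T (fun N t => wdot rho (phi t) (phiN N t)) (fun t => wdot rho (phi t) (phi t)).
Proof.
have [A hA] := lal; have [B hB] := lbe.
pose D := 2 * (A + B).
have hD t : 0 <= t <= T -> dot 0 1 (phi t) (phi t) <= D.
  move=> tT; apply: dot_le_coef; first exact: Lphi.
  move=> N; apply: le_trans (lerD (hA N) (hB N)); rewrite -big_split/=.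
  by apply: ler_sum => i _; rewrite cphi// mode_sqr_le.
have hDN t N : 0 <= t <= T -> dot 0 1 (phiN N t) (phiN N t) <= D.
  move=> tT; rewrite dot_fsum_fsum// /D ler_pM2l//.
  apply: le_trans (lerD (hA N) (hB N)); rewrite -big_split/=.
  by apply: ler_sum => i _; rewrite -expr2 mode_sqr_le.
have D0 : 0 <= D by apply: le_trans (dot_ge0 _ _ _) (hD 0 _); rewrite lexx.
pose C := M ^+ 2 * D + 1.
have C0 : 0 < C by rewrite ltr_wpDl// mulr_ge0 ?sqr_ge0.
have key t g N e : 0 < e -> 0 <= t <= T -> L2 0 1 g -> dot 0 1 g g <= D ->
    dot 0 1 (fun x => phi t x - phiN N t x) (fun x => phi t x - phiN N t x) <= e ^+ 2 / C ->
    `|wdot rho (fun x => phi t x - phiN N t x) g| <= e.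
  move=> e0 tT Lg gD hd.
  have Ld : L2 0 1 (fun x => phi t x - phiN N t x).
    by apply: L2B; [exact: Lphi|exact: L2_fsum].
  apply: ler_sqr_norm; first exact: ltW.
  apply: le_trans (wdot_sqr_le Ld Lg) _.
  move: hd (dot_ge0 0 1 (fun x => phi t x - phiN N t x)); set d := dot 0 1 (fun x => _) _.
  move=> hd d0; apply: le_trans (_ : d * C <= _); last by rewrite -ler_pdivlMr.
  have -> : M ^+ 2 * (d * dot 0 1 g g) = d * (M ^+ 2 * dot 0 1 g g) by ring.
  by rewrite ler_wpM2l// /C ler_wpDr// ler_wpM2l ?sqr_ge0.
split=> e e0.
- have e2 : 0 < e / 2 by rewrite divr_gt0.
  have e1 : 0 < (e / 2) ^+ 2 / C by rewrite divr_gt0// exprn_gt0.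
  have [N0 hN0] := modal_tail e1; exists N0 => // N /= NN t tT.
  have Lt := Lphi tT; have LN := L2_fsum 0 1 (mode al be ^~ t) N.
  have -> : wdot rho (phiN N t) (phiN N t) - wdot rho (phi t) (phi t) =
     - (wdot rho (fun x => phi t x - phiN N t x) (phi t) +
        wdot rho (fun x => phi t x - phiN N t x) (phiN N t)).
    by rewrite !(wdotBl hrho)// (wdotC rho (phi t) (phiN N t)); ring.
  rewrite normrN; apply: le_trans (ler_normD _ _) _.
  rewrite [leRHS](splitr e); apply: lerD.
    exact: (key t _ N _ e2 tT Lt (hD t tT) (hN0 N NN t tT)).
  exact: (key t _ N _ e2 tT LN (hDN t N tT) (hN0 N NN t tT)).
- have e1 : 0 < e ^+ 2 / C by rewrite divr_gt0// exprn_gt0.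
  have [N0 hN0] := modal_tail e1; exists N0 => // N /= NN t tT.
  have Lt := Lphi tT; have LN := L2_fsum 0 1 (mode al be ^~ t) N.
  rewrite distrC [X in _ - X]wdotC -(wdotBl hrho)//.
  by apply: key => //; [exact: hD|exact: hN0].
Qed.

Lemma energy_modal_integrable : integrable_on 0 T (fun t => wdot rho (phi t) (phi t)).
Proof.
have [h _] := energy_modal_unif.
have [|Lf _ _] := @unif_cvg_L2 _ 0 T _ _ T0 _ h; last exact: L2_integrable.
by move=> n; exact: continuous_wdot_modes hrho _ _ _.
Qed.

(** The observability inequality. On (0, period) the truncated energies are exactly diagonal and
    increase with the truncation; [2 * period] is [4 * bconst 1]. *)
Lemma energy_lower N : period <= T ->
  2 * period * \sum_(m < N) (al m ^+ 2 + be m ^+ 2) * wdot rho (sn m) (sn m) <=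
  intg 0 T (fun t => wdot rho (phi t) (phi t)).
Proof.
move=> pT; have p0 : 0 <= period :> R by rewrite ltW// period_gt0.
apply: le_trans (_ : intg 0 period (fun t => wdot rho (phi t) (phi t)) <= _); last first.
  apply: le_intg_sub => //; first exact: energy_modal_integrable.
  by move=> t _; exact: wdot_ge0 hrho _.
have [h _] := energy_modal_unif.
have h' : unif_cvg 0 period (fun N t => wdot rho (phiN N t) (phiN N t)) (fun t => wdot rho (phi t) (phi t)).
  by move=> e e0; apply: filterS (h e e0) => n hn t tp; apply: hn; lra.
have [|_ cv _] := @unif_cvg_L2 _ 0 period _ _ p0 _ h'.
  by move=> n; exact: continuous_wdot_modes hrho _ _ _.
move: cv; rewrite -(cvg_shiftn N) => cv; apply: cvgn_ge cv _ => N'.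
have := int_wdot_modes hrho 1 al be (N' + N); rewrite mul1r => ->.
have -> : 4 * bconst 1 = 2 * period :> R by rewrite /bconst; field.
rewrite ler_pM2l; last by rewrite mulr_gt0// period_gt0.
rewrite addnC big_split_ord/= lerDl; apply: sumr_ge0 => i _.
by rewrite mulr_ge0 ?addr_ge0 ?sqr_ge0// (wdot_ge0 hrho).
Qed.

(** The energy is the limit of the pairings of [phi] with its own truncations, and those are finite
    combinations of the moments prescribed by the control problem. *)
Lemma energy_upper B :
  (forall N, 2 * \sum_(m < N) (al m * dot 0 T (fun t => wdot rho (phi t) (sn m)) (ct m) +
     be m * dot 0 T (fun t => wdot rho (phi t) (sn m)) (st m)) <= B) ->
  intg 0 T (fun t => wdot rho (phi t) (phi t)) <= B.
Proof.
move=> hB; have [_ h] := energy_modal_unif.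
have eN N t : 0 <= t <= T -> wdot rho (phi t) (phiN N t) =
    2 * \sum_(m < N) wdot rho (phi t) (sn m) * mode al be m t.
  move=> tT; rewrite (wdot_fsumr hrho); last exact: Lphi.
  by congr (2 * _); apply: eq_bigr => i _; rewrite mulrC.
have Lh m := wdot_modal_L2 (L2_sn 0 1 m).
have iprod m : integrable_on 0 T (fun t => wdot rho (phi t) (sn m) * mode al be m t).
  by apply: L2_mul; [exact: Lh|exact: L2_mode].
have iN N : integrable_on 0 T (fun t => wdot rho (phi t) (phiN N t)).
  apply: (@eq_integrable_on _ _ _ (fun t => 2 * \sum_(m < N) wdot rho (phi t) (sn m) * mode al be m t)).
    by move=> t tT; rewrite eN.
  apply: integrable_onZl.
  by apply: (integrable_on_sum (F := fun m t => wdot rho (phi t) (sn m) * mode al be m t)).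
have [_ cv] := uniform_intg T0 iN h.
apply: cvgn_le cv _ => N; apply: le_trans (hB N); rewrite le_eqVlt; apply/orP; left; apply/eqP.
have -> : intg 0 T (fun t => wdot rho (phi t) (phiN N t)) =
    intg 0 T (fun t => 2 * \sum_(m < N) wdot rho (phi t) (sn m) * mode al be m t).
  by apply: eq_intg => t tT; rewrite eN.
rewrite intgZl; last by apply: (integrable_on_sum (F := fun m t => wdot rho (phi t) (sn m) * mode al be m t)).
rewrite (intg_sum (F := fun m t => wdot rho (phi t) (sn m) * mode al be m t))//.
by congr (2 * _); apply: eq_bigr => i _; rewrite -/(dot _ _ _ _) dot_mode//; exact: Lh.
Qed.

End Weighted.
End ModalFamilies.

(** * Averages of sines, in general and over the window *)

Section SineAverages.
Context {R : realType}.
Implicit Types (a x t : R).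

Lemma sin_le_id x : 0 <= x -> sin x <= x.
Proof.
move=> x0; have := int_cos x0 (oner_neq0 R).
rewrite mul1r divr1 => <-; rewrite -[leRHS]subr0 -[leRHS]mul1r -intg_cst//.
apply: le_intg; [exact/continuous_integrable/continuous_cosM|exact: integrable_on_cst|].
by move=> y _; rewrite cos_le1.
Qed.

Lemma norm_sin_le x : `|sin x| <= `|x|.
Proof.
wlog x0 : x / 0 <= x.
  move=> h; have [/h//|/ltW x0] := leP 0 x.
  by rewrite -normrN -sinN -[leRHS]normrN h// oppr_ge0.
have [x1|x1] := leP 1 x.
  by rewrite [leRHS]ger0_norm// (le_trans _ x1)// ler_norml sin_le1 sin_geN1.
rewrite !ger0_norm ?sin_le_id// sin_ge0_pi// x0/=.
by have := pi_ge2 R; lra.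
Qed.

Lemma onem_cos_le x : 1 - cos x <= x ^+ 2 / 2.
Proof.
have -> : x = (x / 2) *+ 2 by rewrite mulr2n; field.
rewrite cos_mulr2n cos2sin2 mulr2n.
have := norm_sin_le (x / 2); rewrite -(@ler_pXn2r _ 2) ?nnegrE// !real_normK ?num_real//.
by rewrite !expr2; lra.
Qed.

Lemma sub_sin_le x : 0 <= x -> x - sin x <= x ^+ 3 / 2.
Proof.
move=> x0; have := int_cos x0 (oner_neq0 R); rewrite mul1r divr1 => <-.
have -> : x - intg 0 x (fun t => cos (1 * t)) = intg 0 x (fun t => 1 - cos (1 * t)).
  rewrite intgB; [|exact: integrable_on_cst|exact/continuous_integrable/continuous_cosM].
  by rewrite intg_cst// mul1r subr0.
apply: le_trans (ler_norm _) _.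
have -> : x ^+ 3 / 2 = x ^+ 2 / 2 * (x - 0) by rewrite exprSr; field.
apply: ler_norm_intg_cst => //.
  by apply: integrable_onB; [exact: integrable_on_cst|exact/continuous_integrable/continuous_cosM].
move=> y /andP[y0 yx]; rewrite mul1r ger0_norm ?subr_ge0 ?cos_le1//.
by apply: le_trans (onem_cos_le y) _; rewrite ler_pM2r// lerXn2r ?nnegrE.
Qed.

(** For t > 0 these two functions are the averages of sin^2 and of sin over [a, a + t]. *)
Definition mean_sin2 a t : R := 2^-1 - cos (2 * a + t) * sin t / (2 * t).
Definition mean_sin a t : R := (cos a - cos (a + t)) / t.

Let sigma t : R := sin t / t.

(** Relative to the midpoint, the mean of sin^2 mixes 1/2 and its midpoint value with weights 1 -
    sigma and sigma. The weight sigma = sin t / t is near 1 on short intervals and small on long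
    ones. *)
Let mean_sin2E a t : t != 0 ->
  mean_sin2 a t = (1 - sigma t) / 2 + sigma t * sin (a + t / 2) ^+ 2.
Proof.
move=> t0; rewrite /mean_sin2 /sigma.
have -> : 2 * a + t = (a + t / 2) *+ 2 by rewrite mulr2n; field.
by rewrite cos_mulr2n cos2sin2 mulr2n; field.
Qed.

Let sigma_ge t : 0 < t -> - 2^-1 <= sigma t.
Proof.
move=> t0; rewrite /sigma ler_pdivlMr//.
have [t2|t2] := leP 2 t; first by have := sin_geN1 t; lra.
have : 0 <= sin t by rewrite sin_ge0_pi// ltW//=; have := pi_ge2 R; lra.
lra.
Qed.

(** The bound is cos(t/2): sin t = 2 sin(t/2) cos(t/2) and sin(t/2) <= t/2. Written with sin(t/4) it
    gives (1 - sigma)/2 >= sin(t/4)^2. *)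
Let sigma_le t : 0 < t -> sigma t <= 1 - 2 * sin (t / 4) ^+ 2 \/ 2 <= t.
Proof.
move=> t0; have [t2|t2] := leP 2 t; [by right|left].
have -> : 1 - 2 * sin (t / 4) ^+ 2 = cos (t / 2).
  have -> : t / 2 = (t / 4) *+ 2 by rewrite mulr2n; field.
  by rewrite cos_mulr2n cos2sin2 mulr2n; ring.
rewrite /sigma ler_pdivrMr//.
have -> : sin t = sin (t / 2) * cos (t / 2) * 2.
  have {1}-> : t = (t / 2) *+ 2 by rewrite mulr2n; field.
  by rewrite sin_mulr2n mulr2n; ring.
have t20 : 0 <= t / 2 by lra.
have c0 : 0 <= cos (t / 2).
  by apply: cos_ge0_pihalf; have := pi_ge2 R; lra.
have := sin_le_id t20; nra.
Qed.

Let sin2_le1 x : 0 <= sin x ^+ 2 <= 1.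
Proof. by rewrite sqr_ge0 sin2cos2 gerBl sqr_ge0. Qed.

Let mean_ge_far a t : 0 < t -> 2 <= t -> 4^-1 <= mean_sin2 a t.
Proof.
move=> t0 t2; rewrite mean_sin2E ?gt_eqF//.
have := sigma_ge t0; have : sigma t <= 2^-1.
  by rewrite /sigma ler_pdivrMr//; have := sin_le1 t; lra.
have := sin2_le1 (a + t / 2); nra.
Qed.

(** For t >= 2 the mean is at least 1/4. Otherwise, with A = sin^2 at the midpoint and B =
    sin(t/4)^2, sin(a)^2 <= 2A + 8B while 8 times the mean is at least 8B + 8 sigma A; this suffices
    if sigma >= 1/4, and if sigma < 1/4 the mean is at least 1/4. No smallness of t is needed, hence
    uniformity in the mode. *)
Lemma sin2_le_mean a t : 0 < t -> sin a ^+ 2 <= 8 * mean_sin2 a t.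
Proof.
move=> t0; have /andP[_ a1] := sin2_le1 a.
have [h|t2] := sigma_le t0; last by have := mean_ge_far a t0 t2; lra.
have [A0 A1] := andP (sin2_le1 (a + t / 2)).
rewrite mean_sin2E ?gt_eqF//.
have h1 : sin a ^+ 2 <= 2 * sin (a + t / 2) ^+ 2 + 2 * sin (t / 2) ^+ 2.
  have {1}-> : a = (a + t / 2) - t / 2 by ring.
  rewrite sinB.
  have := cos2Dsin2 (a + t / 2); have := cos2Dsin2 (t / 2).
  set c := cos (a + t / 2); set s := sin (a + t / 2); set c' := cos (t / 2); set s' := sin (t / 2).
  move=> e1 e2; have := sqr_ge0 (s * c' + c * s').
  have : s ^+ 2 * c' ^+ 2 <= s ^+ 2 by rewrite ler_piMr ?sqr_ge0//; have := sqr_ge0 s'; lra.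
  have : c ^+ 2 * s' ^+ 2 <= s' ^+ 2 by rewrite ler_piMl ?sqr_ge0//; have := sqr_ge0 s; lra.
  by rewrite !expr2; lra.
have h2 : sin (t / 2) ^+ 2 <= 4 * sin (t / 4) ^+ 2.
  have -> : t / 2 = (t / 4) *+ 2 by rewrite mulr2n; field.
  rewrite sin_mulr2n mulr2n.
  have : (cos (t / 4) * sin (t / 4)) ^+ 2 <= sin (t / 4) ^+ 2.
    by rewrite exprMn ler_piMl ?sqr_ge0//.
  move: (cos (t / 4)) (sin (t / 4)) => c s h3.
  have -> : (c * s + c * s) ^+ 2 = 4 * (c * s) ^+ 2 by ring.
  lra.
have := sigma_ge t0.
have [s4|s4] := leP 4^-1 (sigma t); first by nra.
by move=> h3; nra.
Qed.

(** For t < 2 the Taylor remainder is at most (3/4) t^2 and the mean of sin^2 at least t^2/64, and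
    36/64 = (3/4)^2 fixes the constant. For t >= 2 the left side is at most (3t/2)^2 and the mean at
    least 1/4. *)
Lemma mean_sin_remainder a t : 0 < t ->
  (sin a + t / 2 * cos a - mean_sin a t) ^+ 2 <= 36 * t ^+ 2 * mean_sin2 a t.
Proof.
move=> t0; have t00 : t != 0 by rewrite gt_eqF.
have sa := sin_le1 a; have sa' := sin_geN1 a.
have ca := cos_le1 a; have ca' := cos_geN1 a.
have sqb (r b : R) : - b <= r <= b -> r ^+ 2 <= b ^+ 2.
  move=> rb; rewrite -subr_ge0 subr_sqr mulr_ge0//; lra.
have [t2|t2] := leP 2 t.
  have hm := mean_ge_far a t0 t2.
  apply: le_trans (_ : (3 / 2 * t) ^+ 2 <= _); last first.
    have tt : 0 < t ^+ 2 by rewrite exprn_gt0.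
    by rewrite exprMn; nra.
  apply: sqb.
  have hq : - 1 <= mean_sin a t <= 1.
    rewrite /mean_sin ler_pdivlMr// ler_pdivrMr//.
    have := cos_le1 (a + t); have := cos_geN1 (a + t); lra.
  have : - (t / 2) <= t / 2 * cos a <= t / 2 by nra.
  lra.
have s3 := sub_sin_le (ltW t0).
have t20 : 0 <= t / 2 by lra.
have t40 : 0 <= t / 4 by lra.
have s3' := sub_sin_le t20; have s0' := sin_le_id t20; have s0 := sin_le_id (ltW t0).
have s4 : t / 8 <= sin (t / 4).
  have := sub_sin_le t40; have : (t / 4) ^+ 3 / 2 <= t / 4 / 8.
    rewrite exprSr.
    have : (t / 4) ^+ 2 <= 4^-1 by rewrite expr2; nra.
    have := sqr_ge0 (t / 4); nra.
  lra.
have hm : t ^+ 2 / 64 <= mean_sin2 a t.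
  rewrite mean_sin2E//.
  have [h|//] := sigma_le t0; last lra.
  have sg0 : 0 <= sigma t.
    rewrite divr_ge0 ?(ltW t0)// ltW// sin_gt0_pi// t0/=.
    by have := pi_ge2 R; lra.
  have : (t / 8) ^+ 2 <= sin (t / 4) ^+ 2 by rewrite lerXn2r ?nnegrE//; lra.
  have -> : (t / 8) ^+ 2 = t ^+ 2 / 64 by field.
  have [A0 A1] := andP (sin2_le1 (a + t / 2)).
  have := mulr_ge0 sg0 A0; lra.
apply: le_trans (_ : (3 / 4 * t ^+ 2) ^+ 2 <= _); last first.
  rewrite exprMn -exprM; have t2' : 0 < t ^+ 2 by rewrite exprn_gt0.
  have -> : t ^+ (2 * 2) = t ^+ 2 * t ^+ 2 by rewrite -exprD.
  nra.
apply: sqb.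
have hs : 0 <= 1 - sigma t <= t ^+ 2 / 2.
  have -> : 1 - sigma t = (t - sin t) / t by rewrite /sigma; field.
  rewrite divr_ge0 ?(ltW t0) ?subr_ge0//= ler_pdivrMr//.
  by rewrite (_ : t ^+ 2 / 2 * t = t ^+ 3 / 2)//; ring.
have hc : 0 <= t / 2 - (1 - cos t) / t <= t ^+ 2 / 4.
  have -> : t / 2 - (1 - cos t) / t = (t / 2 - sin (t / 2)) * ((t / 2 + sin (t / 2)) * 2 / t).
    have {2}-> : t = (t / 2) *+ 2 by rewrite mulr2n; field.
    by rewrite cos_mulr2n cos2sin2 mulr2n; field.
  have sp : 0 <= sin (t / 2) by rewrite sin_ge0_pi//; have := pi_ge2 R; lra.
  have q0 : 0 <= (t / 2 + sin (t / 2)) * 2 / t by rewrite divr_ge0 ?(ltW t0)//; lra.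
  have q2 : (t / 2 + sin (t / 2)) * 2 / t <= 2 by rewrite ler_pdivrMr//; lra.
  rewrite mulr_ge0 ?subr_ge0//=.
  apply: le_trans (_ : (t / 2) ^+ 3 / 2 * 2 <= _).
    by rewrite ler_pM// subr_ge0.
  have -> : (t / 2) ^+ 3 / 2 * 2 = t ^+ 2 * t / 8 by rewrite exprSr; field.
  by have := sqr_ge0 t; nra.
have -> : sin a + t / 2 * cos a - mean_sin a t =
    sin a * (1 - sigma t) + cos a * (t / 2 - (1 - cos t) / t).
  by rewrite /mean_sin /sigma cosD; field.
set p := 1 - sigma t in hs *; set q := t / 2 - _ in hc *.
have : - p <= sin a * p <= p by nra.
have : - q <= cos a * q <= q by nra.
lra.
Qed.

End SineAverages.

Section Window.
Context {R : realType}.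
Implicit Types (f g : R -> R) (m k : nat) (x : R).

Lemma discriminant (A P B : R) : 0 <= B ->
  (forall s, 0 <= A - 2 * s * P + s ^+ 2 * B) -> P ^+ 2 <= A * B.
Proof.
move=> B0 h; have [B0'|B0'] := eqVneq B 0.
  have [->|P0] := eqVneq P 0; first by rewrite B0' mulr0 expr0n.
  have := h ((A + 1) / (2 * P)).
  have -> : 2 * ((A + 1) / (2 * P)) * P = A + 1 by field.
  by rewrite B0' mulr0; lra.
have B1 : 0 < B by rewrite lt_neqAle eq_sym B0'.
have := h (P / B).
have -> : A - 2 * (P / B) * P + (P / B) ^+ 2 * B = (A * B - P ^+ 2) / B by field.
by rewrite pmulr_lge0 ?invr_gt0// subr_ge0.
Qed.
(** Unlike [wdot_sqr_le], the weight stays on both factors, so the estimate does not deteriorate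
    with the bound [M], which is n for the window. *)
Lemma wdot_CauchySchwarz (rho : R -> R) M f g : weight rho M -> L2 0 1 f -> L2 0 1 g ->
  wdot rho f g ^+ 2 <= wdot rho f f * wdot rho g g.
Proof.
move=> hrho Lf Lg; apply: discriminant => [|s]; first exact: wdot_ge0 hrho _.
have := wdot_ge0 hrho (fun x => f x - s * g x).
have Ls := L2Zl s Lg; have Lfs := L2B Lf Ls.
rewrite (wdotBl hrho)// (wdotZl hrho)// (wdotC _ f) (wdotC _ g) !(wdotBl hrho)// !(wdotZl hrho)//.
by rewrite (wdotC _ g f); lra.
Qed.
Variables (xi h : R) (n : nat).
Hypotheses (hxi : 0 < xi < 1) (n0 : (0 < n)%N) (nh : n%:R * h = 1) (hn : h < 1 - xi).
(** The factor n normalizes the window to mass 1, an approximate Dirac mass at [xi], and absorbs the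
    n in the control n phi_n. *)
Definition window x : R := chi xi n x * n%:R.
Let nr0 : n%:R != 0 :> R. Proof. by rewrite pnatr_eq0 -lt0n. Qed.
Let h0 : 0 < h. Proof. by rewrite -(@pmulr_rgt0 _ n%:R) ?nh// ltr0n. Qed.
Let hn0 : h != 0. Proof. by rewrite gt_eqF. Qed.

Lemma windowE x : window x = if xi < x < xi + h then n%:R else 0.
Proof.
have h_inv : n%:R^-1 = h by apply: (mulfI nr0); rewrite mulfV.
rewrite /window /chi h_inv indicE; case: ifPn => hx.
  by rewrite mem_set ?mul1r//= in_itv.
by rewrite memNset ?mul0r//= in_itv; exact/negP.
Qed.
Lemma window_weight : weight window n%:R.
Proof.
split; last by move=> x _; rewrite windowE; case: ifP; rewrite !lexx ?ler0n.
apply: measurable_funM; last exact: measurable_cst.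
by apply: measurable_indic; exact: measurable_itv.
Qed.
Lemma window_intg f : integrable_on 0 1 f ->
  intg 0 1 (fun x => window x * f x) = n%:R * intg xi (xi + h) f.
Proof.
have hpos := h0; have hn1 := hn; have [xi0 xi1] := andP hxi.
move=> hf.
have iw : integrable_on 0 1 (fun x => window x * f x).
  apply: (@integrable_on_le _ _ _ _ (fun x => n%:R * `|f x|)).
  - by apply: measurable_funM; [case: window_weight|exact: integrable_on_measurable].
  - by apply: integrable_onZl; exact: integrable_on_normr.
  - move=> x x01; rewrite normrM ler_wpM2r//.
    by have [_ /(_ x x01)/andP[w0 wn]] := window_weight; rewrite ger0_norm.
have sub c d : 0 <= c -> d <= 1 -> integrable_on c d (fun x => window x * f x).
  by move=> c0 d1; exact: integrable_on_sub iw.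
have i01 : 0 <= xi <= 1 by lra.
have i12 : xi <= xi + h <= 1 by lra.
rewrite (intg_cat i01 iw) (intg_cat i12 (sub _ _ (ltW xi0) (lexx 1))).
have z c d : 0 <= c -> d <= 1 -> (forall x, c < x < d -> window x = 0) ->
    intg c d (fun x => window x * f x) = 0.
  move=> c0 d1 hw; rewrite -(intg0 c d); apply: eq_intg_oo.
  - exact: sub.
  - exact: integrable_on_cst.
  - by move=> x xcd; rewrite hw// mul0r.
have fin x : ~~ (xi < x < xi + h) -> window x = 0 by rewrite windowE => /negbTE->.
rewrite (z 0 xi) ?(z (xi + h) 1); try lra; last 2 first.
- by move=> x hx; apply: fin; lra.
- by move=> x hx; apply: fin; lra.
rewrite add0r addr0 -intgZl; last by apply: integrable_on_sub hf; lra.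
apply: eq_intg_oo; [apply: sub; lra| |].
- by apply: integrable_onZl; apply: integrable_on_sub hf; lra.
- by move=> x hx; rewrite windowE hx.
Qed.
Lemma wdot_window f g : L2 0 1 f -> L2 0 1 g ->
  wdot window f g = n%:R * dot xi (xi + h) f g.
Proof.
move=> Lf Lg; rewrite /dot -window_intg; last exact: L2_mul.
by apply: eq_intg => x _; rewrite mulrA.
Qed.
Lemma window_mean_sin2 m :
  wdot window (sn m) (sn m) = mean_sin2 (freq m * xi) (freq m * h).
Proof.
have hpos := h0; have hn1 := hn; have [xi0 xi1] := andP hxi.
rewrite wdot_window; try exact: L2_sn.
have mu0 : freq m != 0 :> R by rewrite gt_eqF// freq_gt0.
pose F x := x / 2 - sin (2 * freq m * x) / (4 * freq m).
have dF x : is_derive x 1 F (sn m x * sn m x).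
  have hd := is_derive_sinM (2 * freq m) x; apply: is_derive_eq.
  rewrite /GRing.scale/= /sn.
  have -> : 2 * freq m * x = (freq m * x) *+ 2 by rewrite mulr2n; ring.
  by rewrite cos_mulr2n cos2sin2 mulr2n; field.
have cf : continuous (fun x => @sn R m x * sn m x).
  by move=> x; apply: cvgM; exact: continuous_sn.
have xx : xi <= xi + h by lra.
rewrite /dot (FTC2 xx cf dF) /F /mean_sin2.
have -> : 2 * freq m * (xi + h) = (2 * (freq m * xi) + freq m * h) + freq m * h by ring.
have -> : 2 * freq m * xi = (2 * (freq m * xi) + freq m * h) - freq m * h by ring.
rewrite sinD sinB.
set s := sin (_ + _); set c := cos (_ + _); set s' := sin _; set c' := cos _.
have -> : n%:R = h^-1 by apply: (mulIf hn0); rewrite nh mulVf.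
by field; rewrite ?hn0.
Qed.
Lemma window_mean_sin m :
  wdot window (sn m) (fun=> 1) = mean_sin (freq m * xi) (freq m * h).
Proof.
have hpos := h0; have hn1 := hn; have [xi0 xi1] := andP hxi.
rewrite wdot_window; [|exact: L2_sn|exact: L2_cst].
have mu0 : freq m != 0 :> R by rewrite gt_eqF// freq_gt0.
pose F x := - (cos (freq m * x) / freq m).
have dF x : is_derive x 1 F (sn m x).
  have hd := is_derive_cosM (freq m) x; apply: is_derive_eq.
  by rewrite /GRing.scale/= /sn; field.
have xx : xi <= xi + h by lra.
have -> : dot xi (xi + h) (sn m) (fun=> 1) = intg xi (xi + h) (sn m).
  by apply: eq_intg => x _; rewrite mulr1.
rewrite (FTC2 xx (@continuous_sn R m) dF) /F /mean_sin [freq m * (xi + h)]mulrDr.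
have -> : n%:R = h^-1 by apply: (mulIf hn0); rewrite nh mulVf.
by field; rewrite ?hn0.
Qed.
Lemma window_mass : wdot window (fun=> 1) (fun=> 1) = 1.
Proof.
have hpos := h0; have hn1 := hn; have [xi0 xi1] := andP hxi.
rewrite wdot_window; try exact: L2_cst.
rewrite /dot intg_cst; last lra.
by rewrite mulr1 mul1r addrAC subrr add0r.
Qed.
Lemma window_le f M : 0 <= M -> L2 0 1 f ->
  (forall x, xi < x < xi + h -> `|f x| <= M) -> wdot window f f <= M ^+ 2.
Proof.
move=> M0 Lf hf.
have -> : M ^+ 2 = wdot window (fun=> M) (fun=> M).
  have -> : (fun=> M) = (fun x : R => M * 1) by apply/funext => x; rewrite mulr1.
  have L1 := L2_cst 0 1 (1 : R); have LM : L2 0 1 (fun=> M * 1) by exact: L2_cst.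
  rewrite (wdotZl window_weight)// wdotC (wdotZl window_weight)// window_mass.
  by rewrite mulr1 expr2.
have Lw g : L2 0 1 g -> L2 0 1 (fun x => window x * g x) by move=> Lg; exact: (L2_weight window_weight Lg).
apply: le_intg; [apply: L2_mul => //; exact: Lw|apply: L2_mul; [exact: Lw (L2_cst _ _ _)|exact: L2_cst]|].
move=> x x01; rewrite windowE; case: ifPn => hx; last by rewrite !mul0r.
rewrite -!mulrA ler_wpM2l ?ler0n// -!expr2 -[leLHS]real_normK ?num_real//.
by rewrite lerXn2r ?nnegrE ?hf.
Qed.
Lemma window_sn_le1 m : wdot window (sn m) (sn m) <= 1.
Proof.
have := @window_le (sn m) 1 ler01 (L2_sn 0 1 m); rewrite expr1n; apply.
by move=> x _; rewrite ler_norml sin_le1 sin_geN1.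
Qed.
Lemma window_sqr_mean f : L2 0 1 f ->
  wdot window f (fun=> 1) ^+ 2 <= wdot window f f.
Proof.
move=> Lf; have := wdot_CauchySchwarz window_weight Lf (L2_cst 0 1 1).
by rewrite window_mass mulr1.
Qed.
(** On the window [sn m] differs from its value at [xi] by at most [freq m * h]. The m-th weighted
    moment of f is thus close to that of a Dirac source of strength the average of f, with an error
    paid by the weighted energy. *)
Lemma window_sn_near f m : L2 0 1 f ->
  (wdot window f (sn m) - sn m xi * wdot window f (fun=> 1)) ^+ 2 <=
  (freq m * h) ^+ 2 * wdot window f f.
Proof.
move=> Lf; have L1 := L2_cst 0 1 (1 : R).
have Ls : L2 0 1 (fun x => sn m x - sn m xi * 1).
  by apply: L2B; [exact: L2_sn|exact: L2_cst].
have -> : wdot window f (sn m) - sn m xi * wdot window f (fun=> 1) =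
    wdot window f (fun x => sn m x - sn m xi * 1).
  rewrite ![wdot window f _]wdotC (wdotBl window_weight)//; try exact: L2_sn.
    by rewrite (wdotZl window_weight).
  exact: L2_cst.
apply: le_trans (wdot_CauchySchwarz window_weight Lf Ls) _.
rewrite mulrC ler_wpM2r ?(wdot_ge0 window_weight)//.
have m0 := @freq_gt0 R m; have fh : 0 <= freq m * h by rewrite mulr_ge0 ?ltW.
apply: window_le => // x hx.
rewrite mulr1 /sn.
have -> : freq m * x = (freq m * (x + xi) / 2) + (freq m * (x - xi) / 2) by field.
have -> : freq m * xi = (freq m * (x + xi) / 2) - (freq m * (x - xi) / 2) by field.
rewrite sinD sinB.
set s' := sin (freq m * (x + xi) / 2); set c := cos (freq m * (x + xi) / 2).
set s := sin (freq m * (x - xi) / 2); set c' := cos (freq m * (x - xi) / 2).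
have -> : s' * c' + c * s - (s' * c' - c * s) = 2 * c * s by ring.
rewrite normrM; apply: le_trans (_ : 2 * (freq m * (x - xi) / 2) <= _); last first.
  have -> : 2 * (freq m * (x - xi) / 2) = freq m * (x - xi) by field.
  by rewrite ler_pM2l//; lra.
apply: ler_pM => //.
  rewrite normrM ger0_norm// ler_piMr// /c ler_norml cos_le1 cos_geN1//.
apply: le_trans (norm_sin_le _) _; rewrite ger0_norm// divr_ge0// mulr_ge0 ?ltW//; lra.
Qed.
End Window.

(** * Moment equations of a controlled solution *)

Section ControlledModes.
Context {R : realType}.
Implicit Types (a b t s T : R) (m k N : nat) (u ut : R -> R -> R).

Lemma cvg_within_seq (D : set R) t (G : R -> R) (l : R) (s : nat -> R) :
  G x @[x --> within D (dnbhs t)] --> l -> s k @[k --> \oo] --> t ->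
  (forall k, D (s k) /\ s k != t) -> G (s k) @[k --> \oo] --> l.
Proof.
move=> Gl st sD; apply: cvg_trans Gl => A; rewrite /nbhs/= /within/= => hA.
have h1 : nbhs t (fun x => x != t -> D x -> A (G x)) by exact: hA.
have [K _ hK] := st _ h1.
by exists K => // k /= Kk; have [h2 h3] := sD k; exact: hK k Kk h3 h2.
Qed.

Lemma approach_seq T t : 0 < T -> 0 <= t <= T -> exists s : nat -> R,
  s k @[k --> \oo] --> t /\ forall k, `[0, T]%classic (s k) /\ s k != t.
Proof.
move=> T0 tT.
have key (d : R) : d != 0 -> (forall k : nat, 0 <= t + d * k.+1%:R^-1 <= T) ->
    exists s : nat -> R, s k @[k --> \oo] --> t /\
      forall k, `[0, T]%classic (s k) /\ s k != t.
  move=> d0 hd; exists (fun k => t + d * k.+1%:R^-1); split.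
    rewrite -[X in _ --> X]addr0 -[X in _ + X](mulr0 d).
    apply: cvgD; first exact: (@cvg_cst R^o).
    by apply: cvgMr; exact: cvg_harmonic.
  move=> k; split; first exact: hd.
  by rewrite -subr_eq0 addrAC subrr add0r mulf_neq0// invr_eq0 pnatr_eq0.
have k1 k : 0 < (k.+1%:R^-1 : R) <= 1.
  by rewrite invr_gt0 ltr0n/= invf_le1 ?ltr0n// ler1n.
have [t2|t2] := leP t (T / 2).
  apply: (key (T / 2)); first by rewrite gt_eqF// divr_gt0.
  by move=> k; have := k1 k; set q := k.+1%:R^-1 => q1; nra.
apply: (key (- (T / 2))); first by rewrite oppr_eq0 gt_eqF// divr_gt0.
by move=> k; have := k1 k; set q := k.+1%:R^-1 => q1; nra.
Qed.

Lemma W21_slope T p M d2 t (s : nat -> R) : 0 < T -> W21 0 T p M d2 ->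
  0 <= t <= T -> s k @[k --> \oo] --> t ->
  (forall k, `[0, T]%classic (s k) /\ s k != t) ->
  (p (s k) - p t) / (s k - t) @[k --> \oo] --> M t.
Proof.
move=> T0 hW tT st sD; have [cp cM] := W21_continuous (ltW T0) hW.
have [i2 hW'] := hW.
apply/cvgrPdist_le => e e0.
have [d d0 hd] : exists2 d, 0 < d & forall r, 0 <= r <= T -> `|r - t| < d -> `|M r - M t| <= e.
  have /subspace_continuousP/(_ t tT)/cvgrPdist_le/(_ _ e0) := cM.
  move=> [d /= d0 hd]; exists d => // r rT rt; rewrite distrC.
  by apply: hd => //=; rewrite /ball/= distrC.
have iM c c' : 0 <= c -> c' <= T -> integrable_on c c' M.
  by move=> c0 cT; apply: integrable_on_sub (continuous_integrable_on cM).
have pE c c' : 0 <= c -> c <= c' -> c' <= T -> p c' - p c = intg c c' M.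
  move=> c0 cc cT.
  have [-> _] : p c' = p 0 + intg 0 c' M /\ M c' = M 0 + intg 0 c' d2 by apply: hW'; lra.
  have [-> _] : p c = p 0 + intg 0 c M /\ M c = M 0 + intg 0 c d2 by apply: hW'; lra.
  rewrite (@intg_cat _ c 0 c'); [by ring|lra|exact: iM].
have avg c c' : 0 <= c -> c < c' -> c' <= T ->
    (forall r, c <= r <= c' -> `|M r - M t| <= e) ->
    `|(p c' - p c) / (c' - c) - M t| <= e.
  move=> c0 cc cT hM.
  have cc0 : 0 < c' - c by rewrite subr_gt0.
  have -> : (p c' - p c) / (c' - c) - M t = intg c c' (fun r => M r - M t) / (c' - c).
    rewrite intgB; [|exact: iM|exact: integrable_on_cst].
    by rewrite intg_cst ?ltW// (pE c c')// ?ltW//; field; rewrite gt_eqF.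
  rewrite normrM normfV (ger0_norm (ltW cc0)) ler_pdivrMr//.
  apply: ler_norm_intg_cst => //; first exact: ltW.
  by apply: integrable_onB; [exact: iM|exact: integrable_on_cst].
move/cvgrPdist_lt : st => /(_ _ d0); apply: filterS => k hk.
have [sT sne] := sD k; have {sT} sT : 0 <= s k <= T by exact: sT.
rewrite distrC; have [lt|lt|eq] := ltgtP (s k) t; last by rewrite eq eqxx in sne.
- have -> : (p (s k) - p t) / (s k - t) = (p t - p (s k)) / (t - s k).
    have n1 : s k - t != 0 by rewrite subr_eq0.
    have n2 : t - s k != 0 by rewrite subr_eq0 eq_sym.
    by field; rewrite n1 n2.
  apply: avg => //; try lra.
  move=> r hr; apply: hd; first lra.
  by apply: le_lt_trans hk; rewrite ler_norml ger0_norm; lra.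
- apply: avg => //; try lra.
  move=> r hr; apply: hd; first lra.
  by apply: le_lt_trans hk; rewrite (distrC t) ler_norml ger0_norm; lra.
Qed.

(** The weak form provides some derivative [M] of the modal coefficient; comparing difference
    quotients along a sequence inside [0,T] identifies it with the coefficient of [ut], endpoints
    included, so that the prescribed velocities can be used. *)
Lemma C1L2_velocity T u ut m p M d2 t : 0 < T -> C1L2 T u ut ->
  W21 0 T p M d2 -> (forall s, 0 <= s <= T -> p s = coef (u s) m) ->
  0 <= t <= T -> M t = coef (ut t) m.
Proof.
move=> T0 [[Lu _] [Lut _] dut] hW pu tT.
have [s [st sD]] := approach_seq T0 tT.
have sT k : 0 <= s k <= T by have [] := sD k.
have cv := W21_slope T0 hW tT st sD.
have cv' := cvg_within_seq (dut t tT) st sD.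
pose q k x := (u (s k) x - u t x) * (s k - t)^-1.
have Lq k : L2 0 1 (q k).
  have := L2Zl (s k - t)^-1 (L2B (Lu _ (sT k)) (Lu _ tT)).
  by apply: eq_L2 => x _; rewrite /q mulrC.
have cq : coef (q k) m @[k --> \oo] --> coef (ut t) m.
  apply: cvg_dot => //; [exact: Lut|exact: L2_sn].
have e k : coef (q k) m = (p (s k) - p t) / (s k - t).
  rewrite !pu// -coef_sub; [|exact: Lu|exact: Lu].
  rewrite [RHS]mulrC -dotZl; [|by apply: L2B; exact: Lu|exact: L2_sn].
  by apply: eq_dot => // x _; rewrite /q mulrC.
rewrite -(cvg_lim _ cq)//; under eq_fun do rewrite e.
by apply/esym/cvg_lim.
Qed.

(** Rest at time T removes the boundary terms there, so the moments over (0,T) reduce to the initial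
    data; the last item is the backward Duhamel formula. *)
Theorem controlled_modes T f (y0 y1 : R -> R) u m : 0 < T ->
  L2 0 1 y0 -> L2 0 1 y1 -> controlled_solution T f y0 y1 u ->
  integrable_on 0 T (f ^~ (sn m)) ->
  [/\ intg 0 T (fun t => f t (sn m) * ct m t) = - coef y1 m,
      intg 0 T (fun t => f t (sn m) * st m t) = eig m * coef y0 m &
      forall t, 0 <= t <= T -> eig m * coef (u t) m =
        ct m t * intg t T (fun s => f s (sn m) * st m s)
        - st m t * intg t T (fun s => f s (sn m) * ct m s)].
Proof.
move=> T0 Ly0 Ly1 [ut [[_ hC1 hw u0 ut0] uT utT]] ih.
have [[Lu _] [Lut _] _] := hC1.
have t0T : (0 : R) <= 0 <= T by rewrite lexx ltW.
have tTT : 0 <= T <= T by rewrite lexx ltW.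
have [M hM] := beam_weak_coef m hw Lu.
have vel t : 0 <= t <= T -> M t = coef (ut t) m.
  by apply: (C1L2_velocity T0 hC1 hM).
have c0 : coef (fun=> 0) m = 0 :> R.
  by apply: etrans (intg0 0 1); apply: eq_intg => x _; rewrite mul0r.
have eT : coef (u T) m = 0.
  by rewrite -c0; apply: eq_ae01_dot uT => //; [exact: Lu|exact: L2_cst|exact: L2_sn].
have eMT : M T = 0.
  rewrite vel// -c0; apply: eq_ae01_dot utT => //; [exact: Lut|exact: L2_cst|exact: L2_sn].
have e0 : coef (u 0) m = coef y0 m.
  by apply: eq_ae01_dot u0 => //; [exact: Lu|exact: L2_sn].
have eM0 : M 0 = coef y1 m.
  by rewrite vel//; apply: eq_ae01_dot ut0 => //; [exact: Lut|exact: L2_sn].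
have [h1 h2] := oscillator_moments (ltW T0) hM ih.
have z1 : ct m 0 = 1 :> R by rewrite /ct mulr0 cos0.
have z2 : st m 0 = 0 :> R by rewrite /st mulr0 sin0.
split.
- by rewrite h1 eT eMT e0 eM0 z1 z2; ring.
- by rewrite h2 eT eMT e0 eM0 z1 z2; ring.
- by move=> t tT; exact: (oscillator_final tT hM ih eT eMT).
Qed.

End ControlledModes.

(** * Construction of the solution with a point load *)

Section ForcedModes.
Context {R : realType}.
Implicit Types (X Y : nat -> R -> R) (m N K : nat) (r s t e : R).

(** Continuity in time with values in the square-summable sequences, phrased on partial sums with a
    modulus independent of their length. *)
Definition ell2_continuous T X :=
  (forall t, 0 <= t <= T -> ell2 (X ^~ t)) /\
  forall t e, 0 <= t <= T -> 0 < e -> exists2 d, 0 < d &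
    forall s, 0 <= s <= T -> `|s - t| < d ->
      forall N, \sum_(m < N) (X m s - X m t) ^+ 2 <= e.

Lemma ell2_continuousN T X : ell2_continuous T X ->
  ell2_continuous T (fun m t => - X m t).
Proof.
move=> [l c]; split=> [t tT|t e tT e0].
  by apply: ell2_le (l t tT) => m; rewrite normrN.
have [d d0 hd] := c t e tT e0; exists d => // s sT st N.
apply: le_trans (hd s sT st N); rewrite le_eqVlt; apply/orP; left; apply/eqP.
by apply: eq_bigr => m _; rewrite -opprD sqrrN.
Qed.

Lemma ell2_continuous_CL2 T X (u : R -> R -> R) : ell2_continuous T X ->
  (forall t, 0 <= t <= T -> L2 0 1 (u t)) ->
  (forall t m, 0 <= t <= T -> coef (u t) m = X m t) -> CL2 T u.
Proof.
move=> [l c] Lu cu; split=> // t tT; apply/cvgrPdist_le => e e0.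
have e2 : 0 < e / 2 by rewrite divr_gt0.
have [d d0 hd] := c t _ tT e2.
exists d => // s /= st sT; have {}sT : 0 <= s <= T by exact: sT.
have [Ls Lt] := (Lu s sT, Lu t tT).
have -> : intg 0 1 (fun x => (u s x - u t x) ^+ 2) =
    dot 0 1 (fun x => u s x - u t x) (fun x => u s x - u t x).
  by apply: eq_intg => x _; rewrite expr2.
rewrite sub0r normrN ger0_norm ?dot_ge0//.
have -> : e = 2 * (e / 2) by rewrite mulrCA divff ?mulr1.
apply: dot_le_coef => [|N]; first exact: L2B.
rewrite (eq_bigr (fun m : 'I_N => (X m s - X m t) ^+ 2)); last first.
  by move=> m _; rewrite coef_sub// !cu.
by apply: hd => //; rewrite distrC.
Qed.

(** The frequencies are unbounded, so the oscillating factors are not equicontinuous; small tails of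
    the amplitudes at the base time handle the high modes. *)
Lemma ell2_continuous_mode T X Y : ell2_continuous T X -> ell2_continuous T Y ->
  ell2_continuous T (fun m t => mode (X ^~ t) (Y ^~ t) m t).
Proof.
move=> [lX cX] [lY cY]; split=> [t tT|t e tT e0].
  have [M1 h1] := lX t tT; have [M2 h2] := lY t tT; exists (M1 + M2) => N.
  apply: le_trans (_ : \sum_(m < N) (X m t ^+ 2 + Y m t ^+ 2) <= _).
    by apply: ler_sum => m _; exact: mode_sqr_le.
  by rewrite big_split/=; exact: lerD (h1 N) (h2 N).
have e8 : 0 < e / 8 by rewrite divr_gt0.
have e32 : 0 < e / 32 by rewrite divr_gt0.
have e16 : 0 < e / 16 by rewrite divr_gt0.
have [d1 d10 h1] := cX t _ tT e16; have [d2 d20 h2] := cY t _ tT e16.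
have [N1 t1] := ell2_tail (lX t tT) e32; have [N2 t2] := ell2_tail (lY t tT) e32.
pose N0 := maxn N1 N2.
(* The increment with amplitudes frozen at [t]: finitely many modes contribute e/8 by continuity and
   the tail e/4. Together with the variation of the amplitudes, e/16 each, the total is 2(e/16 +
   e/16) + 2(e/8 + e/4) = e. *)
pose D m s := mode (X ^~ t) (Y ^~ t) m s - mode (X ^~ t) (Y ^~ t) m t.
have cD : \sum_(m < N0) D m s ^+ 2 @[s --> t] --> \sum_(m < N0) D m t ^+ 2.
  apply: (@cvg_sum_sqr _ _ _ _ N0 (fun s m => D m s) (fun m => D m t)) => m.
  by apply: cvgB; [exact: continuous_mode|exact: cvg_cst].
have D0 : \sum_(m < N0) D m t ^+ 2 = 0.
  by rewrite big1// => m _; rewrite /D subrr expr0n.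
move/cvgrPdist_lt : cD => /(_ _ e8) [d3 /= d30 h3].
exists (Num.min d1 (Num.min d2 d3)); first by rewrite !lt_min d10 d20.
move=> s sT; rewrite !lt_min => /and3P[s1 s2 s3] N.
have DN : \sum_(m < N) D m s ^+ 2 <= e / 8 + e / 4.
  apply: le_trans (_ : \sum_(m < maxn N N0) D m s ^+ 2 <= _).
    by apply: (@le_sum_sqr _ (fun m => D m s)); rewrite leq_maxl.
  have a1 : \sum_(m < N0) D m s ^+ 2 <= e / 8.
    have := h3 s; rewrite /ball/= distrC => /(_ s3).
    rewrite D0 sub0r normrN ger0_norm; first exact: ltW.
    by apply: sumr_ge0 => m _; exact: sqr_ge0.
  have a2 := @sum_diff_le R (fun m => D m s ^+ 2)
    (fun m => 4 * (X m t ^+ 2 + Y m t ^+ 2)) N0 (maxn N N0).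
  have {}a2 : \sum_(m < maxn N N0) D m s ^+ 2 - \sum_(m < N0) D m s ^+ 2 <= e / 4.
    apply: le_trans (a2 _ _) _.
    - move=> m; rewrite /D.
      have b1 := mode_sqr_le (X ^~ t) (Y ^~ t) m s.
      have b2 := mode_sqr_le (X ^~ t) (Y ^~ t) m t.
      have := sqr_ge0 (mode (X ^~ t) (Y ^~ t) m s + mode (X ^~ t) (Y ^~ t) m t).
      by move: b1 b2; lra.
    - by rewrite leq_maxr.
    - rewrite -!mulr_sumr !big_split/=.
      have N1m : (N1 <= N0)%N by rewrite leq_maxl.
      have N2m : (N2 <= N0)%N by rewrite leq_maxr.
      have Nm : (N0 <= maxn N N0)%N by rewrite leq_maxr.
      by have := t1 _ _ N1m Nm; have := t2 _ _ N2m Nm; lra.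
  by lra.
apply: le_trans (_ : \sum_(m < N) (2 * ((X m s - X m t) ^+ 2 + (Y m s - Y m t) ^+ 2) +
    2 * D m s ^+ 2) <= _).
  apply: ler_sum => m _.
  have b := mode_sqr_le (fun m => X m s - X m t) (fun m => Y m s - Y m t) m s.
  set q := mode (fun m => X m s - X m t) _ m s in b.
  have -> : mode (X ^~ s) (Y ^~ s) m s - mode (X ^~ t) (Y ^~ t) m t = q + D m s.
    by rewrite /q /D /mode; ring.
  by have := sqr_ge0 (q - D m s); lra.
rewrite big_split/= -!mulr_sumr big_split/=.
by have := h1 s sT s1 N; have := h2 s sT s2 N; lra.
Qed.

Lemma ell2_continuous_term T X m : ell2_continuous T X ->
  {within `[0, T], continuous (X m)}.
Proof.
move=> [_ c]; apply/subspace_continuousP => t tT; apply/cvgrPdist_le => e e0.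
have e2 : 0 < e ^+ 2 by rewrite exprn_gt0.
have [d d0 hd] := c t _ tT e2; exists d => // s /= st sT.
apply: ler_sqr_norm; first exact: ltW.
have := hd s sT; rewrite distrC => /(_ st m.+1); apply: le_trans.
rewrite big_ord_recr/= -[X in X <= _]add0r -[X m t - X m s]opprB sqrrN; apply: lerD => //.
by apply: sumr_ge0 => i _; exact: sqr_ge0.
Qed.

Variables (T xi : R) (v : R -> R) (A B : nat -> R).
Hypotheses (T0 : 0 < T) (Lv : L2 0 T v) (lA : ell2 A) (lB : ell2 B).

(** Variation of constants for X' = eig Y, Y' = sn(xi) v - eig X with X(0) = A, Y(0) = B. Here X is
    [eig m] times the coefficient of the state and Y the coefficient of its velocity. *)
Definition cosine_amplitude m t : R := A m - sn m xi * dot 0 t v (st m).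
Definition sine_amplitude m t : R := B m + sn m xi * dot 0 t v (ct m).

(* The m-th coefficient of the solution is [forced_mode m t / eig m]. *)
Definition forced_mode m t : R :=
  mode (cosine_amplitude ^~ t) (sine_amplitude ^~ t) m t.
Definition forced_velocity m t : R :=
  mode (sine_amplitude ^~ t) (fun m => - cosine_amplitude m t) m t.

(** This is why a point load keeps the state in V: as |sin| <= 1, the increments are moments of [v]
    on (s,t), square summable by [bessel_time] with a bound that vanishes as s approaches t. *)
Lemma amplitude_diff K N s t : covers T K -> 0 <= s -> s <= t -> t <= T ->
  \sum_(m < N) ((cosine_amplitude m t - cosine_amplitude m s) ^+ 2 +
                (sine_amplitude m t - sine_amplitude m s) ^+ 2) <=
  bconst K * dot s t v v.
Proof.
move=> cK s0 hst tT; have Lv' := Lv.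
have Lst : L2 s t v by apply: L2_sub Lv'.
apply: le_trans (bessel_time N cK s0 hst tT Lst).
have cat (g : R -> R) : L2 0 T g -> dot 0 t v g = dot 0 s v g + dot s t v g.
  move=> Lg; apply: intg_cat; first by rewrite s0.
  by apply: integrable_on_sub (L2_mul Lv' Lg).
have s2 m : sn m xi ^+ 2 <= 1 :> R.
  by have := cos2Dsin2 (freq m * xi : R); have := sqr_ge0 (cos (freq m * xi : R)); rewrite /sn; lra.
apply: ler_sum => m _; rewrite /cosine_amplitude /sine_amplitude.
rewrite (cat _ (L2_st _ _ _)) (cat _ (L2_ct _ _ _)).
set p := dot s t v (ct m); set q := dot s t v (st m).
have -> : forall a b c : R, (a - b * (c + q) - (a - b * c)) ^+ 2 = b ^+ 2 * q ^+ 2.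
  by move=> *; ring.
have -> : forall a b c : R, (a + b * (c + p) - (a + b * c)) ^+ 2 = b ^+ 2 * p ^+ 2.
  by move=> *; ring.
have := s2 m; have := sqr_ge0 p; have := sqr_ge0 q.
move: (sn m xi ^+ 2) (p ^+ 2) (q ^+ 2) => S P Q; nra.
Qed.

Lemma amplitude_diff_sym K N s t : covers T K -> 0 <= s <= T -> 0 <= t <= T ->
  \sum_(m < N) ((cosine_amplitude m t - cosine_amplitude m s) ^+ 2 +
                (sine_amplitude m t - sine_amplitude m s) ^+ 2) <=
  bconst K * `|dot 0 t v v - dot 0 s v v|.
Proof.
move=> cK sT tT; have Lv' := Lv.
have cat s' t' : 0 <= s' -> s' <= t' -> t' <= T ->
    dot s' t' v v = `|dot 0 t' v v - dot 0 s' v v|.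
  move=> h1 h2 h3.
  have -> : dot 0 t' v v = dot 0 s' v v + dot s' t' v v.
    apply: intg_cat; first by rewrite h1.
    by apply: integrable_on_sub (L2_mul Lv' Lv').
  by rewrite addrAC subrr add0r ger0_norm ?dot_ge0.
have [/andP[s0 sT'] /andP[t0 tT']] := (sT, tT).
have [st|/ltW ts] := leP s t.
  by rewrite -(cat s t)//; exact: amplitude_diff.
rewrite distrC -(cat t s)//; apply: le_trans (amplitude_diff N cK t0 ts sT').
rewrite le_eqVlt; apply/orP; left; apply/eqP; apply: eq_bigr => m _.
by congr (_ + _); rewrite -[LHS]sqrrN opprB.
Qed.

Lemma dot_primitive_continuous t e : 0 <= t <= T -> 0 < e -> exists2 d, 0 < d &
  forall s, 0 <= s <= T -> `|s - t| < d -> `|dot 0 s v v - dot 0 t v v| <= e.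
Proof.
move=> tT e0; have T0' := T0; have Lv' := Lv.
have := primitive_continuous (ltW T0') (L2_mul Lv' Lv').
move=> /subspace_continuousP/(_ t tT)/cvgrPdist_le/(_ _ e0) [d /= d0 hd].
exists d => // s sT st; rewrite distrC.
by apply: hd => //=; rewrite /ball/= distrC.
Qed.

Lemma amplitude_bound : exists M, forall t, 0 <= t <= T -> forall N,
  \sum_(m < N) (cosine_amplitude m t ^+ 2 + sine_amplitude m t ^+ 2) <= M.
Proof.
have [K cK] := exists_cover T; have [MA hA] := lA; have [MB hB] := lB.
exists (2 * (MA + MB) + 2 * (bconst K * dot 0 T v v)) => t tT N.
have T0' := T0; have Lv' := Lv; have /andP[t0 tT'] := tT.
have h := amplitude_diff N cK (lexx 0) t0 tT'.
have h2 : bconst K * dot 0 t v v <= bconst K * dot 0 T v v.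
  rewrite ler_wpM2l ?(ltW (bconst_gt0 cK))//.
  apply: le_intg_sub => //; first exact: L2_mul.
  by move=> x _; rewrite -expr2 sqr_ge0.
apply: le_trans (_ : \sum_(m < N) (2 * (A m ^+ 2 + B m ^+ 2) +
   2 * ((cosine_amplitude m t - cosine_amplitude m 0) ^+ 2 +
        (sine_amplitude m t - sine_amplitude m 0) ^+ 2)) <= _).
  apply: ler_sum => m _; rewrite /cosine_amplitude /sine_amplitude.
  rewrite /dot !intg_set1 !mulr0 subr0 addr0.
  set p := _ * intg 0 t _; set q := _ * intg 0 t _.
  have := sqr_ge0 (A m + p); have := sqr_ge0 (B m - q); lra.
rewrite big_split/= -!mulr_sumr big_split/=.
by have := hA N; have := hB N; lra.
Qed.

Lemma amplitude_continuous :
  ell2_continuous T cosine_amplitude /\ ell2_continuous T sine_amplitude.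
Proof.
have [K cK] := exists_cover T; have [M hM] := amplitude_bound.
have b0 := bconst_gt0 cK.
have key t e : 0 <= t <= T -> 0 < e -> exists2 d, 0 < d &
    forall s, 0 <= s <= T -> `|s - t| < d -> forall N,
    \sum_(m < N) ((cosine_amplitude m s - cosine_amplitude m t) ^+ 2 +
                (sine_amplitude m s - sine_amplitude m t) ^+ 2) <= e.
  move=> tT e0; have e1 : 0 < e / bconst K by rewrite divr_gt0.
  have [d d0 hd] := dot_primitive_continuous tT e1; exists d => // s sT st N.
  apply: le_trans (amplitude_diff_sym N cK tT sT) _.
  by rewrite mulrC -ler_pdivlMr//; exact: hd.
split; split=> [t tT|t e tT e0].
- exists M => N; apply: le_trans (hM t tT N); apply: ler_sum => m _.
  by rewrite lerDl sqr_ge0.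
- have [d d0 hd] := key t e tT e0; exists d => // s sT st N.
  apply: le_trans (hd s sT st N); apply: ler_sum => m _.
  by rewrite lerDl sqr_ge0.
- exists M => N; apply: le_trans (hM t tT N); apply: ler_sum => m _.
  by rewrite lerDr sqr_ge0.
- have [d d0 hd] := key t e tT e0; exists d => // s sT st N.
  apply: le_trans (hd s sT st N); apply: ler_sum => m _.
  by rewrite lerDr sqr_ge0.
Qed.

Lemma forced_mode_continuous :
  ell2_continuous T forced_mode /\ ell2_continuous T forced_velocity.
Proof.
have [hC hS] := amplitude_continuous; split; first exact: ell2_continuous_mode.
by apply: (@ell2_continuous_mode _ sine_amplitude (fun m t => - cosine_amplitude m t)) => //;
  exact: ell2_continuousN.
Qed.

Lemma forced_mode_bound : exists M, forall t, 0 <= t <= T -> forall N,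
  \sum_(m < N) forced_mode m t ^+ 2 <= M /\ \sum_(m < N) forced_velocity m t ^+ 2 <= M.
Proof.
have [M hM] := amplitude_bound; exists M => t tT N.
split; apply: le_trans (hM t tT N); apply: ler_sum => m _.
  exact: mode_sqr_le.
by apply: le_trans (mode_sqr_le _ _ _ _) _; rewrite sqrrN addrC.
Qed.

(** The control is only in L^2, so the amplitudes are merely absolutely continuous and the system is
    verified in integrated form by parts. *)
Lemma forced_mode_ode m t : 0 <= t <= T ->
  forced_mode m t = forced_mode m 0 + eig m * intg 0 t (forced_velocity m) /\
  forced_velocity m t = forced_velocity m 0 +
    intg 0 t (fun s => sn m xi * v s - eig m * forced_mode m s).
Proof.
move=> /andP[t0 tT]; have Lv' := Lv.
have Lvt : L2 0 t v by apply: L2_sub Lv'.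
set S := sn m xi; set E := eig m.
have dst (x : R) : is_derive x 1 (@st R m) (E * ct m x) by exact: is_derive_sinM.
have dct (x : R) : is_derive x 1 (@ct R m) (- E * st m x) by exact: is_derive_cosM.
have dNst (x : R) : is_derive x 1 (fun x => - st m x : R) (- E * ct m x).
  by apply: is_derive_eq; rewrite /GRing.scale/=; ring.
have ccE k : continuous (fun x => k * ct m x : R) by exact/continuousZ/continuous_ct.
have csE k : continuous (fun x => k * st m x : R) by exact/continuousZ/continuous_st.
pose C := cosine_amplitude m; pose D := sine_amplitude m.
pose gC s := - S * (v s * st m s); pose gD s := S * (v s * ct m s).
have ivs : integrable_on 0 t (fun s => v s * st m s) by exact: (L2_mul Lvt (L2_st _ _ _)).
have ivc : integrable_on 0 t (fun s => v s * ct m s) by exact: (L2_mul Lvt (L2_ct _ _ _)).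
have igC : integrable_on 0 t gC by exact: integrable_onZl.
have igD : integrable_on 0 t gD by exact: integrable_onZl.
have hC x : 0 <= x <= t -> C x = C 0 + intg 0 x gC.
  move=> /andP[x0 xt]; rewrite /C /cosine_amplitude /gC intgZl; last first.
    by apply: integrable_on_sub ivs.
  by rewrite /dot intg_set1 /S; ring.
have hD x : 0 <= x <= t -> D x = D 0 + intg 0 x gD.
  move=> /andP[x0 xt]; rewrite /D /sine_amplitude /gD intgZl; last first.
    by apply: integrable_on_sub ivc.
  by rewrite /dot intg_set1 /S; ring.
have cC : {within `[0, t], continuous C}.
  apply: (@subspace_eq_continuous _ _ _ (fun x => C 0 + intg 0 x gC)).
    by move=> x; rewrite inE => /itvccP xt; rewrite /from_subspace/= -hC.
  apply: within_continuousD; last exact: primitive_continuous.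
  exact/continuous_within/cst_continuous.
have cD : {within `[0, t], continuous D}.
  apply: (@subspace_eq_continuous _ _ _ (fun x => D 0 + intg 0 x gD)).
    by move=> x; rewrite inE => /itvccP xt; rewrite /from_subspace/= -hD.
  apply: within_continuousD; last exact: primitive_continuous.
  exact/continuous_within/cst_continuous.
have iM (w F : R -> R) : continuous w -> {within `[0, t], continuous F} ->
    integrable_on 0 t (fun x => w x * F x).
  move=> cw cF; apply: continuous_integrable_on; apply: within_continuousM => //.
  exact: continuous_within.
have p1 := integral_by_parts t0 (csE (- E)) dct igC hC.
have p2 := integral_by_parts t0 (ccE E) dst igD hD.
have p3 := integral_by_parts t0 (ccE (- E)) dNst igC hC.
have p4 := integral_by_parts t0 (csE (- E)) dct igD hD.
have LgC : L2 0 t gC.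
  apply: L2Zl; have := @L2_bounded_mul R 0 t v (st m) 1.
  under [in X in _ -> _ -> _ -> X]eq_fun do rewrite mulrC.
  apply=> // [|x _]; last by rewrite ler_norml sin_geN1 sin_le1.
  by case: (L2_st 0 t m).
have LgD : L2 0 t gD.
  apply: L2Zl; have := @L2_bounded_mul R 0 t v (ct m) 1.
  under [in X in _ -> _ -> _ -> X]eq_fun do rewrite mulrC.
  apply=> // [|x _]; last by rewrite ler_norml cos_geN1 cos_le1.
  by case: (L2_ct 0 t m).
have z1 : ct m 0 = 1 :> R by rewrite /ct mulr0 cos0.
have z2 : st m 0 = 0 :> R by rewrite /st mulr0 sin0.
(* The point of variation of constants: the derivatives of the amplitudes cancel in X, and by [q2]
   leave exactly the forcing in Y. *)
have q1 : intg 0 t (fun x => ct m x * gC x) + intg 0 t (fun x => st m x * gD x) = 0.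
  rewrite -intgD; [|exact: L2_mul (L2_ct _ _ _) LgC|exact: L2_mul (L2_st _ _ _) LgD].
  by rewrite -[RHS](intg0 0 t); apply: eq_intg => x _; rewrite /gC /gD; ring.
have q2 : intg 0 t (fun x => - st m x * gC x) + intg 0 t (fun x => ct m x * gD x) =
    intg 0 t (fun x => S * v x).
  rewrite -intgD; last 2 first.
  - exact: L2_mul (L2N (L2_st _ _ _)) LgC.
  - exact: L2_mul (L2_ct _ _ _) LgD.
  apply: eq_intg => x _; rewrite /gC /gD.
  have -> : - st m x * (- S * (v x * st m x)) + ct m x * (S * (v x * ct m x)) =
    S * v x * (ct m x ^+ 2 + st m x ^+ 2) by ring.
  by rewrite ct2st2 mulr1.
have iX : integrable_on 0 t (forced_mode m).
  have := integrable_onD (iM _ _ (@continuous_ct R m) cC) (iM _ _ (@continuous_st R m) cD).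
  by apply: eq_integrable_on => x _; rewrite /forced_mode /mode /C /D; ring.
have iY : integrable_on 0 t (forced_velocity m).
  have := integrable_onB (iM _ _ (@continuous_ct R m) cD) (iM _ _ (@continuous_st R m) cC).
  by apply: eq_integrable_on => x _; rewrite /forced_velocity /mode /C /D; ring.
have e0 : forced_mode m 0 = C 0 by rewrite /forced_mode /mode z1 z2 /C; ring.
have f0 : forced_velocity m 0 = D 0 by rewrite /forced_velocity /mode z1 z2 /D; ring.
have et : forced_mode m t = C t * ct m t + D t * st m t by [].
have ft : forced_velocity m t = D t * ct m t - C t * st m t.
  by rewrite /forced_velocity /mode /C /D; ring.
split.
  rewrite -intgZl// e0 et.
  have -> : intg 0 t (fun x => E * forced_velocity m x) =
      intg 0 t (fun x => - E * st m x * C x) + intg 0 t (fun x => E * ct m x * D x).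
    rewrite -intgD; [|exact: iM (csE _) cC|exact: iM (ccE _) cD].
    by apply: eq_intg => x _; rewrite /forced_velocity /mode /C /D; ring.
  by rewrite p1 p2 z1 z2; move: q1; lra.
rewrite f0 ft intgB; [|exact/integrable_onZl/L2_integrable|exact: integrable_onZl].
have -> : intg 0 t (fun x => E * forced_mode m x) =
    - (intg 0 t (fun x => - E * ct m x * C x) + intg 0 t (fun x => - E * st m x * D x)).
  rewrite -intgD; [|exact: iM (ccE _) cC|exact: iM (csE _) cD].
  rewrite -intgN; last first.
    by apply: integrable_onD; [exact: iM (ccE _) cC|exact: iM (csE _) cD].
  by apply: eq_intg => x _; rewrite /forced_mode /mode /C /D; ring.
by rewrite p3 p4 z1 z2; move: q2; lra.
Qed.

End ForcedModes.

Section BeamTests.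
Context {R : realType}.
Implicit Types (w : R -> R) (m : nat) (x : R).

Lemma V_with_C2 w dw d2w : (forall x, is_derive x 1 w (dw x)) ->
  (forall x, is_derive x 1 dw (d2w x)) -> continuous d2w ->
  w 0 = 0 -> dw 1 = 0 -> @V_with R w dw d2w.
Proof.
move=> h1 h2 cd2 w0 dw1.
have cdw : continuous dw by exact: is_derive_continuous h2.
split=> //; split; last exact: continuous_L2.
split; first exact: continuous_integrable.
move=> x /andP[x0 x1]; rewrite (FTC2 x0 cdw h1) (FTC2 x0 cd2 h2).
by split; ring.
Qed.

(** The four boundary conditions say that both w and its second derivative lie in V, so [V_coef_d2]
    applies twice. *)
Lemma beam_test_V w : beam_test w ->
  [/\ V_with w (derive1n 1 w) (derive1n 2 w),
      L2 0 1 (derive1n 4 w) &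
      forall m, coef (derive1n 4 w) m = eig m ^+ 2 * coef w m].
Proof.
move=> [dw c4 w0 w1 [w2 w3]].
have D k : (k < 4)%N -> forall x, is_derive x 1 (derive1n k w) (derive1n k.+1 w x).
  by move=> k4 x; apply: DeriveDef; [exact: dw|rewrite derive1nS derive1E].
have c k : (k < 4)%N -> continuous (derive1n k w).
  by move=> k4; exact: is_derive_continuous (D k k4).
have V1 : V_with w (derive1n 1 w) (derive1n 2 w).
  apply: V_with_C2 (c 2%N isT) w0 w1; [exact: (D 0%N isT)|exact: (D 1%N isT)].
have V2 : V_with (derive1n 2 w) (derive1n 3 w) (derive1n 4 w).
  apply: V_with_C2 c4 w2 w3; [exact: (D 2%N isT)|exact: (D 3%N isT)].
split=> //; first exact: continuous_L2.
by move=> m; rewrite (V_coef_d2 m V2) (V_coef_d2 m V1); ring.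
Qed.

End BeamTests.

Section Existence.
Context {R : realType}.
Implicit Types (m N K : nat) (r s t e x : R).
Variables (T xi : R) (v y0 y1 : R -> R) (A B : nat -> R).
Hypotheses (T0 : 0 < T) (hxi : 0 < xi < 1) (Lv : L2 0 T v).
Hypotheses (lA : ell2 A) (lB : ell2 B) (Ly0 : L2 0 1 y0) (Ly1 : L2 0 1 y1).
Hypotheses (cy0 : forall m, eig m * coef y0 m = A m) (cy1 : forall m, coef y1 m = B m).

Local Notation X := (forced_mode xi v A B).
Local Notation Y := (forced_velocity xi v A B).

Let e0 m : eig m != 0 :> R. Proof. by rewrite gt_eqF// eig_gt0. Qed.

Let cX : ell2_continuous T X.
Proof. exact: (forced_mode_continuous xi T0 Lv lA lB).1. Qed.

Let cY : ell2_continuous T Y.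
Proof. exact: (forced_mode_continuous xi T0 Lv lA lB).2. Qed.

Let ex_state t : exists u : (R -> R) * (R -> R) * (R -> R) * (R -> R),
  0 <= t <= T -> [/\ V_with u.1.1.1 u.1.1.2 u.1.2,
    forall m, coef u.1.1.1 m = X m t / eig m, L2 0 1 u.2 &
    forall m, coef u.2 m = Y m t].
Proof.
have [tT|tT] := boolP (0 <= t <= T); last by exists (id, id, id, id).
have lX : ell2 (fun m => eig m * (X m t / eig m)).
  by apply: ell2_le (cX.1 t tT) => m; rewrite mulrCA divff// mulr1.
have [u [du [d2u [Vu cu]]]] := V_of_coef lX.
have [ut [Lut cut _]] := RieszFischer (cY.1 t tT).
by exists ((u, du, d2u), ut).
Qed.

(** States are rebuilt from their modes at each time separately; all regularity in time is recovered
    from the modal sequences. *)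
Lemma forced_solution : exists u ut,
  beam_solution T (pointwise_source xi v) y0 y1 u ut /\
  forall t m, 0 <= t <= T -> eig m * coef (u t) m = X m t /\ coef (ut t) m = Y m t.
Proof.
have [S hS] := choice ex_state; have T0' := T0; have Lv' := Lv.
pose u t := (S t).1.1.1; pose du t := (S t).1.1.2; pose d2u t := (S t).1.2.
pose ut t := (S t).2.
have Vu t : 0 <= t <= T -> V_with (u t) (du t) (d2u t) by move=> /hS[].
have cu t m : 0 <= t <= T -> coef (u t) m = X m t / eig m.
  by move=> /hS[_ h _ _]; exact: h.
have Lut t : 0 <= t <= T -> L2 0 1 (ut t) by move=> /hS[].
have cut t m : 0 <= t <= T -> coef (ut t) m = Y m t by move=> /hS[_ _ _ h]; exact: h.
have Lu t : 0 <= t <= T -> L2 0 1 (u t) by move=> /Vu/V_with_L2[].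
have Lu1 t : 0 <= t <= T -> L2 0 1 (du t) by move=> /Vu/V_with_L2[].
have Lu2 t : 0 <= t <= T -> L2 0 1 (d2u t) by move=> /Vu/V_with_L2[].
exists u, ut; split; last first.
  by move=> t m tT; rewrite cu// cut// mulrCA divff// mulr1.
have CL2d2 : CL2 T d2u.
  apply: (ell2_continuous_CL2 (ell2_continuousN cX)) => // t m tT.
  by rewrite (V_coef_d2 m (Vu t tT)) cu// mulNr mulrCA divff// mulr1.
have Vdiff s t : 0 <= s <= T -> 0 <= t <= T -> V_with (fun x => u s x - u t x)
    (fun x => du s x - du t x) (fun x => d2u s x - d2u t x).
  move=> sT tT; have := V_with_lin (-1) (Vu t tT) (Vu s sT).
  rewrite [X in V_with X](_ : _ = (fun x => u s x - u t x)); last by apply/funext => x; ring.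
  rewrite [X in V_with _ X](_ : _ = (fun x => du s x - du t x)); last by apply/funext => x; ring.
  by rewrite [X in V_with _ _ X](_ : _ = (fun x => d2u s x - d2u t x)); last by apply/funext => x; ring.
(* Continuity of u and du in time is inherited from d2u through the pointwise bounds of
   [V_with_bound]. *)
have low (z : R -> R -> R) : (forall t, 0 <= t <= T -> L2 0 1 (z t)) ->
    (forall s t x, 0 <= s <= T -> 0 <= t <= T -> 0 <= x <= 1 -> (z s x - z t x) ^+ 2 <=
       dot 0 1 (fun x => d2u s x - d2u t x) (fun x => d2u s x - d2u t x)) -> CL2 T z.
  move=> Lz hz; split=> // t tT; have [_ c2] := CL2d2.
  apply/cvgrPdist_le => e e_gt0.
  have /cvgrPdist_le/(_ _ e_gt0)[d /= d0 hd] := c2 t tT.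
  exists d => // s /= st sT; have := hd s st sT.
  rewrite !sub0r !normrN !ger0_norm; last 2 first.
  - by apply: intg_ge0 => x _; exact: sqr_ge0.
  - by apply: intg_ge0 => x _; exact: sqr_ge0.
  apply: le_trans.
  have {}sT : 0 <= s <= T by exact: sT.
  rewrite -[leRHS]mulr1 -[X in _ * X](subr0 1) -intg_cst//; apply: le_intg.
  - by have [] := L2B (Lz s sT) (Lz t tT).
  - exact: integrable_on_cst.
  - move=> x x01; apply: le_trans (hz s t x sT tT x01) _.
    by rewrite le_eqVlt; apply/orP; left; apply/eqP/eq_intg => y _; rewrite expr2.
have CL2u : CL2 T u.
  by apply: low => // s t x sT tT x01; have [] := V_with_bound (Vdiff s t sT tT) x01.
have CL2du : CL2 T du.
  by apply: low => // s t x sT tT x01; have [] := V_with_bound (Vdiff s t sT tT) x01.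
have CL2ut : CL2 T ut by exact: (ell2_continuous_CL2 cY).
have cXm (m : nat) : {within `[0, T], continuous (X m)} := @ell2_continuous_term R T _ m cX.
have cYm (m : nat) : {within `[0, T], continuous (Y m)} := @ell2_continuous_term R T _ m cY.
have iX m s t : 0 <= s -> t <= T -> integrable_on s t (X m).
  by move=> s0 tT; apply: integrable_on_sub (continuous_integrable_on (cXm m)).
have iY m s t : 0 <= s -> t <= T -> integrable_on s t (Y m).
  by move=> s0 tT; apply: integrable_on_sub (continuous_integrable_on (cYm m)).
have ode m t := @forced_mode_ode R T xi v A B Lv' m t.
(* The difference quotient of X/eig is the time average of Y, so by Cauchy-Schwarz its
   square-summable distance to Y(t) is at most the largest distance on the interval. This gives the
   C^1 property. *)
have slope t lo hi E N : 0 <= t <= T -> 0 <= lo -> lo < hi -> hi <= T ->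
    (forall r, lo <= r <= hi -> \sum_(m < N) (Y m r - Y m t) ^+ 2 <= E) ->
    \sum_(m < N) ((X m hi / eig m - X m lo / eig m) / (hi - lo) - Y m t) ^+ 2 <= E.
  move=> tT lo0 lohi hiT hE; have d0 : 0 < hi - lo by rewrite subr_gt0.
  have L2Y m : L2 lo hi (fun r => Y m r - Y m t).
    apply: L2B; last exact: L2_cst.
    by apply: L2_sub (within_continuous_L2 (cYm m)).
  have i2 (i : nat) : integrable_on lo hi (fun r => (Y i r - Y i t) ^+ 2).
    by have [] := L2Y i.
  rewrite -(ler_pM2l d0); apply: le_trans (_ : intg lo hi (fun r =>
      \sum_(m < N) (Y m r - Y m t) ^+ 2) <= _); last first.
    rewrite mulrC -intg_cst ?(ltW lohi)//; apply: le_intg => //.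
    - by apply: (@integrable_on_sum R lo hi (fun m r => (Y m r - Y m t) ^+ 2)) => i _; exact: i2.
    - exact: integrable_on_cst.
  rewrite (@intg_sum R lo hi (fun m r => (Y m r - Y m t) ^+ 2)) => [|i _]; last exact: i2.
  rewrite mulr_sumr; apply: ler_sum => m _.
  have -> : (X m hi / eig m - X m lo / eig m) / (hi - lo) - Y m t =
      intg lo hi (fun r => Y m r - Y m t) / (hi - lo).
    rewrite intgB; [|exact: iY|exact: integrable_on_cst].
    rewrite intg_cst ?(ltW lohi)//.
    have o1 : 0 <= hi <= T by lra.
    have o2 : 0 <= lo <= T by lra.
    have [-> _] := ode m hi o1; have [-> _] := ode m lo o2.
    rewrite (@intg_cat _ lo 0 hi); [|lra|exact: iY].
    have h1 := lt0r_neq0 d0; have h2 : eig m != 0 :> R := e0 m.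
    by field; rewrite ?h1 ?h2.
  have := CauchySchwarz (L2Y m) (L2_cst lo hi 1).
  have -> : dot lo hi (fun r => Y m r - Y m t) (fun=> 1) = intg lo hi (fun r => Y m r - Y m t).
    by apply: eq_intg => r _; rewrite mulr1.
  have -> : dot lo hi (fun r => Y m r - Y m t) (fun r => Y m r - Y m t) =
      intg lo hi (fun r => (Y m r - Y m t) ^+ 2).
    by apply: eq_intg => r _; rewrite expr2.
  have -> : dot lo hi (fun=> 1) (fun=> 1) = hi - lo.
    by rewrite /dot intg_cst ?(ltW lohi)// !mul1r.
  move: (intg _ _ _) (intg _ _ _) => q p pq.
  have -> : (hi - lo) * (p / (hi - lo)) ^+ 2 = p ^+ 2 / (hi - lo).
    have h1 := lt0r_neq0 d0; by field; rewrite ?h1.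
  by rewrite ler_pdivrMr.
have C1 : C1L2 T u ut.
  split=> // t tT; apply/cvgrPdist_le => e e_gt0.
  have e2 : 0 < e / 2 by rewrite divr_gt0.
  have [d d0 hd] := cY.2 t _ tT e2.
  exists d => // s /= st snt sT; have {}sT : 0 <= s <= T by exact: sT.
  have Ld : L2 0 1 (fun x => (s - t)^-1 * (u s x - u t x)) by apply: L2Zl; apply: L2B; exact: Lu.
  set z := fun x => (u s x - u t x) / (s - t) - ut t x.
  have zE : z = (fun x => (s - t)^-1 * (u s x - u t x) - ut t x).
    by apply/funext => x; rewrite /z mulrC.
  have Lz : L2 0 1 z by rewrite zE; apply: L2B => //; exact: Lut.
  have cz m : coef z m = (X m s / eig m - X m t / eig m) / (s - t) - Y m t.
    rewrite zE coef_sub//; last exact: Lut.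
    rewrite /coef dotZl; [|by apply: L2B; exact: Lu|exact: L2_sn].
    by rewrite -!/(coef _ m) (coef_sub m (Lu s sT) (Lu t tT)) !cu// cut// mulrC.
  have -> : intg 0 1 (fun x => z x ^+ 2) = dot 0 1 z z.
    by apply: eq_intg => x _; rewrite expr2.
  rewrite sub0r normrN ger0_norm ?dot_ge0//.
  have -> : e = 2 * (e / 2) by rewrite mulrCA divff ?mulr1.
  apply: dot_le_coef => // N; rewrite (eq_bigr (fun m : 'I_N =>
    ((X m s / eig m - X m t / eig m) / (s - t) - Y m t) ^+ 2)); last by move=> m _; rewrite cz.
  have hr r : Num.min s t <= r <= Num.max s t ->
      \sum_(m < N) (Y m r - Y m t) ^+ 2 <= e / 2.
    rewrite ge_min le_max => hr; apply: hd.
      by move: sT tT hr => /andP[a1 a2] /andP[a3 a4] /andP[/orP[a5|a5] /orP[a6|a6]]; lra.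
    apply: le_lt_trans st; rewrite (distrC t) ler_norml.
    have := ler_norm (s - t); have := ler_norm (t - s); rewrite (distrC t) => a7 a8.
    by move: hr => /andP[/orP[a5|a5] /orP[a6|a6]]; have := normr_ge0 (s - t); lra.
  have [lt|lt|eq] := ltgtP s t; last by rewrite eq eqxx in snt.
    rewrite (eq_bigr (fun m : 'I_N =>
      ((X m t / eig m - X m s / eig m) / (t - s) - Y m t) ^+ 2)); last first.
      by move=> m _; rewrite -[s - t]opprB -[X m s / _ - _]opprB invrN mulrNN.
    apply: slope => //; [by case/andP: sT|by case/andP: tT|].
    by move=> r rr; apply: hr; rewrite ge_min le_max; move/andP: rr => [-> ->]; rewrite orbT.
  apply: slope => //; [by case/andP: tT|by case/andP: sT|].
  by move=> r rr; apply: hr; rewrite ge_min le_max; move/andP: rr => [-> ->]; rewrite orbT.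
have weak : beam_weak T (pointwise_source xi v) u.
  move=> w hw; have [Vw L4 c4] := beam_test_V hw; have [Lw _ _] := V_with_L2 Vw.
  have [M hM] := forced_mode_bound xi T0' Lv' lA lB.
  have bnd (Z : nat -> R -> R) (d : nat -> R) : (forall t N, 0 <= t <= T ->
      \sum_(m < N) Z m t ^+ 2 <= M) -> ell2 d -> exists2 B, 0 <= B &
      forall N t, 0 <= t <= T -> `|2 * \sum_(m < N) Z m t * d m| <= B.
    move=> hZ [D hD]; have M0 : 0 <= M by have := hZ 0 0%N; rewrite big_ord0; apply; rewrite lexx ltW.
    have D0 : 0 <= D by have := hD 0%N; rewrite big_ord0.
    exists (M + D); first exact: addr_ge0.
    move=> N t tT; rewrite normrM ger0_norm//.
    have := sum_young N (Z ^~ t) d ltr01; rewrite invr1 !mul1r => /le_trans; apply.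
    by apply: lerD; [exact: hZ|exact: hD].
  have tM (Z : nat -> R -> R) (d : nat -> R) (g : R -> R) t : 0 <= t <= T ->
      (forall m, {within `[0, T], continuous (Z m)}) ->
      (forall t N, 0 <= t <= T -> \sum_(m < N) Z m t ^+ 2 <= M) -> ell2 d ->
      (forall t, 0 <= t <= T -> 2 * \sum_(m < N) Z m t * d m @[N --> \oo] --> g t) ->
      integrable_on 0 t g /\
      2 * \sum_(m < N) intg 0 t (Z m) * d m @[N --> \oo] --> intg 0 t g.
    move=> /andP[t0 tT] cZ hZ ld hg; have [D D0 hD] := bnd Z d hZ ld.
    have iZ (m : nat) : integrable_on 0 t (fun s => Z m s * d m).
      by apply: integrable_onZr; apply: integrable_on_sub (continuous_integrable_on (cZ m)).
    have [||s st|N s st|h1 h2] := @dominated_intg R 0 t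
        (fun N s => 2 * \sum_(m < N) Z m s * d m) g (fun=> D).
    - move=> N; apply: integrable_on_measurable; apply: integrable_onZl.
      by apply: (@integrable_on_sum R 0 t (fun m s => Z m s * d m)) => i _; exact: iZ.
    - exact: integrable_on_cst.
    - by apply: hg; lra.
    - by apply: hD; lra.
    split=> //; rewrite (_ : (fun N => 2 * _) = (fun N => intg 0 t (fun s =>
        2 * \sum_(m < N) Z m s * d m))) //; apply/funext => N.
    rewrite intgZl; last by apply: (@integrable_on_sum R 0 t (fun m s => Z m s * d m)) => i _; exact: iZ.
    rewrite (@intg_sum R 0 t (fun m s => Z m s * d m)) => [|i _]; last exact: iZ.
    congr (_ * _); apply: eq_bigr => m _; rewrite intgZr//.
    by apply: integrable_on_sub (continuous_integrable_on (cZ m)).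
  (* X carries a factor [eig m], so pairing with [w4] uses these quotients, equal to
     [eig m * coef w m] and square summable because w is in V. The weak equation holds for
     truncations and passes to the limit by dominated convergence. *)
  pose w4 := derive1n 4 w; pose d m := coef w4 m / eig m.
  have dE m : d m = eig m * coef w m by rewrite /d c4 expr2 -mulrA mulrC mulrA divfK// mulrC.
  have ld : ell2 d by apply: ell2_le (eig_coef_ell2 Vw) => m; rewrite dE.
  have lw := coef_ell2 Lw.
  have cut_w t : 0 <= t <= T -> 2 * \sum_(m < N) Y m t * coef w m @[N --> \oo] --> ip (ut t) w.
    move=> tT; have := parseval_dot (Lut t tT) Lw.
    rewrite (_ : (fun N => _) = (fun N => 2 * \sum_(m < N) Y m t * coef w m))//.
    by apply/funext => N; congr (_ * _); apply: eq_bigr => m _; rewrite cut.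
  have cu_w4 t : 0 <= t <= T -> 2 * \sum_(m < N) X m t * d m @[N --> \oo] --> ip (u t) w4.
    move=> tT; have := parseval_dot (Lu t tT) L4.
    rewrite (_ : (fun N => _) = (fun N => 2 * \sum_(m < N) X m t * d m))//.
    apply/funext => N; congr (_ * _); apply: eq_bigr => m _.
    by rewrite cu// /d -mulrA (mulrC (eig m)^-1).
  have cu_w t : 0 <= t <= T -> 2 * \sum_(m < N) X m t / eig m * coef w m @[N --> \oo] --> ip (u t) w.
    move=> tT; have := parseval_dot (Lu t tT) Lw.
    rewrite (_ : (fun N => _) = (fun N => 2 * \sum_(m < N) X m t / eig m * coef w m))//.
    by apply/funext => N; congr (_ * _); apply: eq_bigr => m _; rewrite cu.
  have tTT : 0 <= T <= T by rewrite lexx ltW.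
  have [i4 _] := tM X d _ T tTT cXm (fun t N tT => (hM t tT N).1) ld cu_w4.
  exists (fun t => ip (ut t) w); split.
    apply: integrable_onB => //; apply: integrable_onZr; exact: L2_integrable.
  have t00 : (0 : R) <= 0 <= T by rewrite lexx ltW.
  move=> t tT; have /andP[t0 tT'] := tT.
  have ivt : integrable_on 0 t v by apply: integrable_on_sub (L2_integrable Lv').
  have [_ l4] := tM X d _ t tT cXm (fun t N tT => (hM t tT N).1) ld cu_w4.
  have [_ lY] := tM Y (coef w) _ t tT cYm (fun t N tT => (hM t tT N).2) lw cut_w.
  split.
    apply: (cvgn_addE (cu_w t tT) (cu_w 0 t00) lY) => N.
    rewrite -mulrDr -big_split; congr (_ * _); apply: eq_bigr => m _ /=.
    have [-> _] := ode m t tT; have h1 : eig m != 0 :> R := e0 m.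
    by field; rewrite ?h1.
  have x01 : 0 <= xi <= 1 by have := hxi; lra.
  have lR : (intg 0 t v * fsum (coef w) N xi - 2 * \sum_(m < N) intg 0 t (X m) * d m)
     @[N --> \oo] --> intg 0 t v * w xi - intg 0 t (fun r => ip (u r) w4).
    by apply: cvgB l4; exact: cvgMr (V_fsum_cvg Vw x01).
  rewrite intgB; [|exact: integrable_onZr|]; last first.
    by have [] := tM X d _ t tT cXm (fun t N tT => (hM t tT N).1) ld cu_w4.
  rewrite intgZr//; apply: (cvgn_addE (cut_w t tT) (cut_w 0 t00) lR) => N.
  rewrite /fsum !mulr_sumr -sumrB -big_split; apply: eq_bigr => m _ /=.
  have [_ ->] := ode m t tT.
  rewrite intgB; [|exact: integrable_onZl|exact/integrable_onZl/iX].
  by rewrite !intgZl ?dE//; [ring|exact: iX].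
have t00 : (0 : R) <= 0 <= T by rewrite lexx ltW.
have X0 m : X m 0 = A m.
  rewrite /forced_mode /mode /cosine_amplitude /sine_amplitude /dot !intg_set1.
  by rewrite /ct /st !mulr0 cos0 sin0; ring.
have Y0 m : Y m 0 = B m.
  rewrite /forced_velocity /mode /cosine_amplitude /sine_amplitude /dot !intg_set1.
  by rewrite /ct /st !mulr0 cos0 sin0; ring.
split=> //.
- by exists du, d2u.
- by apply: coef_inj => // [|m]; [exact: Lu|rewrite cu// X0 -cy0 mulrAC divff// mul1r].
- by apply: coef_inj => // [|m]; [exact: Lut|rewrite cut// Y0 cy1].
Qed.

End Existence.

(** * Smooth cutoff functions *)

Section SmoothFunctions.
Context {R : realType}.
Implicit Types (f g : R -> R) (k n : nat) (x y a b : R).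

(** A chain of explicit derivatives makes closure under sums, products and affine changes an
    induction. Index k provides k + 1 derivatives, so that [derive1n k f] is itself derivable. *)
Fixpoint differentiable_upto k f : Prop :=
  exists2 f' : R -> R, (forall x, is_derive x 1 f (f' x)) &
    if k is k'.+1 then differentiable_upto k' f' else True.

Lemma differentiable_uptoW k f : differentiable_upto k.+1 f -> differentiable_upto k f.
Proof.
elim: k f => [|k IH] f [f' df hf]; first by exists f'.
by exists f' => //; exact: IH.
Qed.

Lemma differentiable_upto_derivable k f : differentiable_upto k f ->
  forall x, derivable (derive1n k f) x 1.
Proof.
elim: k f => [|k IH] f [f' df hf] x; first by rewrite derive1n0; case: (df x).
rewrite derive1Sn (_ : derive1 f = f'); first exact: IH.
by apply/funext => y; rewrite derive1E derive_val.
Qed.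

Lemma eq_is_derive f g (df dg : R) x : f =1 g -> df = dg ->
  is_derive x 1 f df -> is_derive x 1 g dg.
Proof. by move=> /funext -> ->. Qed.

Lemma differentiable_uptoD k f g : differentiable_upto k f ->
  differentiable_upto k g -> differentiable_upto k (fun x => f x + g x).
Proof.
elim: k f g => [|k IH] f g [f' df hf] [g' dg hg];
  exists (fun x => f' x + g' x) => //; try (by move=> x; exact: is_deriveD).
exact: IH.
Qed.

Lemma differentiable_uptoZ k c f : differentiable_upto k f ->
  differentiable_upto k (fun x => c * f x).
Proof.
elim: k f => [|k IH] f [f' df hf];
  exists (fun x => c * f' x) => //; try (by move=> x; exact: is_deriveZ).
exact: IH.
Qed.

Lemma differentiable_upto_cst k (c : R) : differentiable_upto k (fun=> c).
Proof.
elim: k c => [|k IH] c; exists (fun=> 0) => //; move=> x; exact: is_derive_cst.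
Qed.

Lemma differentiable_uptoM k f g : differentiable_upto k f ->
  differentiable_upto k g -> differentiable_upto k (fun x => f x * g x).
Proof.
have dM f1 g1 (f' g' : R -> R) : (forall x, is_derive x 1 f1 (f' x)) ->
    (forall x, is_derive x 1 g1 (g' x)) -> forall x,
    is_derive x 1 (fun x => f1 x * g1 x) (f1 x * g' x + f' x * g1 x).
  move=> d1 d2 x; have := is_deriveM (d1 x) (d2 x); apply: eq_is_derive => //.
  by rewrite /GRing.scale/= [f' x * _]mulrC.
elim: k f g => [|k IH] f g hf hg.
  move: hf hg => [f' df hf] [g' dg hg].
  by exists (fun x => f x * g' x + f' x * g x) => //; exact: dM.
have [hf0 hg0] := (differentiable_uptoW hf, differentiable_uptoW hg).
move: hf hg => [f' df hf] [g' dg hg].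
exists (fun x => f x * g' x + f' x * g x); first exact: dM.
by apply: differentiable_uptoD; exact: IH.
Qed.

Lemma differentiable_uptoX k f n : differentiable_upto k f ->
  differentiable_upto k (fun x => f x ^+ n).
Proof.
move=> hf; elim: n => [|n IH]; first exact: (differentiable_upto_cst k 1).
have := differentiable_uptoM hf IH.
by rewrite (_ : (fun x => f x * f x ^+ n) = (fun x => f x ^+ n.+1))//; apply/funext => x; rewrite exprS.
Qed.

Lemma differentiable_upto_affine k f a b : differentiable_upto k f ->
  differentiable_upto k (fun x => f (a * x + b)).
Proof.
elim: k f => [|k IH] f [f' df hf]; exists (fun x => a * f' (a * x + b)) => //.
- move=> x; rewrite mulrC; apply: (@is_derive1_comp _ f (fun x => a * x + b)) => //.
  by apply: is_derive_eq; rewrite /GRing.scale/= addr0 mulr1.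
- move=> x; rewrite mulrC; apply: (@is_derive1_comp _ f (fun x => a * x + b)) => //.
  by apply: is_derive_eq; rewrite /GRing.scale/= addr0 mulr1.
- by apply: differentiable_uptoZ; exact: IH.
Qed.

Lemma differentiable_upto_sin k c d e :
  differentiable_upto k (fun x => d * sin (c * x) + e * cos (c * x)).
Proof.
have D d' e' x : is_derive x 1 (fun x => d' * sin (c * x) + e' * cos (c * x))
    ((- (e' * c)) * sin (c * x) + (d' * c) * cos (c * x)).
  have h1 := is_deriveZ d' (is_derive_sinM c x); have h2 := is_deriveZ e' (is_derive_cosM c x).
  by have := is_deriveD h1 h2; apply: eq_is_derive => //; rewrite /GRing.scale/=; ring.
elim: k d e => [|k IH] d e.
  by exists (fun x => (- (e * c)) * sin (c * x) + (d * c) * cos (c * x)).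
by exists (fun x => (- (e * c)) * sin (c * x) + (d * c) * cos (c * x)).
Qed.

Lemma differentiable_upto_fsum k c N : differentiable_upto k (@fsum R c N).
Proof.
elim: N => [|N IH].
  rewrite (_ : fsum c 0 = (fun=> 0)); first exact: differentiable_upto_cst.
  by apply/funext => x; rewrite /fsum big_ord0.
rewrite (_ : fsum c N.+1 = (fun x => fsum c N x + 2 * c N * sn N x)); last first.
  by apply/funext => x; rewrite /fsum big_ord_recr.
apply: differentiable_uptoD => //; apply: differentiable_uptoZ.
have := differentiable_upto_sin k (freq N) 1 0.
by rewrite (_ : (fun x => _) = sn N)//; apply/funext => x; rewrite mul1r mul0r addr0.
Qed.

(* The functions [x^-k exp(-1/x)] on the right half-line, extended by 0. *)
Definition flat k x : R := if 0 < x then x^-1 ^+ k * expR (- x^-1) else 0.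

Lemma flat_ge0 k x : 0 <= flat k x.
Proof. by rewrite /flat; case: ifP => // x0; rewrite mulr_ge0 ?expR_ge0 ?exprn_ge0 ?invr_ge0// ltW. Qed.

(** With y = 1/x, exp(y) dominates y^(k+1)/(k+1)!. One spare power of x is what the difference
    quotient at 0 needs. *)
Lemma flat_le k x : 0 <= x -> flat k x <= k.+1`!%:R * x.
Proof.
rewrite /flat; case: ifP => [x0 _|_ x0]; last by rewrite mulr_ge0.
have y0 : 0 < x^-1 by rewrite invr_gt0.
have e0 := expR_gt0 x^-1; have f0 : 0 < k.+1`!%:R :> R by rewrite ltr0n fact_gt0.
rewrite expRN ler_pdivrMr//.
have := expR_ge1Dxn k (ltW y0) => h.
have {}h : x^-1 ^+ k.+1 / k.+1`!%:R <= expR x^-1 by move: h; lra.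
have {}h : x^-1 ^+ k.+1 <= expR x^-1 * k.+1`!%:R by rewrite -ler_pdivrMr.
have -> : x^-1 ^+ k = x^-1 ^+ k.+1 * x by rewrite exprSr divfK// gt_eqF.
by rewrite [leRHS]mulrAC; apply: ler_wpM2r; [exact: ltW|rewrite mulrC].
Qed.

(** The derivative stays inside the family, which makes smoothness an induction. At 0 the quotient
    [flat k h / h] is [flat k.+1 h], small by [flat_le]. *)
Lemma flat_derive k x : is_derive x 1 (flat k) (- k%:R * flat k.+1 x + flat k.+2 x).
Proof.
have [x0|x0|x0] := ltgtP x 0.
- rewrite /flat [0 < x]ltNge (ltW x0)/= mulr0 addr0.
  have h0 : is_derive x 1 (fun=> 0 : R) 0 by exact: is_derive_cst.
  apply: near_eq_is_derive h0.
  near=> y; rewrite /flat ifN// -leNgt ltW//; near: y.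
  exact: lt_nbhsl.
- rewrite /flat x0.
  have xn : x != 0 by rewrite gt_eqF.
  have dV : is_derive x 1 (fun y : R => y^-1) (- x ^- 2 *: 1).
    exact: (@is_deriveV _ id).
  have dE : is_derive x 1 (fun y => expR (- y^-1)) (expR (- x^-1) * x^-1 ^+ 2).
    apply: (@is_derive1_comp _ expR (fun y => - y^-1)).
    have := is_deriveN dV; apply: eq_is_derive => //.
    by rewrite /GRing.scale/= mulr1 opprK exprVn.
  have dX := is_deriveX k dV.
  have dM := is_deriveM dX dE.
  suff : is_derive x 1 (fun y => y^-1 ^+ k * expR (- y^-1))
      (- k%:R * (x^-1 ^+ k.+1 * expR (- x^-1)) + x^-1 ^+ k.+2 * expR (- x^-1)).
    apply: near_eq_is_derive; near=> y; rewrite /flat ifT//; near: y; exact: lt_nbhsr.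
  move: dM; apply: eq_is_derive; first by move=> y; rewrite !fctE.
  rewrite !fctE /GRing.scale/= mulr1; move: (expR _) => E.
  rewrite -exprVn; clear; case: k => [|k]; first by rewrite !expr0; ring.
  by rewrite /= !exprS; ring.
- rewrite x0 {x x0}; rewrite /flat ltxx mulr0 addr0.
  have d0 : (fun h : R => h^-1 *: (flat k (h *: 1 + 0) - flat k 0)) h @[h --> 0^'] --> (0 : R).
    apply/cvgrPdist_le => e e0; pose M : R := k.+2`!%:R.
    have M0 : 0 < M by rewrite ltr0n fact_gt0.
    exists (e / M); first by rewrite /= divr_gt0.
    move=> h /=; rewrite sub0r normrN => hh hn0.
    rewrite addr0 /GRing.scale/= mulr1 /flat ltxx subr0 sub0r normrN.
    case: ifP => [h0|_]; last by rewrite mulr0 normr0 ltW.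
    have := flat_le k.+1 (ltW h0); rewrite /flat h0 exprS -mulrA => hl.
    rewrite ger0_norm; last by rewrite !mulr_ge0 ?expR_ge0 ?exprn_ge0 ?invr_ge0// ltW.
    apply: le_trans hl _; rewrite mulrC -ler_pdivlMr// ltW//.
    by move: hh; rewrite gtr0_norm.
  have dd : derivable (flat k) 0 1 by apply/cvg_ex; exists 0.
  by apply: DeriveDef => //; exact: cvg_lim d0.
Unshelve. all: by end_near. Qed.

Lemma flat_smooth j k : differentiable_upto j (flat k).
Proof.
elim: j k => [|j IH] k; exists (fun x => - k%:R * flat k.+1 x + flat k.+2 x) => //;
  try exact: flat_derive.
by apply: differentiable_uptoD => //; exact: differentiable_uptoZ.
Qed.

Lemma flat0_le1 x : flat 0 x <= 1.
Proof.
rewrite /flat; case: ifP => // x0; rewrite expr0 mul1r -expR0 ler_expR oppr_le0.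
by rewrite invr_ge0 ltW.
Qed.

(** Instead of a plateau, p_n in [0,1], positive inside the support, is replaced by 1 - (1 - p_n)^n:
    this tends to 1 at every interior point and keeps the support. The shift to n + 3 keeps the
    support interval nonempty. *)
Definition bump n x : R :=
  1 - (1 - flat 0 (x - n.+3%:R^-1) * flat 0 (1 - n.+3%:R^-1 - x)) ^+ n.

Let pr n x := flat 0 (x - n.+3%:R^-1) * flat 0 (1 - n.+3%:R^-1 - x).

Let pr01 n x : 0 <= pr n x <= 1.
Proof. by rewrite mulr_ge0 ?flat_ge0//= mulr_ile1 ?flat_ge0 ?flat0_le1. Qed.

Lemma bump_smooth j n : differentiable_upto j (bump n).
Proof.
rewrite (_ : bump n = (fun x => 1 + (-1) * (1 + (-1) * (flat 0 (1 * x + (- n.+3%:R^-1)) *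
   flat 0 ((-1) * x + (1 - n.+3%:R^-1)))) ^+ n)).
  apply: differentiable_uptoD; first exact: differentiable_upto_cst.
  apply: differentiable_uptoZ; apply: differentiable_uptoX.
  apply: differentiable_uptoD; first exact: differentiable_upto_cst.
  apply: differentiable_uptoZ; apply: differentiable_uptoM;
    by apply: differentiable_upto_affine; exact: flat_smooth.
apply/funext => x; rewrite /bump !mulN1r mul1r; congr (1 - (1 - flat 0 _ * flat 0 _) ^+ _).
by rewrite addrC.
Qed.

Lemma bump_bounds n x : 0 <= bump n x <= 1.
Proof.
have := pr01 n x; rewrite /bump -/(pr n x) => h.
have h1 : 0 <= (1 - pr n x) ^+ n by rewrite exprn_ge0//; lra.
have h2 : (1 - pr n x) ^+ n <= 1 by rewrite exprn_ile1//; lra.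
by lra.
Qed.

Lemma bump_support n x : ~~ (n.+3%:R^-1 <= x <= 1 - n.+3%:R^-1) -> bump n x = 0.
Proof.
move=> h; rewrite /bump; suff -> : flat 0 (x - n.+3%:R^-1) * flat 0 (1 - n.+3%:R^-1 - x) = 0.
  by rewrite subr0 expr1n subrr.
rewrite /flat !subr_gt0; move: h; rewrite negb_and -!ltNge => /orP[h|h].
  by rewrite [_ < x]ltNge (ltW h) mul0r.
by rewrite [x < _]ltNge (ltW h) mulr0.
Qed.

Lemma bump_cvg x : 0 < x < 1 -> bump n x @[n --> \oo] --> (1 : R).
Proof.
move=> x01; have cf : continuous (flat 0) by exact: is_derive_continuous (flat_derive 0).
pose c := flat 0 x * flat 0 (1 - x).
have c0 : 0 < c.
  by rewrite /c /flat subr_gt0; case/andP: x01 => -> ->; rewrite !expr0 !mul1r mulr_gt0 ?expR_gt0.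
have ch : (fun n => n.+3%:R^-1 : R) n @[n --> \oo] --> (0 : R).
  apply: cvg0_squeeze (@cvg_harmonic R) => n; first by rewrite invr_ge0.
  by rewrite /harmonic/= lef_pV2 ?posrE ?ltr0n// ler_nat; lia.
have cpr : pr n x @[n --> \oo] --> c.
  apply: cvgM.
    have h : (x - n.+3%:R^-1) @[n --> \oo] --> x.
      by rewrite -[X in _ --> X]subr0; apply: cvgB => //; exact: (@cvg_cst R^o).
    exact: continuous_cvg (cf x) h.
  have h : (1 - n.+3%:R^-1 - x) @[n --> \oo] --> 1 - x.
    apply: cvgB; last exact: (@cvg_cst R^o).
    by rewrite -[X in _ --> X]subr0; apply: cvgB => //; exact: (@cvg_cst R^o).
  exact: continuous_cvg (cf (1 - x)) h.
have c2 : 0 < c / 2 by rewrite divr_gt0.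
have c1 : c <= 1 by rewrite mulr_ile1 ?flat_ge0 ?flat0_le1.
have geo : (1 - c / 2) ^+ n @[n --> \oo] --> (0 : R).
  by apply: cvg_expr; rewrite ger0_norm; lra.
apply/cvgrPdist_le => e e0.
move/cvgrPdist_le : cpr => /(_ _ c2) hpr.
move/cvgrPdist_le : geo => /(_ _ e0) hgeo.
near=> n.
have h1 : `|c - pr n x| <= c / 2 by near: n.
have h2 : `|0 - (1 - c / 2) ^+ n| <= e by near: n.
rewrite /bump -/(pr n x) opprB addrCA subrr addr0.
have := pr01 n x => p01; have p1 : 0 <= 1 - pr n x by lra.
rewrite ger0_norm ?exprn_ge0//; apply: le_trans h2.
rewrite sub0r normrN ger0_norm ?exprn_ge0//; last lra.
by apply: lerXn2r; rewrite ?nnegrE//; move: h1; rewrite ler_norml; lra.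
Unshelve. all: by end_near. Qed.

End SmoothFunctions.

(** * The space F' in terms of coefficients *)

Section DualSpace.
Context {R : realType}.
Implicit Types (f g p : R -> R) (m n k j N : nat) (x t : R).

Lemma testD_beam_test p : testD p -> beam_test p.
Proof.
move=> [dp [a [b [a0 b1 p0]]]].
have D j x : is_derive x 1 (derive1n j p) (derive1n j.+1 p x).
  by apply: DeriveDef; [exact: dp|rewrite derive1nS derive1E].
have z j x : ~~ (a <= x <= b) -> derive1n j p x = 0.
  elim: j x => [|j IH] x hx; first by rewrite derive1n0 p0.
  have h0 : is_derive x 1 (fun=> 0 : R) 0 by exact: is_derive_cst.
  have h1 : is_derive x 1 (derive1n j p) 0.
    apply: near_eq_is_derive h0; move: hx; rewrite negb_and -!ltNge => /orP[xa|bx].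
      near=> y; rewrite IH// negb_and -!ltNge; apply/orP; left; near: y; exact: lt_nbhsl.
    near=> y; rewrite IH// negb_and -!ltNge; apply/orP; right; near: y; exact: lt_nbhsr.
  by have /@derive_val <- := D j x; rewrite (@derive_val _ _ _ _ _ _ _ h1).
have n0 : ~~ (a <= 0 <= b) by rewrite leNgt a0.
have n1 : ~~ (a <= 1 <= b) by rewrite negb_and -!ltNge b1 orbT.
have p00 : p 0 = 0 by have := z 0%N 0 n0; rewrite derive1n0.
split=> //; [exact: is_derive_continuous (D 4%N)|exact: z|by split; exact: z].
Unshelve. all: by end_near. Qed.

Lemma bump_fsum_testD c N k : testD (fun x => bump k x * fsum c N x : R).
Proof.
split.
  move=> j; apply: differentiable_upto_derivable; apply: differentiable_uptoM.
    exact: bump_smooth.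
  exact: differentiable_upto_fsum.
have k3 : 0 < k.+3%:R^-1 :> R by rewrite invr_gt0 ltr0n.
exists k.+3%:R^-1, (1 - k.+3%:R^-1); split; [exact: k3|by rewrite gtrDl oppr_lt0|].
by move=> x hx; rewrite bump_support// mul0r.
Qed.

Lemma bump_mul_cvg f : continuous f ->
  dot 0 1 (fun x => bump k x * f x - f x) (fun x => bump k x * f x - f x)
    @[k --> \oo] --> (0 : R).
Proof.
move=> cf; have cb k : continuous (@bump R k).
  have [b' db _] := @bump_smooth R 0 k; exact: is_derive_continuous db.
(* The bumps vanish at 0 and 1, so the pointwise limit is not zero there; two points do not affect
   the integral. *)
pose l x := if 0 < x < 1 then 0 else (f x) ^+ 2.
have ep (x : R) : ~~ (0 < x < 1) -> 0 <= x <= 1 -> forall k, @bump R k x = 0.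
  move=> h x01 k; apply: bump_support; apply: contra h => /andP[h1 h2].
  have k3 : 0 < k.+3%:R^-1 :> R by rewrite invr_gt0 ltr0n.
  by move: k3 h1 h2; set q := k.+3%:R^-1 => *; lra.
have c2 k : continuous (fun x => (bump k x * f x - f x) * (bump k x * f x - f x)).
  move=> x; have h : {for x, continuous (fun x => bump k x * f x - f x)}.
    by apply: cvgB; [apply: cvgM; [exact: cb|exact: cf]|exact: cf].
  by apply: cvgM; exact: h.
have [||||il cl] := @dominated_intg R 0 1
    (fun k x => (bump k x * f x - f x) * (bump k x * f x - f x)) l (fun x => f x ^+ 2).
- by move=> k; apply: integrable_on_measurable; exact: continuous_integrable.
- by have [] := continuous_L2 0 1 cf.
- move=> x x01; rewrite /l; case: ifPn => h.
    rewrite (_ : 0 = (1 * f x - f x) * (1 * f x - f x)); last by ring.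
    have c1 : (bump k x * f x - f x) @[k --> \oo] --> 1 * f x - f x.
      apply: cvgB; last exact: (@cvg_cst R^o).
      by apply: cvgM; [exact: bump_cvg|exact: (@cvg_cst R^o)].
    by apply: cvgM; exact: c1.
  rewrite (_ : (fun k => _) = (fun=> f x ^+ 2)); first exact: (@cvg_cst R^o).
  by apply/funext => k; rewrite ep//; ring.
- move=> k x x01; have := bump_bounds k x => b01.
  rewrite ger0_norm -?expr2 ?sqr_ge0//.
  have -> : (bump k x * f x - f x) ^+ 2 = (1 - bump k x) ^+ 2 * f x ^+ 2 by ring.
  by apply: ler_piMl; [exact: sqr_ge0|rewrite exprn_ile1//; lra].
suff e : intg 0 1 l = 0 by move: cl; rewrite e.
rewrite -[RHS](intg0 0 1); apply: eq_intg_oo => //; first exact: integrable_on_cst.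
by move=> x x01; rewrite /l x01.
Qed.

Lemma sum_truncated (z : nat -> R) N N' : (forall m, (N <= m)%N -> z m = 0) ->
  \sum_(m < N') z m ^+ 2 <= \sum_(m < N) z m ^+ 2.
Proof.
move=> hz; have [NN|/ltnW NN] := leqP N' N; first exact: le_sum_sqr.
rewrite -(subnKC NN); elim: (N' - N)%N => [|j IH]; first by rewrite addn0.
by rewrite addnS big_ord_recr/= hz ?leq_addr// expr0n/= addr0.
Qed.

Lemma sn_sqr_le1 m x : sn m x ^+ 2 <= 1 :> R.
Proof.
by have := cos2Dsin2 (freq m * x : R); have := sqr_ge0 (cos (freq m * x : R)); rewrite /sn; lra.
Qed.

(** The direct inequality: at xi the sine series of a free solution is a trigonometric sum in time,
    bounded on (0, K period) by orthogonality; Fatou's lemma removes the truncation, and the 4 is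
    the square of the factor 2 of [fsum]. *)
Lemma free_trace_bound T K xi (u : R -> R -> R) (A B : nat -> R) M :
  0 < T -> 0 < xi < 1 -> covers T K -> (forall t, 0 <= t <= T -> V (u t)) ->
  (forall t m, 0 <= t <= T -> eig m * coef (u t) m = mode A B m t) ->
  (forall N, \sum_(m < N) ((A m / eig m) ^+ 2 + (B m / eig m) ^+ 2) * sn m xi ^+ 2 <= M) ->
  intg 0 T (fun t => u t xi ^+ 2) <= 4 * (bconst K * M).
Proof.
move=> T0 hxi cK Vu cu hM.
pose al m := A m / eig m * sn m xi; pose be m := B m / eig m * sn m xi.
have e0 m : eig m != 0 :> R by rewrite gt_eqF// eig_gt0.
have [||||_ //] := @fatou_intg R 0 T (fun N t => 4 * (tsum al be N t * tsum al be N t))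
   (fun t => u t xi ^+ 2) (4 * (bconst K * M)).
- by move=> N; apply: integrable_onZl; apply: L2_mul; exact: L2_tsum.
- by move=> N t _; rewrite -expr2 mulr_ge0 ?sqr_ge0.
- move=> t tT; have [du [d2u Vt]] := Vu t tT.
  have x01 : 0 <= xi <= 1 by lra.
  have h := V_fsum_cvg Vt x01; rewrite expr2.
  rewrite (_ : (fun N => _) = (fun N => fsum (coef (u t)) N xi * fsum (coef (u t)) N xi)).
    by apply: cvgM; exact: h.
  apply/funext => N.
  have -> : fsum (coef (u t)) N xi = 2 * tsum al be N t.
    rewrite /fsum /tsum mulr_sumr; apply: eq_bigr => m _.
    have -> : coef (u t) m = mode A B m t / eig m by rewrite -cu// mulrAC divff// mul1r.
    by rewrite /mode /al /be; ring.
  by ring.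
- move=> N; rewrite intgZl; last by apply: L2_mul; exact: L2_tsum.
  rewrite ler_pM2l//; have [_ TK] := cK.
  apply: le_trans (dot_tsum_le al be N cK (lexx 0) (ltW T0) (lexx T)) _.
  rewrite ler_pM2l ?(bconst_gt0 cK)//; apply: le_trans (hM N).
  by rewrite le_eqVlt; apply/orP; left; apply/eqP/eq_bigr => m _; rewrite /al /be; ring.
Qed.

(** Membership in F' is tested on compactly supported functions only, while the coefficients call
    for finite sine sums. L^2 approximation by cutoffs suffices, because the trace norm is
    controlled by the L^2 norms of the initial data. *)
Lemma dualF_pairing (T xi : R) (y0 y1 : R -> R) : 0 < T -> 0 < xi < 1 -> in_dualF T xi y0 y1 ->
  exists2 C : R, 0 <= C & forall (ga de : nat -> R) N,
    (\sum_(m < N) ga m * coef y1 m - \sum_(m < N) de m * (eig m * coef y0 m)) ^+ 2 <=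
    C * \sum_(m < N) (ga m ^+ 2 + de m ^+ 2) * sn m xi ^+ 2.
Proof.
move=> T0 hxi [Ly0 Ly1 [C hC]]; have [K cK] := exists_cover T.
have b0 := bconst_gt0 cK.
exists (2 * (C ^+ 2 * bconst K)); first by apply: mulr_ge0 => //; apply: mulr_ge0; [exact: sqr_ge0|exact: ltW].
move=> ga de N; set S0 := \sum_(m < N) _ * sn m xi ^+ 2.
(* An initial velocity enters the trace divided by [eig m]; this factor restores [de m]. *)
pose de' m := eig m * de m.
pose f := fsum ga N; pose g := fsum de' N.
pose p k x := bump k x * f x; pose q k x := bump k x * g x.
have Lf : L2 0 1 f := L2_fsum _ _ _ _; have Lg : L2 0 1 g := L2_fsum _ _ _ _.
have tp k : testD (p k) by exact: bump_fsum_testD.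
have tq k : testD (q k) by exact: bump_fsum_testD.
have Lt (h : R -> R) : testD h -> L2 0 1 h.
  by move=> th; have [Vh _ _] := beam_test_V (testD_beam_test th); have [] := V_with_L2 Vh.
pose dp k := dot 0 1 (fun x => p k x - f x) (fun x => p k x - f x).
pose dq k := dot 0 1 (fun x => q k x - g x) (fun x => q k x - g x).
have e0 m : eig m != 0 :> R by rewrite gt_eqF// eig_gt0.
have z2 : L2 0 T (fun=> 0 : R) by exact: L2_cst.
(* The trace sum of a cutoff datum exceeds twice that of the finite sum by at most their squared L^2
   distance, by Bessel. The factor r is 1 for positions and 1/eig for velocities. *)
have half (h h' : R -> R) (c r : nat -> R) N' : L2 0 1 h -> h' = fsum c N ->
   (forall m, r m ^+ 2 <= 1) ->
   \sum_(m < N') (coef h m * r m) ^+ 2 * sn m xi ^+ 2 <=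
   dot 0 1 (fun x => h x - h' x) (fun x => h x - h' x) + 2 * \sum_(m < N) (c m * r m) ^+ 2 * sn m xi ^+ 2.
  move=> Lh h'E r1; have Lh' : L2 0 1 h' by rewrite h'E; exact: L2_fsum.
  pose z m := coef h' m * (r m * sn m xi).
  have cz m : (N <= m)%N -> z m = 0 by rewrite /z h'E coef_fsum leqNgt => /negbTE ->; rewrite mul0r.
  have -> : \sum_(m < N) (c m * r m) ^+ 2 * sn m xi ^+ 2 = \sum_(m < N) z m ^+ 2.
    by apply: eq_bigr => m _; rewrite /z h'E coef_fsum ltn_ord; ring.
  have := sum_truncated N' cz; have := bessel N' (L2B Lh Lh') => h1 h2.
  apply: le_trans (_ : \sum_(m < N') (2 * (coef (fun x => h x - h' x) m) ^+ 2 + 2 * z m ^+ 2) <= _).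
    apply: ler_sum => m _; rewrite coef_sub// /z.
    have s1 := sn_sqr_le1 m xi; have s0 := sqr_ge0 (sn m xi : R).
    have w1 : (r m * sn m xi) ^+ 2 <= 1 by rewrite exprMn mulr_ile1 ?sqr_ge0.
    rewrite -exprMn -mulrA; move: (r m * sn m xi) w1 => w w1.
    set a := coef h m; set b := coef h' m.
    have : ((a - b) * w) ^+ 2 <= (a - b) ^+ 2 by rewrite exprMn ler_piMr ?sqr_ge0.
    have := sqr_ge0 ((a - b) * w - b * w); lra.
  by rewrite big_split/= -!mulr_sumr; move: h1 h2; lra.
have key k : (dot 0 1 y1 (p k) - dot 0 1 y0 (q k)) ^+ 2 <=
    C ^+ 2 * (4 * (bconst K * (dp k + dq k + 2 * S0))).
  have [Vp _ _] := beam_test_V (testD_beam_test (tp k)).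
  have lA := eig_coef_ell2 Vp; have lB := coef_ell2 (Lt _ (tq k)).
  have [u [ut [hu cu]]] := @forced_solution R T xi (fun=> 0) (p k) (q k) _ _
    T0 hxi z2 lA lB (Lt _ (tp k)) (Lt _ (tq k)) (fun=> erefl) (fun=> erefl).
  have src : pointwise_source xi (fun=> 0) = (fun _ _ => 0 : R).
    by apply/funext => t; apply/funext => w; rewrite /pointwise_source mul0r.
  rewrite src in hu; have := hC _ _ _ _ (tp k) (tq k) hu => hn.
  have {}hn : (dot 0 1 y1 (p k) - dot 0 1 y0 (q k)) ^+ 2 <= C ^+ 2 * normF T xi u ^+ 2.
    rewrite -exprMn -real_normK ?num_real// -[leRHS]real_normK ?num_real//.
    rewrite lerXn2r ?nnegrE//; apply: le_trans hn _; exact: ler_norm.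
  apply: le_trans hn _; rewrite ler_wpM2l ?sqr_ge0//.
  rewrite sqr_sqrtr; last by apply: intg_ge0 => t _; exact: sqr_ge0.
  apply: (free_trace_bound T0 hxi cK) => [t tT|t m tT|N'].
  - by have [[du [d2u [h _]]] _ _ _ _] := hu; exists (du t), (d2u t); exact: h.
  - have [-> _] := cu t m tT.
    rewrite /forced_mode /mode /cosine_amplitude /sine_amplitude.
    have z (h : R -> R) : dot 0 t (fun=> 0) h = 0.
      by apply: etrans (intg0 0 t); apply: eq_intg => x _; rewrite mul0r.
    by rewrite !z !mulr0 subr0 addr0.
  - have h1 := half (p k) f ga (fun=> 1) N' (Lt _ (tp k)) erefl.
    have h2 := half (q k) g de' (fun m => (eig m)^-1) N' (Lt _ (tq k)) erefl.
    have i1 m : (eig m)^-1 ^+ 2 <= 1 :> R.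
      by rewrite exprn_ile1 ?invr_ge0 ?(ltW (eig_gt0 _))// invf_le1 ?eig_gt0// eig_ge1.
    have {}h2 := h2 i1; have i2 (m : nat) : 1 ^+ 2 <= 1 :> R by rewrite expr1n.
    have {}h1 := h1 i2; have -> : S0 = \sum_(m < N) (ga m * 1) ^+ 2 * sn m xi ^+ 2 +
        \sum_(m < N) (de' m / eig m) ^+ 2 * sn m xi ^+ 2.
      rewrite -big_split; apply: eq_bigr => m _ /=; rewrite /de' mulr1.
      by rewrite [eig m * _]mulrC mulfK// -mulrDl.
    apply: le_trans (_ : \sum_(m < N') (coef (p k) m * 1) ^+ 2 * sn m xi ^+ 2 +
        \sum_(m < N') (coef (q k) m / eig m) ^+ 2 * sn m xi ^+ 2 <= _); last first.
      by rewrite mulrDr addrACA; exact: lerD h1 h2.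
    rewrite -big_split le_eqVlt; apply/orP; left; apply/eqP/eq_bigr => m _ /=.
    by rewrite [eig m * _]mulrC mulfK// mulr1 -mulrDl.
have cdp : dp k @[k --> \oo] --> (0 : R) by apply: bump_mul_cvg; exact: fsum_continuous.
have cdq : dq k @[k --> \oo] --> (0 : R) by apply: bump_mul_cvg; exact: fsum_continuous.
have cp : dot 0 1 y1 (p k) @[k --> \oo] --> dot 0 1 y1 f.
  have := cvg_dot (fun k => Lt _ (tp k)) Lf Ly1 cdp.
  rewrite dotC (_ : (fun k => dot 0 1 (p k) y1) = (fun k => dot 0 1 y1 (p k)))//.
  by apply/funext => k; rewrite dotC.
have cq : dot 0 1 y0 (q k) @[k --> \oo] --> dot 0 1 y0 g.
  have := cvg_dot (fun k => Lt _ (tq k)) Lg Ly0 cdq.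
  rewrite dotC (_ : (fun k => dot 0 1 (q k) y0) = (fun k => dot 0 1 y0 (q k)))//.
  by apply/funext => k; rewrite dotC.
have cb : (dot 0 1 y1 (p k) - dot 0 1 y0 (q k)) @[k --> \oo] --> dot 0 1 y1 f - dot 0 1 y0 g.
  exact: cvgB cp cq.
have cr : (C ^+ 2 * (4 * (bconst K * (dp k + dq k + 2 * S0)))) @[k --> \oo] -->
    C ^+ 2 * (4 * (bconst K * (0 + 0 + 2 * S0))).
  by do 3 apply: cvgMr; apply: cvgD; [exact: cvgD|exact: (@cvg_cst R^o)].
have cd : (C ^+ 2 * (4 * (bconst K * (dp k + dq k + 2 * S0))) -
    (dot 0 1 y1 (p k) - dot 0 1 y0 (q k)) * (dot 0 1 y1 (p k) - dot 0 1 y0 (q k)))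
    @[k --> \oo] --> C ^+ 2 * (4 * (bconst K * (0 + 0 + 2 * S0))) -
    (dot 0 1 y1 f - dot 0 1 y0 g) * (dot 0 1 y1 f - dot 0 1 y0 g).
  by apply: cvgB cr _; apply: cvgM; exact: cb.
have h : 0 <= C ^+ 2 * (4 * (bconst K * (0 + 0 + 2 * S0))) -
    (dot 0 1 y1 f - dot 0 1 y0 g) * (dot 0 1 y1 f - dot 0 1 y0 g).
  by apply: (cvgn_ge cd) => k; rewrite subr_ge0 -expr2; exact: key.
move: h; rewrite !dot_fsum//.
have -> : \sum_(m < N) de' m * coef y0 m = \sum_(m < N) de m * (eig m * coef y0 m).
  by apply: eq_bigr => m _; rewrite /de'; ring.
by move: (\sum_(m < N) _) (\sum_(m < N) _) => a b; lra.
Qed.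

Theorem dualF_ell2 T xi y0 y1 : 0 < T -> 0 < xi < 1 -> strategic xi ->
  in_dualF T xi y0 y1 -> exists M : R, forall N,
  \sum_(m < N) (coef y1 m ^+ 2 + (eig m * coef y0 m) ^+ 2) / sn m xi ^+ 2 <= M.
Proof.
move=> T0 hxi hs hy; have [C C0 hC] := dualF_pairing T0 hxi hy.
exists C => N; pose s2 m : R := sn m xi ^+ 2.
have s0 m : s2 m != 0 by rewrite sqrf_eq0; exact: hs.
(* The extremal choice: with it the pairing and the weighted square sum both equal S, so the
   inequality reads S^2 <= C S. *)
have := hC (fun m => coef y1 m / s2 m) (fun m => - (eig m * coef y0 m) / s2 m) N.
set S := \sum_(m < N) (_ + _) / _.
have -> : \sum_(m < N) coef y1 m / s2 m * coef y1 m -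
    \sum_(m < N) - (eig m * coef y0 m) / s2 m * (eig m * coef y0 m) = S.
  by rewrite -sumrB; apply: eq_bigr => m _; rewrite -/(s2 m); ring.
have -> : \sum_(m < N) ((coef y1 m / s2 m) ^+ 2 + (- (eig m * coef y0 m) / s2 m) ^+ 2) *
    sn m xi ^+ 2 = S.
  by apply: eq_bigr => m _; rewrite -/(s2 m); have h := s0 m; field.
have S0 : 0 <= S.
  by apply: sumr_ge0 => m _; rewrite mulr_ge0 ?invr_ge0 ?addr_ge0 ?sqr_ge0.
have [->|Sn] := eqVneq S 0; first by [].
have Sp : 0 < S by rewrite lt_neqAle eq_sym Sn.
by rewrite expr2 ler_pM2r.
Qed.

End DualSpace.

(** * Uniform energy bound for the internal controls *)

Section InternalControl.
Context {R : realType}.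
Implicit Types (f : R -> R) (m N K : nat) (t x : R).
Variables (T xi : R) (y0 y1 : R -> R) (M : R).
Hypotheses (hT : 2 <= T) (hxi : 0 < xi < 1) (hs : strategic xi).
Hypotheses (Ly0 : L2 0 1 y0) (Ly1 : L2 0 1 y1).
Hypothesis hM : forall N, \sum_(m < N)
  (coef y1 m ^+ 2 + (eig m * coef y0 m) ^+ 2) / sn m xi ^+ 2 <= M.
Variables (n : nat) (phi psi : R -> R -> R).
Hypotheses (n0 : (0 < n)%N) (hn : n%:R^-1 < 1 - xi).
Hypothesis hphi : hom_solution T phi.
Hypothesis hpsi : controlled_solution T
  (internal_source xi n (fun t x => n%:R * phi t x)) y0 y1 psi.

Local Notation rho := (window xi n).
Let T0 : 0 < T. Proof. by have := hT; lra. Qed.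
Let nh : n%:R * n%:R^-1 = 1 :> R. Proof. by rewrite divff// pnatr_eq0 -lt0n. Qed.
Let hrho : weight rho n%:R := window_weight xi n0 nh.
Let pT : period <= T. Proof. by have := hT; have := @period_le2 R; lra. Qed.

Lemma internal_source_window t m :
  internal_source xi n (fun t x => n%:R * phi t x) t (sn m) = wdot rho (phi t) (sn m).
Proof. by apply: eq_intg => x _; rewrite /window; ring. Qed.

(* Energy identity: testing the equation of [psi] with [phi] gives
   [2 sum (eig y0_m be_m - y1_m al_m)], which Young's inequality absorbs since
   [sn m xi ^+ 2] is at most 8 times its mean over the window. *)
Theorem internal_control : exists al be : nat -> R,
  [/\ ell2 al, ell2 be,
      forall t m, 0 <= t <= T -> coef (phi t) m = mode al be m t,
      intg 0 T (fun t => wdot rho (phi t) (phi t)) <= 16 * M / period &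
   [/\ forall N, 2 * period * \sum_(m < N) (al m ^+ 2 + be m ^+ 2) * wdot rho (sn m) (sn m) <=
         16 * M / period,
       forall m, dot 0 T (fun t => wdot rho (phi t) (sn m)) (ct m) = - coef y1 m,
       forall m, dot 0 T (fun t => wdot rho (phi t) (sn m)) (st m) = eig m * coef y0 m &
       forall t m, 0 <= t <= T -> eig m * coef (psi t) m =
         ct m t * dot t T (fun t => wdot rho (phi t) (sn m)) (st m)
         - st m t * dot t T (fun t => wdot rho (phi t) (sn m)) (ct m)]].
Proof.
have [[Lphi cphi0] _] := hphi.
have [al [be [lal lbe cphi]]] := hom_modes hT hphi.
have T0' := T0; have hrho' := hrho; have pT' := pT; have p0 := @period_gt0 R.
have Lh m := wdot_modal_L2 (ltW T0') lal lbe Lphi cphi hrho' (L2_sn 0 1 m).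
have moments m : _ := @controlled_modes R T _ y0 y1 psi m T0' Ly0 Ly1 hpsi.
have src m : internal_source xi n (fun t x => n%:R * phi t x) ^~ (sn m) =
    (fun t => wdot rho (phi t) (sn m)).
  by apply/funext => t; exact: internal_source_window.
have {}moments m := moments m (eq_ind_r _ (L2_integrable (Lh m)) (src m)).
exists al, be.
have m1 m : dot 0 T (fun t => wdot rho (phi t) (sn m)) (ct m) = - coef y1 m.
  by have [<- _ _] := moments m; apply: eq_intg => t _; rewrite internal_source_window.
have m2 m : dot 0 T (fun t => wdot rho (phi t) (sn m)) (st m) = eig m * coef y0 m.
  by have [_ <- _] := moments m; apply: eq_intg => t _; rewrite internal_source_window.
have lower N := energy_lower (ltW T0') lal lbe Lphi cphi hrho' N pT'.
set E := intg 0 T _ in lower *.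
(* Absorption: E is a finite number and E <= E/2 + 8 M / period. *)
have EM : E <= 16 * M / period.
  have h (N : nat) : 2 * \sum_(m < N) (al m * dot 0 T (fun t => wdot rho (phi t) (sn m)) (ct m) +
     be m * dot 0 T (fun t => wdot rho (phi t) (sn m)) (st m)) <= E / 2 + 8 * M / period.
    rewrite mulr_sumr; apply: le_trans (_ : \sum_(m < N) (period *
      ((al m ^+ 2 + be m ^+ 2) * wdot rho (sn m) (sn m)) + 8 / period *
      ((coef y1 m ^+ 2 + (eig m * coef y0 m) ^+ 2) / sn m xi ^+ 2)) <= _).
      apply: ler_sum => m _; rewrite m1 m2.
      have w8 : sn m xi ^+ 2 <= 8 * wdot rho (sn m) (sn m).
        rewrite (window_mean_sin2 hxi n0 nh hn); apply: sin2_le_mean.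
        by rewrite mulr_gt0 ?freq_gt0// invr_gt0 ltr0n.
      have s0 : sn m xi != 0 := hs m.
      (* The weight period/8 is chosen so that, after sin(mu_m xi)^2 is replaced by 8 times its
         window mean, the first sum is at most E/2 by [energy_lower]. *)
      have young (a y : R) : 2 * (a * y) <=
          period / 8 * (a * sn m xi) ^+ 2 + 8 / period * (y / sn m xi) ^+ 2.
        have pn : period != 0 :> R by rewrite gt_eqF.
        have -> : period / 8 * (a * sn m xi) ^+ 2 + 8 / period * (y / sn m xi) ^+ 2 =
            2 * (a * y) + 8 / period * (period / 8 * (a * sn m xi) - y / sn m xi) ^+ 2.
          by field; rewrite ?pn ?s0.
        by rewrite lerDl mulr_ge0 ?sqr_ge0// divr_ge0// ltW.
      have y1' := young (al m) (- coef y1 m); have y2' := young (be m) (eig m * coef y0 m).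
      rewrite mulrDr; apply: le_trans (lerD y1' y2') _.
      have -> : period / 8 * (al m * sn m xi) ^+ 2 + 8 / period * (- coef y1 m / sn m xi) ^+ 2 +
         (period / 8 * (be m * sn m xi) ^+ 2 + 8 / period * (eig m * coef y0 m / sn m xi) ^+ 2) =
         period / 8 * ((al m ^+ 2 + be m ^+ 2) * sn m xi ^+ 2) +
         8 / period * ((coef y1 m ^+ 2 + (eig m * coef y0 m) ^+ 2) / sn m xi ^+ 2).
        have pn : period != 0 :> R by rewrite gt_eqF.
        by field; rewrite ?pn ?s0.
      rewrite lerD2r -mulrA ler_pM2l// mulrCA ler_wpM2l ?addr_ge0 ?sqr_ge0//.
      by rewrite mulrC ler_pdivrMr// mulrC.
    rewrite big_split/= -!mulr_sumr.
    have := lower N; have : 8 / period * \sum_(i < N) (coef y1 i ^+ 2 + (eig i * coef y0 i) ^+ 2) / sn i xi ^+ 2 <= 8 / period * M.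
      by apply: ler_wpM2l => //; rewrite divr_ge0// ltW.
    have -> : 8 / period * M = 8 * M / period by rewrite mulrAC.
    move: (8 * M / period) (8 / period * _) => p q; set s := \sum_(i < N) _.
    by rewrite -mulrA; move: (period * s) => r; lra.
  have := energy_upper (ltW T0') lal lbe Lphi cphi hrho' h.
  rewrite -/E; have -> : 16 * M / period = 2 * (8 * M / period) by ring.
  by move: (8 * M / period) => p; lra.
split=> //; split=> //; first by move=> N; exact: le_trans (lower N) EM.
move=> t m tT; have [_ _ h] := moments m; rewrite (h t tT).
have e (g : R -> R) :
    intg t T (fun s => internal_source xi n (fun t x => n%:R * phi t x) s (sn m) * g s) =
    dot t T (fun s => wdot rho (phi s) (sn m)) g.
  by apply: eq_intg => s _; rewrite internal_source_window.
by rewrite (e (st m)) (e (ct m)).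
Qed.

End InternalControl.

(** * Averages of the controls over the window *)

Section WindowAverages.
Context {R : realType}.
Implicit Types (f theta : R -> R) (m N K : nat) (t x : R).
Variables (T xi E : R) (n : nat) (phi : R -> R -> R) (al be : nat -> R).
Hypotheses (T0 : 0 <= T) (hxi : 0 < xi < 1) (n0 : (0 < n)%N) (hn : n%:R^-1 < 1 - xi).
Hypotheses (lal : ell2 al) (lbe : ell2 be).
Hypothesis Lphi : forall t, 0 <= t <= T -> L2 0 1 (phi t).
Hypothesis cphi : forall t m, 0 <= t <= T -> coef (phi t) m = mode al be m t.
Local Notation rho := (window xi n).
Hypothesis hE : intg 0 T (fun t => wdot rho (phi t) (phi t)) <= E.

Let nh : n%:R * n%:R^-1 = 1 :> R. Proof. by rewrite divff// pnatr_eq0 -lt0n. Qed.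
Let hrho : weight rho n%:R := window_weight xi n0 nh.

Definition average t : R := wdot rho (phi t) (fun=> 1).

Lemma average_L2 : L2 0 T average.
Proof. exact: (wdot_modal_L2 T0 lal lbe Lphi cphi hrho (L2_cst 0 1 1)). Qed.

Lemma average_bound : dot 0 T average average <= E.
Proof.
apply: le_trans hE; have Lg := average_L2; apply: le_intg.
- exact: L2_mul.
- exact: (energy_modal_integrable T0 lal lbe Lphi cphi hrho).
- by move=> t tT; rewrite -expr2; exact: (window_sqr_mean hxi n0 nh hn (Lphi tT)).
Qed.

(** Averaging the truncated modal sums gives trigonometric sums in time that converge uniformly to
    the average. *)
Lemma average_span : exists (a b : nat -> R),
  dot 0 T (fun t => tsum a b N t - average t) (fun t => tsum a b N t - average t)
    @[N --> \oo] --> (0 : R).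
Proof.
pose a m := 2 * al m * wdot rho (sn m) (fun=> 1).
pose b m := 2 * be m * wdot rho (sn m) (fun=> 1).
exists a, b; have L1 := L2_cst 0 1 (1 : R); have T0' := T0.
have h := wdot_modal_unif lal lbe Lphi cphi hrho L1.
have e N : tsum a b N = (fun t => wdot rho (fsum (mode al be ^~ t) N) (fun=> 1)).
  apply/funext => t; rewrite wdotC (wdot_fsumr hrho)// /tsum mulr_sumr.
  by apply: eq_bigr => m _; rewrite /mode /a /b [wdot rho (fun=> 1) _]wdotC; ring.
have [|_ _] := @unif_cvg_L2 _ 0 T _ _ T0' _ h.
  by move=> N; exact: (continuous_wdot_modal hrho L1).
have -> // : (fun N => dot 0 T (fun t => tsum a b N t - average t)
    (fun t => tsum a b N t - average t)) = (fun N => dot 0 T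
  (fun t => wdot rho (fsum (mode al be ^~ t) N) (fun=> 1) - wdot rho (phi t) (fun=> 1))
  (fun t => wdot rho (fsum (mode al be ^~ t) N) (fun=> 1) - wdot rho (phi t) (fun=> 1))).
by apply/funext => N; rewrite e.
Qed.

(** The distributed source acts on mode m like the average placed at [xi], up to O(1/n) for fixed m.
    Subintervals are allowed because the state at time t involves the moments over (t,T). *)
Lemma average_near theta m c d : 0 <= c -> d <= T -> L2 c d theta ->
  (dot c d (fun t => wdot rho (phi t) (sn m)) theta - sn m xi * dot c d average theta) ^+ 2 <=
  (freq m / n%:R) ^+ 2 * E * dot c d theta theta.
Proof.
move=> c0 dT Lt; have Lg := average_L2.
have Lh := wdot_modal_L2 T0 lal lbe Lphi cphi hrho (L2_sn 0 1 m).
have Lg' : L2 c d average by apply: L2_sub Lg.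
have Lh' : L2 c d (fun t => wdot rho (phi t) (sn m)) by apply: L2_sub Lh.
pose r t := wdot rho (phi t) (sn m) - sn m xi * average t.
have Lr : L2 0 T r by apply: L2B => //; exact: L2Zl.
have Lr' : L2 c d r by apply: L2_sub Lr.
have -> : dot c d (fun t => wdot rho (phi t) (sn m)) theta - sn m xi * dot c d average theta =
    dot c d r theta.
  by rewrite /r dotBl ?dotZl//; exact: L2Zl.
apply: le_trans (CauchySchwarz Lr' Lt) _; rewrite ler_wpM2r ?dot_ge0//.
(* For d < c the segment is empty and the squared norm of the difference is 0. *)
have [cd|dc] := leP c d; last first.
  have -> : dot c d r r = 0.
    rewrite /dot /intg (_ : `[c, d]%classic = set0); first exact: Rintegral_set0.
    by apply/seteqP; split=> x //= /itvccP; lra.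
  rewrite mulr_ge0 ?sqr_ge0//; apply: le_trans hE; apply: intg_ge0 => t _.
  exact: (wdot_ge0 hrho).
apply: le_trans (_ : dot 0 T r r <= _).
  by apply: le_intg_sub => //; [exact: L2_mul|move=> x _; rewrite -expr2 sqr_ge0].
have ie := energy_modal_integrable T0 lal lbe Lphi cphi hrho.
apply: le_trans (_ : intg 0 T (fun t => (freq m / n%:R) ^+ 2 * wdot rho (phi t) (phi t)) <= _).
  apply: le_intg; [exact: L2_mul|exact: integrable_onZl|move=> t tT].
  rewrite -expr2; exact: (window_sn_near hxi n0 nh hn m (Lphi tT)).
by rewrite intgZl// ler_wpM2l// sqr_ge0.
Qed.

End WindowAverages.

Section Restriction.
Context {R : realType}.
Implicit Types (f g : R -> R) (a b c d x : R).

Lemma L2_restrict a b c d f : L2 a b f ->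
  L2 a b (fun x => \1_(`[c, d]%classic : set R) x * f x).
Proof.
move=> Lf; have mi : measurable_fun `[a, b] (\1_(`[c, d]%classic : set R) : R -> R).
  by apply: measurable_indic; exact: measurable_itv.
apply: (@L2_bounded_mul _ _ _ _ _ 1) => //.
by move=> x _; rewrite indicE; case: (_ \in _); rewrite ?normr1 ?normr0.
Qed.

Lemma dot_restrict a b c d f g : a <= c -> c <= d -> d <= b -> L2 a b f -> L2 a b g ->
  dot a b (fun x => \1_(`[c, d]%classic : set R) x * f x) g = dot c d f g.
Proof.
move=> ac cd db Lf Lg; pose F x := \1_(`[c, d]%classic : set R) x * f x * g x.
have iF : integrable_on a b F by exact: (L2_mul (L2_restrict c d Lf) Lg).
have F0 x : ~~ (c <= x <= d) -> F x = 0.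
  move=> h; rewrite /F indicE memNset ?mul0r// => /itvccP h'.
  by rewrite h' in h.
have i0 a' b' : integrable_on a' b' (fun=> 0 : R) by exact: integrable_on_cst.
have -> : dot c d f g = intg c d F.
  by apply: eq_intg => x xcd; rewrite /F indicE mem_set ?mul1r//; exact/itvccP.
rewrite /dot -/(intg a b F) (@intg_cat _ c a b)//; last by rewrite ac (le_trans cd).
rewrite (@intg_cat _ d c b) ?cd//; last by apply: integrable_on_sub iF.
have -> : intg a c F = 0.
  rewrite -[RHS](intg0 a c); apply: eq_intg_oo => //; first by apply: integrable_on_sub iF => //; exact: le_trans db.
  by move=> x /andP[_ xc]; apply: F0; rewrite negb_and -!ltNge xc.
have -> : intg d b F = 0.
  rewrite -[RHS](intg0 d b); apply: eq_intg_oo => //; first by apply: integrable_on_sub iF => //; exact: le_trans cd.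
  by move=> x /andP[dx _]; apply: F0; rewrite negb_and -!ltNge dx orbT.
by rewrite add0r addr0.
Qed.

End Restriction.

(** * The moment problem in time and weak convergence in the closed span *)

Section TimeControl.
Context {R : realType}.
Implicit Types (al be p q : nat -> R) (f g v w theta : R -> R) (m n k N K : nat) (a b t T e : R).

Lemma tsum_sub al be N N' t : (N <= N')%N -> tsum al be N' t - tsum al be N t =
  tsum (fun m => if (N <= m)%N then al m else 0) (fun m => if (N <= m)%N then be m else 0) N' t.
Proof.
move=> /subnKC <-; elim: (N' - N)%N => [|j IH].
  rewrite addn0 subrr /tsum big1// => m _; rewrite /mode leqNgt ltn_ord.
  by rewrite !mul0r addr0.
by rewrite addnS /tsum !big_ord_recr/= addrAC IH /mode leq_addr.
Qed.

Definition trigonometric w := exists al be N, w = tsum al be N.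

Lemma trigonometric_L2 a b w : trigonometric w -> L2 a b w.
Proof. by move=> [al [be [N ->]]]; exact: L2_tsum. Qed.

Lemma tsum_widen al be N N' : (N <= N')%N -> tsum al be N =
  tsum (fun m => if (m < N)%N then al m else 0) (fun m => if (m < N)%N then be m else 0) N'.
Proof.
move=> NN; apply/funext => t; rewrite /tsum (big_ord_widen N' (fun m => mode al be m t) NN) big_mkcond.
by apply: eq_bigr => m _; rewrite /mode; case: ifP => //; rewrite !mul0r addr0.
Qed.

Lemma trigonometric_lin (c : R) u w : trigonometric u -> trigonometric w ->
  trigonometric (fun t => c * u t + w t).
Proof.
move=> [al [be [N ->]]] [ga [de [N' ->]]].
rewrite (tsum_widen _ _ (leq_maxl N N')) (tsum_widen ga de (leq_maxr N N')).
move: (fun m => if (m < N)%N then al m else 0) (fun m => if (m < N)%N then be m else 0)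
  (fun m => if (m < N')%N then ga m else 0) (fun m => if (m < N')%N then de m else 0) => a1 b1 a2 b2.
exists (fun m => c * a1 m + a2 m), (fun m => c * b1 m + b2 m), (maxn N N').
apply/funext => t; rewrite /tsum mulr_sumr -big_split; apply: eq_bigr => m _ /=.
by rewrite /mode; ring.
Qed.

Lemma trigonometric0 : trigonometric (fun=> 0 : R).
Proof. by exists (fun=> 0), (fun=> 0), 0%N; apply/funext => t; rewrite /tsum big_ord0. Qed.

Lemma trigonometric_mode m : trigonometric (@ct R m) /\ trigonometric (@st R m).
Proof.
split.
  exists (fun j => (j == m)%:R), (fun=> 0), m.+1; apply/funext => t.
  rewrite /tsum big_ord_recr/= big1 ?add0r; first by rewrite /mode eqxx mul1r mul0r addr0.
  by move=> i _; rewrite /mode ltn_eqF// !mul0r addr0.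
exists (fun=> 0), (fun j => (j == m)%:R), m.+1; apply/funext => t.
rewrite /tsum big_ord_recr/= big1 ?add0r; first by rewrite /mode eqxx mul1r mul0r add0r.
by move=> i _; rewrite /mode ltn_eqF// !mul0r addr0.
Qed.

(** The L^2(0,T) closure of the trigonometric sums, expressed by sequences as delivered by
    [L2_projection]. *)
Definition in_span T v := exists w : nat -> R -> R, (forall k, trigonometric (w k)) /\
  dot 0 T (fun t => w k t - v t) (fun t => w k t - v t) @[k --> \oo] --> (0 : R).

Lemma tsum_cvg T p q : 0 < T -> ell2 p -> ell2 q -> exists w, L2 0 T w /\
  dot 0 T (fun t => tsum p q N t - w t) (fun t => tsum p q N t - w t) @[N --> \oo] --> (0 : R).
Proof.
move=> T0 lp lq; have [K cK] := exists_cover T; have b0 := bconst_gt0 cK.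
apply: L2_complete => [N|e e0]; first exact: L2_tsum.
have e1 : 0 < e / bconst K / 2 by apply: divr_gt0 => //; exact: divr_gt0.
have [N1 h1] := ell2_tail lp e1; have [N2 h2] := ell2_tail lq e1.
have key N N' : (maxn N1 N2 <= N)%N -> (N <= N')%N ->
    dot 0 T (fun t => tsum p q N' t - tsum p q N t) (fun t => tsum p q N' t - tsum p q N t) <= e.
  rewrite geq_max => /andP[n1 n2] NN.
  pose p' m := if (N <= m)%N then p m else 0; pose q' m := if (N <= m)%N then q m else 0.
  rewrite (@eq_dot _ _ _ _ (tsum p' q' N') _ (tsum p' q' N')); try by move=> t _; rewrite tsum_sub.
  apply: le_trans (dot_tsum_le p' q' N' cK (lexx 0) (ltW T0) (lexx T)) _.
  rewrite mulrC -ler_pdivlMr//.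
  have tl (z : nat -> R) (z' := fun m => if (N <= m)%N then z m else 0) :
      \sum_(m < N') z' m ^+ 2 = \sum_(m < N') z m ^+ 2 - \sum_(m < N) z m ^+ 2.
    rewrite -(subnKC NN); elim: (N' - N)%N => [|j IH].
      rewrite addn0 subrr big1// => m _; rewrite /z' leqNgt ltn_ord.
      by rewrite expr0n.
    by rewrite addnS !big_ord_recr/= IH /z' leq_addr; ring.
  rewrite big_split/= !tl; have := h1 _ _ n1 NN; have := h2 _ _ n2 NN.
  by move: (e / bconst K) => r; lra.
exists (maxn N1 N2) => m n hm hn; have [mn|/ltnW nm] := leqP m n.
  by rewrite dotBC; exact: key.
exact: key.
Qed.

(** On (0, period) orthogonality solves the moment problem by a series with factor 2/period. Its
    restriction to that interval, extended by 0, has the same moments on (0,T); projecting onto the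
    closed span preserves them and puts [v] where weak limits can be identified. *)
Theorem time_control T p q : 2 <= T -> ell2 p -> ell2 q -> exists v,
  [/\ L2 0 T v, in_span T v & forall m, dot 0 T v (ct m) = p m /\ dot 0 T v (st m) = q m].
Proof.
move=> hT lp lq; have T0 : 0 < T by lra.
have p0 := @period_gt0 R; have pn : period != 0 :> R by rewrite gt_eqF.
have pT : period <= T by have := @period_le2 R; lra.
have lp' := ell2Z (2 / period) lp; have lq' := ell2Z (2 / period) lq.
have [w [Lw cw]] := tsum_cvg T0 lp' lq'.
set F := tsum _ _ in cw.
have Lr := L2_restrict 0 period Lw.
have [v [Lv sv hv]] := @L2_projection R 0 T trigonometric _
  (@trigonometric_L2 0 T) trigonometric0 trigonometric_lin Lr.
exists v; split=> // m.
have [tc ts] := trigonometric_mode m.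
rewrite -!hv// !dot_restrict//; try exact: ltW; try exact: L2_ct; try exact: L2_st.
have Lwp : L2 0 period w by apply: L2_sub Lw.
have cwp : dot 0 period (fun t => F N t - w t) (fun t => F N t - w t) @[N --> \oo] --> (0 : R).
  apply: cvg0_squeeze cw => N; first exact: dot_ge0.
  apply: le_intg_sub => //; first exact: ltW.
    by apply: L2_mul; apply: L2B => //; exact: L2_tsum.
  by move=> t _; rewrite -expr2 sqr_ge0.
(* Once mode m is included its moments are exact, so they need only be carried to the limit. *)
have mom N : (m < N)%N -> dot 0 period (F N) (ct m) = p m /\ dot 0 period (F N) (st m) = q m.
  move=> mN; have LF j : L2 0 period (mode (fun m => 2 / period * p m) (fun m => 2 / period * q m) j).
    exact: L2_mode.
  have orth j := @periodic_orthogonal R j m 1.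
  have one (z : nat -> R) : \sum_(i < N) (if (i == m :> nat) then z i else 0) = z m.
    rewrite (bigD1 (Ordinal mN))//= eqxx big1 ?addr0// => i /negbTE im.
    by rewrite ifN//; apply/negbT; rewrite -im.
  split; rewrite /F /tsum dot_suml//; try exact: L2_ct; try exact: L2_st.
    rewrite -[RHS]one; apply: eq_bigr => j _; rewrite dotC dot_mode; last exact: L2_ct.
    have [i1 _ i3] := orth j; rewrite mul1r in i1 i3; rewrite dotC i1 [dot _ _ (ct m) _]dotC i3; case: ifP => _; last by ring.
    by field; rewrite ?pn.
  rewrite -[RHS]one; apply: eq_bigr => j _; rewrite dotC dot_mode; last exact: L2_st.
  have [_ i2 _] := orth j; have [_ _ i3] := @periodic_orthogonal R m j 1; rewrite mul1r in i2.
  rewrite mul1r in i3; rewrite i3 [dot _ _ (st m) (st j)]dotC i2; case: ifP => _; last by ring.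
  by field; rewrite ?pn.
have LF N : L2 0 period (F N) by exact: L2_tsum.
have c1 := cvg_dot LF Lwp (L2_ct 0 period m) cwp.
have c2 := cvg_dot LF Lwp (L2_st 0 period m) cwp.
have lim_eq (s : nat -> R) (l c : R) : s N @[N --> \oo] --> l ->
    (forall N, (m < N)%N -> s N = c) -> l = c.
  move=> sl sc; rewrite -(cvg_lim (@Rhausdorff R) sl); apply: cvg_lim => //.
  apply: cvg_near_cst; exists m.+1 => // N /= mN; exact: sc.
split; [apply: lim_eq c1 _|apply: lim_eq c2 _] => N mN; by have [] := mom N mN.
Qed.

(** On the closed span, [theta] acts as its projection [u], which is approximated by trigonometric
    sums, where convergence is known. Boundedness of [g] makes the approximation error uniform in
    n. *)
Theorem span_weak_cvg T E (g : nat -> R -> R) v theta :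
  L2 0 T v -> in_span T v -> (forall n, L2 0 T (g n)) -> (forall n, in_span T (g n)) ->
  (forall n, dot 0 T (g n) (g n) <= E) ->
  (forall m, dot 0 T (g n) (ct m) @[n --> \oo] --> dot 0 T v (ct m)) ->
  (forall m, dot 0 T (g n) (st m) @[n --> \oo] --> dot 0 T v (st m)) ->
  L2 0 T theta -> dot 0 T (g n) theta @[n --> \oo] --> dot 0 T v theta.
Proof.
move=> Lv sv Lg sg gE cc cs Lth.
have [u [Lu [w [tw cw]] hu]] := @L2_projection R 0 T trigonometric _
  (@trigonometric_L2 0 T) trigonometric0 trigonometric_lin Lth.
have Lw k : L2 0 T (w k) by exact: trigonometric_L2.
have proj f : L2 0 T f -> in_span T f -> dot 0 T f theta = dot 0 T f u.
  move=> Lf [z [tz cz]].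
  have Lz k : L2 0 T (z k) by exact: trigonometric_L2.
  rewrite -(cvg_lim (@Rhausdorff R) (cvg_dot Lz Lf Lth cz)).
  rewrite -(cvg_lim (@Rhausdorff R) (cvg_dot Lz Lf Lu cz)).
  by congr (lim (_ @ \oo)); apply/funext => k; rewrite dotC hu// dotC.
have ctrig z : trigonometric z -> dot 0 T (g n) z @[n --> \oo] --> dot 0 T v z.
  move=> [al [be [N ->]]].
  have e f : L2 0 T f -> dot 0 T f (tsum al be N) =
      \sum_(m < N) (al m * dot 0 T f (ct m) + be m * dot 0 T f (st m)).
    move=> Lf; rewrite /tsum (dot_sumr (F := mode al be))//; last by move=> i; exact: L2_mode.
    by apply: eq_bigr => m _; rewrite dot_mode.
  rewrite e//; rewrite (_ : (fun n => _) = (fun n => \sum_(m < N)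
    (al m * dot 0 T (g n) (ct m) + be m * dot 0 T (g n) (st m)))); last first.
    by apply/funext => n; rewrite e.
  apply: (@cvg_sumr R nat \oo _ N (fun n m => al m * dot 0 T (g n) (ct m) + be m * dot 0 T (g n) (st m))
    (fun m => al m * dot 0 T v (ct m) + be m * dot 0 T v (st m))) => m.
  by apply: cvgD; apply: cvgMr; [exact: cc|exact: cs].
rewrite proj//; rewrite (_ : (fun n => _) = (fun n => dot 0 T (g n) u)); last first.
  by apply/funext => n; exact: proj.
have E0 : 0 <= E by apply: le_trans (gE 0%N); exact: dot_ge0.
pose D := 2 * E + 2 * dot 0 T v v + 1.
have D0 : 0 < D by have := dot_ge0 0 T v; rewrite /D; lra.
apply/cvgrPdist_le => e e0.
have e2 : 0 < (e / 2) ^+ 2 / D by rewrite divr_gt0 ?exprn_gt0 ?divr_gt0.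
move/cvgrPdist_le : cw => /(_ _ e2) [k0 _ hk].
have {hk} := hk k0 (leqnn k0); rewrite sub0r normrN ger0_norm ?dot_ge0// => hk.
have e22 : 0 < e / 2 by rewrite divr_gt0.
move/cvgrPdist_le : (ctrig _ (tw k0)) => /(_ _ e22); apply: filterS => n hn.
have Lgv : L2 0 T (fun t => v t - g n t) by exact: L2B.
have Luw : L2 0 T (fun t => w k0 t - u t) by exact: L2B.
have -> : dot 0 T v u - dot 0 T (g n) u = (dot 0 T v (w k0) - dot 0 T (g n) (w k0)) -
    dot 0 T (fun t => v t - g n t) (fun t => w k0 t - u t).
  by rewrite dotBl// !dotBr//; ring.
apply: le_trans (ler_normB _ _) _.
suff : `|dot 0 T (fun t => v t - g n t) (fun t => w k0 t - u t)| <= e / 2 by lra.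
apply: ler_sqr_norm; first exact: ltW.
apply: le_trans (CauchySchwarz Lgv Luw) _.
have gD : dot 0 T (fun t => v t - g n t) (fun t => v t - g n t) <= D.
  have := dot_sqrB Lv (Lg n); have := dot_sqrD_le Lv (L2N (Lg n)); rewrite dotNN /D.
  by have := gE n; lra.
apply: le_trans (_ : D * ((e / 2) ^+ 2 / D) <= _); last by rewrite mulrC divfK// gt_eqF.
by apply: ler_pM => //; exact: dot_ge0.
Qed.

End TimeControl.

(** * Traces at the control point and their comparison with averages *)

Section InteriorRegularity.
Context {R : realType}.
Implicit Types (u du d2u w : R -> R) (m N : nat) (x : R).

Lemma V_is_derive u du d2u x : @V_with R u du d2u -> 0 < x < 1 ->
  is_derive x 1 u (du x) /\ {for x, continuous du}.
Proof.
move=> [[[i2 hW] _] _ _] /andP[x0 x1].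
have hW' : W21 0 1 u du d2u by [].
have [_ cdu] := W21_continuous ler01 hW'.
have cx : {for x, continuous du}.
  have := within_continuous_continuous ltr01 cdu; apply.
  by rewrite in_itv/= x0 x1.
split=> //.
have idu := continuous_integrable_on cdu.
have [] := @continuous_FTC1 R du (BLeft 0) x 1 x1 idu _ cx; first by rewrite lte_fin.
rewrite derive1E => dF eF.
have h : is_derive x 1 (fun y => u 0 + intg 0 y du) (du x).
  have h1 : is_derive x 1 (fun y => intg 0 y du) (du x) by split.
  have := is_deriveD (is_derive_cst (u 0) x (1 : R)) h1.
  by rewrite add0r.
apply: near_eq_is_derive h; near=> y.
have y01 : 0 <= y <= 1.
  apply/andP; split; apply/ltW; near: y; [exact: lt_nbhsr|exact: lt_nbhsl].
by have [-> _] := hW y y01.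
Unshelve. all: by end_near. Qed.

Lemma V_derive1 u du d2u x : @V_with R u du d2u -> 0 < x < 1 ->
  [/\ derivable u x 1, derive1 u x = du x & {for x, continuous (derive1 u)}].
Proof.
move=> Vu x01; have [[dx ex] cx] := V_is_derive Vu x01.
have e y : 0 < y < 1 -> derive1 u y = du y.
  by move=> y01; rewrite derive1E; have [[]] := V_is_derive Vu y01.
split; [exact: dx|exact: e|].
rewrite /prop_for /continuous_at (e x x01); have [x0 x1] := andP x01.
apply: cvg_trans cx; apply: near_eq_cvg; near=> y; rewrite e//.
apply/andP; split; near: y; [exact: lt_nbhsr|exact: lt_nbhsl].
Unshelve. all: by end_near. Qed.

Lemma V_coef_ext u w x : @V R u -> V w -> (forall m, coef u m = coef w m) ->
  0 <= x <= 1 -> u x = w x.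
Proof.
move=> [du [d2u Vu]] [dw [d2w Vw]] e x01.
have h1 := V_fsum_cvg Vu x01; have h2 := V_fsum_cvg Vw x01.
rewrite -(cvg_lim (@Rhausdorff R) h1) -(cvg_lim (@Rhausdorff R) h2).
by congr (lim (_ @ \oo)); apply/funext => N; apply: eq_bigr => m _; rewrite e.
Qed.

Lemma fsum_is_derive (c : nat -> R) N x :
  is_derive x 1 (fsum c N) (\sum_(m < N) 2 * c m * (freq m * cn m x)).
Proof.
elim: N => [|N IH].
  rewrite big_ord0 (_ : fsum c 0 = (fun=> 0)); first exact: is_derive_cst.
  by apply/funext => y; rewrite /fsum big_ord0.
rewrite big_ord_recr/= (_ : fsum c N.+1 = (fun y => fsum c N y + (2 * c N) * sn N y)); last first.
  by apply/funext => y; rewrite /fsum big_ord_recr.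
exact: is_deriveD IH (is_deriveZ (2 * c N) (is_derive_sinM (freq N) x)).
Qed.

(** The sup bound on the remainder also covers its first derivative, so the sine series may be
    differentiated term by term at interior points. *)
Lemma V_derive_cvg u du d2u x : @V_with R u du d2u -> 0 < x < 1 ->
  \sum_(m < N) 2 * coef u m * (freq m * cn m x) @[N --> \oo] --> du x.
Proof.
move=> Vu x01; have [_ _ Ld2] := V_with_L2 Vu.
have x01' : 0 <= x <= 1 by lra.
have [du1 _] := V_is_derive Vu x01.
apply/cvgrPdist_le => e e0.
have e2 : 0 < e ^+ 2 by rewrite exprn_gt0.
have /cvgrPdist_le/(_ _ e2) := parseval_cvg Ld2; apply: filterS => N.
rewrite sub0r normrN ger0_norm ?dot_ge0// => h.
have [dr Vr] := V_sub_fsum N Vu.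
have [dr1 _] := V_is_derive Vr x01.
have dr2 := is_deriveB du1 (fsum_is_derive (coef u) N x).
have <- : dr x = du x - \sum_(m < N) 2 * coef u m * (freq m * cn m x).
  by have [_ <-] := dr1; have [_ <-] := dr2.
apply: ler_sqr_norm; first exact: ltW.
have [_ h1] := V_with_bound Vr x01'.
by apply: le_trans h1 _; rewrite dotBC.
Qed.

Lemma sum_sqr_le (z X Y : nat -> R) N :
  (forall m, 0 <= X m) -> (forall m, 0 <= Y m) -> (forall m, z m ^+ 2 <= X m * Y m) ->
  (\sum_(m < N) z m) ^+ 2 <= (\sum_(m < N) X m) * (\sum_(m < N) Y m).
Proof.
move=> X0 Y0 zXY.
have := sum_CauchySchwarz N (fun m => Num.sqrt (X m)) (fun m => Num.sqrt (Y m)).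
have sq (W : nat -> R) : (forall m, 0 <= W m) ->
    \sum_(m < N) Num.sqrt (W m) ^+ 2 = \sum_(m < N) W m.
  by move=> W0; apply: eq_bigr => m _; rewrite sqr_sqrtr.
rewrite !sq//.
apply: le_trans; rewrite -[leLHS]real_normK ?num_real//.
have S0 : 0 <= \sum_(m < N) Num.sqrt (X m) * Num.sqrt (Y m).
  by apply: sumr_ge0 => m _; rewrite mulr_ge0 ?sqrtr_ge0.
rewrite lerXn2r ?nnegrE//; apply: le_trans (ler_norm_sum _ _ _) _.
apply: ler_sum => m _; apply: ler_sqr_norm; first by rewrite mulr_ge0 ?sqrtr_ge0.
by rewrite exprMn !sqr_sqrtr.
Qed.

End InteriorRegularity.

Section Traces.
Context {R : realType}.
Implicit Types (p dp f w : R -> R) (m N K : nat) (t x : R).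
Variables (T xi : R) (phi : R -> R -> R) (al be : nat -> R).
Hypotheses (T0 : 0 < T) (hxi : 0 < xi < 1).
Hypotheses (lal : ell2 al) (lbe : ell2 be).
Hypothesis Lphi : forall t, 0 <= t <= T -> L2 0 1 (phi t).
Hypothesis cphi : forall t m, 0 <= t <= T -> coef (phi t) m = mode al be m t.

Lemma H10_W21 p dp : H10_with T p dp -> integrable_on 0 T dp /\
  forall t, 0 <= t <= T -> p t = p 0 + intg 0 t dp.
Proof.
move=> [Ldp hp _]; split; first exact: L2_integrable.
have T0' := T0; move=> t tT; rewrite hp// (hp 0) ?lexx ?(ltW T0')//.
by rewrite intg_set1 add0r.
Qed.

Lemma H10_continuous p dp : H10_with T p dp -> {within `[0, T], continuous p}.
Proof.
move=> hp; have [idp e] := H10_W21 hp; have T0' := T0.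
apply: (@subspace_eq_continuous _ _ _ (fun x => p 0 + intg 0 x dp)).
  by move=> x; rewrite inE => /itvccP xT; rewrite /from_subspace/= -e.
apply: within_continuousD; last exact/primitive_continuous/idp/ltW.
exact/continuous_within/cst_continuous.
Qed.

Lemma H10_L2 p : H10 T p -> L2 0 T p.
Proof. by move=> [dp /H10_continuous]; exact: within_continuous_L2. Qed.

(** [p] vanishes at both ends, so integration by parts gains a factor [eig m] with no boundary
    term. *)
Lemma H10_moments p dp m : H10_with T p dp ->
  eig m * dot 0 T p (ct m) = - dot 0 T dp (st m) /\
  eig m * dot 0 T p (st m) = dot 0 T dp (ct m).
Proof.
move=> hp; have [idp e] := H10_W21 hp; have T0' := ltW T0.
have [Ldp hp' pT] := hp; have p0 : p 0 = 0 by rewrite hp' ?lexx// intg_set1.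
have Lp : L2 0 T p by apply: H10_L2; exists dp.
have dst (x : R) : is_derive x 1 (@st R m) (eig m * ct m x) by exact: is_derive_sinM.
have dct (x : R) : is_derive x 1 (@ct R m) (- eig m * st m x) by exact: is_derive_cosM.
have ccE : continuous (fun x => eig m * ct m x : R) by exact/continuousZ/continuous_ct.
have csE : continuous (fun x => - eig m * st m x : R) by exact/continuousZ/continuous_st.
have h1 := integral_by_parts T0' ccE dst idp e.
have h2 := integral_by_parts T0' csE dct idp e.
rewrite pT p0 !mulr0 !subr0 !sub0r in h1 h2.
have i1 := L2_mul (L2_ct 0 T m) Lp; have i2 := L2_mul (L2_st 0 T m) Lp.
split.
  rewrite [dot 0 T p _]dotC [dot 0 T dp _]dotC /dot -h1 -intgZl//.
  by apply: eq_intg => x _; rewrite mulrA.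
rewrite [dot 0 T p _]dotC [dot 0 T dp _]dotC /dot -[RHS]opprK -h2 -mulN1r -!intgZl//.
  by apply: eq_intg => x _; ring.
by apply: eq_integrable_on (integrable_onZl (- eig m) i2) => x _; rewrite mulrA.
Qed.

Lemma H10_moments_sum K p dp N : covers T K -> H10_with T p dp ->
  \sum_(m < N) eig m ^+ 2 * (dot 0 T p (ct m) ^+ 2 + dot 0 T p (st m) ^+ 2) <=
  bconst K * dot 0 T dp dp.
Proof.
move=> cK hp; have [Ldp _ _] := hp; have T0' := ltW T0.
apply: le_trans (bessel_time N cK (lexx 0) T0' (lexx T) Ldp).
apply: ler_sum => m _; have [h1 h2] := H10_moments m hp.
by rewrite mulrDr -!exprMn h1 h2 sqrrN addrC.
Qed.

(** The m-th sine coefficient of the time integral of phi(t) p(t). *)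
Definition pairing_coef p m : R := al m * dot 0 T p (ct m) + be m * dot 0 T p (st m).

Lemma pairing_coef_sqr p m : pairing_coef p m ^+ 2 <=
  (al m ^+ 2 + be m ^+ 2) * (dot 0 T p (ct m) ^+ 2 + dot 0 T p (st m) ^+ 2).
Proof.
rewrite /pairing_coef; set a := dot _ _ _ _; set b := dot _ _ _ _.
have := sqr_ge0 (al m * b - be m * a); lra.
Qed.

Let amplitude_sup : exists2 Q : R, 0 <= Q & forall m, al m ^+ 2 + be m ^+ 2 <= Q.
Proof.
have [M1 h1] := lal; have [M2 h2] := lbe.
have M10 : 0 <= M1 by have := h1 0%N; rewrite big_ord0.
have M20 : 0 <= M2 by have := h2 0%N; rewrite big_ord0.
exists (M1 + M2) => [|m]; first exact: addr_ge0.
have top (z : nat -> R) : z m ^+ 2 <= \sum_(i < m.+1) z i ^+ 2.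
  by rewrite big_ord_recr/= lerDr sumr_ge0// => i _; exact: sqr_ge0.
by apply: lerD; [apply: le_trans (top al) _|apply: le_trans (top be) _].
Qed.

(** One time derivative on [p] pays for two space derivatives: the amplitudes are bounded and
    [eig m] times the moments of [p] are square summable. Hence the time pairing lies in V and has a
    value and a slope at [xi]. *)
Lemma pairing_coef_sum : exists2 C : R, 0 <= C & forall p dp N, H10_with T p dp ->
  \sum_(m < N) (eig m * pairing_coef p m) ^+ 2 <= C * dot 0 T dp dp.
Proof.
have [Q Q0 hQ] := amplitude_sup; have [K cK] := exists_cover T.
exists (Q * bconst K); first by rewrite mulr_ge0// ltW// (bconst_gt0 cK).
move=> p dp N hp; rewrite -mulrA.
apply: le_trans (ler_wpM2l Q0 (H10_moments_sum N cK hp)); rewrite mulr_sumr.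
apply: ler_sum => m _; rewrite exprMn [leRHS]mulrCA ler_wpM2l ?sqr_ge0//.
apply: le_trans (pairing_coef_sqr p m) _.
by rewrite ler_wpM2r ?hQ// addr_ge0 ?sqr_ge0.
Qed.

Lemma pairing_exists p : exists P : R -> R, H10 T p ->
  V P /\ forall m, coef P m = pairing_coef p m.
Proof.
have [[dp hp]|n] := pselect (H10 T p); last by exists id.
have [C C0 hC] := pairing_coef_sum.
have l : ell2 (fun m => eig m * pairing_coef p m).
  by exists (C * dot 0 T dp dp) => N; exact: hC.
have [P [dP [d2P [VP cP]]]] := V_of_coef l.
by exists P => _; split=> //; exists dP, d2P.
Qed.

(** Both sides are limits of the same finite sums, one by uniform convergence in time and the other
    by Parseval in space, which replaces Fubini. *)
Lemma pairing_time p P : H10 T p -> V P -> (forall m, coef P m = pairing_coef p m) ->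
  time_pairing T phi p P.
Proof.
move=> hp [dP [d2P VP]] cP; have [LP _ _] := V_with_L2 VP; split=> // w Lw.
have Lp := H10_L2 hp; have T0' := ltW T0.
have h1 : @weight R (fun=> 1) 1.
  by split; [exact: measurable_cst|move=> x _; rewrite ler01 lexx].
have one f : wdot (fun=> 1) f w = dot 0 1 f w.
  by apply: eq_intg => x _; rewrite mul1r.
have hu := wdot_modal_unif lal lbe Lphi cphi h1 Lw.
pose F N t := wdot (fun=> 1) (fsum (mode al be ^~ t) N) w.
have cF N : continuous (F N) by exact: (continuous_wdot_modal h1 Lw).
have [Lf _ cf] := unif_cvg_L2 T0' cF hu.
have LF N : L2 0 T (F N) by exact: continuous_L2.
have c1 := cvg_dot LF Lf Lp cf.
have c2 := parseval_dot LP Lw.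
have e : (fun N => dot 0 T (F N) p) = (fun N => 2 * \sum_(m < N) coef P m * coef w m).
  apply/funext => N.
  have FE t : F N t = 2 * \sum_(m < N) coef w m * mode al be m t.
    rewrite /F one dotC dot_fsum// ; congr (2 * _); apply: eq_bigr => m _; exact: mulrC.
  have -> : dot 0 T (F N) p = dot 0 T (fun t => \sum_(m < N) 2 * coef w m * mode al be m t) p.
    by apply: eq_dot => // t _; rewrite FE mulr_sumr; apply: eq_bigr => m _; rewrite mulrA.
  rewrite (dot_suml (F := fun m t => 2 * coef w m * mode al be m t))//; last first.
    by move=> m; apply: L2Zl; exact: L2_mode.
  rewrite mulr_sumr; apply: eq_bigr => m _; rewrite dotZl//; last exact: L2_mode.
  by rewrite dotC dot_mode// cP /pairing_coef; ring.
rewrite e in c1.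
have -> : ip P w = dot 0 1 P w by [].
rewrite -(cvg_lim (@Rhausdorff R) c2) (cvg_lim (@Rhausdorff R) c1).
by apply: eq_intg => t _; rewrite one.
Qed.

Theorem traces_exist : exists PP : (R -> R) -> R -> R,
  [/\ forall p, H10 T p -> V (PP p) /\ forall m, coef (PP p) m = pairing_coef p m,
      xtraces T xi phi (fun p => PP p xi) (fun p => derive1 (PP p) xi) &
      forall p, H10 T p -> time_pairing T phi p (PP p)].
Proof.
have [PP hPP] := choice pairing_exists; exists PP; split=> //; last first.
  by move=> p hp; have [VP cP] := hPP p hp; exact: pairing_time.
have x01 : 0 <= xi <= 1 by have := hxi; lra.
have hxi' := hxi; have T0' := ltW T0.
(* [PP] comes from a choice, so linearity must be read off the coefficients, which determine an
   element of V at every point of [0,1]. *)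
have lin (a : R) p q x : H10 T p -> H10 T q -> 0 <= x <= 1 ->
    PP (fun t => a * p t + q t) x = a * PP p x + PP q x.
  move=> hp hq x1; have [Vp cp] := hPP p hp; have [Vq cq] := hPP q hq.
  have hpq : H10 T (fun t => a * p t + q t).
    have [dp [Lp ip pT]] := hp; have [dq [Lq iq qT]] := hq.
    exists (fun t => a * dp t + dq t); split.
    - by apply: L2D => //; exact: L2Zl.
    - move=> t tT; have s1 := L2_integrable Lp; have s2 := L2_integrable Lq.
      have j1 : integrable_on 0 t dp by apply: integrable_on_sub s1 => //; case/andP: tT.
      have j2 : integrable_on 0 t dq by apply: integrable_on_sub s2 => //; case/andP: tT.
      by rewrite intgD ?intgZl -?ip -?iq//; exact: integrable_onZl.
    - by rewrite pT qT mulr0 addr0.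
  have [Vpq cpq] := hPP _ hpq.
  have Vs : V (fun x => a * PP p x + PP q x).
    have [d1 [d2 h1]] := Vp; have [e1 [e2 h2]] := Vq.
    by eexists; eexists; exact: V_with_lin h1 h2.
  apply: (V_coef_ext Vpq Vs) => // m; rewrite cpq.
  have [d1 [d2 h1]] := Vp; have [e1 [e2 h2]] := Vq.
  have [L1 _ _] := V_with_L2 h1; have [M1 _ _] := V_with_L2 h2.
  rewrite /coef dotDl ?dotZl//; try exact: L2_sn; last exact: L2Zl.
  rewrite -!/(coef _ m) cp cq /pairing_coef.
  have [Lp Lq] := (H10_L2 hp, H10_L2 hq).
  rewrite !dotDl ?dotZl//; try exact: L2_ct; try exact: L2_st; try exact: L2Zl.
  by ring.
have [C C0 hC] := pairing_coef_sum.
have bound p dp : H10_with T p dp -> PP p xi ^+ 2 <= 2 * (C * dot 0 T dp dp) /\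
    derive1 (PP p) xi ^+ 2 <= 2 * (C * dot 0 T dp dp).
  move=> hp; have [[dP [d2P VP]] cP] := hPP p (ex_intro _ dp hp).
  have [_ -> _] := V_derive1 VP hxi'.
  have [b1 b2] := V_with_bound VP x01.
  have b3 : dot 0 1 d2P d2P <= 2 * (C * dot 0 T dp dp).
    apply: (V_dot_d2 VP) => N; apply: le_trans (hC p dp N hp).
    by rewrite le_eqVlt; apply/orP; left; apply/eqP/eq_bigr => m _; rewrite cP.
  by split; [exact: le_trans b1 b3|exact: le_trans b2 b3].
have Hm (z : (R -> R) -> R) : linear_on (H10 T) z -> (forall p dp, H10_with T p dp ->
    z p ^+ 2 <= 2 * (C * dot 0 T dp dp)) -> Hm1 T z.
  move=> lz hz; split=> //; exists (Num.sqrt (2 * C)) => p dp hp.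
  have C2 : 0 <= 2 * C by rewrite mulr_ge0.
  apply: ler_sqr_norm; first by rewrite mulr_ge0 ?sqrtr_ge0.
  have Lp : L2 0 T p by apply: H10_L2; exists dp.
  have [Ldp _ _] := hp.
  have i1 : integrable_on 0 T (fun t => p t ^+ 2 + dp t ^+ 2).
    by apply: integrable_onD; [case: Lp|case: Ldp].
  rewrite exprMn !sqr_sqrtr//; last by apply: intg_ge0 => t _; rewrite addr_ge0 ?sqr_ge0.
  apply: le_trans (hz p dp hp) _; rewrite mulrA ler_wpM2l//; apply: le_intg => //.
    exact: L2_mul.
  by move=> t _; rewrite -expr2 lerDr sqr_ge0.
split.
- apply: Hm; first by move=> a p q hp hq; exact: lin.
  by move=> p dp /bound[].
- apply: Hm; last by move=> p dp /bound[].
  move=> a p q hp hq; have [[d1 [d2 Vp]] _] := hPP p hp; have [[e1 [e2 Vq]] _] := hPP q hq.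
  have [_ -> _] := V_derive1 Vp hxi'; have [_ -> _] := V_derive1 Vq hxi'.
  have [h _] := V_is_derive (V_with_lin a Vp Vq) hxi'.
  rewrite derive1E; suff [_ ->] : is_derive xi 1 (PP (fun t => a * p t + q t)) (a * d1 xi + e1 xi) by [].
  have [h0 h1] := andP hxi'.
  apply: near_eq_is_derive h; near=> y; rewrite lin//.
  apply/andP; split; apply/ltW; near: y; [exact: lt_nbhsr|exact: lt_nbhsl].
- move=> p hp; have [VP cP] := hPP p hp; exists (PP p); split=> //.
    exact: pairing_time.
  move=> x x1; have [d1 [d2 Vp]] := VP.
  by have [h1 _ h2] := V_derive1 Vp x1.
Unshelve. all: by end_near. Qed.

End Traces.

Section TraceAverage.
Context {R : realType}.
Implicit Types (p dp : R -> R) (m N K : nat) (t x : R).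

(** Value, slope and average are all linear in the coefficients of P, so a single factor [q m] per
    mode remains, the remainder of [mean_sin_remainder]. Cauchy-Schwarz pairs its window mean with
    the energy bound and the rest with the H^1 norm of p; 72 is 2^2 * 36 / 2. *)
Lemma trace_average T xi E K (n : nat) (phi : R -> R -> R) (al be : nat -> R)
    p dp (P : R -> R) : 0 < T -> 0 < xi < 1 -> (0 < n)%N -> n%:R^-1 < 1 - xi -> covers T K ->
  (forall N, 2 * period * \sum_(m < N) (al m ^+ 2 + be m ^+ 2) *
     wdot (window xi n) (sn m) (sn m) <= E) ->
  H10_with T p dp -> V P -> (forall m, coef P m = pairing_coef T al be p m) ->
  time_pairing T phi p P ->
  (P xi + (2 * n%:R)^-1 * derive1 P xi - dot 0 T (average xi n phi) p) ^+ 2 <=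
  72 * E * (bconst K * dot 0 T dp dp) / period * n%:R^-1 ^+ 2.
Proof.
move=> T0 hxi n0 hn cK hE hp [dP [d2P VP]] cP [LP tP].
have nn : n%:R != 0 :> R by rewrite pnatr_eq0 -lt0n.
have nh : n%:R * n%:R^-1 = 1 :> R by rewrite divff.
have hrho := window_weight xi n0 nh.
pose h : R := n%:R^-1; have h0 : 0 < h by rewrite invr_gt0 ltr0n.
pose rho := window xi n.
have Lrho : L2 0 1 rho.
  by apply: eq_L2 (L2_weight hrho (L2_cst 0 1 1)) => x _; rewrite mulr1.
have -> : dot 0 T (average xi n phi) p = dot 0 1 P rho.
  have e t : average xi n phi t = ip (phi t) rho.
    by apply: eq_intg => x _; rewrite mulr1 mulrC.
  have -> : dot 0 1 P rho = intg 0 T (fun t => ip (phi t) rho * p t) by exact: tP.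
  by apply: eq_intg => t _; rewrite e.
have x01 : 0 <= xi <= 1 by lra.
have [_ -> _] := V_derive1 VP hxi.
have c1 := V_fsum_cvg VP x01; have c2 := V_derive_cvg VP hxi; have c3 := parseval_dot LP Lrho.
have p0 := @period_gt0 R; have pn : period != 0 :> R by rewrite gt_eqF.
pose w m : R := wdot rho (sn m) (sn m).
have w0 m : 0 <= w m by exact: (wdot_ge0 hrho).
have wE m : w m = mean_sin2 (freq m * xi) (freq m * h) by exact: window_mean_sin2.
pose q m := sn m xi + freq m * h / 2 * cn m xi - coef rho m.
have qE m : q m ^+ 2 <= 36 * (freq m * h) ^+ 2 * w m.
  rewrite wE /q; have -> : coef rho m = mean_sin (freq m * xi) (freq m * h).
    rewrite -(window_mean_sin hxi n0 nh hn) wdotC; apply: eq_intg => x _.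
    by rewrite mulr1.
  by apply: mean_sin_remainder; rewrite mulr_gt0 ?freq_gt0.
pose pc m := dot 0 T p (ct m) ^+ 2 + dot 0 T p (st m) ^+ 2.
have pc0 m : 0 <= pc m by rewrite addr_ge0 ?sqr_ge0.
pose X m := (al m ^+ 2 + be m ^+ 2) * w m.
(* [(freq m * h) ^+ 2] is [eig m * h ^+ 2], enlarged to [eig m ^+ 2 * h ^+ 2] because the moments of
   p are summable with weight [eig m ^+ 2]; h = 1/n gives the rate. *)
pose Y m := 36 * h ^+ 2 * (eig m ^+ 2 * pc m).
have X0 m : 0 <= X m by rewrite mulr_ge0 ?addr_ge0 ?sqr_ge0.
have Y0 m : 0 <= Y m.
  by apply: mulr_ge0; apply: mulr_ge0 => //; exact: sqr_ge0.
have zXY m : (coef P m * q m) ^+ 2 <= X m * Y m.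
  rewrite exprMn cP.
  apply: le_trans (_ : (al m ^+ 2 + be m ^+ 2) * pc m * (36 * (freq m * h) ^+ 2 * w m) <= _).
    by apply: ler_pM; rewrite ?sqr_ge0//; exact: pairing_coef_sqr.
  have -> : X m * Y m = (al m ^+ 2 + be m ^+ 2) * pc m * (36 * (eig m ^+ 2 * h ^+ 2) * w m).
    by rewrite /X /Y; ring.
  apply: ler_wpM2l; first by rewrite mulr_ge0// addr_ge0 ?sqr_ge0.
  apply: ler_wpM2r => //; apply: ler_wpM2l => //.
  rewrite exprMn -/(eig m); apply: ler_wpM2r; first exact: sqr_ge0.
  by rewrite expr2 ler_peMl ?eig_ge1// ltW// eig_gt0.
pose r N := fsum (coef P) N xi + (2 * n%:R)^-1 * (\sum_(m < N) 2 * coef P m * (freq m * cn m xi))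
  - 2 * \sum_(m < N) coef P m * coef rho m.
have rE N : r N = 2 * \sum_(m < N) coef P m * q m.
  rewrite /r /fsum !mulr_sumr -big_split -sumrB; apply: eq_bigr => m _ /=.
  by rewrite /q /h; field; rewrite ?nn.
have rb N : r N * r N <= 72 * E * (bconst K * dot 0 T dp dp) / period * n%:R^-1 ^+ 2.
  rewrite rE -expr2 exprMn.
  have s1 := sum_sqr_le N X0 Y0 zXY.
  have s2 := hE N; rewrite -/rho in s2.
  have s3 := H10_moments_sum T0 N cK hp.
  have sX0 : 0 <= \sum_(m < N) X m by apply: sumr_ge0.
  have sY : \sum_(m < N) Y m <= 36 * h ^+ 2 * (bconst K * dot 0 T dp dp).
    by rewrite -mulr_sumr; apply: ler_wpM2l => //; rewrite mulr_ge0 ?sqr_ge0.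
  have sX : \sum_(m < N) X m <= E / (2 * period).
    rewrite ler_pdivlMr; first by rewrite mulrC.
    exact: mulr_gt0.
  have sY0 : 0 <= \sum_(m < N) Y m by apply: sumr_ge0.
  have s4 := le_trans s1 (ler_pM sX0 sY0 sX sY).
  have -> : 72 * E * (bconst K * dot 0 T dp dp) / period * n%:R^-1 ^+ 2 =
     2 ^+ 2 * (E / (2 * period) * (36 * h ^+ 2 * (bconst K * dot 0 T dp dp))).
    by rewrite /h; field; rewrite ?pn ?nn.
  by apply: ler_wpM2l => //; exact: sqr_ge0.
have cr : r N @[N --> \oo] --> P xi + (2 * n%:R)^-1 * dP xi - dot 0 1 P rho.
  by apply: cvgB c3; apply: cvgD c1 _; exact: cvgMr.
rewrite expr2; have cr2 : r N * r N @[N --> \oo] -->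
    (P xi + (2 * n%:R)^-1 * dP xi - dot 0 1 P rho) * (P xi + (2 * n%:R)^-1 * dP xi - dot 0 1 P rho).
  by apply: cvgM; exact: cr.
exact: cvgn_le cr2 rb.
Qed.

End TraceAverage.

(** * Weak star convergence in V from convergence of the modes *)

Section WeakStar.
Context {R : realType}.
Implicit Types (f w : R -> R) (m n N K : nat) (t x : R) (l : (R -> R) -> R).

Lemma V_sn m : V (@sn R m).
Proof. by eexists; eexists; exact: V_with_sn. Qed.

Lemma V_fsum (c : nat -> R) N : V (fsum c N).
Proof. by have [du h] := V_with_fsum c N; exists du, (fsum (fun m => - eig m * c m) N). Qed.

Lemma linear_fsum l (c : nat -> R) N : linear_on (@V R) l ->
  l (fsum c N) = \sum_(m < N) 2 * c m * l (sn m).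
Proof.
move=> hl; have V0 : V (fun=> 0 : R) by eexists; eexists; exact: V_with0.
elim: N => [|N IH].
  rewrite big_ord0 (_ : fsum c 0 = (fun=> 0)); last by apply/funext => x; rewrite /fsum big_ord0.
  have := hl 1 _ _ V0 V0.
  have -> : (fun=> 1 * 0 + 0) = (fun=> 0 : R) :> (R -> R) by rewrite mulr0 addr0.
  by lra.
rewrite big_ord_recr/= -IH addrC -hl; [|exact: V_sn|exact: V_fsum].
by congr (l _); apply/funext => x; rewrite /fsum big_ord_recr/= addrC.
Qed.

(** Testing l on the sum with coefficients l(sn m)/eig^2 gives the value 2S, and a second derivative
    of squared norm 2S; so (2S)^2 <= 8 k^2 S, hence S <= 2 k^2. *)
Lemma dualV_coef l (k : R) : dualV l k -> ell2 (fun m => l (sn m) / eig m).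
Proof.
move=> [hl hk]; exists (2 * k ^+ 2) => N.
pose c m := l (sn m) / eig m ^+ 2; set S := \sum_(m < N) _.
have e0 m : eig m != 0 :> R by rewrite gt_eqF// eig_gt0.
have [du Vc] := V_with_fsum c N.
have h1 := hk _ _ _ Vc.
have S0 : 0 <= S by apply: sumr_ge0 => m _; exact: sqr_ge0.
have E1 : l (fsum c N) = 2 * S.
  rewrite linear_fsum// mulr_sumr; apply: eq_bigr => m _.
  by rewrite /c; have := e0 m => h; field.
have E2 : dot 0 1 (fsum (fun m => - eig m * c m) N) (fsum (fun m => - eig m * c m) N) = 2 * S.
  rewrite (dot_fsum_fsum _ _ (leqnn N)); congr (2 * _); apply: eq_bigr => m _.
  by rewrite /c; have := e0 m => h; field.
have h2 := normH2_le Vc.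
have h3 : l (fsum c N) ^+ 2 <= k ^+ 2 * (4 * (2 * S)).
  rewrite -[leLHS]real_normK ?num_real//.
  have n0 : 0 <= normH2 (fsum c N) du (fsum (fun m => - eig m * c m) N) by exact: sqrtr_ge0.
  have k0 : 0 <= `|l (fsum c N)| by [].
  apply: le_trans (_ : (k * normH2 (fsum c N) du (fsum (fun m => - eig m * c m) N)) ^+ 2 <= _).
    by rewrite lerXn2r ?nnegrE// (le_trans k0).
  rewrite exprMn ler_wpM2l ?sqr_ge0// -E2 -nrm_sqr.
  have -> : 4 * nrm 0 1 (fsum (fun m => - eig m * c m) N) ^+ 2 =
    (2 * nrm 0 1 (fsum (fun m => - eig m * c m) N)) ^+ 2 by ring.
  by rewrite lerXn2r ?nnegrE// mulr_ge0 ?nrm_ge0.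
have [->|Sn] := eqVneq S 0; first by rewrite mulr_ge0 ?sqr_ge0.
have Sp : 0 < S by rewrite lt_neqAle eq_sym Sn.
rewrite -(ler_pM2r Sp); move: h3; rewrite E1 expr2; move: (k ^+ 2) => q h3.
have -> : 2 * q * S = q * (4 * (2 * S)) / 4 by field.
by rewrite ler_pdivlMr//; lra.
Qed.

Lemma dualV_series l (k : R) u : dualV l k -> V u ->
  \sum_(m < N) (eig m * coef u m) * (2 * (l (sn m) / eig m)) @[N --> \oo] --> l u.
Proof.
move=> [hl hk] [du [d2u Vu]]; have [_ _ Ld2] := V_with_L2 Vu.
have e0 m : eig m != 0 :> R by rewrite gt_eqF// eig_gt0.
have -> : (fun N => \sum_(m < N) (eig m * coef u m) * (2 * (l (sn m) / eig m))) =
    (fun N => l (fsum (coef u) N)).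
  apply/funext => N; rewrite linear_fsum//; apply: eq_bigr => m _.
  by have := e0 m => h; field.
apply/cvgrPdist_le => e e_gt0.
pose k' := `|k| + 1; have k'0 : 0 < k' by rewrite ltr_wpDl.
have e2 : 0 < (e / (2 * k')) ^+ 2 by rewrite exprn_gt0// divr_gt0// mulr_gt0.
have /cvgrPdist_le/(_ _ e2) := parseval_cvg Ld2; apply: filterS => N.
rewrite sub0r normrN ger0_norm ?dot_ge0// => h.
have [dr Vr] := V_sub_fsum N Vu.
have -> : l u - l (fsum (coef u) N) = l (fun x => u x - fsum (coef u) N x).
  have Vu' : V u by exists du, d2u.
  have := hl (-1) _ _ (V_fsum (coef u) N) Vu'; rewrite mulN1r addrC => <-.
  by congr (l _); apply/funext => x; rewrite mulN1r addrC.
apply: le_trans (hk _ _ _ Vr) _.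
set q := normH2 _ _ _; have q0 : 0 <= q by exact: sqrtr_ge0.
have q1 : q <= 2 * (e / (2 * k')).
  apply: le_trans (normH2_le Vr) _; rewrite ler_pM2l//.
  rewrite -[leLHS]ger0_norm ?nrm_ge0//; apply: ler_sqr_norm.
    by rewrite divr_ge0 ?(ltW e_gt0)// mulr_ge0// ltW.
  by rewrite nrm_sqr dotBC.
apply: le_trans (_ : k' * q <= _).
  by rewrite ler_wpM2r//; have := ler_norm k; rewrite /k'; lra.
apply: le_trans (_ : k' * (2 * (e / (2 * k'))) <= _); first by rewrite ler_pM2l.
by rewrite le_eqVlt; apply/orP; left; apply/eqP; have := lt0r_neq0 k'0 => h1; field.
Qed.

Lemma CL2_coef_continuous T (u : R -> R -> R) m : CL2 T u ->
  {within `[0, T], continuous (fun t => coef (u t) m)}.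
Proof.
move=> [Lu cu]; apply/subspace_continuousP => t tT; apply/cvgrPdist_le => e e0.
have e2 : 0 < e ^+ 2 by rewrite exprn_gt0.
have tT' : 0 <= t <= T by exact: tT.
have /cvgrPdist_le/(_ _ e2)[d /= d0 hd] := cu t tT'.
exists d => // s /= st sT; have := hd s st sT.
have sT' : 0 <= s <= T by exact: sT.
rewrite sub0r normrN ger0_norm; last by apply: intg_ge0 => x _; exact: sqr_ge0.
move=> h; apply: ler_sqr_norm; first exact: ltW.
rewrite -coef_sub; [|exact: Lu|exact: Lu].
have Ld := L2B (Lu _ tT') (Lu _ sT').
apply: le_trans (CauchySchwarz Ld (L2_sn 0 1 m)) _.
rewrite sn_orthogonal eqxx dotBC.
have -> : dot 0 1 (fun x => u s x - u t x) (fun x => u s x - u t x) =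
  intg 0 1 (fun x => (u s x - u t x) ^+ 2) by apply: eq_intg => x _; rewrite expr2.
by move: h (ltW e2) => h h'; lra.
Qed.

(** At each time the duality pairing is a product of square-summable sequences, one bounded and
    convergent by components, the other fixed. Dominated convergence in time, with the integrable
    bound of the dual norm, concludes. *)
Theorem weakstar_of_modes T (u_ : nat -> R -> R -> R) (u : R -> R -> R) B :
  (forall n, CL2 T (u_ n)) -> (forall n t, 0 <= t <= T -> V (u_ n t)) ->
  (forall t, 0 <= t <= T -> V (u t)) ->
  (forall n t N, 0 <= t <= T -> \sum_(m < N) (eig m * coef (u_ n t) m) ^+ 2 <= B) ->
  (forall t m, 0 <= t <= T -> coef (u_ n t) m @[n --> \oo] --> coef (u t) m) ->
  weakstar_LooV T u_ u.
Proof.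
move=> Cu Vu_ Vu hB cu g [mg [k [ik hk]]].
have B0 t : 0 <= t <= T -> 0 <= B by move=> tT; have := hB 0%N t 0%N tT; rewrite big_ord0.
have [||||//] := @dominated_intg R 0 T (fun n t => g t (u_ n t)) (fun t => g t (u t))
   (fun t => `|k t| * (2 * Num.sqrt (2 * B))).
- move=> n.
  (* Measurability of g(t) is given only against a fixed element of V; the modal series transfers it
     to the moving argument [u_ n t]. *)
  pose F N t := \sum_(m < N) (eig m * coef (u_ n t) m) * (2 * (g t (sn m) / eig m)).
  apply: (@measurable_fun_cvg _ _ _ _ F) => [N|t tT].
    apply: measurable_sum => m; apply: measurable_funM.
      apply: measurable_funM; first exact: measurable_cst.
      apply: integrable_on_measurable; apply: continuous_integrable_on.
      exact: CL2_coef_continuous.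
    apply: measurable_funM; first exact: measurable_cst.
    by apply: measurable_funM; [apply: mg; exact: V_sn|exact: measurable_cst].
  have tT' : 0 <= t <= T by exact: tT.
  exact: dualV_series (hk t tT') (Vu_ n t tT').
- by apply: integrable_onZr; exact: integrable_on_normr.
- move=> t tT; have lG := ell2Z 2 (dualV_coef (hk t tT)).
  apply: (@ell2_weak_cvg R nat \oo _ (fun n => g t (u_ n t)) (g t (u t))
     (fun n m => eig m * coef (u_ n t) m) (fun m => eig m * coef (u t) m) _ B lG).
  + by apply: nearW => n N; exact: hB.
  + by move=> m; apply: cvgMr; exact: cu.
  + by apply: nearW => n; exact: dualV_series (hk t tT) (Vu_ n t tT).
  + exact: dualV_series (hk t tT) (Vu t tT).
- move=> n t tT; have [_ hg] := hk t tT.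
  have [du [d2u Vn]] := Vu_ n t tT.
  apply: le_trans (hg _ _ _ Vn) _.
  have n0 : 0 <= normH2 (u_ n t) du d2u by exact: sqrtr_ge0.
  apply: le_trans (ler_wpM2r n0 (ler_norm (k t))) _; apply: ler_wpM2l => //.
  apply: le_trans (normH2_le Vn) _; rewrite ler_pM2l//; apply: ler_wsqrtr.
  by apply: (V_dot_d2 Vn) => N; exact: hB.
Qed.

End WeakStar.

(** * Passage to the limit in the controls, the states and the traces *)

Section ControlLimit.
Context {R : realType}.
Implicit Types (p dp theta : R -> R) (m k N : nat) (t x : R).
Variables (T xi E : R) (y0 y1 v : R -> R) (nu : nat -> nat).
Variables (phi psi_ : nat -> R -> R -> R) (al be : nat -> nat -> R).
Hypotheses (T0 : 0 < T) (hxi : 0 < xi < 1) (hs : strategic xi).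
Hypotheses (nu0 : forall k, (0 < nu k)%N) (nuE : forall k, (nu k)%:R^-1 < 1 - xi).
Hypothesis cnu : (nu k)%:R^-1 @[k --> \oo] --> (0 : R).
Hypotheses (lal : forall k, ell2 (al k)) (lbe : forall k, ell2 (be k)).
Hypothesis Lphi : forall k t, 0 <= t <= T -> L2 0 1 (phi k t).
Hypothesis cphi : forall k t m, 0 <= t <= T -> coef (phi k t) m = mode (al k) (be k) m t.
Local Notation rho k := (window xi (nu k)).
Local Notation src k m := (fun t => wdot (rho k) (phi k t) (sn m)).
Local Notation avg k := (average xi (nu k) (phi k)).
Hypothesis hE : forall k, intg 0 T (fun t => wdot (rho k) (phi k t) (phi k t)) <= E.
Hypothesis src_ct : forall k m, dot 0 T (src k m) (ct m) = - coef y1 m.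
Hypothesis src_st : forall k m, dot 0 T (src k m) (st m) = eig m * coef y0 m.
Hypothesis psiE : forall k t m, 0 <= t <= T -> eig m * coef (psi_ k t) m =
  ct m t * dot t T (src k m) (st m) - st m t * dot t T (src k m) (ct m).
Hypotheses (Lv : L2 0 T v) (sv : in_span T v).
Hypothesis v_ct : forall m, dot 0 T v (ct m) = - coef y1 m / sn m xi.
Hypothesis v_st : forall m, dot 0 T v (st m) = eig m * coef y0 m / sn m xi.

Let T0' : 0 <= T. Proof. exact: ltW. Qed.
Let nh k : (nu k)%:R * (nu k)%:R^-1 = 1 :> R.
Proof. by rewrite divff// pnatr_eq0 -lt0n. Qed.
Let hrho k : weight (rho k) (nu k)%:R := window_weight xi (nu0 k) (nh k).
Let s0 m : sn m xi != 0. Proof. exact: hs. Qed.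

Lemma cvg_of_sqr (r : nat -> R) (C : R) :
  (forall k, r k ^+ 2 <= C * (nu k)%:R^-1 ^+ 2) -> r k @[k --> \oo] --> (0 : R).
Proof.
move=> hr; have C0 : 0 <= C.
  rewrite -(pmulr_lge0 _ (_ : 0 < (nu 0%N)%:R^-1 ^+ 2)) ?exprn_gt0 ?invr_gt0 ?ltr0n//.
  by apply: le_trans (hr 0%N); exact: sqr_ge0.
have nC : `|r k| @[k --> \oo] --> (0 : R).
  apply: (@cvg0_squeeze R (fun k => `|r k|) (fun k => Num.sqrt C * (nu k)%:R^-1)) => [k|k|].
  - exact: normr_ge0.
  - apply: ler_sqr_norm; first by rewrite mulr_ge0 ?sqrtr_ge0.
    by rewrite exprMn sqr_sqrtr.
  - by rewrite -[X in _ --> X](mulr0 (Num.sqrt C)); exact: cvgMr.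
by apply/norm_cvg0P.
Qed.

Lemma source_near theta m c d : 0 <= c -> d <= T -> L2 c d theta ->
  (dot c d (src k m) theta - sn m xi * dot c d (avg k) theta) @[k --> \oo] --> (0 : R).
Proof.
move=> c0 dT Lt; apply: (@cvg_of_sqr _ (freq m ^+ 2 * E * dot c d theta theta)) => k.
have := average_near T0' hxi (nu0 k) (nuE k) (lal k) (lbe k) (@Lphi k) (@cphi k) (hE k) m c0 dT Lt.
move/le_trans; apply; rewrite le_eqVlt; apply/orP; left; apply/eqP.
by rewrite exprMn; ring.
Qed.

Lemma average_cvg theta : L2 0 T theta -> dot 0 T (avg k) theta @[k --> \oo] --> dot 0 T v theta.
Proof.
have Lg k := average_L2 xi T0' (nu0 k) (lal k) (lbe k) (@Lphi k) (@cphi k).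
have sg k : in_span T (avg k).
  have [a [b h]] := average_span xi T0' (nu0 k) (lal k) (lbe k) (@Lphi k) (@cphi k).
  by exists (tsum a b); split=> // j; exists a, b, j.
have bg k := average_bound T0' hxi (nu0 k) (nuE k) (lal k) (lbe k) (@Lphi k) (@cphi k) (hE k).
have mom (theta' : R -> R) m c : L2 0 T theta' -> (forall k, dot 0 T (src k m) theta' = c) ->
    dot 0 T (avg k) theta' @[k --> \oo] --> c / sn m xi.
  move=> Lt hc; have h := source_near m (lexx 0) (lexx T) Lt.
  have -> : (fun k => dot 0 T (avg k) theta') = (fun k => (c - (dot 0 T (src k m) theta' -
      sn m xi * dot 0 T (avg k) theta')) * (sn m xi)^-1).
    by apply/funext => k; rewrite hc; have := s0 m => hm; field.
  apply: cvgMl; rewrite -[X in _ --> X]subr0; apply: cvgB h; exact: (@cvg_cst R^o).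
apply: (span_weak_cvg Lv sv Lg sg bg) => m.
  by rewrite v_ct; apply: mom => //; exact: L2_ct.
by rewrite v_st; apply: mom => //; exact: L2_st.
Qed.

(** Weak convergence is tested on (0,T), so [theta] is cut off to [t,T] by an indicator;
    [source_near] exchanges the source for the average. *)
Lemma source_cvg theta m t : 0 <= t <= T -> L2 0 T theta ->
  dot t T (src k m) theta @[k --> \oo] --> sn m xi * dot t T v theta.
Proof.
move=> /andP[t0 tT] Lt; have Lt' : L2 t T theta by apply: L2_sub Lt.
have Lg k := average_L2 xi T0' (nu0 k) (lal k) (lbe k) (@Lphi k) (@cphi k).
have h := source_near m t0 (lexx T) Lt'.
have Lr := L2_restrict t T Lt.
have rest f : L2 0 T f -> dot 0 T f (fun x => \1_(`[t, T]%classic : set R) x * theta x) = dot t T f theta.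
  by move=> Lf; rewrite dotC dot_restrict// dotC.
have h2 := average_cvg Lr; rewrite (rest _ Lv) in h2.
have e : (fun k => dot 0 T (avg k) (fun x => \1_(`[t, T]%classic : set R) x * theta x)) =
   (fun k => dot t T (avg k) theta) by apply/funext => k; exact: rest.
rewrite e in h2.
have h3 : ((dot t T (src k m) theta - sn m xi * dot t T (avg k) theta) +
   sn m xi * dot t T (avg k) theta) @[k --> \oo] --> 0 + sn m xi * dot t T v theta.
  by apply: cvgD h _; exact: cvgMr.
rewrite add0r in h3.
have -> // : (fun k => dot t T (src k m) theta) = (fun k => (dot t T (src k m) theta -
    sn m xi * dot t T (avg k) theta) + sn m xi * dot t T (avg k) theta).
by apply/funext => k; rewrite subrK.
Qed.

(** [psi_] is described backwards from rest at T and [psi] forwards from the data; the moments of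
    [v] over (0,T) make the two Duhamel formulas agree. *)
Lemma state_cvg (psi : R -> R -> R) t m : 0 <= t <= T ->
  eig m * coef (psi t) m = forced_mode xi v (fun m => eig m * coef y0 m) (coef y1) m t ->
  coef (psi_ k t) m @[k --> \oo] --> coef (psi t) m.
Proof.
move=> tT hpsi; have e0 : eig m != 0 :> R by rewrite gt_eqF// eig_gt0.
have h1 := @source_cvg _ m _ tT (L2_st 0 T m).
have h2 := @source_cvg _ m _ tT (L2_ct 0 T m).
have [t0 tT'] := andP tT.
have cat (g : R -> R) : L2 0 T g -> dot 0 T v g = dot 0 t v g + dot t T v g.
  by move=> Lg; apply: intg_cat => //; exact: L2_mul.
have -> : coef (psi t) m = (eig m)^-1 *
    (ct m t * (sn m xi * dot t T v (st m)) - st m t * (sn m xi * dot t T v (ct m))).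
  apply: (mulfI e0); rewrite hpsi mulVKf//.
  rewrite /forced_mode /mode /cosine_amplitude /sine_amplitude.
  have q1 : eig m * coef y0 m = sn m xi * (dot 0 t v (st m) + dot t T v (st m)).
    by rewrite -cat ?v_st; [have := s0 m => hm; field|exact: L2_st].
  have q2 : coef y1 m = - (sn m xi * (dot 0 t v (ct m) + dot t T v (ct m))).
    by rewrite -cat ?v_ct; [have := s0 m => hm; field|exact: L2_ct].
  by rewrite q1 q2; ring.
have -> : (fun k => coef (psi_ k t) m) = (fun k => (eig m)^-1 *
    (ct m t * dot t T (src k m) (st m) - st m t * dot t T (src k m) (ct m))).
  by apply/funext => k; rewrite -psiE// mulrA mulVf// mul1r.
by apply: cvgMr; apply: cvgB; exact: cvgMr.
Qed.

(** The backward formula bounds the state by the moments of the source on (t,T), and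
    [bessel_weighted] bounds those by the window energy, uniformly in the index. *)
Lemma state_bound K k t N : covers T K -> 0 <= t <= T ->
  \sum_(m < N) (eig m * coef (psi_ k t) m) ^+ 2 <= bconst K * E.
Proof.
move=> cK tT; have [t0 tT'] := andP tT.
have Lh m := wdot_modal_L2 T0' (lal k) (lbe k) (@Lphi k) (@cphi k) (hrho k) (L2_sn 0 1 m).
have ie := energy_modal_integrable T0' (lal k) (lbe k) (@Lphi k) (@cphi k) (hrho k).
have b := @bessel_weighted R (rho k) _ (hrho k) T K t T (phi k) E N cK t0 tT' (lexx T)
  (window_sn_le1 hxi (nu0 k) (nh k) (nuE k)).
apply: le_trans (b _ _ _ _).
- apply: ler_sum => m _; rewrite psiE// [leRHS]addrC.
  have h := @mode_sqr_le R (fun m => dot t T (src k m) (st m)) (fun m => - dot t T (src k m) (ct m)) m t.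
  rewrite sqrrN /mode in h; apply: le_trans h.
  by rewrite le_eqVlt; apply/orP; left; apply/eqP; ring.
- by move=> s /andP[ts sT]; apply: Lphi; rewrite (le_trans t0).
- by move=> m; apply: L2_sub (Lh m).
- by apply: integrable_on_sub ie.
- apply: le_trans (hE k); apply: le_intg_sub => // s _.
  exact: (wdot_ge0 (hrho k)).
Qed.

Hypothesis hmass : forall k N, 2 * period * \sum_(m < N) (al k m ^+ 2 + be k m ^+ 2) *
  wdot (rho k) (sn m) (sn m) <= E.

Lemma trace_cvg p (P : nat -> R -> R) : H10 T p -> (forall k, V (P k)) ->
  (forall k m, coef (P k) m = pairing_coef T (al k) (be k) p m) ->
  (forall k, time_pairing T (phi k) p (P k)) ->
  (P k xi + (2 * (nu k)%:R)^-1 * derive1 (P k) xi) @[k --> \oo] -->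
    intg 0 T (fun t => v t * p t).
Proof.
move=> hp VP cP tP; have [K cK] := exists_cover T.
have Lp : L2 0 T p by exact: H10_L2 hp.
have [dp hdp] := hp.
have h1 := average_cvg Lp.
have h2 : (P k xi + (2 * (nu k)%:R)^-1 * derive1 (P k) xi - dot 0 T (avg k) p)
    @[k --> \oo] --> (0 : R).
  apply: (@cvg_of_sqr _ (72 * E * (bconst K * dot 0 T dp dp) / period)) => k.
  exact: (trace_average T0 hxi (nu0 k) (nuE k) cK (hmass k) hdp (VP k) (cP k) (tP k)).
have -> : (fun k => P k xi + (2 * (nu k)%:R)^-1 * derive1 (P k) xi) =
    (fun k => (P k xi + (2 * (nu k)%:R)^-1 * derive1 (P k) xi - dot 0 T (avg k) p) +
       dot 0 T (avg k) p) by apply/funext => k; rewrite subrK.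
by rewrite -[X in _ --> X]add0r; exact: cvgD h2 h1.
Qed.

End ControlLimit.

Theorem theorem6p1 (R : realType) (T xi : R) (y0 y1 : R -> R)
    (phi psi_ : nat -> R -> R -> R)
    (hT : 2 <= T) (hxi : 0 < xi < 1) (hstrat : strategic xi)
    (hy : in_dualF T xi y0 y1)
    (hphi : forall n : nat, (0 < n)%N -> n%:R^-1 < 1 - xi ->
      hom_solution T (phi n))
    (hpsi : forall n : nat, (0 < n)%N -> n%:R^-1 < 1 - xi ->
      controlled_solution T
        (internal_source xi n (fun t x => n%:R * phi n t x)) y0 y1 (psi_ n)) :
  exists (v : R -> R) (psi : R -> R -> R),
    [/\ L2 0 T v,
        controlled_solution T (pointwise_source xi v) y0 y1 psi,
        weakstar_LooV T psi_ psi &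
        exists z0 z1 : nat -> (R -> R) -> R,
          (forall n : nat, (0 < n)%N -> n%:R^-1 < 1 - xi ->
            xtraces T xi (phi n) (z0 n) (z1 n)) /\
          weakstar_Hm1 T (fun n p => z0 n p + (2 * n%:R)^-1 * z1 n p) v].
Proof.
have T0 : 0 < T by lra.
have [Ly0 Ly1 _] := hy; have [M hM] := dualF_ell2 T0 hxi hstrat hy.
pose valid n := (0 < n)%N && (n%:R^-1 < 1 - xi).
(* The statement is guarded by [valid n], with zero amplitudes as default, so that the amplitudes
   can be chosen for all n at once. *)
have ex n : exists ab : (nat -> R) * (nat -> R), valid n ->
  [/\ ell2 ab.1, ell2 ab.2,
      forall t m, 0 <= t <= T -> coef (phi n t) m = mode ab.1 ab.2 m t,
      intg 0 T (fun t => wdot (window xi n) (phi n t) (phi n t)) <= 16 * M / period &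
   [/\ forall N, 2 * period * \sum_(m < N) (ab.1 m ^+ 2 + ab.2 m ^+ 2) *
         wdot (window xi n) (sn m) (sn m) <= 16 * M / period,
       forall m, dot 0 T (fun t => wdot (window xi n) (phi n t) (sn m)) (ct m) = - coef y1 m,
       forall m, dot 0 T (fun t => wdot (window xi n) (phi n t) (sn m)) (st m) = eig m * coef y0 m &
       forall t m, 0 <= t <= T -> eig m * coef (psi_ n t) m =
         ct m t * dot t T (fun t => wdot (window xi n) (phi n t) (sn m)) (st m)
         - st m t * dot t T (fun t => wdot (window xi n) (phi n t) (sn m)) (ct m)]].
  have [/andP[n0 hn]|_] := boolP (valid n); last by exists (fun=> 0, fun=> 0).
  have [al [be h]] := internal_control hT hxi hstrat Ly0 Ly1 hM n0 hn (hphi n n0 hn) (hpsi n n0 hn).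
  by exists (al, be).
have [ab hab] := choice ex.
have Lphi n t : valid n -> 0 <= t <= T -> L2 0 1 (phi n t).
  by move=> /andP[n0 hn] tT; have [[h _] _] := hphi n n0 hn; exact: h.
have exP n : exists PP : (R -> R) -> R -> R, valid n ->
  [/\ forall p, H10 T p -> V (PP p) /\ forall m, coef (PP p) m = pairing_coef T (ab n).1 (ab n).2 p m,
      xtraces T xi (phi n) (fun p => PP p xi) (fun p => derive1 (PP p) xi) &
      forall p, H10 T p -> time_pairing T (phi n) p (PP p)].
  have [hn|_] := boolP (valid n); last by exists (fun=> id).
  have [lal lbe cphi _ _] := hab n hn.
  have [PP h] := traces_exist T0 hxi lal lbe (fun t => Lphi n t hn) cphi.
  by exists PP.
have [PP hPP] := choice exP.
(* Nothing is known for small n, whose windows may leave (0,1). The limits are taken along the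
   shifted sequence, which does not change them. *)
have [N0 valid_shift] : exists N0, forall k, valid (k + N0)%N.
  have d0 : 0 < 1 - xi by lra.
  have [N0 _ hN] := near_infty_natSinv_lt (PosNum d0).
  exists N0.+1 => k; rewrite /valid addnS ltn0Sn/=.
  by apply: hN; rewrite /= leq_addl.
pose nu k := (k + N0)%N.
have nu0 k : (0 < nu k)%N by have /andP[] := valid_shift k.
have nuE k : (nu k)%:R^-1 < 1 - xi by have /andP[] := valid_shift k.
have cnu : (nu k)%:R^-1 @[k --> \oo] --> (0 : R).
  have N00 : (0 < N0)%N := nu0 0%N.
  apply: cvg0_squeeze (@cvg_harmonic R) => k; first by rewrite invr_ge0.
  by rewrite /harmonic/= lef_pV2 ?posrE ?ltr0n// ?ler_nat /nu; lia.
have sM (z : nat -> R) : (forall m, z m ^+ 2 <= (coef y1 m ^+ 2 + (eig m * coef y0 m) ^+ 2) / sn m xi ^+ 2) ->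
    ell2 z.
  by move=> hz; exists M => N; apply: le_trans (hM N); apply: ler_sum => m _; exact: hz.
have s0 m : sn m xi != 0 by exact: hstrat.
have s2 m : 0 <= (sn m xi ^+ 2)^-1 by rewrite invr_ge0 sqr_ge0.
have lp : ell2 (fun m => - coef y1 m / sn m xi).
  apply: sM => m; rewrite exprMn sqrrN exprVn ler_wpM2r//.
  by rewrite lerDl sqr_ge0.
have lq : ell2 (fun m => eig m * coef y0 m / sn m xi).
  apply: sM => m; rewrite exprMn exprVn ler_wpM2r//.
  by rewrite lerDr sqr_ge0.
have [v [Lv sv mv]] := time_control hT lp lq.
have v_ct m : dot 0 T v (ct m) = - coef y1 m / sn m xi by have [] := mv m.
have v_st m : dot 0 T v (st m) = eig m * coef y0 m / sn m xi by have [] := mv m.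
(* Dividing by [sn m xi], of modulus at most 1, only enlarges the terms; thus the F' bound already
   places y0 in V at the level of coefficients. *)
have lA : ell2 (fun m => eig m * coef y0 m).
  apply: ell2_le lq => m; rewrite [leRHS]normrM ler_peMr// normfV invf_ge1 ?normr_gt0//.
  by rewrite ler_norml sin_geN1 sin_le1.
have lB := coef_ell2 Ly1.
have [psi [psit [hsol modes]]] := forced_solution T0 hxi Lv lA lB Ly0 Ly1 (fun=> erefl) (fun=> erefl).
have TT : 0 <= T <= T by rewrite lexx ltW.
have [[dpsi [d2psi [Vpsi _]]] [[Lpsi _] [Lpsit _] _] _ _ _] := hsol.
(* The moments of [v] over (0,T) cancel the data, so both amplitudes vanish at T and the limit state
   is brought to rest. *)
have C0 m : cosine_amplitude xi v (fun m => eig m * coef y0 m) m T = 0.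
  by rewrite /cosine_amplitude v_st; have h := s0 m; field.
have S0 m : sine_amplitude xi v (coef y1) m T = 0.
  by rewrite /sine_amplitude v_ct; have h := s0 m; field.
have c0 m : coef (fun=> 0) m = 0 :> R.
  by apply: etrans (intg0 0 1); apply: eq_intg => x _; rewrite mul0r.
have e0 m : eig m != 0 :> R by rewrite gt_eqF// eig_gt0.
pose al k := (ab (nu k)).1; pose be k := (ab (nu k)).2.
have ok k := hab (nu k) (valid_shift k).
have lal k : ell2 (al k) by have [] := ok k.
have lbe k : ell2 (be k) by have [] := ok k.
have Lphi' k t (tT : 0 <= t <= T) : L2 0 1 (phi (nu k) t) := Lphi _ t (valid_shift k) tT.
have cphi k t m : 0 <= t <= T -> coef (phi (nu k) t) m = mode (al k) (be k) m t.
  by have [_ _ h _ _] := ok k; exact: h.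
have hE k : intg 0 T (fun t => wdot (window xi (nu k)) (phi (nu k) t) (phi (nu k) t)) <= 16 * M / period.
  by have [_ _ _ h _] := ok k.
have hmass k N : 2 * period * \sum_(m < N) (al k m ^+ 2 + be k m ^+ 2) *
    wdot (window xi (nu k)) (sn m) (sn m) <= 16 * M / period.
  by have [_ _ _ _ [h _ _ _]] := ok k; exact: h.
have src_ct k m : dot 0 T (fun t => wdot (window xi (nu k)) (phi (nu k) t) (sn m)) (ct m) = - coef y1 m.
  by have [_ _ _ _ [_ h _ _]] := ok k; exact: h.
have src_st k m : dot 0 T (fun t => wdot (window xi (nu k)) (phi (nu k) t) (sn m)) (st m) = eig m * coef y0 m.
  by have [_ _ _ _ [_ _ h _]] := ok k; exact: h.
have psiE k t m (tT : 0 <= t <= T) : eig m * coef (psi_ (nu k) t) m =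
    ct m t * dot t T (fun t => wdot (window xi (nu k)) (phi (nu k) t) (sn m)) (st m)
    - st m t * dot t T (fun t => wdot (window xi (nu k)) (phi (nu k) t) (sn m)) (ct m).
  by have [_ _ _ _ [_ _ _ h]] := ok k; exact: h.
exists v, psi; split=> //.
- exists psit; split=> //.
    apply: coef_inj; [exact: Lpsi|exact: L2_cst|move=> m].
    have [h _] := modes T m TT; apply: (mulfI (e0 m)); rewrite h c0 /forced_mode /mode C0 S0.
    by rewrite !mul0r mulr0 addr0.
  apply: coef_inj; [exact: Lpsit|exact: L2_cst|move=> m].
  have [_ h] := modes T m TT; rewrite h c0 /forced_velocity /mode C0 S0.
  by rewrite oppr0 !mul0r addr0.
- have h : weakstar_LooV T (fun k => psi_ (nu k)) psi.
    have [K cK] := exists_cover T.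
    have sol k := hpsi (nu k) (nu0 k) (nuE k).
    apply: (@weakstar_of_modes R T _ _ (bconst K * (16 * M / period))).
    + by move=> k; have [ut [[_ [h _ _] _ _ _] _ _]] := sol k.
    + move=> k t tT; have [ut [[[du [d2u [h _]]] _ _ _ _] _ _]] := sol k.
      by exists (du t), (d2u t); exact: h.
    + by move=> t tT; exists (dpsi t), (d2psi t); exact: Vpsi.
    + move=> k t N tT.
      exact: (state_bound T0 hxi nu0 nuE lal lbe Lphi' cphi hE psiE k N cK tT).
    + move=> t m tT; have [h _] := modes t m tT.
      exact: (state_cvg T0 hxi hstrat nu0 nuE cnu lal lbe Lphi' cphi hE src_ct src_st psiE Lv sv v_ct v_st tT h).
  by move=> g hg; have := h g hg; rewrite (cvg_shiftn N0 (fun n => intg 0 T (fun t => g t (psi_ n t)))).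
- exists (fun n p => PP n p xi), (fun n p => derive1 (PP n p) xi); split.
    by move=> n n0 hn; have [] := hPP n (introT andP (conj n0 hn)).
  move=> p hp.
  rewrite -(cvg_shiftn N0 (fun n => PP n p xi + (2 * n%:R)^-1 * derive1 (PP n p) xi)).
  have hP k := hPP (nu k) (valid_shift k).
  apply: (trace_cvg T0 hxi hstrat nu0 nuE cnu lal lbe Lphi' cphi hE src_ct src_st Lv sv v_ct v_st hmass hp
    (P := fun k => PP (nu k) p)) => k.
  - by have [h _ _] := hP k; have [] := h p hp.
  - by move=> m; have [h _ _] := hP k; have [_] := h p hp; exact.
  - by have [_ _ h] := hP k; exact: h.
Qed.
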